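(* Let $\gamma:A^\bullet_-(X,\mathcal Z)\to B^\bullet_{\boldsymbol m}[|\boldsymbol m|-2k]$ be the linear map defined on the forms $\omega_K^{\boldsymbol j}$ by $$\omega^{\boldsymbol j}_K\mapsto f\otimes\phi^K_{\boldsymbol m^{\boldsymbol j}}\ \text{ if } |K|=e(\boldsymbol j)-1,\qquad \omega^{\boldsymbol j}_K\mapsto\phi^K_{\boldsymbol m^{\boldsymbol j}}\ \text{ if }|K|=e(\boldsymbol j).$$ Then $\gamma$ defines an isomorphism of the complexes $(A^\bullet_-(X,\mathcal Z),\tilde\omega_a+\mathrm{res})$ and $(B^\bullet_{\boldsymbol m}[|\boldsymbol m|-2k],\tilde d)$ (with gradings matched by the shift $A^l_-(X,\mathcal Z)\to B^{l-k+1}_{\boldsymbol m}[|\boldsymbol m|-2k]$).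
   Context: Arrangement. Fix $\boldsymbol m=(m_1,\dots,m_n)$ with positive integer coordinates and a positive integer $k$, with $m_j\le k-1$ for $j=1,\dots,n_0$ and $m_j>k-1$ for $j=n_0+1,\dots,n$; distinct $z_1,\dots,z_n\in\mathbb{C}$; a generic nonzero number $\kappa$. $|\boldsymbol m|=\sum m_i$. In $\mathbb{C}^k$ with coordinates $t_1,\dots,t_k$ take the weighted arrangement of hyperplanes $t_i-t_j=0$ ($1\le i<j\le k$) with weight $2/\kappa$ and $t_i-z_j=0$ ($1\le i\le k$, $1\le j\le n$) with weight $-m_j/\kappa$. $H$ is the union of the hyperplanes, $U=\mathbb{C}^k-H$, and $\omega_a=\sum_{i<j}\frac{2}{\kappa}d\log(t_i-t_j)-\sum_{i,j}\frac{m_j}{\kappa}d\log(t_i-z_j)$. The group $S_k$ acts by permuting coordinates. An edge is a nonempty intersection of hyperplanes; it is dense if the hyperplanes containing it cannot be partitioned into nonempty sets so that, after a change of coordinates, hyperplanes in different sets are in different coordinates. The weight of an edge is the sum of weights of hyperplanes containing it; it is resonant if the weight is $0$. The resonant dense edges are $X_I^j=\{t_i=z_j,\ i\in I\}$, $1\le j\le n_0$, $I\subset\{1,\dots,k\}$, $|I|=m_j+1$. The manifold. Let $\pi:\tilde Y\to\mathbb{C}^k$ be the minimal resolution of singularities of $H$ (blow up the dense vertices, then the proper preimages of dense 1-dimensional edges, and so on), $\tilde H=\pi^{-1}H$; the irreducible components of $\tilde H$ are labeled by dense edges. $X$ is $\tilde Y$ minus the union of all components labeled by nonresonant dense edges;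 $D=\tilde H\cap X$ is a normal crossings divisor in $X$; $\tilde H_I^j$ is the component of $D$ labeled by $X_I^j$. $\mathcal Z=\{X=Z_0\supset D=Z_1\supset Z_2\supset\dots\}$, where $Z_p$ is the set of points at which $p$ local branches of $D$ meet. $S_k$ acts on $(X,D)$. The form $\tilde\omega_a=\pi^*\omega_a$ is regular on $X$. The connected components of $Z_p-Z_{p+1}$ are denoted $C_{\boldsymbol I}^{\boldsymbol j}$, labeled by $p$-element subsets $\boldsymbol j\subset\{1,\dots,n_0\}$ and families $\boldsymbol I=\{I_j\}_{j\in\boldsymbol j}$ of pairwise disjoint subsets of $\{1,\dots,k\}$ with $|I_j|=m_j+1$ ($p=0$: the only component is $U$); $C_{\boldsymbol I}^{\boldsymbol j}$ is open in $\bigcap_{j\in\boldsymbol j}\tilde H_{I_j}^j$. Let $e(\boldsymbol j)=k-p-\sum_{j\in\boldsymbol j}m_j$. $C_{\boldsymbol I}^{\boldsymbol j}$ is isomorphic to the complement in $(\prod_{j\in\boldsymbol j}\mathbb{P}^{m_j})\times\mathbb{C}^{e(\boldsymbol j)}$ of a product arrangement: for $I_j=\{i_0<\dots<i_{m_j}\}$, $\mathbb{P}^{m_j}$ has affine coordinates $u_{i_l}=(t_{i_l}-z_j)/(t_{i_0}-z_j)$, $l=1,\dots,m_j$, and hyperplanes $u_{i_l}=0$, $u_{i_l}=1$, $u_{i_l}=u_{i_q}$ and infinity; $\mathbb{C}^{e(\boldsymbol j)}$ has coordinates $t_i$, $i\notin\bigcup I_j$, with hyperplanes $t_i=t_q$,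 $t_i=z_l$. $A^\bullet(C_{\boldsymbol I}^{\boldsymbol j})$ is the graded $\mathbb{C}$-algebra of forms generated by the logarithmic differentials of $u_{i_l}$, $u_{i_l}-1$, $u_{i_l}-u_{i_q}$, $t_i-t_q$, $t_i-z_l$. Aomoto complex. $A^l(X,\mathcal Z)=\bigoplus A^{l-2p}(C_{\boldsymbol I}^{\boldsymbol j})$ (sum over all components, $p=|\boldsymbol j|$), with differential $\tilde\omega_a+\mathrm{res}$: exterior multiplication by $\tilde\omega_a$ plus the residue maps from each component of $Z_p-Z_{p+1}$ to the components of $Z_{p+1}-Z_{p+2}$ in its closure, normalized by $\mathrm{res}(\frac{dz}{z}\wedge\eta)=\eta|_{z=0}$. $A^\bullet_-(X,\mathcal Z)$ is the subcomplex of $S_k$-skew-symmetric elements ($\sigma\eta=(-1)^{|\sigma|}\eta$). The forms $\omega_K^{\boldsymbol j}$. Let $\boldsymbol j=\{j_1<\dots<j_p\}\subset\{1,\dots,n_0\}$, $p\ge0$, with $e(\boldsymbol j)\ge0$. Put $d_{\boldsymbol j}=\sum_{i=1}^{p-1}i(m_{j_i}+1)$, $s_{\boldsymbol j}=p+\sum_{i=1}^pm_{j_i}$, and $I^0_{j_i}=\{1+\sum_{l<i}(m_{j_l}+1),\dots,m_{j_i}+1+\sum_{l<i}(m_{j_l}+1)\}$, $\boldsymbol I^0=\{I^0_{j_i}\}$. For $I=\{i_0<\dots<i_m\}$ let $\mu_I=d\log u_{i_1}\wedge\dots\wedge d\log u_{i_m}$. For $K=(k_1,\dots,k_n)\in\mathbb{Z}_{\ge0}^n$,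 $|K|=\sum k_i$, with $|K|\in\{e(\boldsymbol j),e(\boldsymbol j)-1\}$, put $l_i=k_1+\dots+k_i$, $l_0=0$, $\eta^{\boldsymbol j}_{K,i}=d\log(t_{s_{\boldsymbol j}+l_{i-1}+1}-z_i)\wedge\dots\wedge d\log(t_{s_{\boldsymbol j}+l_i}-z_i)$, $\alpha_K^{\boldsymbol j}=(-1)^{d_{\boldsymbol j}}\big((m_{j_1}+1)!\cdots(m_{j_p}+1)!\,k_1!\cdots k_n!\big)^{-1}$, and $\theta=\alpha_K^{\boldsymbol j}\,\mu_{I^0_{j_1}}\wedge\dots\wedge\mu_{I^0_{j_p}}\wedge\eta^{\boldsymbol j}_{K,1}\wedge\dots\wedge\eta^{\boldsymbol j}_{K,n}$, a form on $C^{\boldsymbol j}_{\boldsymbol I^0}$ extended by zero to the other components of $\bigcup_{\boldsymbol I}C^{\boldsymbol j}_{\boldsymbol I}$. Then $\omega_K^{\boldsymbol j}=\mathrm{Skew}(\kappa^{-k}\theta)$ if $|K|=e(\boldsymbol j)$, and $\omega_K^{\boldsymbol j}=\mathrm{Skew}((-1)^{k-p}\kappa^{-(k-1)}\theta)$ if $|K|=e(\boldsymbol j)-1$, where $\mathrm{Skew}\,\eta=\sum_{\sigma\in S_k}(-1)^{|\sigma|}\sigma\eta$. The forms $\omega_K^{\boldsymbol j}$ (all $\boldsymbol j$, $K$) form a basis of $A^\bullet_-(X,\mathcal Z)$. The vector $\boldsymbol m^{\boldsymbol j}$ has coordinates $m_i^{\boldsymbol j}=-m_i-2$ if $i\in\boldsymbol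 j$ and $m_i^{\boldsymbol j}=m_i$ otherwise. The algebraic complex. $\mathfrak{sl}_2$ has basis $e,f,h$ with $[e,f]=h$, $[h,e]=2e$, $[h,f]=-2f$; $\mathfrak n_-=\mathbb{C}f$. $M_m$ is the Verma module with highest weight vector $v_m$ of weight $m$ and basis $f^jv_m$, $j\ge0$. For a weight module $V=\oplus V[\lambda]$ with finite-dimensional weight spaces, $V^*=\oplus V[\lambda]^*$ with $\langle e\phi,v\rangle=\langle\phi,fv\rangle$, $\langle f\phi,v\rangle=\langle\phi,ev\rangle$, $\langle h\phi,v\rangle=\langle\phi,hv\rangle$. $\{\phi^j_m\}$ is the basis of $M_m^*$ dual to $\{f^jv_m\}$ and $\phi^K_{\boldsymbol m}=\phi^{k_1}_{m_1}\otimes\dots\otimes\phi^{k_n}_{m_n}$. For a positive integer $m$, $\iota:M_m^*\to M_{-m-2}^*$ is the epimorphism dual to the inclusion $M_{-m-2}\hookrightarrow M_m$, $f^jv_{-m-2}\mapsto f^{j+m+1}v_m$. Let $A^0_{m_a}=M^*_{m_a}$, $A^1_{m_a}=M^*_{-m_a-2}$, $\iota_a=\iota$, $A^i_{\boldsymbol m}=\bigoplus_{i_1+\dots+i_n=i}A^{i_1}_{m_1}\otimes\dots\otimes A^{i_n}_{m_n}$ with differential $\iota(x_1\otimes\dots\otimes x_n)=\sum_a(-1)^{\deg x_1+\dots+\deg x_{a-1}}x_1\otimes\dots\otimes\iota_ax_a\otimes\dots\otimes x_n$. Then $B^i_{\boldsymbol m}=(\mathfrak n_-\otimes A^i_{\boldsymbol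 m})\oplus A^{i-1}_{\boldsymbol m}$ with $\tilde d(f\otimes x+y)=fx-f\otimes\iota x+\iota y$, and $B^i_{\boldsymbol m}[\lambda]=(\mathfrak n_-\otimes A^i_{\boldsymbol m}[\lambda+2])\oplus A^{i-1}_{\boldsymbol m}[\lambda]$.
   Formalization: The sign exponent d_j is taken as the sum over i=1..p-1 of (p-i)(m_{j_i}+1) instead of i(m_{j_i}+1); with the printed exponent the map does not commute with the differentials, e.g. for p=3, m=(1,2,1), k=7. *)

(* Defs.v *)
From HB Require Import structures.
From mathcomp Require Import all_boot all_order all_algebra perm generic_quotient.
From mathcomp Require Import boolp classical_sets functions reals complex mpoly.

Set Implicit Arguments.
Unset Strict Implicit.
Unset Printing Implicit Defensive.

Import GRing.Theory.
Local Open Scope ring_scope.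

(* Cochain complexes realised inside an ambient vector space: a family of     *)
(* subspaces [P l], indexed by the degree l, and an operator d.               *)

Section Complexes.
Variables (C : fieldType) (V W : lmodType C).

Definition linear_on (A : set V) (g : V -> W) : Prop :=
  forall (a : C) u v, A u -> A v -> g (a *: u + v) = a *: g u + g v.

Definition direct_sum (P : int -> set V) : set V :=
  [set v | exists (s : seq int) (w : int -> V),
     (forall l, P l (w l)) /\ v = \sum_(l <- s) w l].

End Complexes.

Definition is_complex (C : fieldType) (V : lmodType C)
    (P : int -> set V) (d : V -> V) : Prop :=
  [/\ forall l, P l 0,
      forall l (a : C) u v, P l u -> P l v -> P l (a *: u + v),
      forall l, linear_on (P l) d,
      forall l v, P l v -> P (l + 1) (d v)
    & forall l v, P l v -> d (d v) = 0].

Definition complex_iso (C : fieldType) (V W : lmodType C)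
    (P : int -> set V) (dP : V -> V) (Q : int -> set W) (dQ : W -> W)
    (s : int) (g : V -> W) : Prop :=
  [/\ is_complex P dP,
      is_complex Q dQ,
      linear_on (direct_sum P) g,
      forall l, set_bij (P l) (Q (l + s)) g
    & forall l v, P l v -> g (dP v) = dQ (g v)].

(* Rational functions and rational differential forms in k variables; the     *)
(* form sum_S eta_S dx_S, with dx_S the wedge of the dx_i (i in S) in         *)
(* increasing order, is the function S |-> eta_S.                             *)

Definition ratfun (C : fieldType) (k : nat) : Type := {fraction {mpoly C[k]}}.

HB.instance Definition _ C k := GRing.Field.on (ratfun C k).

Section RatfunModule.
Variables (C : fieldType) (k : nat).

Definition polyF (p : {mpoly C[k]}) : ratfun C k := tofrac p.
Definition cstF (a : C) : ratfun C k := polyF a%:MP.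
Definition varF (i : 'I_k) : ratfun C k := polyF 'X_i.

Definition scaleF (a : C) (f : ratfun C k) : ratfun C k := cstF a * f.

Lemma scaleFA a b f : scaleF a (scaleF b f) = scaleF (a * b) f.
Proof. by rewrite /scaleF /cstF /polyF mpolyCM rmorphM mulrA. Qed.

Lemma scaleF1 : left_id 1 scaleF.
Proof. by move=> f; rewrite /scaleF /cstF /polyF rmorph1 mul1r. Qed.

Lemma scaleFDr : right_distributive scaleF +%R.
Proof. by move=> a f g; rewrite /scaleF mulrDr. Qed.

Lemma scaleFDl f : {morph scaleF^~ f : a b / a + b}.
Proof. by move=> a b; rewrite /scaleF /cstF /polyF mpolyCD rmorphD mulrDl. Qed.

HB.instance Definition _ :=
  GRing.Zmodule_isLmodule.Build C (ratfun C k) scaleFA scaleF1 scaleFDr scaleFDl.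

End RatfunModule.

Notation ratform C k := {ffun {set 'I_k} -> ratfun C k}.

Section RationalForms.
Variables (C : fieldType) (k : nat).
Local Notation F := (ratfun C k).
Local Notation form := (ratform C k).

Definition numF (f : F) : {mpoly C[k]} := (frac (repr f)).1.
Definition denF (f : F) : {mpoly C[k]} := (frac (repr f)).2.

Definition derivF (i : 'I_k) (f : F) : F :=
  polyF (mderiv i (numF f) * denF f - numF f * mderiv i (denF f))
  / polyF (denF f) ^+ 2.

(* The value of f at x_i = s_i; only used when the s_i are algebraically      *)
(* independent, so that no denominator vanishes.                              *)
Definition substF (s : 'I_k -> F) (f : F) : F :=
  mmap (@cstF C k) s (numF f) / mmap (@cstF C k) s (denF f).

Definition wedge_sign (A B : {set 'I_k}) : F :=
  (-1) ^+ #|[set ab in finset.setX A B | (ab.2 < ab.1)%N]%SET|.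

Definition wedge (eta theta : form) : form :=
  [ffun S : {set 'I_k} => \sum_(A : {set 'I_k} | A \subset S)
     wedge_sign A (S :\: A) * eta A * theta (S :\: A)].

Definition form1 : form := [ffun S : {set 'I_k} => (S == finset.set0)%:R].

Definition dform (f : F) : form :=
  [ffun S : {set 'I_k} => \sum_(i | S == [set i]%SET) derivF i f].

Definition fscale (f : F) (eta : form) : form :=
  [ffun S : {set 'I_k} => f * eta S].

Definition dlog (f : F) : form := fscale f^-1 (dform f).

(* Big wedges are taken in the increasing order of the ordinal indices. *)

Definition pullback (s : 'I_k -> F) (eta : form) : form :=
  \sum_(S : {set 'I_k})
    fscale (substF s (eta S)) (\big[wedge/form1]_(i in S) dform (s i)).

Definition killP (V : {set 'I_k}) (p : {mpoly C[k]}) : {mpoly C[k]} :=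
  p \mPo [tuple (if i \in V then 0 else 'X_i) | i < k].

(* f is regular along the subspace x_i = 0 (i in V) iff it has a           *)
(* presentation p / q with q not vanishing identically there; the value is    *)
(* then independent of p and q. Other f get the junk value 0.                 *)
Definition restrF (V : {set 'I_k}) (f : F) : F :=
  xget 0 [set g : F | exists p q : {mpoly C[k]},
    [/\ killP V q != 0, f = polyF p / polyF q
      & g = polyF (killP V p) / polyF (killP V q)]]%classic.

Definition restr_form (V : {set 'I_k}) (eta : form) : form :=
  [ffun S : {set 'I_k} => if [disjoint S & V] then restrF V (eta S) else 0].

(* Residue along x_i = 0 of a form with at most a simple pole there: writing  *)
(* eta = dx_i / x_i /\ rho + (terms without dx_i), it is rho at x_i = 0.      *)
Definition residue (i : 'I_k) (eta : form) : form :=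
  [ffun S : {set 'I_k} => if i \in S then 0 else
     restrF [set i]%SET
       (varF C i * (wedge_sign [set i]%SET S * eta (i |: S)%SET))].

End RationalForms.

Section Aomoto.
Variables (C : fieldType) (n k n0 : nat) (m : 'I_n -> nat) (z : 'I_n -> C).
Variable (kappa : C).
Local Notation F := (ratfun C k).
Local Notation form := (ratform C k).
Local Notation t i := (varF C i).
Local Notation zc j := (cstF k (z j)).

(* The label of the component C_I^j, with the convention I_j = set0 for j not *)
(* in the index set of the family I.                                          *)
Definition label : Type := {ffun 'I_n -> {set 'I_k}}.

Definition is_component (c : label) : bool :=
  [forall j, (c j != finset.set0) ==> (j < n0)%N && (#|c j| == (m j).+1)] &&
  [forall j, forall j', (j != j') ==> [disjoint c j & c j']].

Definition index_set (c : label) : {set 'I_n} :=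
  [set j | c j != finset.set0]%SET.

Definition free_coord (c : label) (i : 'I_k) : bool :=
  [forall j, i \notin c j].

(* The least element of I, if I contains i. *)
Definition base (I : {set 'I_k}) (i : 'I_k) : 'I_k := head i (enum I).

Definition ucoord (j : 'I_n) (I : {set 'I_k}) (i : 'I_k) : F :=
  (t i - zc j) / (t (base I i) - zc j).

(* Forms on C_I^j are identified with their pullbacks to U under the dominant *)
(* map t |-> (([t_i - z_j]_(i in I_j))_j, (t_i)_(i free)), that is, with      *)
(* rational forms in t written through the u- and t-coordinates of C_I^j.     *)

Inductive log_divisor (c : label) : F -> Prop :=
| Div_u0 j i : i \in c j -> i != base (c j) i ->
    log_divisor c (ucoord j (c j) i)
| Div_u1 j i : i \in c j -> i != base (c j) i ->
    log_divisor c (ucoord j (c j) i - 1)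
| Div_uu j i q : i \in c j -> i != base (c j) i ->
    q \in c j -> q != base (c j) q -> i != q ->
    log_divisor c (ucoord j (c j) i - ucoord j (c j) q)
| Div_tt i q : free_coord c i -> free_coord c q -> i != q ->
    log_divisor c (t i - t q)
| Div_tz i l : free_coord c i -> log_divisor c (t i - zc l).

Inductive log_algebra (c : label) : nat -> form -> Prop :=
| Log_gen g : log_divisor c g -> log_algebra c 1 (dlog g)
| Log_one : log_algebra c 0 (form1 C k)
| Log_zero d : log_algebra c d 0
| Log_lin d (a : C) eta theta : log_algebra c d eta -> log_algebra c d theta ->
    log_algebra c d (a *: eta + theta)
| Log_wedge d d' eta theta : log_algebra c d eta -> log_algebra c d' theta ->
    log_algebra c (d + d') (wedge eta theta).

Definition chains : Type := {ffun label -> form}.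
HB.instance Definition _ := GRing.Lmodule.on chains.

Definition aomoto (l : int) : set chains :=
  [set eta | forall c : label,
     match is_component c, l - (2 * #|index_set c|)%:Z with
     | true, Posz d => log_algebra c d (eta c)
     | _, _ => eta c = 0
     end]%classic.

(* The coordinates of X near C_I^j are x_i = t_i for i free and, for I_j with *)
(* least element i_0, x_{i_0} = t_{i_0} - z_j and x_i = u_i for the other     *)
(* elements i of I_j; D has the equation prod_j x_{i_0(j)} = 0 there. [chart] *)
(* gives t in terms of x, and [cochart] gives x in terms of t.                *)

Definition chart (c : label) (i : 'I_k) : F :=
  if [pick j | i \in c j] is Some j then
    let i0 := base (c j) i in
    zc j + (if i == i0 then t i else t i0 * t i)
  else t i.

Definition cochart (c : label) (i : 'I_k) : F :=
  if [pick j | i \in c j] is Some j then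
    if i == base (c j) i then t i - zc j else ucoord j (c j) i
  else t i.

Definition base_set (c : label) : {set 'I_k} :=
  [set i | [exists j, (i \in c j) && (i == base (c j) i)]]%SET.

Definition omega_a : form :=
  \sum_(i < k) \sum_(j < k | (i < j)%N) (2 / kappa) *: dlog (t i - t j)
  - \sum_(i < k) \sum_(j < n) ((m j)%:R / kappa) *: dlog (t i - zc j).

Definition omega_a_on (c : label) : form :=
  pullback (cochart c) (restr_form (base_set c) (pullback (chart c) omega_a)).

(* Residue to the component c along the divisor labelled by (b, c b). *)
Definition res (c : label) (b : 'I_n) (eta : form) : form :=
  if [pick i in base_set c | i \in c b] is Some i0 then
    pullback (cochart c) (residue i0 (pullback (chart c) eta))
  else 0.

Definition label_without (c : label) (b : 'I_n) : label :=
  [ffun j => if j == b then finset.set0 else c j].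

Definition aomoto_d (eta : chains) : chains :=
  [ffun c : label => if is_component c then
     wedge (omega_a_on c) (eta c)
     + \sum_(b in index_set c) res c b (eta (label_without c b))
   else 0].

Definition perm_act (s : 'S_k) (eta : chains) : chains :=
  [ffun c : label =>
     pullback (fun i => t (s i)) (eta [ffun j => (s @^-1: c j)%SET])].

Definition aomoto_skew (l : int) : set chains :=
  [set eta | aomoto l eta /\
     forall s : 'S_k, perm_act s eta = (-1) ^+ s *: eta]%classic.

Definition Skew (eta : chains) : chains :=
  \sum_(s : 'S_k) (-1) ^+ s *: perm_act s eta.

Definition e_of (J : {set 'I_n}) : int :=
  k%:Z - #|J|%:Z - \sum_(j in J) (m j)%:Z.

Definition s_of (J : {set 'I_n}) : nat := (\sum_(j in J) (m j).+1)%N.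

(* For J = {j_1 < ... < j_p} this is the sum over i < p of                    *)
(* (p - i) (m_{j_i} + 1): the weight of j_i is the number of elements of J    *)
(* after j_i, which makes the residue of omega_form (J :\ j) _ agree with the *)
(* sign (-1)^#{b in J, b < j} of Aiota. With the weights i in place of p - i, *)
(* it fails for p = 3, m = (1, 2, 1), k = 7; for p <= 2 both are the same.    *)
Definition d_of (J : {set 'I_n}) : nat :=
  (\sum_(j in J) #|[set l in J | (j < l)%N]%SET| * (m j).+1)%N.

Definition I0 (J : {set 'I_n}) : label :=
  [ffun j : 'I_n => if j \in J then
     let o := (\sum_(l in J | l < j) (m l).+1)%N in
     [set i : 'I_k | (o <= i < o + (m j).+1)%N]%SET
   else finset.set0].

Definition mu_form (j : 'I_n) (I : {set 'I_k}) : form :=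
  \big[@wedge C k/form1 C k]_(i <- behead (enum I)) dlog (ucoord j I i).

Definition eta_form (J : {set 'I_n}) (K : 'X_{1..n}) (a : 'I_n) : form :=
  let lo := (s_of J + \sum_(b < n | b < a) K b)%N in
  \big[@wedge C k/form1 C k]_(i < k | (lo <= i < lo + K a)%N) dlog (t i - zc a).

Definition alpha_coef (J : {set 'I_n}) (K : 'X_{1..n}) : C :=
  (-1) ^+ d_of J
  * ((\prod_(j in J) ((m j).+1)`!%:R) * \prod_(a < n) (K a)`!%:R)^-1.

Definition theta_form (J : {set 'I_n}) (K : 'X_{1..n}) : chains :=
  [ffun c : label => if c == I0 J then
     alpha_coef J K *:
       wedge (\big[@wedge C k/form1 C k]_(j in J) mu_form j (I0 J j))
             (\big[@wedge C k/form1 C k]_(a < n) eta_form J K a)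
   else 0].

Definition omega_form (J : {set 'I_n}) (K : 'X_{1..n}) : chains :=
  if (mdeg K)%:Z == e_of J then Skew (kappa ^- k *: theta_form J K)
  else Skew (((-1) ^+ (k - #|J|) * kappa ^- k.-1) *: theta_form J K).

End Aomoto.

(* The Verma module M_mu is modelled on {poly C}, with f^j v_mu = 'X^j. *)

Section Verma.
Variable (C : fieldType).

Definition verma_f (v : {poly C}) : {poly C} := 'X * v.

Definition verma_e (mu : int) (v : {poly C}) : {poly C} :=
  \sum_(j < size v) (v`_j * j%:R * (mu - j%:Z + 1)%:~R) *: 'X^(j.-1).

Definition verma_h (mu : int) (v : {poly C}) : {poly C} :=
  \poly_(j < size v) ((mu - 2 * j%:Z)%:~R * v`_j).

(* M_{-m-2} -> M_m, f^j v_{-m-2} |-> f^(j+m+1) v_m *)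
Definition verma_incl (m : nat) (v : {poly C}) : {poly C} := 'X^(m.+1) * v.

(* The restricted dual M_mu^* also lives on {poly C}, with 'X^j the element   *)
(* phi_mu^j of the dual basis. The transpose T^* phi = phi o T has the        *)
(* coefficients <T^* phi, 'X^j> = <phi, T 'X^j>; the degree bound covers the  *)
(* operators T used here, none of which lowers degrees by more than 1.        *)

Definition pairing (phi v : {poly C}) : C := \sum_(j < size phi) phi`_j * v`_j.

Definition transpose (T : {poly C} -> {poly C}) (phi : {poly C}) : {poly C} :=
  \poly_(j < (size phi).+1) pairing phi (T 'X^j).

Definition dual_f (mu : int) := transpose (verma_e mu).
Definition dual_h (mu : int) := transpose (verma_h mu).
Definition iota_dual (m : nat) := transpose (verma_incl m).

End Verma.

Section AlgebraicComplex.
Variables (C : fieldType) (n : nat) (m : 'I_n -> nat).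

(* A tensor product of n restricted duals is {mpoly C[n]}, with               *)
(* phi^(K 1) (x) ... (x) phi^(K n) = 'X_[K]. [on_factor a T] is the operator  *)
(* 1 (x) ... (x) T (x) ... (x) 1, with T linear acting on the factor a.       *)

Definition set_exponent (K : 'X_{1..n}) (a : 'I_n) (l : nat) : 'X_{1..n} :=
  [multinom (if b == a then l else K b) | b < n].

Definition on_factor (a : 'I_n) (T : {poly C} -> {poly C})
    (x : {mpoly C[n]}) : {mpoly C[n]} :=
  \sum_(K <- msupp x) \sum_(l < size (T 'X^(K a)))
    (x@_K * (T 'X^(K a))`_l) *: 'X_[set_exponent K a l].

Definition mvec (J : {set 'I_n}) (a : 'I_n) : int :=
  if a \in J then - (m a)%:Z - 2 else (m a)%:Z.

(* A_m^i is the sum over the subsets J of cardinality i of the tensor         *)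
(* products of the M_{mvec J a}^*.                                            *)
Definition Asp : Type := {ffun {set 'I_n} -> {mpoly C[n]}}.
HB.instance Definition _ := GRing.Lmodule.on Asp.

Definition Agr (i lam : int) : set Asp :=
  [set x | forall J : {set 'I_n}, if #|J|%:Z == i then
     \sum_(a < n) on_factor a (dual_h (mvec J a)) (x J) = lam%:~R *: x J
   else x J = 0]%classic.

Definition Af (x : Asp) : Asp :=
  [ffun J : {set 'I_n} =>
     \sum_(a < n) on_factor a (dual_f (mvec J a)) (x J)].

Definition Aiota (x : Asp) : Asp :=
  [ffun J : {set 'I_n} => \sum_(a in J)
     (-1) ^+ #|[set b in J | (b < a)%N]%SET|
       *: on_factor a (@iota_dual C (m a)) (x (J :\ a)%SET)].

(* The pair (x, y) is the element f (x) x + y. *)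
Definition Bsp : Type := (Asp * Asp)%type.
HB.instance Definition _ := GRing.Lmodule.on Bsp.

Definition Bgr (lam i : int) : set Bsp :=
  [set b | Agr i (lam + 2) b.1 /\ Agr (i - 1) lam b.2]%classic.

Definition Bd (b : Bsp) : Bsp := (- Aiota b.1, Af b.1 + Aiota b.2).

Definition phi (J : {set 'I_n}) (K : 'X_{1..n}) : Asp :=
  [ffun J' => if J' == J then 'X_[K] else 0].

Definition f_tensor (x : Asp) : Bsp := (x, 0).
Definition no_f (y : Asp) : Bsp := (0, y).

End AlgebraicComplex.

Definition is_gamma (C : fieldType) (n k n0 : nat) (m : 'I_n -> nat)
    (z : 'I_n -> C) (kappa : C) (g : chains C n k -> Bsp C n) : Prop :=
  let Aminus := direct_sum (aomoto_skew (k := k) n0 m z) in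
  linear_on Aminus g /\
  forall (J : {set 'I_n}) (K : 'X_{1..n}),
    (forall j, j \in J -> (j < n0)%N) -> 0 <= e_of k m J ->
    [/\ (mdeg K)%:Z = e_of k m J \/ (mdeg K)%:Z = e_of k m J - 1 ->
          Aminus (omega_form k m z kappa J K),
        (mdeg K)%:Z = e_of k m J - 1 ->
          g (omega_form k m z kappa J K) = f_tensor (phi C J K)
      & (mdeg K)%:Z = e_of k m J ->
          g (omega_form k m z kappa J K) = no_f (phi C J K)].

(* Main.v *)
From HB Require Import structures.
Require Import Defs.
From mathcomp Require Import boolp classical_sets functions reals complex mpoly ring zify.
From mathcomp Require Import all_boot all_order all_algebra perm generic_quotient.
From mathcomp Require action fingroup.

(** Every chain is described by finitely many constants, and both differentials
    become the same explicit operator on these constants.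

    Colourings.  A colouring [chi : 'I_k -> option 'I_n] stands for the monomial
    [lam z chi], the wedge of the dlog(t_i - z_(chi i)) over the coloured i. These
    monomials are linearly independent ([lam_indep]: at t_i = z_(chi0 i) only one
    of them survives). A form on a component is a combination of products of
    dlog(t_i - t_q) and dlog(t_i - z_a). By the relation
    dlog f dlog g = (dlog f - dlog g) dlog(f - g) one can write it with at most one
    factor involving a given t_i; if it is skew under the exchange of t_i and t_q,
    the coefficient of dlog(t_i - t_q) vanishes, because exchanging the variables
    changes the sign of dt_i - dt_q over t_i - t_q differently from what skewness
    asks ([skew_residue_zero]). So a skew form is a constant combination of
    monomials ([skew_lspan]).

    Structure of a chain.  Forms on the component labelled by c are pulled back
    from a product of projective spaces, so they are killed by the Euler vector
    field of each block c_j ([gspan_eul]). Together with skewness this leaves, in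
    each block, exactly one uncoloured coordinate, the others having the colour
    of the block, and at most one uncoloured free coordinate ([valid]). All such
    colourings with the same set J of blocks and the same numbers K_a of free
    coordinates of colour a are exchanged by permutations, so that a skew chain
    is [tau A] for a function A of (J, K) ([skew_tau]), and A is determined by the
    chain ([tau_inj]). The sign in [hlam] is the one that makes [tau A] skew for
    every A. Counting the permutations that carry one colouring to another gives
    the factorials in alpha_K^j, hence omega_K^j is a multiple of tau of a delta
    function ([omega_tau]).

    The differential.  On the component of c the form kappa omega_a restricts to
    the sum of the dlog(t_i - t_q) over ordered pairs in one block or both free,
    minus the sum of weighted dlog(t_i - z_a); the weight of a free coordinate at
    z_a is m_a - 2 |c_a|, which is the coordinate of m^j ([omega_a_onE]). A pair
    of coordinates acts through two colourings at a time, and partial fractions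
    turn dlog(t_i - t_q) into dlog(t_i - z_a) ([pair_None]). Inside a block the
    result cancels against the weight because the edge is resonant; for a free
    coordinate one finds K_a (m_a^j - K_a + 1) ([omc_tau]). The residue along the
    block b is the contraction with the Euler field of b ([res_tau]), and it moves
    m_b + 1 coordinates of colour b into the block b ([res_tau_hlam]). These are
    the matrix coefficients of f and of iota on the dual Verma modules
    ([dual_f_coef], [iota_coef]), so the map from A to the pair of polynomials
    with coefficients A J K / [nrm] J K intertwines the differentials ([Gm_d]). It
    is bijective in each degree because the weight condition on the algebraic
    side says exactly that (J, K) is one of the admissible pairs ([AgrP]). *)

Set Implicit Arguments.
Unset Strict Implicit.
Unset Printing Implicit Defensive.

Import GRing.Theory Num.Theory.
Local Open Scope ring_scope.

(** * Exterior algebra of rational forms *)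

Section Fock.
Variables (C : fieldType) (k : nat).
Local Notation F := (ratfun C k).
Local Notation form := (ratform C k).
Implicit Types (i q : 'I_k) (S T : {set 'I_k}) (eta theta a b : form) (f g : F).

Definition below i S : nat := (\sum_(q in S) (q < i))%N.
Definition sg i S : F := (-1) ^+ below i S.

Lemma sg_sq i S : sg i S * sg i S = 1.
Proof. by rewrite /sg -signr_odd -expr2 sqrr_sign. Qed.

Lemma belowU1 i q S : q \notin S -> below i (q |: S)%SET = ((q < i) + below i S)%N.
Proof. by move=> h; rewrite /below big_setU1. Qed.

Lemma sgU1 i q S : q \notin S -> sg i (q |: S)%SET = (-1) ^+ (q < i)%N * sg i S.
Proof. by move=> h; rewrite /sg belowU1 // exprD. Qed.

Lemma sgD1 i q S : q \in S -> sg i (S :\ q)%SET = (-1) ^+ (q < i)%N * sg i S.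
Proof.
move=> h; rewrite -{2}(setD1K h) sgU1 ?inE ?eqxx //.
by rewrite mulrA -expr2 sqrr_sign mul1r.
Qed.

Lemma sg_self i S : sg i (S :\ i)%SET = sg i S.
Proof.
case: (boolP (i \in S)) => h; first by rewrite sgD1 // ltnn mul1r.
by congr sg; apply/setP => q; rewrite !inE; case: eqP => // ->; rewrite (negPf h).
Qed.

Lemma sgUself i S : i \notin S -> sg i (i |: S)%SET = sg i S.
Proof. by move=> h; rewrite sgU1 // ltnn mul1r. Qed.

Lemma sign_lt i q : i != q -> (-1) ^+ (i < q)%N = - (-1) ^+ (q < i)%N :> F.
Proof. by rewrite -val_eqE /=; case: ltngtP => // _ _; rewrite ?expr1 ?expr0 ?opprK. Qed.

(** Exterior multiplication by dx_i and contraction with d/dx_i. With these two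
    operators and their anticommutation relations no other sign of the exterior
    algebra has to be computed by hand. *)
Definition crea i eta : form := [ffun S : {set 'I_k} => if i \in S then sg i S * eta (S :\ i)%SET else 0].
Definition anni i eta : form := [ffun S : {set 'I_k} => if i \in S then 0 else sg i S * eta (i |: S)%SET].

Lemma formP eta theta : (forall S : {set 'I_k}, eta S = theta S) -> eta = theta.
Proof. by move=> h; apply/ffunP. Qed.

Lemma formDE eta theta S : (eta + theta) S = eta S + theta S. Proof. by rewrite ffunE. Qed.
Lemma formNE eta S : (- eta) S = - eta S. Proof. by rewrite ffunE. Qed.
Lemma form0E S : (0 : form) S = 0. Proof. by rewrite ffunE. Qed.
Lemma fscaleE f eta S : fscale f eta S = f * eta S. Proof. by rewrite ffunE. Qed.

Lemma creaD i eta theta : crea i (eta + theta) = crea i eta + crea i theta.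
Proof. by apply: formP => S; rewrite !ffunE; case: ifP; rewrite ?ffunE ?addr0 // mulrDr. Qed.
Lemma creaZ i f eta : crea i (fscale f eta) = fscale f (crea i eta).
Proof. by apply: formP => S; rewrite !ffunE; case: ifP; rewrite ?ffunE ?mulr0 // mulrCA. Qed.
Lemma anniD i eta theta : anni i (eta + theta) = anni i eta + anni i theta.
Proof. by apply: formP => S; rewrite !ffunE; case: ifP; rewrite ?ffunE ?addr0 // mulrDr. Qed.
Lemma anniZ i f eta : anni i (fscale f eta) = fscale f (anni i eta).
Proof. by apply: formP => S; rewrite !ffunE; case: ifP; rewrite ?ffunE ?mulr0 // mulrCA. Qed.

Lemma fscaleA f g eta : fscale f (fscale g eta) = fscale (f * g) eta.
Proof. by apply: formP => S; rewrite !ffunE mulrA. Qed.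
Lemma fscale1 eta : fscale 1 eta = eta.
Proof. by apply: formP => S; rewrite !ffunE mul1r. Qed.
Lemma fscale0 eta : fscale 0 eta = 0.
Proof. by apply: formP => S; rewrite !ffunE mul0r. Qed.
Lemma fscaler0 f : fscale f (0 : form) = 0.
Proof. by apply: formP => S; rewrite !ffunE mulr0. Qed.
Lemma fscaleDr f eta theta : fscale f (eta + theta) = fscale f eta + fscale f theta.
Proof. by apply: formP => S; rewrite !ffunE mulrDr. Qed.
Lemma fscaleDl f g eta : fscale (f + g) eta = fscale f eta + fscale g eta.
Proof. by apply: formP => S; rewrite !ffunE mulrDl. Qed.
Lemma fscaleN1 eta : fscale (-1) eta = - eta.
Proof. by apply: formP => S; rewrite !ffunE mulN1r. Qed.
Lemma fscaleN f eta : fscale (- f) eta = - fscale f eta.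
Proof. by apply: formP => S; rewrite !ffunE mulNr. Qed.
Lemma fscalerN f eta : fscale f (- eta) = - fscale f eta.
Proof. by apply: formP => S; rewrite !ffunE mulrN. Qed.
Lemma fscale_sum (I : Type) (r : seq I) (P : pred I) (h : I -> form) f :
  fscale f (\sum_(x <- r | P x) h x) = \sum_(x <- r | P x) fscale f (h x).
Proof. by apply: (big_morph _ (fscaleDr f) (fscaler0 f)). Qed.
Lemma fscale_suml (I : Type) (r : seq I) (P : pred I) (h : I -> F) eta :
  fscale (\sum_(x <- r | P x) h x) eta = \sum_(x <- r | P x) fscale (h x) eta.
Proof.
by apply: formP => S; rewrite ffunE sum_ffunE mulr_suml; apply: eq_bigr => x _; rewrite ffunE.
Qed.
Lemma scaleE (a : C) eta : a *: eta = fscale (cstF k a) eta.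
Proof. by apply: formP => S; rewrite !ffunE. Qed.

Lemma crea0 i : crea i 0 = 0.
Proof. by rewrite -(fscale0 0) creaZ !fscale0. Qed.
Lemma anni0 i : anni i 0 = 0.
Proof. by rewrite -(fscale0 0) anniZ !fscale0. Qed.
Lemma anniN i eta : anni i (- eta) = - anni i eta.
Proof. by rewrite -fscaleN1 anniZ fscaleN1. Qed.
Lemma crea_sum (I : Type) (r : seq I) (P : pred I) (h : I -> form) i :
  crea i (\sum_(x <- r | P x) h x) = \sum_(x <- r | P x) crea i (h x).
Proof. by apply: (big_morph _ (creaD i) (crea0 i)). Qed.
Lemma anni_sum (I : Type) (r : seq I) (P : pred I) (h : I -> form) i :
  anni i (\sum_(x <- r | P x) h x) = \sum_(x <- r | P x) anni i (h x).
Proof. by apply: (big_morph _ (anniD i) (anni0 i)). Qed.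

Lemma crea_sq i eta : crea i (crea i eta) = 0.
Proof. by apply: formP => S; rewrite !ffunE !inE eqxx /= mulr0; case: ifP. Qed.
Lemma crea_anti i q eta : i != q -> crea i (crea q eta) = - crea q (crea i eta).
Proof.
move=> niq; apply: formP => S; rewrite !ffunE !inE (eq_sym q i) niq /=.
case: (boolP (i \in S)) => hi; case: (boolP (q \in S)) => hq; rewrite ?mulr0 ?oppr0 //.
have -> : (S :\ i :\ q = S :\ q :\ i)%SET by rewrite setDDl setUC -setDDl.
rewrite !sgD1 //.
rewrite (sign_lt niq); by ring.
Qed.

Lemma anni_anti i q eta : i != q -> anni i (anni q eta) = - anni q (anni i eta).
Proof.
move=> niq; apply: formP => S; rewrite !ffunE !inE (eq_sym q i) (negPf niq) /=.
case: (boolP (i \in S)) => hi; case: (boolP (q \in S)) => hq; rewrite ?mulr0 ?oppr0 //.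
rewrite setUCA !sgU1 // (sign_lt niq); by ring.
Qed.

Lemma crea_anni i q eta : i != q -> crea i (anni q eta) = - anni q (crea i eta).
Proof.
move=> niq; apply: formP => S; rewrite !ffunE !inE (eq_sym q i) (negPf niq) /=.
case: (boolP (i \in S)) => hi; case: (boolP (q \in S)) => hq; rewrite ?mulr0 ?oppr0 //.
have -> : ((q |: S) :\ i = q |: (S :\ i))%SET.
  by apply/setP => x; rewrite !inE; case: (x =P i) => // ->; rewrite (negPf niq) .
rewrite sgU1 // sgD1 // (sign_lt niq); by ring.
Qed.

Lemma anni_crea i eta : anni i (crea i eta) = eta - crea i (anni i eta).
Proof.
apply: formP => S; rewrite !ffunE !inE eqxx /=.
case: (boolP (i \in S)) => hi.
  by rewrite setD1K // sg_self mulrA sg_sq mul1r subrr.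
by rewrite setU1K // subr0 sgUself // mulrA sg_sq mul1r.
Qed.

Definition dX S : form := [ffun T : {set 'I_k} => (T == S)%:R].

Lemma dXE S T : dX S T = (T == S)%:R. Proof. by rewrite ffunE. Qed.

Lemma dX0 : dX set0 = form1 C k. Proof. by []. Qed.

Lemma crea_dX i S : crea i (dX S) = if i \in S then 0 else fscale (sg i S) (dX (i |: S)%SET).
Proof.
apply: formP => T; rewrite !ffunE; case: (boolP (i \in S)) => hi; rewrite !ffunE.
  case: ifP => // _; case: eqP => [E|]; rewrite ?mulr0 //.
  by move: hi; rewrite -E !inE eqxx.
case: (boolP (i \in T)) => hT.
  have -> : (T :\ i == S)%SET = (T == i |: S)%SET.
    apply/eqP/eqP => [<-|->]; first by rewrite setD1K.
    by rewrite setU1K.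
  by case: eqP => [->|]; rewrite ?mulr0 // sgUself.
case: eqP => [E|]; last by rewrite mulr0.
by move: hT; rewrite E !inE eqxx.
Qed.

Lemma anni_dX i S : anni i (dX S) = if i \in S then fscale (sg i S) (dX (S :\ i)%SET) else 0.
Proof.
apply: formP => T; rewrite !ffunE; case: (boolP (i \in S)) => hi; rewrite !ffunE.
  case: (boolP (i \in T)) => hT.
    case: eqP => [E|]; last by rewrite mulr0.
    by move: hT; rewrite E !inE eqxx.
  have -> : (i |: T == S)%SET = (T == S :\ i)%SET.
    apply/eqP/eqP => [<-|->]; first by rewrite setU1K.
    by rewrite setD1K.
  by case: eqP => [->|]; rewrite ?mulr0 // sg_self.
case: ifP => // _; case: eqP => [E|]; rewrite ?mulr0 //.
by move: hi; rewrite -E !inE eqxx.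
Qed.

Lemma form_dX eta : eta = \sum_S fscale (eta S) (dX S).
Proof.
apply: formP => T; rewrite sum_ffunE (bigD1 T) //= big1 => [|S nS]; rewrite !ffunE.
  by rewrite eqxx mulr1 addr0.
by rewrite eq_sym (negPf nS) mulr0.
Qed.

Lemma dX_crea i S : i \in S -> dX S = fscale (sg i S) (crea i (dX (S :\ i)%SET)).
Proof.
move=> hi; rewrite crea_dX !inE eqxx /= setD1K // fscaleA sg_self.
by rewrite sg_sq fscale1.
Qed.

(** Reduces an identity that is linear over the functions to its behaviour under
    exterior multiplication by one dx_i. *)
Lemma form_ind (P : form -> Prop) :
  P 0 -> (forall a b, P a -> P b -> P (a + b)) -> (forall f a, P a -> P (fscale f a)) ->
  P (form1 C k) -> (forall i a, P a -> P (crea i a)) -> forall eta, P eta.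
Proof.
move=> P0 PD PZ P1 Pc eta; rewrite (form_dX eta).
apply: (big_ind P) => // S _; apply/PZ.
have [N] := ubnP #|S|; elim: N S => // N IH S /ltnSE leS.
case: (set_0Vmem S) => [->|[i hi]]; first by rewrite dX0.
rewrite (dX_crea hi); apply/PZ/Pc/IH.
by move: leS; rewrite (cardsD1 i) hi.
Qed.

Lemma wedgeDl a b eta : wedge (a + b) eta = wedge a eta + wedge b eta.
Proof.
apply: formP => S; rewrite !ffunE -big_split; apply: eq_bigr => A _.
by rewrite !ffunE mulrDr mulrDl.
Qed.
Lemma wedgeDr a eta theta : wedge a (eta + theta) = wedge a eta + wedge a theta.
Proof.
apply: formP => S; rewrite !ffunE -big_split; apply: eq_bigr => A _.
by rewrite !ffunE mulrDr.
Qed.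
Lemma wedgeZl f a eta : wedge (fscale f a) eta = fscale f (wedge a eta).
Proof.
apply: formP => S; rewrite !ffunE mulr_sumr; apply: eq_bigr => A _.
by rewrite !ffunE; ring.
Qed.
Lemma wedgeZr f a eta : wedge a (fscale f eta) = fscale f (wedge a eta).
Proof.
apply: formP => S; rewrite !ffunE mulr_sumr; apply: eq_bigr => A _.
by rewrite !ffunE; ring.
Qed.
Lemma wedge0l eta : wedge 0 eta = 0.
Proof. by rewrite -(fscale0 0) wedgeZl !fscale0. Qed.
Lemma wedge0r a : wedge a 0 = 0.
Proof. by rewrite -(fscale0 0) wedgeZr !fscale0. Qed.
Lemma wedgeNl a b : wedge (- a) b = - wedge a b.
Proof. by rewrite -!fscaleN1 wedgeZl. Qed.
Lemma wedgeNr a b : wedge a (- b) = - wedge a b.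
Proof. by rewrite -!fscaleN1 wedgeZr. Qed.
Lemma wedge_suml (I : Type) (r : seq I) (P : pred I) (h : I -> form) b :
  wedge (\sum_(x <- r | P x) h x) b = \sum_(x <- r | P x) wedge (h x) b.
Proof.
apply: (big_ind2 (fun u v => wedge u b = v)) => // [|u u' v v' <- <-]; first exact: wedge0l.
exact: wedgeDl.
Qed.
Lemma wedge_sumr (I : Type) (r : seq I) (P : pred I) (h : I -> form) b :
  wedge b (\sum_(x <- r | P x) h x) = \sum_(x <- r | P x) wedge b (h x).
Proof. by apply: (big_morph _ (wedgeDr b) (wedge0r b)). Qed.

Lemma wedge_sign_below (A B : {set 'I_k}) :
  wedge_sign C A B = (-1) ^+ (\sum_(i in A) below i B)%N.
Proof.
rewrite /wedge_sign; congr (_ ^+ _).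
rewrite -sum1_card; transitivity (\sum_(ab | (ab.1 \in A) && (ab.2 \in B)) (ab.2 < ab.1 : nat))%N.
  rewrite big_mkcond [in RHS]big_mkcond /=; apply: eq_bigr => -[a b] _.
  by rewrite !inE /=; case: (a \in A); case: (b \in B); case: (_ < _)%N.
by rewrite /below pair_big_dep.
Qed.

Lemma wedge_signU1 i (A B : {set 'I_k}) : i \notin A ->
  wedge_sign C (i |: A)%SET B = sg i B * wedge_sign C A B.
Proof. by move=> h; rewrite !wedge_sign_below big_setU1 //= exprD. Qed.

Lemma sgUd i (A B : {set 'I_k}) : [disjoint A & B] -> sg i (A :|: B)%SET = sg i A * sg i B.
Proof.
move=> d; rewrite /sg -exprD; congr (_ ^+ _).
by rewrite /below (eq_bigl [predU A & B]) ?bigU // => x; rewrite !inE.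
Qed.

(** The only place where the sign of a shuffle is computed; associativity and
    the other rules of the wedge product follow from it by induction on products
    of dx_i. *)
Lemma wedge_crea i a b : wedge (crea i a) b = crea i (wedge a b).
Proof.
apply: formP => S; rewrite !ffunE.
case: (boolP (i \in S)) => hi; last first.
  rewrite big1 // => A sA; rewrite !ffunE ifN ?mulr0 ?mul0r //.
  by apply: contra hi; move/subsetP: sA; apply.
rewrite big_distrr /= (bigID (fun A : {set 'I_k} => i \in A)) /= addrC big1 ?add0r; last first.
  by move=> A /andP[_ h]; rewrite !ffunE (negPf h) mulr0 mul0r.
rewrite (reindex_onto (fun B : {set 'I_k} => (i |: B)%SET) (fun A : {set 'I_k} => (A :\ i)%SET)) /=; last first.
  by move=> A /andP[_ h]; rewrite setD1K.
apply: eq_big => B.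
  rewrite !inE eqxx /= andbT subUset sub1set hi /= subsetD1.
  case: (boolP (i \in B)) => hB; last by rewrite setU1K // eqxx.
  rewrite andbF; apply/andP => -[_ /eqP E].
  by move: hB; rewrite -E !inE eqxx.
case/andP => /andP[sBS _] /eqP E.
have hB : i \notin B by rewrite -E !inE eqxx.
rewrite !ffunE !inE eqxx /= setU1K // wedge_signU1 // sgUself //.
have -> : (S :\: (i |: B) = S :\ i :\: B)%SET by rewrite setDDl.
have sB : B \subset S :\ i by rewrite subsetD1 hB andbT (subset_trans _ sBS) // subsetUr.
have -> : sg i S = sg i B * sg i (S :\ i :\: B)%SET.
  rewrite -(sg_self i S) -sgUd; last first.
    by rewrite disjoints_subset; apply/subsetP => x xB; rewrite !inE xB.
  congr sg; apply/setP => x; rewrite !inE.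
  by case: (boolP (x \in B)) => //= /(subsetP sB); rewrite !inE.
by ring.
Qed.

Lemma wedge1l b : wedge (form1 C k) b = b.
Proof.
apply: formP => S; rewrite !ffunE (bigD1 set0) ?sub0set //= big1 => [|A /andP[_ nA]].
  by rewrite !ffunE eqxx mulr1 setD0 addr0 wedge_sign_below big_set0 expr0 mul1r.
by rewrite !ffunE (negPf nA) mulr0 mul0r.
Qed.

Lemma wedgeA a b c : wedge a (wedge b c) = wedge (wedge a b) c.
Proof.
elim/form_ind: a => [|a a' Ha Ha'|f a Ha||i a Ha].
- by rewrite !wedge0l.
- by rewrite !wedgeDl Ha Ha'.
- by rewrite !wedgeZl Ha.
- by rewrite !wedge1l.
- by rewrite !wedge_crea Ha.
Qed.

Lemma wedge1r b : wedge b (form1 C k) = b.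
Proof.
elim/form_ind: b => [|a a' Ha Ha'|f a Ha||i a Ha].
- by rewrite !wedge0l.
- by rewrite !wedgeDl Ha Ha'.
- by rewrite !wedgeZl Ha.
- by rewrite !wedge1l.
- by rewrite !wedge_crea Ha.
Qed.

HB.instance Definition _ := Monoid.isLaw.Build form (form1 C k) (@wedge C k) wedgeA wedge1l wedge1r.

Definition oneform (w : 'I_k -> F) : form := \sum_i fscale (w i) (crea i (form1 C k)).

Definition is_oneform eta : Prop := forall S : {set 'I_k}, #|S| != 1%N -> eta S = 0.

Lemma wedge_oneform w eta : wedge (oneform w) eta = \sum_i fscale (w i) (crea i eta).
Proof.
rewrite /oneform wedge_suml; apply: eq_bigr => i _.
by rewrite wedgeZl wedge_crea wedge1l.
Qed.

Lemma oneformE w i : oneform w [set i]%SET = w i.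
Proof.
rewrite /oneform sum_ffunE (bigD1 i) //= big1 => [|q nq]; rewrite !ffunE !inE.
  by rewrite eqxx setDv eqxx /sg /below big_set1 ltnn expr0 !mulr1 addr0.
by rewrite (negPf nq) mulr0.
Qed.

Lemma is_oneformP eta : is_oneform eta -> eta = oneform (fun i => eta [set i]%SET).
Proof.
move=> h; apply: formP => S; case: (boolP (#|S| == 1%N)) => [/cards1P[i ->]|nS].
  by rewrite oneformE.
rewrite h // /oneform sum_ffunE big1 // => i _; rewrite !ffunE; case: ifP => iS; rewrite ?mulr0 //.
case: eqP => [E|]; rewrite ?mulr0 //; move: nS.
by rewrite -(setD1K iS) E setU0 cards1.
Qed.

Lemma oneform_is w : is_oneform (oneform w).
Proof.
move=> S nS; rewrite /oneform sum_ffunE big1 // => i _; rewrite !ffunE; case: ifP => iS; rewrite ?mulr0 //.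
case: eqP => [E|]; rewrite ?mulr0 //; move: nS.
by rewrite -(setD1K iS) E setU0 cards1.
Qed.

Lemma oneform_eq w w' : w =1 w' -> oneform w = oneform w'.
Proof. by move=> h; apply: eq_bigr => i _; rewrite h. Qed.

Lemma is_oneformD a b : is_oneform a -> is_oneform b -> is_oneform (a + b).
Proof. by move=> ha hb S nS; rewrite !ffunE ha // hb // addr0. Qed.
Lemma is_oneformZ f a : is_oneform a -> is_oneform (fscale f a).
Proof. by move=> ha S nS; rewrite !ffunE ha // mulr0. Qed.
Lemma is_oneformN a : is_oneform a -> is_oneform (- a).
Proof. by rewrite -fscaleN1; apply: is_oneformZ. Qed.
Lemma is_oneform0 : is_oneform 0.
Proof. by move=> S nS; rewrite ffunE. Qed.

Lemma crea_oneform_anti q w eta :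
  is_oneform w -> crea q (wedge w eta) = - wedge w (crea q eta).
Proof.
move=> /is_oneformP ->; rewrite !wedge_oneform crea_sum -sumrN; apply: eq_bigr => i _.
rewrite creaZ; case: (altP (q =P i)) => [->|n]; first by rewrite crea_sq !fscaler0 oppr0.
by rewrite crea_anti // fscalerN.
Qed.

Lemma wedge_anti w w' eta : is_oneform w -> is_oneform w' ->
  wedge w (wedge w' eta) = - wedge w' (wedge w eta).
Proof.
move=> h; move/is_oneformP => ->; rewrite !wedge_oneform wedge_sumr -sumrN.
by apply: eq_bigr => i _; rewrite wedgeZr crea_oneform_anti // fscalerN opprK.
Qed.

Lemma wedge_sq w eta : is_oneform w -> wedge w (wedge w eta) = 0.
Proof.
move=> /is_oneformP ->; set u := fun i => w _; rewrite wedge_oneform.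
under eq_bigr => i _ do rewrite wedge_oneform crea_sum fscale_sum.
rewrite pair_bigA /= (bigID (fun p : 'I_k * 'I_k => p.1 < p.2)%N) /=.
rewrite [X in _ + X](bigID (fun p : 'I_k * 'I_k => p.2 < p.1)%N) /=.
rewrite [X in _ + (_ + X)]big1 ?addr0; last first.
  move=> [i q] /=; rewrite -!leqNgt => /andP[le1 le2].
  have -> : i = q by apply/val_inj/eqP; rewrite eqn_leq le1 le2.
  by rewrite creaZ crea_sq !fscaler0.
rewrite [X in _ + X](reindex_inj (h := fun p : 'I_k * 'I_k => (p.2, p.1))) /=; last by move=> [a b] [c d] [-> ->].
rewrite [X in _ + X](eq_bigl (fun p : 'I_k * 'I_k => p.1 < p.2)%N); last first.
  by move=> [i q] /=; case: ltngtP.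
rewrite -big_split big1 //= => -[i q] /= lt.
rewrite !creaZ !fscaleA [u q * _]mulrC crea_anti; last by rewrite -val_eqE /=; case: ltngtP lt.
by rewrite fscalerN addNr.
Qed.

End Fock.

Local Open Scope quotient_scope.

(** * Contraction with vector fields *)

Section Contraction.
Variables (C : fieldType) (k : nat).
Local Notation F := (ratfun C k).
Local Notation form := (ratform C k).
Implicit Types (i q : 'I_k) (S T : {set 'I_k}) (eta theta a b w : form) (f g : F) (v : 'I_k -> F).

Definition contr v eta : form := \sum_i fscale (v i) (anni i eta).
Definition ev1 v w : F := \sum_i v i * w [set i]%SET.

Lemma anni_oneform i w eta : is_oneform w ->
  anni i (wedge w eta) = fscale (w [set i]%SET) eta - wedge w (anni i eta).
Proof.
move=> h; rewrite {1 3}(is_oneformP h) !wedge_oneform anni_sum.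
rewrite (bigD1 i) //= anniZ anni_crea fscaleDr -addrA; congr (_ + _).
rewrite [in RHS](bigD1 i) //= opprD fscalerN; congr (_ + _).
rewrite -sumrN; apply: eq_bigr => q nq; rewrite anniZ -fscalerN; congr fscale.
by rewrite crea_anni // opprK.
Qed.

Lemma contrD v a b : contr v (a + b) = contr v a + contr v b.
Proof. by rewrite /contr -big_split; apply: eq_bigr => i _; rewrite anniD fscaleDr. Qed.
Lemma contrZ v f a : contr v (fscale f a) = fscale f (contr v a).
Proof.
by rewrite /contr fscale_sum; apply: eq_bigr => i _; rewrite anniZ !fscaleA mulrC.
Qed.
Lemma contr0 v : contr v 0 = 0.
Proof. by rewrite -(fscale0 0) contrZ !fscale0. Qed.
Lemma contrN v a : contr v (- a) = - contr v a.
Proof. by rewrite -!fscaleN1 contrZ. Qed.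
Lemma contr_sum v (I : Type) (r : seq I) (P : pred I) (h : I -> form) :
  contr v (\sum_(x <- r | P x) h x) = \sum_(x <- r | P x) contr v (h x).
Proof. by apply: (big_morph _ (contrD v) (contr0 v)). Qed.

Lemma anni_form1 i : anni i (form1 C k) = 0.
Proof. by rewrite -dX0 anni_dX inE. Qed.

Lemma contr_form1 v : contr v (form1 C k) = 0.
Proof. by rewrite /contr big1 // => i _; rewrite anni_form1 fscaler0. Qed.

Lemma contr_wedge v w eta : is_oneform w ->
  contr v (wedge w eta) = fscale (ev1 v w) eta - wedge w (contr v eta).
Proof.
move=> h; rewrite /contr /ev1 fscale_suml wedge_sumr -sumrB; apply: eq_bigr => i _.
by rewrite anni_oneform // fscaleDr fscaleA fscalerN wedgeZr.
Qed.

(** A contraction squares to zero since contractions with coordinate fields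
    anticommute. *)
Lemma contr_sq v a : contr v (contr v a) = 0.
Proof.
elim/form_ind: a => [|a a' Ha Ha'|f a Ha||i a Ha].
- by rewrite !contr0.
- by rewrite !contrD Ha Ha' addr0.
- by rewrite !contrZ Ha fscaler0.
- by rewrite contr_form1 contr0.
have h : is_oneform (crea i (form1 C k)).
  move=> S nS; rewrite -dX0 crea_dX inE setU0 !ffunE; case: eqP => [E|]; rewrite ?mulr0 //.
  by move: nS; rewrite E cards1.
rewrite -[a]wedge1l -wedge_crea contr_wedge // contrD contrN contrZ contr_wedge // Ha.
by rewrite wedge0r subr0 subrr.
Qed.

Definition prodform (w : 'I_k -> form) S : form := \big[@wedge C k/form1 C k]_(i in S) w i.

Lemma index_enum_ordE : index_enum 'I_k = enum 'I_k.
Proof. by rewrite enumT; unlock. Qed.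

Lemma sorted_enum_ord : sorted (fun i q : 'I_k => i < q)%N (enum 'I_k).
Proof.
have -> : (fun i q : 'I_k => i < q)%N = relpre val ltn by [].
rewrite -sorted_map val_enum_ord.
exact: iota_ltn_sorted.
Qed.

Lemma wedge_prodform (w : 'I_k -> form) q S : (forall i, is_oneform (w i)) ->
  wedge (w q) (prodform w S)
  = if q \in S then 0 else fscale (sg C q S) (prodform w (q |: S)%SET).
Proof.
move=> hw; rewrite /prodform /sg /below index_enum_ordE.
move: (mem_enum 'I_k q) sorted_enum_ord; rewrite inE.
elim: (enum 'I_k) => // x r IH; rewrite inE => hq /= hs.
have hs' := path_sorted hs.
have hx : {in r, forall y : 'I_k, (x < y)%N}.
  by apply/allP; apply: (order_path_min _ hs) => a b c; apply: ltn_trans.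
have nxr : x \notin r by apply/negP => /hx; rewrite ltnn.
rewrite !big_cons !inE.
case: (altP (q =P x)) hq => [E|nqx] /= hq; last first.
  rewrite (eq_sym x) (negPf nqx) /=.
  have lt : (x < q)%N by apply: hx.
  case: (boolP (x \in S)) => xS; last by rewrite -IH.
  rewrite wedge_anti // IH //; case: ifP => qS; first by rewrite wedge0r oppr0.
  by rewrite lt wedgeZr -fscaleN1 fscaleA exprD expr1.
subst x; rewrite eqxx ltnn add0n /=.
case: (boolP (q \in S)) => qS; first by rewrite wedge_sq.
have E i : (i \in r) -> (i \in q |: S)%SET = (i \in S).
  by rewrite !inE; case: eqP => // -> hr; rewrite hr in nxr.
rewrite [X in fscale (_ ^+ X)]big1_seq ?expr0 ?fscale1; last first.
  by move=> y /andP[_ /hx]; case: ltngtP.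
by congr wedge; rewrite [in LHS]big_seq_cond [in RHS]big_seq_cond; apply: eq_bigl => i; case: (boolP (i \in r)) => //= /E ->.
Qed.

Lemma prodformD1 (w : 'I_k -> form) q S : (forall i, is_oneform (w i)) -> q \in S ->
  prodform w S = fscale (sg C q S) (wedge (w q) (prodform w (S :\ q)%SET)).
Proof.
move=> hw qS; rewrite wedge_prodform // !inE eqxx /= setD1K // fscaleA sg_self.
by rewrite sg_sq fscale1.
Qed.

Lemma prodform0 (w : 'I_k -> form) : prodform w set0 = form1 C k.
Proof. by rewrite /prodform big_set0. Qed.

End Contraction.

(** * Evaluation of rational functions *)

Section Evaluation.
Variables (C : fieldType) (k : nat).
Local Notation F := (ratfun C k).
Local Notation form := (ratform C k).
Local Notation poly := {mpoly C[k]}.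
Implicit Types (i : 'I_k) (S T : {set 'I_k}) (eta theta : form) (f g : F) (p q : poly).

Lemma cstF_zmod : zmod_morphism (@cstF C k).
Proof. by move=> a b; rewrite /cstF /polyF mpolyCB rmorphB. Qed.
Lemma cstF_monoid : monoid_morphism (@cstF C k).
Proof. by split=> [|a b]; rewrite /cstF /polyF ?mpolyC1 ?rmorph1 // mpolyCM rmorphM. Qed.
HB.instance Definition _ := GRing.isZmodMorphism.Build C F (@cstF C k) cstF_zmod.
HB.instance Definition _ := GRing.isMonoidMorphism.Build C F (@cstF C k) cstF_monoid.

Lemma polyF_zmod : zmod_morphism (@polyF C k).
Proof. by move=> a b; rewrite /polyF rmorphB. Qed.
Lemma polyF_monoid : monoid_morphism (@polyF C k).
Proof. by split=> [|a b]; rewrite /polyF ?rmorph1 // rmorphM. Qed.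
HB.instance Definition _ := GRing.isZmodMorphism.Build poly F (@polyF C k) polyF_zmod.
HB.instance Definition _ := GRing.isMonoidMorphism.Build poly F (@polyF C k) polyF_monoid.

Lemma polyFM p q : polyF (p * q) = polyF p * polyF q. Proof. exact: rmorphM. Qed.
Lemma polyFD p q : polyF (p + q) = polyF p + polyF q. Proof. exact: rmorphD. Qed.
Lemma polyFN p : polyF (- p) = - polyF p. Proof. exact: rmorphN. Qed.
Lemma polyF1 : polyF 1 = 1 :> F. Proof. exact: rmorph1. Qed.
Lemma polyF0 : polyF 0 = 0 :> F. Proof. exact: rmorph0. Qed.

Lemma polyF_eq0 p : (polyF p == 0) = (p == 0).
Proof. exact: tofrac_eq0. Qed.
Lemma polyF_inj : injective (@polyF C k).
Proof. by move=> p q /eqP; rewrite -subr_eq0 -rmorphB /= polyF_eq0 subr_eq0 => /eqP. Qed.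
Lemma cstF_eq0 (c : C) : (cstF k c == 0) = (c == 0).
Proof. by rewrite polyF_eq0 mpolyC_eq0. Qed.

Lemma denF_neq0 f : denF f != 0.
Proof. exact: denom_ratioP. Qed.

Lemma numdenF f : f = polyF (numF f) / polyF (denF f).
Proof.
apply: (canRL (mulfK _)); first by rewrite polyF_eq0 denF_neq0.
rewrite -{1}[f]reprK /numF /denF; set x := repr f.
apply/eqP; rewrite /polyF; change (FracField.mul (\pi_(FracField.type _) x) (FracField.tofrac (frac x).2) == FracField.tofrac (frac x).1).
rewrite !piE FracField.equivfE /FracField.mulf !numden_Ratio ?oner_neq0 ?mulr1 ?denom_ratioP //.
by rewrite mulrC.
Qed.

Fact ev_sealed : {e : ('I_k -> F) -> poly -> F | e = fun s => mmap (@cstF C k) s}.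
Proof. by exists (fun s => mmap (@cstF C k) s). Qed.
(** Sealed: the value of a polynomial in the field of fractions should not be
    unfolded by unification. *)
Definition ev := sval ev_sealed.
Lemma evE s p : ev s p = mmap (@cstF C k) s p.
Proof. by rewrite /ev (svalP ev_sealed). Qed.

Lemma evM s p q : ev s (p * q) = ev s p * ev s q. Proof. by rewrite !evE rmorphM. Qed.
Lemma evD s p q : ev s (p + q) = ev s p + ev s q. Proof. by rewrite !evE rmorphD. Qed.
Lemma evN s p : ev s (- p) = - ev s p. Proof. by rewrite !evE rmorphN. Qed.
Lemma ev_1 s : ev s 1 = 1. Proof. by rewrite evE rmorph1. Qed.
Lemma ev_0 s : ev s 0 = 0. Proof. by rewrite evE rmorph0. Qed.

Lemma ev_C s c : ev s c%:MP = cstF k c. Proof. by rewrite evE mmapC. Qed.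
Lemma ev_X s i : ev s 'X_i = s i. Proof. by rewrite evE mmapX mmap1U. Qed.

Lemma poly_gen_ind (P : poly -> Prop) :
  (forall c, P c%:MP) -> (forall i, P 'X_i) -> (forall p q, P p -> P q -> P (p + q)) ->
  (forall p q, P p -> P q -> P (p * q)) -> forall p, P p.
Proof.
move=> PC PX PD PM p; rewrite [p]mpolyE.
apply: (big_ind P) => [|//|m _]; first by rewrite -(mpolyC0 k C).
rewrite -mul_mpolyC; apply: (PM _ _ (PC _)).
rewrite mpolyXE_id; apply: (big_ind P) => [|//|i _]; first by rewrite -(mpolyC1 k C).
by elim: (m i) => [|d IH]; [rewrite expr0 -(mpolyC1 k C)|rewrite exprS; apply: PM].
Qed.

Fact nz_sealed : {b : F -> bool | b = fun f => f != 0}.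
Proof. by exists (fun f => f != 0). Qed.
(** Nonvanishing, sealed so that fractions are not compared by computation. *)
Definition nz := sval nz_sealed.
Lemma nzE f : nz f = (f != 0).
Proof. by rewrite /nz (svalP nz_sealed). Qed.
Lemma nzP f : reflect (f <> 0) (nz f).
Proof. by rewrite nzE; apply: (iffP idP) => /eqP. Qed.
Lemma nzM f g : nz (f * g) = nz f && nz g.
Proof. by rewrite !nzE mulf_eq0 negb_or. Qed.
Lemma nzV f : nz f^-1 = nz f.
Proof. by rewrite !nzE invr_eq0. Qed.
Lemma nz1 : nz 1. Proof. by rewrite nzE oner_eq0. Qed.
Lemma nz_polyF p : nz (polyF p) = (p != 0). Proof. by rewrite nzE polyF_eq0. Qed.
Lemma divff_nz f : nz f -> f / f = 1. Proof. by rewrite nzE => /divff. Qed.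
Lemma mulfK_nz f g : nz g -> f * g / g = f. Proof. by rewrite nzE => /mulfK. Qed.
Lemma divfK_nz f g : nz g -> f / g * g = f. Proof. by rewrite nzE => /divfK. Qed.
Lemma eqr_div_nz f g f' g' : nz g -> nz g' -> f / g = f' / g' <-> f * g' = f' * g.
Proof.
rewrite !nzE => n n'; split => [/eqP|/eqP h]; first by rewrite (eqr_div _ _ n n') => /eqP.
by apply/eqP; rewrite (eqr_div _ _ n n').
Qed.
Lemma addf_div_nz f g f' g' : nz g -> nz g' -> f / g + f' / g' = (f * g' + f' * g) / (g * g').
Proof. by rewrite !nzE; apply: addf_div. Qed.

(** The point s may make some denominators vanish, so evaluation is a relation:
    f has a presentation whose denominator survives at s. It is single-valued
    ([evalF_fun]). *)
Definition evalF s f g : Prop :=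
  exists p q, [/\ nz (ev s q), f = polyF p / polyF q & g = ev s p / ev s q].

Lemma ev_neq0 s q : nz (ev s q) -> nz (polyF q).
Proof. by rewrite nz_polyF nzE; apply: contra => /eqP ->; rewrite ev_0. Qed.

Variable s : 'I_k -> F.

Lemma evalF_fun f g g' : evalF s f g -> evalF s f g' -> g = g'.
Proof.
move=> [p [q [nq -> ->]]] [p' [q' [nq' E ->]]].
apply/(eqr_div_nz _ _ nq nq').
move/(eqr_div_nz _ _ (ev_neq0 nq) (ev_neq0 nq')): E.
by rewrite -!polyFM => /polyF_inj /(congr1 (ev s)); rewrite !evM.
Qed.

Lemma evalF_poly p : evalF s (polyF p) (ev s p).
Proof. by exists p, 1; rewrite ev_1 polyF1 !divr1 nz1. Qed.
Lemma evalF_cst c : evalF s (cstF k c) (cstF k c).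
Proof. by have := evalF_poly c%:MP; rewrite ev_C. Qed.
Lemma evalF_var i : evalF s (varF C i) (s i).
Proof. by have := evalF_poly 'X_i; rewrite ev_X. Qed.
Lemma evalF0 : evalF s 0 0.
Proof. by have := evalF_poly 0; rewrite polyF0 ev_0. Qed.
Lemma evalF1 : evalF s 1 1.
Proof. by have := evalF_poly 1; rewrite polyF1 ev_1. Qed.

Lemma evalFD f g f' g' : evalF s f f' -> evalF s g g' -> evalF s (f + g) (f' + g').
Proof.
move=> [p [q [nq -> ->]]] [p' [q' [nq' -> ->]]].
exists (p * q' + p' * q), (q * q'); rewrite polyFD !polyFM evD !evM nzM nq nq'.
by rewrite (addf_div_nz _ _ nq nq') (addf_div_nz _ _ (ev_neq0 nq) (ev_neq0 nq')).
Qed.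
Lemma evalFM f g f' g' : evalF s f f' -> evalF s g g' -> evalF s (f * g) (f' * g').
Proof.
move=> [p [q [nq -> ->]]] [p' [q' [nq' -> ->]]].
by exists (p * p'), (q * q'); rewrite !polyFM !evM nzM nq nq' !mulf_div.
Qed.
Lemma evalFN f f' : evalF s f f' -> evalF s (- f) (- f').
Proof.
move=> [p [q [nq -> ->]]].
by exists (- p), q; rewrite polyFN evN !mulNr.
Qed.
Lemma evalFB f g f' g' : evalF s f f' -> evalF s g g' -> evalF s (f - g) (f' - g').
Proof. by move=> h h'; apply: (evalFD h (evalFN h')). Qed.
Lemma evalFV f f' : evalF s f f' -> nz f' -> evalF s f^-1 f'^-1.
Proof.
move=> [p [q [nq -> ->]]]; rewrite nzM => /andP[np _].
by exists q, p; rewrite np !invf_div.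
Qed.
Lemma evalF_div f g f' g' : evalF s f f' -> evalF s g g' -> nz g' -> evalF s (f / g) (f' / g').
Proof. by move=> h h' n; apply: (evalFM h (evalFV h' n)). Qed.
Lemma evalF_sign n : evalF s ((-1) ^+ n) ((-1) ^+ n).
Proof. by elim: n => [|n IH]; rewrite ?exprS; [exact: evalF1|apply/evalFM/IH/evalFN/evalF1]. Qed.
Lemma evalF_sum (I : Type) (r : seq I) (P : pred I) (h h' : I -> F) :
  (forall x, P x -> evalF s (h x) (h' x)) ->
  evalF s (\sum_(x <- r | P x) h x) (\sum_(x <- r | P x) h' x).
Proof. by move=> H; apply: (big_ind2 (evalF s)) => //; [exact: evalF0|move=> *; exact: evalFD]. Qed.
Lemma evalF_prod (I : Type) (r : seq I) (P : pred I) (h h' : I -> F) :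
  (forall x, P x -> evalF s (h x) (h' x)) ->
  evalF s (\prod_(x <- r | P x) h x) (\prod_(x <- r | P x) h' x).
Proof. by move=> H; apply: (big_ind2 (evalF s)) => //; [exact: evalF1|move=> *; exact: evalFM]. Qed.

Lemma evalF_mmap (s1 s2 : 'I_k -> F) p :
  (forall i, evalF s (s1 i) (s2 i)) -> evalF s (ev s1 p) (ev s2 p).
Proof.
move=> h; elim/poly_gen_ind: p => [c|i|p q hp hq|p q hp hq].
- by rewrite !ev_C; apply: evalF_cst.
- by rewrite !ev_X; apply: h.
- by rewrite !evD; apply: evalFD.
- by rewrite !evM; apply: evalFM.
Qed.

Lemma ev_var p : ev (@varF C k) p = polyF p.
Proof.
elim/poly_gen_ind: p => [c|i|p q hp hq|p q hp hq].
- by rewrite ev_C.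
- by rewrite ev_X.
- by rewrite evD polyFD hp hq.
- by rewrite evM polyFM hp hq.
Qed.

(** Algebraic independence of the values s, so that every fraction can be
    evaluated at s. *)
Definition injev : Prop := forall p, p != 0 -> nz (ev s p).

Lemma evalF_subst f : injev -> evalF s f (substF s f).
Proof.
move=> inj; exists (numF f), (denF f); rewrite (inj _ (denF_neq0 f)) -numdenF !evE.
by split.
Qed.

End Evaluation.

(** * Derivatives and logarithmic differentials *)

Section Derivation.
Variables (C : fieldType) (k : nat).
Local Notation F := (ratfun C k).
Local Notation form := (ratform C k).
Local Notation poly := {mpoly C[k]}.
Implicit Types (i : 'I_k) (S T : {set 'I_k}) (eta theta : form) (f g : F) (p q : poly).

Lemma polyF_numden f : exists p q, nz (polyF q) /\ f = polyF p / polyF q.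
Proof. by exists (numF f), (denF f); rewrite nz_polyF denF_neq0 -numdenF. Qed.

(** The quotient rule does not depend on the chosen numerator and denominator:
    differentiate the equality of cross products. *)
Lemma derivF_frac i p q : nz (polyF q) ->
  derivF i (polyF p / polyF q) = polyF (mderiv i p * q - p * mderiv i q) / polyF q ^+ 2.
Proof.
move=> nq; set f := _ / _; rewrite /derivF.
have nd : nz (polyF (denF f)) by rewrite nz_polyF denF_neq0.
have E : polyF (numF f) / polyF (denF f) = polyF p / polyF q by rewrite -numdenF.
move/(eqr_div_nz _ _ nd nq): E; move: nd; rewrite -!polyFM => nd /polyF_inj.
move: (numF f) (denF f) nd => n d nd E.
have := congr1 (mderiv i) E; rewrite !mderivM => E'.
rewrite !expr2; apply/eqr_div_nz; rewrite ?nzM ?nd ?nq //.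
rewrite -!polyFM; congr polyF.
have -> : (mderiv i n * d - n * mderiv i d) * (q * q)
  = (mderiv i n * q + n * mderiv i q) * d * q - n * q * (mderiv i q * d + mderiv i d * q) by ring.
rewrite E' E; ring.
Qed.

Lemma derivF_poly i p : derivF i (polyF p) = polyF (mderiv i p).
Proof.
have := @derivF_frac i p 1; rewrite polyF1 expr1n !divr1 => -> //; last exact: nz1.
by rewrite mulr1 -mpolyC1 mderivC mulr0 subr0.
Qed.

Lemma derivF_cst i (c : C) : derivF i (cstF k c) = 0.
Proof. by rewrite derivF_poly mderivC polyF0. Qed.
Lemma derivF_var i j : derivF i (varF C j) = (i == j)%:R.
Proof.
rewrite derivF_poly mderivX mnm1E eq_sym; case: eqP => [->|_]; last by rewrite scale0r polyF0.
have -> : (U_(j) - U_(j) = 0 :> 'X_{1..k})%MM by apply/mnmP => l; rewrite mnmBE mnm0E subnn.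
by rewrite scale1r mpolyX0 polyF1.
Qed.

Lemma derivFD i f g : derivF i (f + g) = derivF i f + derivF i g.
Proof.
have [p [q [nq ->]]] := polyF_numden f; have [p' [q' [nq' ->]]] := polyF_numden g.
have nqq : nz (polyF (q * q')) by rewrite polyFM nzM nq nq'.
rewrite (addf_div_nz _ _ nq nq') -!polyFM -polyFD !derivF_frac //.
rewrite !expr2 addf_div_nz ?nzM ?nq ?nq' // -!polyFM -polyFD.
apply/eqr_div_nz; rewrite ?polyFM ?nzM ?nq ?nq' //.
rewrite -!polyFM; congr polyF; rewrite !(mderivD, mderivM); ring.
Qed.

Lemma derivFM i f g : derivF i (f * g) = derivF i f * g + f * derivF i g.
Proof.
have [p [q [nq ->]]] := polyF_numden f; have [p' [q' [nq' ->]]] := polyF_numden g.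
have nqq : nz (polyF (q * q')) by rewrite polyFM nzM nq nq'.
rewrite mulf_div -!polyFM !derivF_frac // !mulf_div !expr2.
rewrite addf_div_nz ?nzM ?nq ?nq' // -!polyFM -polyFD.
apply/eqr_div_nz; rewrite ?polyFM ?nzM ?nq ?nq' //.
rewrite -!polyFM; congr polyF; rewrite !(mderivD, mderivM); ring.
Qed.

Lemma cstF0 : cstF k (0 : C) = 0 :> F. Proof. exact: rmorph0. Qed.
Lemma cstF1 : cstF k (1 : C) = 1 :> F. Proof. exact: rmorph1. Qed.
Lemma cstFN (c : C) : cstF k (- c) = - cstF k c :> F. Proof. exact: rmorphN. Qed.
Lemma cstFB (c d : C) : cstF k (c - d) = cstF k c - cstF k d :> F. Proof. exact: rmorphB. Qed.
Lemma cstFM (c d : C) : cstF k (c * d) = cstF k c * cstF k d :> F. Proof. exact: rmorphM. Qed.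
Lemma nz_cstF (c : C) : nz (cstF k c) = (c != 0). Proof. by rewrite nzE cstF_eq0. Qed.
Lemma derivFN i f : derivF i (- f) = - derivF i f.
Proof. by rewrite -mulN1r derivFM -cstF1 -cstFN derivF_cst mul0r add0r cstFN cstF1 mulN1r. Qed.
Lemma derivFB i f g : derivF i (f - g) = derivF i f - derivF i g.
Proof. by rewrite derivFD derivFN. Qed.
Lemma derivFV i f : nz f -> derivF i f^-1 = - derivF i f / (f * f).
Proof.
move=> nf; have : derivF i (f * f^-1) = 0 by rewrite divff_nz // -cstF1 derivF_cst.
rewrite derivFM => /eqP; rewrite addrC addr_eq0 => /eqP E.
have E2 := congr1 (fun x => f^-1 * x) E; rewrite mulrA [f^-1 * f]mulrC divff_nz // mul1r in E2.
by rewrite E2 invfM; ring.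
Qed.

Lemma dformE f : dform f = oneform (fun i => derivF i f).
Proof.
apply: formP => S; rewrite ffunE /oneform sum_ffunE big_mkcond; apply: eq_bigr => i _ /=.
rewrite -dX0 crea_dX inE setU0 !ffunE /sg /below big_set0 expr0 mul1r.
by case: eqP => _; rewrite ?mulr1 ?mulr0.
Qed.

Lemma dform_is f : is_oneform (dform f).
Proof. by rewrite dformE; apply: oneform_is. Qed.

Lemma dform1 f i : dform f [set i]%SET = derivF i f.
Proof. by rewrite dformE oneformE. Qed.

Lemma oneform_ext eta theta : is_oneform eta -> is_oneform theta ->
  (forall i, eta [set i]%SET = theta [set i]%SET) -> eta = theta.
Proof.
by move=> h h' E; rewrite (is_oneformP h) (is_oneformP h'); apply: oneform_eq.
Qed.

Lemma dformD f g : dform (f + g) = dform f + dform g.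
Proof.
apply: oneform_ext => [||i]; try exact: dform_is.
  by apply: is_oneformD; exact: dform_is.
by rewrite formDE !dform1 derivFD.
Qed.
Lemma dformB f g : dform (f - g) = dform f - dform g.
Proof.
apply: oneform_ext => [||i]; try exact: dform_is.
  by apply/is_oneformD/is_oneformN; exact: dform_is.
by rewrite formDE formNE !dform1 derivFB.
Qed.
Lemma dformM f g : dform (f * g) = fscale g (dform f) + fscale f (dform g).
Proof.
apply: oneform_ext => [||i]; try exact: dform_is.
  by apply/is_oneformD; apply/is_oneformZ; exact: dform_is.
by rewrite formDE !fscaleE !dform1 derivFM [g * _]mulrC.
Qed.
Lemma dformV f : nz f -> dform f^-1 = fscale (- f^-1 * f^-1) (dform f).
Proof.
move=> nf; apply: oneform_ext => [||i]; try exact: dform_is.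
  by apply/is_oneformZ; exact: dform_is.
by rewrite fscaleE !dform1 derivFV // invfM; ring.
Qed.
Lemma dform_cst (c : C) : dform (cstF k c) = 0.
Proof.
apply: oneform_ext => [||i]; [exact: dform_is|exact: is_oneform0|].
by rewrite form0E dform1 derivF_cst.
Qed.
Lemma dform_var i : dform (varF C i) = crea i (form1 C k).
Proof.
apply: formP => S; rewrite -dX0 crea_dX inE ffunE setU0 !ffunE /sg /below big_set0 expr0 mul1r.
rewrite big_mkcond (bigD1 i) //= big1 => [|j nj]; rewrite derivF_var.
  by rewrite eqxx addr0; case: ifP.
by rewrite (negPf nj); case: ifP.
Qed.
Lemma wedge_dvar i eta : wedge (dform (varF C i)) eta = crea i eta.
Proof. by rewrite dform_var wedge_crea wedge1l. Qed.

Lemma dlog_is f : is_oneform (dlog f).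
Proof. by apply/is_oneformZ/dform_is. Qed.
Lemma dlogM f g : nz f -> nz g -> dlog (f * g) = dlog f + dlog g.
Proof.
move=> nf ng; rewrite /dlog dformM fscaleDr !fscaleA; congr (fscale _ _ + fscale _ _).
  by rewrite invfM -mulrA [g^-1 * g]mulrC divff_nz // mulr1.
by rewrite invfM mulrAC [f^-1 * f]mulrC divff_nz // mul1r.
Qed.
Lemma dlogV f : nz f -> dlog f^-1 = - dlog f.
Proof.
move=> nf; rewrite /dlog dformV // fscaleA -fscaleN; congr fscale.
by rewrite invrK mulrA mulrN divff_nz // mulN1r.
Qed.
Lemma dlog_div f g : nz f -> nz g -> dlog (f / g) = dlog f - dlog g.
Proof. by move=> nf ng; rewrite dlogM ?dlogV ?nzV. Qed.

End Derivation.

(** * Pullback of forms *)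

Section Pullback.
Variables (C : fieldType) (k : nat).
Local Notation F := (ratfun C k).
Local Notation form := (ratform C k).
Local Notation poly := {mpoly C[k]}.
Implicit Types (i q : 'I_k) (S T : {set 'I_k}) (eta theta a b : form) (f g : F).

(** A substitution with a left inverse is injective on polynomials. *)
Lemma injev_inv (s s' : 'I_k -> F) : (forall i, evalF s' (s i) (varF C i)) -> injev s.
Proof.
move=> h p np; apply/nzP => E.
have := evalF_mmap p h; rewrite ev_var E => /evalF_fun /(_ (evalF0 s')) /eqP.
by rewrite polyF_eq0 (negPf np).
Qed.

Variable s : 'I_k -> F.
Hypothesis inj : injev s.

Lemma substF_eq f g : evalF s f g -> substF s f = g.
Proof. by move=> h; apply: (evalF_fun (evalF_subst f inj) h). Qed.

Lemma substFD f g : substF s (f + g) = substF s f + substF s g.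
Proof. by apply: substF_eq; apply: evalFD; apply: evalF_subst. Qed.
Lemma substFM f g : substF s (f * g) = substF s f * substF s g.
Proof. by apply: substF_eq; apply: evalFM; apply: evalF_subst. Qed.
Lemma substFN f : substF s (- f) = - substF s f.
Proof. by apply: substF_eq; apply: evalFN; apply: evalF_subst. Qed.
Lemma substFB f g : substF s (f - g) = substF s f - substF s g.
Proof. by rewrite substFD substFN. Qed.
Lemma substF0 : substF s 0 = 0. Proof. by apply: substF_eq; apply: evalF0. Qed.
Lemma substF1 : substF s 1 = 1. Proof. by apply: substF_eq; apply: evalF1. Qed.
Lemma substF_cst (c : C) : substF s (cstF k c) = cstF k c.
Proof. by apply: substF_eq; apply: evalF_cst. Qed.
Lemma substF_var i : substF s (varF C i) = s i.
Proof. by apply: substF_eq; apply: evalF_var. Qed.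
Lemma substF_sign n : substF s ((-1) ^+ n) = (-1) ^+ n.
Proof. by apply: substF_eq; apply: evalF_sign. Qed.
Lemma nz_subst f : nz f -> nz (substF s f).
Proof.
move=> nf; apply/nzP => E; have := substFM f f^-1.
by rewrite divff_nz // substF1 E mul0r => /eqP; rewrite oner_eq0.
Qed.
Lemma substFV f : substF s f^-1 = (substF s f)^-1.
Proof.
case: (boolP (nz f)) => nf; last first.
  have -> : f = 0 by apply/eqP; move: nf; rewrite nzE negbK.
  by rewrite invr0 substF0 invr0.
by apply: substF_eq; apply: evalFV; [apply: evalF_subst|apply: nz_subst].
Qed.

Lemma pullbackD a b : pullback s (a + b) = pullback s a + pullback s b.
Proof. by rewrite /pullback -big_split; apply: eq_bigr => S _; rewrite ffunE substFD fscaleDl. Qed.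
Lemma pullbackZ f a : pullback s (fscale f a) = fscale (substF s f) (pullback s a).
Proof. by rewrite /pullback fscale_sum; apply: eq_bigr => S _; rewrite ffunE substFM fscaleA. Qed.
Lemma pullback0 : pullback s 0 = 0.
Proof. by rewrite -(fscale0 0) pullbackZ substF0 !fscale0. Qed.
Lemma pullbackN a : pullback s (- a) = - pullback s a.
Proof. by rewrite -fscaleN1 pullbackZ substFN substF1 fscaleN1. Qed.
Lemma pullback_sum (I : Type) (r : seq I) (P : pred I) (h : I -> form) :
  pullback s (\sum_(x <- r | P x) h x) = \sum_(x <- r | P x) pullback s (h x).
Proof. by apply: (big_morph _ pullbackD pullback0). Qed.
Lemma pullback_scale (c : C) a : pullback s (c *: a) = c *: pullback s a.
Proof. by rewrite !scaleE pullbackZ substF_cst. Qed.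

Local Notation ds := (fun i => dform (s i)).

Lemma pullback_dX S : pullback s (dX C S) = prodform ds S.
Proof.
rewrite /pullback (bigD1 S) //= [X in _ + X]big1 => [|T nT]; rewrite dXE.
  by rewrite eqxx substF1 fscale1 addr0.
by rewrite (negPf nT) substF0 fscale0.
Qed.

Lemma pullback_form1 : pullback s (form1 C k) = form1 C k.
Proof. by rewrite -dX0 pullback_dX prodform0. Qed.

Lemma pullback_crea q a : pullback s (crea q a) = wedge (dform (s q)) (pullback s a).
Proof.
rewrite (form_dX a) crea_sum !pullback_sum wedge_sumr; apply: eq_bigr => S _.
rewrite creaZ !pullbackZ wedgeZr; congr fscale.
rewrite pullback_dX (wedge_prodform q S (fun i => dform_is (s i))) crea_dX.
case: ifP => qS; first exact: pullback0.
by rewrite pullbackZ substF_sign pullback_dX.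
Qed.

Lemma pullback_wedge a b : pullback s (wedge a b) = wedge (pullback s a) (pullback s b).
Proof.
elim/form_ind: a => [|a a' Ha Ha'|f a Ha||i a Ha].
- by rewrite wedge0l pullback0 wedge0l.
- by rewrite wedgeDl !pullbackD wedgeDl Ha Ha'.
- by rewrite wedgeZl !pullbackZ wedgeZl Ha.
- by rewrite pullback_form1 !wedge1l.
- by rewrite wedge_crea !pullback_crea Ha wedgeA.
Qed.

Lemma pullback_big (I : Type) (r : seq I) (P : pred I) (w : I -> form) :
  pullback s (\big[@wedge C k/form1 C k]_(i <- r | P i) w i)
  = \big[@wedge C k/form1 C k]_(i <- r | P i) pullback s (w i).
Proof. by apply: (big_morph _ pullback_wedge pullback_form1). Qed.

Lemma pullback_contr (v v' : 'I_k -> F) a :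
  (forall i, ev1 v' (dform (s i)) = substF s (v i)) ->
  contr v' (pullback s a) = pullback s (contr v a).
Proof.
move=> h; elim/form_ind: a => [|a a' Ha Ha'|f a Ha||i a Ha].
- by rewrite pullback0 !contr0 pullback0.
- by rewrite pullbackD !contrD pullbackD Ha Ha'.
- by rewrite pullbackZ !contrZ pullbackZ Ha.
- by rewrite pullback_form1 !contr_form1 pullback0.
rewrite pullback_crea contr_wedge ?h; last exact: dform_is.
have E : ev1 v (dform (varF C i)) = v i.
  rewrite /ev1 (bigD1 i) //= big1 => [|j nj]; rewrite dform1 derivF_var.
    by rewrite eqxx mulr1 addr0.
  by rewrite (negPf nj) mulr0.
have -> : crea i a = wedge (dform (varF C i)) a by rewrite wedge_dvar.
rewrite contr_wedge; last exact: dform_is.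
by rewrite E pullbackD pullbackN pullbackZ Ha wedge_dvar pullback_crea.
Qed.

End Pullback.

(** * Functoriality of the pullback *)

Section PullbackComposition.
Variables (C : fieldType) (k : nat).
Local Notation F := (ratfun C k).
Local Notation form := (ratform C k).
Implicit Types (i q : 'I_k) (a : form) (f g : F) (s : 'I_k -> F).

(** Chain rule; it suffices to check it on constants and variables, as both
    sides satisfy the Leibniz rule. *)
Lemma pullback_dform s f : injev s -> pullback s (dform f) = dform (substF s f).
Proof.
move=> inj; pose P g := pullback s (dform g) = dform (substF s g).
have PM g h : P g -> P h -> P (g * h).
  by rewrite /P dformM (pullbackD inj) !(pullbackZ inj) (substFM inj) dformM => -> ->.
have PV g : nz g -> P g -> P g^-1.
  move=> ng; rewrite /P dformV // (pullbackZ inj) (substFV inj) dformV ?nz_subst // => ->.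
  by rewrite (substFM inj) (substFN inj) (substFV inj).
have Pp p : P (polyF p).
  elim/poly_gen_ind: p => [c|i|p q hp hq|p q hp hq].
  - by rewrite /P -[polyF _]/(cstF k c) dform_cst (pullback0 inj) (substF_cst inj) dform_cst.
  - rewrite /P -[polyF _]/(varF C i) dform_var (pullback_crea inj) (pullback_form1 inj) wedge1r.
    by rewrite (substF_var inj).
  - by rewrite polyFD /P dformD (pullbackD inj) (substFD inj) dformD hp hq.
  - by rewrite polyFM; apply: PM.
by have [p [q [nq ->]]] := polyF_numden f; apply: PM; last apply: PV.
Qed.

Lemma pullback_dlog s f : injev s -> pullback s (dlog f) = dlog (substF s f).
Proof. by move=> inj; rewrite /dlog (pullbackZ inj) pullback_dform // (substFV inj). Qed.

Lemma substF_comp s s' s2 f : injev s -> injev s' -> injev s2 ->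
  (forall i, evalF s (s' i) (s2 i)) -> substF s (substF s' f) = substF s2 f.
Proof.
move=> h h' h2 E; have [p [q [nq ->]]] := polyF_numden f; rewrite nz_polyF in nq.
rewrite (substF_eq h' (evalF_div (evalF_poly _ p) (evalF_poly _ q) (h' q nq))).
rewrite (substF_eq h2 (evalF_div (evalF_poly _ p) (evalF_poly _ q) (h2 q nq))).
exact: (substF_eq h (evalF_div (evalF_mmap p E) (evalF_mmap q E) (h2 q nq))).
Qed.

Lemma pullback_comp s s' s2 a : injev s -> injev s' -> injev s2 ->
  (forall i, evalF s (s' i) (s2 i)) -> pullback s (pullback s' a) = pullback s2 a.
Proof.
move=> h h' h2 E; elim/form_ind: a => [|a a' Ha Ha'|f a Ha||i a Ha].
- by rewrite !pullback0.
- by rewrite !pullbackD // Ha Ha'.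
- by rewrite (pullbackZ h') (pullbackZ h) (pullbackZ h2) Ha (substF_comp _ h h' h2 E).
- by rewrite !pullback_form1.
rewrite (pullback_crea h') (pullback_crea h2) (pullback_wedge h) Ha pullback_dform //.
by rewrite (substF_eq h (E i)).
Qed.

Lemma injev_var : injev (@varF C k).
Proof. by move=> p np; rewrite ev_var nz_polyF. Qed.

Lemma pullback_id a : pullback (@varF C k) a = a.
Proof.
have inj := injev_var; elim/form_ind: a => [|a a' Ha Ha'|f a Ha||i a Ha].
- by rewrite !pullback0.
- by rewrite !pullbackD // Ha Ha'.
- rewrite pullbackZ // Ha; congr fscale; apply: (substF_eq inj).
  have [p [q [nq ->]]] := polyF_numden f.
  by apply: evalF_div => //; rewrite -[X in evalF _ _ X]ev_var; apply: evalF_poly.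
- by rewrite !pullback_form1.
by rewrite pullback_crea // Ha wedge_dvar.
Qed.

End PullbackComposition.

(** * Permutations of the coordinates *)

Section Permutations.
Variables (C : fieldType) (k : nat).
Local Notation F := (ratfun C k).
Local Notation form := (ratform C k).
Implicit Types (i q : 'I_k) (S T : {set 'I_k}) (eta theta a b : form) (f g : F) (s : 'S_k).

Definition pvar s : 'I_k -> F := fun i => varF C (s i).

Lemma evalF_pvar s i : evalF (pvar s^-1%g) (pvar s i) (varF C i).
Proof. by have := evalF_var (pvar s^-1%g) (s i); rewrite /pvar permK. Qed.

Lemma injev_pvar s : injev (pvar s).
Proof. exact: (injev_inv (evalF_pvar s)). Qed.

Lemma pull_crea s i a : pullback (pvar s) (crea i a) = crea (s i) (pullback (pvar s) a).
Proof. by rewrite (pullback_crea (injev_pvar s)) wedge_dvar. Qed.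

Lemma pull_anni s i a : pullback (pvar s) (anni i a) = anni (s i) (pullback (pvar s) a).
Proof.
have E j b : anni j b = contr (fun q => (q == j)%:R) b.
  rewrite /contr (bigD1 j) //= big1 => [|q nq]; first by rewrite eqxx fscale1 addr0.
  by rewrite (negPf nq) fscale0.
rewrite [in RHS]E [in LHS]E; apply/esym; apply: (pullback_contr (injev_pvar s)) => q.
rewrite /ev1 (bigD1 (s q)) //= big1 => [|j nj]; rewrite dform1 derivF_var.
  rewrite eqxx mulr1 addr0 (inj_eq perm_inj); case: eqP => _.
    by rewrite (substF1 (injev_pvar s)).
  by rewrite (substF0 (injev_pvar s)).
by rewrite (negPf nj) mulr0.
Qed.

Lemma pull_dX_fix s S : (forall i, i \in S -> s i = i) -> pullback (pvar s) (dX C S) = dX C S.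
Proof.
move=> h; have [N] := ubnP #|S|; elim: N S h => // N IH S h /ltnSE leS.
case: (set_0Vmem S) => [->|[i hi]].
  by rewrite dX0 (pullback_form1 (injev_pvar s)).
rewrite (dX_crea C hi) (pullbackZ (injev_pvar s)) (substF_sign (injev_pvar s)) pull_crea.
rewrite h // IH // => [j|]; first by rewrite inE => /andP[_ /h].
by move: leS; rewrite (cardsD1 i) hi.
Qed.

Lemma pull_comp s s' a : pullback (pvar s) (pullback (pvar s') a) = pullback (pvar (s' * s)%g) a.
Proof.
apply: pullback_comp => [|||i]; try exact: injev_pvar.
by rewrite /pvar permM; exact: evalF_var.
Qed.

Definition vol : form := dX C [set: 'I_k]%SET.

Lemma pull_tperm_vol i q : i != q -> pullback (pvar (tperm i q)) vol = - vol.
Proof.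
move=> niq; have inj := injev_pvar (tperm i q).
have hq : q \in ([set: 'I_k] :\ i)%SET by rewrite !inE eq_sym niq.
rewrite /vol (dX_crea C (in_setT i)) (dX_crea C hq) creaZ !fscaleA.
rewrite (pullbackZ inj) (substFM inj) !(substF_sign inj) !pull_crea tpermL tpermR.
rewrite pull_dX_fix => [|j]; last first.
  by rewrite !inE andbT => /andP[nq ni]; rewrite tpermD // eq_sym.
by rewrite crea_anti 1?eq_sym // fscalerN.
Qed.

(** A permutation is a product of transpositions, each of which changes the sign
    of the volume form. *)
Lemma pull_vol s : pullback (pvar s) vol = fscale ((-1) ^+ s) vol.
Proof.
have [r -> ] := prod_tpermP s; elim: r => [|[i q] r IH] /=.
  rewrite big_nil odd_perm1 expr0 fscale1 => _; apply: pull_dX_fix => i _; exact: perm1.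
case/andP => niq hr; rewrite big_cons -pull_comp pull_tperm_vol //.
rewrite (pullbackN (injev_pvar _)) IH // odd_permM odd_tperm niq.
by rewrite -fscaleN; case: (odd_perm _); rewrite ?expr1 ?expr0 ?opprK.
Qed.

End Permutations.

Arguments pvar {C k} s _.
Arguments injev_pvar {C k} s _ _.

Lemma arnold_id (K : fieldType) (f g : K) : f != 0 -> g != 0 -> f - g != 0 ->
  f^-1 / g = - (f^-1 / (f - g)) + g^-1 / (f - g).
Proof. by move=> nf ng nfg; field; rewrite nf ng nfg. Qed.

(** * Logarithmic monomials *)

Section LogForms.
Variables (C : fieldType) (k n : nat) (z : 'I_n -> C).
Hypothesis z_inj : injective z.
Local Notation F := (ratfun C k).
Local Notation form := (ratform C k).
Local Notation t i := (varF C (i : 'I_k)).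
Local Notation zc a := (cstF k (z a)).
Implicit Types (i q r : 'I_k) (a b : 'I_n) (S T : {set 'I_k}) (eta theta : form) (f g : F).

Definition wf i a : form := dlog (t i - zc a).
Definition xf i q : form := dlog (t i - t q).

Lemma nz_var_sub i q : i != q -> nz (t i - t q).
Proof.
move=> niq; rewrite /varF -polyFN -polyFD nz_polyF; apply/eqP => /(congr1 (mderiv i)).
rewrite mderivB !mderivX !mnm1E mderiv0 eqxx [q == i]eq_sym (negPf niq) scale0r subr0 scale1r.
have -> : (U_(i) - U_(i) = 0 :> 'X_{1..k})%MM by apply/mnmP => l; rewrite mnmBE mnm0E subnn.
by rewrite mpolyX0 => /eqP; rewrite oner_eq0.
Qed.

Lemma nz_var_cst i (c : C) : nz (t i - cstF k c).
Proof.
rewrite /varF /cstF -polyFN -polyFD nz_polyF; apply/eqP => /(congr1 (mderiv i)).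
rewrite mderivB mderivX mderivC mnm1E mderiv0 eqxx subr0 scale1r.
have -> : (U_(i) - U_(i) = 0 :> 'X_{1..k})%MM by apply/mnmP => l; rewrite mnmBE mnm0E subnn.
by rewrite mpolyX0 => /eqP; rewrite oner_eq0.
Qed.

Lemma nz_zc a b : a != b -> nz (zc a - zc b : F).
Proof. by move=> n0; rewrite -cstFB nz_cstF subr_eq0 (inj_eq z_inj). Qed.

Lemma wedge_wf i a eta : wedge (wf i a) eta = fscale (t i - zc a)^-1 (crea i eta).
Proof. by rewrite /wf /dlog wedgeZl dformB dform_cst subr0 wedge_dvar. Qed.
Lemma wedge_xf i q eta : wedge (xf i q) eta = fscale (t i - t q)^-1 (crea i eta - crea q eta).
Proof. by rewrite /xf /dlog wedgeZl dformB wedgeDl wedgeNl !wedge_dvar. Qed.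
Lemma wf_is i a : is_oneform (wf i a). Proof. exact: dlog_is. Qed.
Lemma dlogN f : dlog (- f) = dlog f.
Proof.
have E : - f = cstF k (-1) * f by rewrite cstFN cstF1 mulN1r.
rewrite /dlog E dformM dform_cst fscaler0 add0r fscaleA; congr fscale.
have n1 : nz (cstF k (- (1 : C))) by rewrite nz_cstF oppr_eq0 oner_eq0.
by rewrite invfM mulrAC [_^-1 * cstF _ _]mulrC divff_nz // mul1r.
Qed.

Lemma xfC i q : xf i q = xf q i.
Proof. by rewrite /xf -dlogN opprB. Qed.

Lemma dlog_cst (c : C) : dlog (cstF k c) = 0.
Proof. by rewrite /dlog dform_cst fscaler0. Qed.

Implicit Types chi : {ffun 'I_k -> option 'I_n}.

Definition supp chi : {set 'I_k} := [set i | chi i != None]%SET.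
Definition den chi i : F := if chi i is Some a then t i - zc a else 1.
Definition gfun chi : F := \prod_i (den chi i)^-1.
(** The monomial of a colouring: the product of dlog(t_i - z_(chi i)) over the
    coloured coordinates, in increasing order. *)
Definition lam chi : form := fscale (gfun chi) (dX C (supp chi)).
Definition setc chi i (o : option 'I_n) : {ffun 'I_k -> option 'I_n} :=
  [ffun j => if j == i then o else chi j].

Lemma setcE chi i o j : setc chi i o j = if j == i then o else chi j.
Proof. by rewrite ffunE. Qed.

Lemma supp_setc chi i a : supp (setc chi i (Some a)) = (i |: supp chi)%SET.
Proof. by apply/setP => j; rewrite !inE setcE; case: (j == i). Qed.

Lemma supp_setN chi i : supp (setc chi i None) = (supp chi :\ i)%SET.
Proof. by apply/setP => j; rewrite !inE setcE; case: (j == i). Qed.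

Lemma gfun_setc chi i a : i \notin supp chi ->
  gfun (setc chi i (Some a)) = (t i - zc a)^-1 * gfun chi.
Proof.
rewrite inE negbK => /eqP hi.
rewrite /gfun (bigD1 i) //= [in RHS](bigD1 i) //= {1}/den setcE eqxx.
rewrite {2}/den hi invr1 mul1r; congr (_ * _); apply: eq_bigr => j nj.
by rewrite /den setcE (negPf nj).
Qed.

Lemma wedge_wf_lam i a chi : wedge (wf i a) (lam chi) =
  if i \in supp chi then 0 else fscale (sg C i (supp chi)) (lam (setc chi i (Some a))).
Proof.
rewrite wedge_wf /lam creaZ crea_dX; case: ifP => hi; first by rewrite !fscaler0.
by rewrite !fscaleA supp_setc gfun_setc ?hi // ; congr fscale; ring.
Qed.

Lemma lam_anni i a chi : chi i = Some a ->
  fscale (t i - zc a) (anni i (lam chi)) = fscale (sg C i (supp chi)) (lam (setc chi i None)).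
Proof.
move=> hi; have hs : i \in supp chi by rewrite inE hi.
have E : gfun chi = (t i - zc a)^-1 * gfun (setc chi i None).
  rewrite -gfun_setc ?supp_setN ?inE ?eqxx //; congr gfun.
  by apply/ffunP => j; rewrite !setcE; case: eqP => // ->.
rewrite /lam anniZ anni_dX hs E !fscaleA supp_setN; congr fscale.
by rewrite -[RHS]mul1r -(divff_nz (nz_var_cst i (z a))); ring.
Qed.

Lemma lam_anniN i chi : chi i = None -> anni i (lam chi) = 0.
Proof.
by move=> hi; rewrite /lam anniZ anni_dX inE hi /= fscaler0.
Qed.

Definition zsub chi j : F := if chi j is Some a then zc a else t j.

Lemma den_ratio chi chi0 i : supp chi = supp chi0 ->
  evalF (zsub chi0) (den chi0 i / den chi i) (chi i == chi0 i)%:R.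
Proof.
move=> E; rewrite /den; have := congr1 (fun A : {set 'I_k} => i \in A) E; rewrite !inE.
case h : (chi i) => [a|]; case h0 : (chi0 i) => [b|] //= _; last first.
  by rewrite divr1; apply: evalF1.
case: (altP (a =P b)) => [->|nab].
  rewrite divff_nz ?nz_var_cst // eqxx; exact: evalF1.
have -> : (Some a == Some b) = false by apply/negP => /eqP [] /eqP; rewrite (negPf nab).
have si : zsub chi0 i = zc b by rewrite /zsub h0.
have -> : 0%:R = (zc b - zc b) / (zc b - zc a) :> F by rewrite subrr mul0r.
apply: evalF_div.
- by apply: evalFB; [rewrite -si; apply: evalF_var|apply: evalF_cst].
- by apply: evalFB; [rewrite -si; apply: evalF_var|apply: evalF_cst].
- by apply: nz_zc; rewrite eq_sym.
Qed.

(** Compare coefficients of dx_S and evaluate the ratio to the monomial of chi0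
    at t_i = z_(chi0 i): every other colouring with the same support gives 0. *)
Lemma lam_indep (c : {ffun 'I_k -> option 'I_n} -> C) :
  \sum_chi c chi *: lam chi = 0 -> forall chi, c chi = 0.
Proof.
move=> E chi0; pose s := zsub chi0.
have H : evalF s (\sum_chi cstF k (c chi) * (if supp chi == supp chi0 then \prod_i (den chi0 i / den chi i) else 0))
   (\sum_chi cstF k (c chi) * (chi == chi0)%:R).
  apply: evalF_sum => chi _; apply: evalFM; first exact: evalF_cst.
  case: (altP (supp chi =P supp chi0)) => [e|ne]; last first.
    by case: (chi =P chi0) ne => [->|_ _]; [rewrite eqxx|exact: evalF0].
  have -> : (chi == chi0)%:R = \prod_i (chi i == chi0 i)%:R :> F.
    case: (altP (chi =P chi0)) => [->|/eqP nc]; first by rewrite big1 // => i _; rewrite eqxx.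
    have [i ni] : exists i, chi i != chi0 i.
      apply/existsP; rewrite -negb_forall; apply/negP => /forallP h; apply: nc.
      by apply/ffunP => i; apply/eqP/h.
    by rewrite (bigD1 i) //= (negPf ni) mul0r.
  by apply: evalF_prod => i _; apply: den_ratio.
have Z : \sum_chi cstF k (c chi) * (if supp chi == supp chi0 then \prod_i (den chi0 i / den chi i) else 0) = 0 :> F.
  have := congr1 (fun x : form => \prod_i den chi0 i * x (supp chi0)) E.
  rewrite form0E mulr0 => E0; rewrite -[RHS]E0 sum_ffunE mulr_sumr; apply: eq_bigr => chi _.
  rewrite scaleE fscaleE /lam fscaleE dXE mulrCA; congr (_ * _).
  rewrite [supp chi0 == _]eq_sym; case: eqP => _; last by rewrite !mulr0.
  by rewrite mulr1 /gfun -big_split.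
have := evalF_fun (evalF0 s); rewrite -{1}Z => /(_ _ H).
rewrite (bigD1 chi0) //= eqxx mulr1 big1 ?addr0 => [/esym/eqP|chi nc]; last by rewrite (negPf nc) mulr0.
by rewrite cstF_eq0 => /eqP.
Qed.

Lemma lam_indep2 (c d : {ffun 'I_k -> option 'I_n} -> C) :
  \sum_chi c chi *: lam chi = \sum_chi d chi *: lam chi -> forall chi, c chi = d chi.
Proof.
move=> E chi; apply/eqP; rewrite -subr_eq0; apply/eqP.
apply: (lam_indep (c := fun x => c x - d x)).
under eq_bigr => x _ do rewrite scalerBl.
by rewrite sumrB E subrr.
Qed.

(** The relation of Arnold, which is the identity 1/(f g) = (1/g - 1/f)/(f - g)
    multiplied by df dg. *)
Lemma arnold f g eta : nz f -> nz g -> nz (f - g) ->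
  wedge (dlog f) (wedge (dlog g) eta)
  = wedge (dlog f) (wedge (dlog (f - g)) eta) - wedge (dlog g) (wedge (dlog (f - g)) eta).
Proof.
move=> nf ng nfg; rewrite /dlog dformB !(wedgeZl, wedgeZr, wedgeDl, wedgeNl, wedgeDr, wedgeNr).
rewrite (wedge_sq _ (dform_is f)) (wedge_sq _ (dform_is g)).
rewrite [wedge (dform g) (wedge (dform f) eta)]wedge_anti; try exact: dform_is.
rewrite sub0r oppr0 addr0 !fscalerN !fscaleA opprK -fscaleN -fscaleDl. congr (fscale _ _).
rewrite nzE in nf; rewrite nzE in ng; rewrite nzE in nfg.
exact (arnold_id nf ng nfg).
Qed.

Lemma pull_wf (s : 'S_k) i a : pullback (pvar s) (wf i a) = wf (s i) a.
Proof.
have inj := @injev_pvar C k s.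
rewrite -[wf i a]wedge1r -[wf (s i) a]wedge1r !wedge_wf (pullbackZ inj) pull_crea.
by rewrite (pullback_form1 inj) (substFV inj) (substFB inj) (substF_var inj) (substF_cst inj).
Qed.
Lemma pull_xf (s : 'S_k) i q : pullback (pvar s) (xf i q) = xf (s i) (s q).
Proof.
have inj := @injev_pvar C k s.
rewrite -[xf i q]wedge1r -[xf (s i) _]wedge1r !wedge_xf (pullbackZ inj) (pullbackD inj) (pullbackN inj) !pull_crea.
by rewrite (pullback_form1 inj) (substFV inj) (substFB inj) !(substF_var inj).
Qed.

End LogForms.

(** * Skew-symmetric logarithmic forms have no poles on the diagonals *)

Section PoleTheorem.
Variables (C : numFieldType) (k n : nat) (z : 'I_n -> C).
Hypothesis z_inj : injective z.
Local Notation F := (ratfun C k).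
Local Notation form := (ratform C k).
Local Notation t i := (varF C (i : 'I_k)).
Local Notation zc a := (cstF k (z a)).
Local Notation cent := ('I_k + 'I_n)%type.
Implicit Types (i q r : 'I_k) (a b : 'I_n) (S T U : {set 'I_k}) (eta theta : form) (f g : F) (p : cent).

Implicit Types chi : {ffun 'I_k -> option 'I_n}.

Variables (cls : rel 'I_k) (acol : 'I_k -> pred 'I_n).
Hypothesis cls_refl : reflexive cls.
Hypothesis cls_sym : symmetric cls.
Hypothesis cls_trans : transitive cls.
Hypothesis acol_cls : forall i q, cls i q -> acol i =1 acol q.

Definition pt p : F := match p with inl q => t q | inr a => zc a end.
(** Centres allowed for t_i when only the coordinates in T occur: coordinates of
    the same class, and points z_a of an allowed colour. *)
Definition okc i T p : bool := match p with inl q => [&& q \in T, cls i q & i != q] | inr a => acol i a end.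
Definition yf i p : form := dlog (t i - pt p).

(** Constant combinations of products of dlog(t_i - t_q) and dlog(t_i - z_a)
    with i and q in T. *)
Inductive lspan T : form -> Prop :=
| ls_one : lspan T (form1 C k)
| ls_lin (c : C) eta theta : lspan T eta -> lspan T theta -> lspan T (c *: eta + theta)
| ls_gen i p eta : i \in T -> okc i T p -> lspan T eta -> lspan T (wedge (yf i p) eta).

Lemma lspan0 T : lspan T 0.
Proof. by have := ls_lin (-1) (ls_one T) (ls_one T); rewrite scaleN1r addNr. Qed.
Lemma lspanZ T (c : C) eta : lspan T eta -> lspan T (c *: eta).
Proof. by move=> h; have := ls_lin c h (lspan0 T); rewrite addr0. Qed.
Lemma lspanD T eta theta : lspan T eta -> lspan T theta -> lspan T (eta + theta).
Proof. by move=> h h'; have := ls_lin 1 h h'; rewrite scale1r. Qed.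
Lemma lspanN T eta : lspan T eta -> lspan T (- eta).
Proof. by move=> h; rewrite -scaleN1r; apply: lspanZ. Qed.
Lemma lspan_sum T (I : Type) (s : seq I) (P : pred I) (h : I -> form) :
  (forall x, P x -> lspan T (h x)) -> lspan T (\sum_(x <- s | P x) h x).
Proof. by move=> H; apply: big_ind => //; [exact: lspan0|exact: lspanD]. Qed.

Lemma yf_is i p : is_oneform (yf i p). Proof. exact: dlog_is. Qed.

Lemma wedgeZc (c : C) eta theta : wedge eta (c *: theta) = c *: wedge eta theta.
Proof. by rewrite !scaleE wedgeZr. Qed.

Lemma nz_ptB i T p : okc i T p -> nz (t i - pt p).
Proof. by case: p => [q /and3P[_ _ ni]|a _]; [exact: nz_var_sub|exact: nz_var_cst]. Qed.

Lemma nz_pt i T p p' : okc i T p -> okc i T p' -> p != p' -> nz (pt p - pt p').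
Proof.
case: p p' => [q|a] [r|b] /= _ _ np.
- by apply: nz_var_sub; apply: contra np => /eqP ->.
- exact: nz_var_cst.
- by rewrite -opprB -mulN1r nzM nz_var_cst andbT -cstF1 -cstFN nz_cstF oppr_eq0 oner_eq0.
- by apply: (@nz_zc _ k _ _ z_inj); apply: contra np => /eqP ->.
Qed.

Definition Df i p p' : form := dlog ((t i - pt p) - (t i - pt p')).

Lemma DfE i p p' : Df i p p' = dlog (pt p - pt p').
Proof. by rewrite /Df -dlogN; congr dlog; ring. Qed.

Lemma lspan_Df i T p p' eta : okc i T p -> okc i T p' -> p != p' ->
  lspan T eta -> lspan T (wedge (Df i p p') eta).
Proof.
rewrite DfE; case: p p' => [q|a] [r|b] /=.
- move=> /and3P[qT iq _] /and3P[rT ir _] nqr; apply: (@ls_gen T q (inl r)) => //=.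
  by rewrite rT /= (cls_trans _ ir) 1?cls_sym //=; apply: contra nqr => /eqP ->.
- by move=> /and3P[qT iq _] ib _; apply: (@ls_gen T q (inr b)) => //=; rewrite -(acol_cls iq).
- move=> ia /and3P[rT ir _] _; rewrite -dlogN opprB; apply: (@ls_gen T r (inr a)) => //=.
  by rewrite -(acol_cls ir).
- by move=> _ _ _ _; rewrite -cstFB dlog_cst wedge0l; exact: lspan0.
Qed.

(** Forms written with at most one factor involving t_i. *)
Definition decomp i T eta : Prop := exists (al0 : form) (al : cent -> form),
  [/\ lspan T al0, forall p, lspan T (al p), forall p, ~~ okc i T p -> al p = 0
    & eta = al0 + \sum_p wedge (yf i p) (al p)].

Lemma decomp_lin i T (c : C) eta theta : decomp i T eta -> decomp i T theta ->
  decomp i T (c *: eta + theta).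
Proof.
move=> [a0 [al [h0 h hz ->]]] [b0 [be [g0 g gz ->]]].
exists (c *: a0 + b0), (fun p => c *: al p + be p); split.
- exact: ls_lin.
- by move=> p; apply: ls_lin.
- by move=> p np; rewrite hz // gz // scaler0 addr0.
rewrite scalerDr addrACA scaler_sumr -big_split; congr (_ + _); apply: eq_bigr => p _ /=.
by rewrite wedgeDr wedgeZc.
Qed.

Lemma decomp_free i T u eta : is_oneform u -> (forall theta, lspan T theta -> lspan T (wedge u theta)) ->
  decomp i T eta -> decomp i T (wedge u eta).
Proof.
move=> hu H [a0 [al [h0 h hz ->]]].
exists (wedge u a0), (fun p => - wedge u (al p)); split.
- exact: H.
- by move=> p; apply/lspanN/H.
- by move=> p np; rewrite hz // wedge0r oppr0.
rewrite wedgeDr wedge_sumr; congr (_ + _); apply: eq_bigr => p _.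
by rewrite wedge_anti ?wedgeNr //; exact: yf_is.
Qed.

(** A second factor involving t_i is moved to a factor without t_i by the Arnold
    relation. *)
Lemma decomp_yf i T p eta : okc i T p -> decomp i T eta -> decomp i T (wedge (yf i p) eta).
Proof.
move=> hp [a0 [al [h0 h hz ->]]].
exists 0, (fun p' => if p' == p then a0 + \sum_(r : cent | r != p) wedge (Df i p r) (al r)
                     else - wedge (Df i p p') (al p')).
have hD (r : cent) : r != p -> lspan T (wedge (Df i p r) (al r)).
  move=> nr; case: (boolP (okc i T r)) => hr; last by rewrite hz // wedge0r; exact: lspan0.
  by apply: lspan_Df => //; rewrite eq_sym.
split; first exact: lspan0.
- move=> p'; case: eqP => [_|/eqP np]; last by apply/lspanN/hD.
  by apply: lspanD => //; apply: lspan_sum.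
- move=> p' np; case: eqP np => [->|_ np]; first by rewrite hp.
  by rewrite hz // wedge0r oppr0.
rewrite add0r wedgeDr wedge_sumr [in LHS](bigD1 p) //= wedge_sq ?add0r; last exact: yf_is.
rewrite [in RHS](bigD1 p) //= eqxx wedgeDr -addrA; congr (_ + _).
rewrite wedge_sumr -big_split; apply: eq_bigr => r nr /=; rewrite (negPf nr) wedgeNr.
case: (boolP (okc i T r)) => hr; last by rewrite hz // !wedge0r oppr0 addr0.
rewrite /yf arnold ?(nz_ptB hp) ?(nz_ptB hr) //.
have -> : t i - pt p - (t i - pt r) = pt r - pt p by ring.
exact: (nz_pt hr hp nr).
Qed.

(** Partial fractions in the variable t_i. *)
Lemma decompP i T eta : i \notin T -> lspan (i |: T)%SET eta -> decomp i T eta.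
Proof.
move=> niT; elim=> {eta} [|c eta theta _ h1 _ h2|j p eta].
- exists (form1 C k), (fun _ => 0); split=> //; first exact: ls_one.
    by move=> _; exact: lspan0.
  by rewrite big1 ?addr0 // => p _; rewrite wedge0r.
- exact: decomp_lin.
rewrite in_setU1; case: (altP (j =P i)) => [-> _|nji /= jT] hp _ IH.
  apply: (decomp_yf _ IH); case: p hp => //= q /and3P[].
  by rewrite in_setU1 => /orP[/eqP ->|->] -> //; rewrite eqxx.
have [E|hp'] : (p = inl i /\ cls i j) \/ okc j T p.
- case: p hp => [q|a] /=; last by right.
  rewrite in_setU1 => /and3P[/orP[/eqP ->|qT] cj nq]; last by right; rewrite qT cj nq.
  by left; rewrite cls_sym.
- case: E => -> cij; have -> : yf j (inl i) = yf i (inl j) by exact: xfC.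
  by apply: (decomp_yf _ IH); rewrite /= jT cij eq_sym.
apply: (decomp_free (yf_is j p) _ IH).
by move=> theta; apply: ls_gen.
Qed.

Definition subi i f : 'I_k -> F := fun j => if j == i then f else t j.
Definition free i eta : Prop :=
  (forall S, i \in S -> eta S = 0) /\ forall f S, evalF (subi i f) (eta S) (eta S).

Lemma evalF_pt i f p : p != inl i -> evalF (subi i f) (pt p) (pt p).
Proof.
case: p => [q|a] np /=; last exact: evalF_cst.
have nqi : q != i by apply: contra np => /eqP ->.
by have := evalF_var (subi i f) q; rewrite /subi (negPf nqi).
Qed.
Lemma evalF_ti i f : evalF (subi i f) (t i) f.
Proof. by have := evalF_var (subi i f) i; rewrite /subi eqxx. Qed.

Lemma wedge_yf i p eta : wedge (yf i p) eta =
  fscale (t i - pt p)^-1 (crea i eta - if p is inl q then crea q eta else 0).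
Proof.
case: p => [q|a]; first exact: wedge_xf.
by rewrite subr0; exact: wedge_wf.
Qed.

Lemma freeD i eta theta : free i eta -> free i theta -> free i (eta + theta).
Proof.
move=> [h1 h2] [g1 g2]; split=> [S iS|f S]; first by rewrite formDE h1 // g1 // addr0.
by rewrite formDE; apply: evalFD.
Qed.
Lemma freeZ i f eta : (forall g, evalF (subi i g) f f) -> free i eta -> free i (fscale f eta).
Proof.
move=> hf [h1 h2]; split=> [S iS|g S]; first by rewrite fscaleE h1 // mulr0.
by rewrite fscaleE; apply: evalFM.
Qed.
Lemma freeN i eta : free i eta -> free i (- eta).
Proof. by rewrite -fscaleN1; apply: freeZ => g; apply/evalFN/evalF1. Qed.
Lemma free0 i : free i 0.
Proof. by split=> [S _|f S]; rewrite form0E //; exact: evalF0. Qed.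
Lemma free_crea i j eta : i != j -> free i eta -> free i (crea j eta).
Proof.
move=> nij [h1 h2]; split=> [S iS|g S]; rewrite ffunE; case: ifP => // jS.
- by rewrite h1 ?mulr0 // !inE nij.
- by apply: evalFM => //; apply: evalF_sign.
exact: evalF0.
Qed.
Lemma free_anni i j eta : free i eta -> free i (anni j eta).
Proof.
move=> [h1 h2]; split=> [S iS|g S]; rewrite ffunE; case: ifP => // jS.
- by rewrite h1 ?mulr0 // !inE iS orbT.
- exact: evalF0.
- by apply: evalFM => //; apply: evalF_sign.
Qed.

Lemma lspan_free i T eta : i \notin T -> lspan T eta -> free i eta.
Proof.
move=> niT; elim=> {eta} [|c eta theta _ h1 _ h2|j p eta jT hp _ h].
- split=> [S iS|f S]; rewrite -dX0 dXE; first by case: eqP iS => // ->; rewrite inE.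
  by case: eqP => _; [exact: evalF1|exact: evalF0].
- by rewrite scaleE; apply: freeD => //; apply: freeZ => // g; apply: evalF_cst.
have nij : i != j by apply: contra niT => /eqP ->.
have np : p != inl i.
  by case: p hp => // q /and3P[qT _ _]; apply: contra niT => /eqP [<-].
rewrite wedge_yf; apply: freeZ => [g|].
  apply: evalFV; last exact: (nz_ptB hp).
  by apply: evalFB; [apply: (@evalF_pt i g (inl j)); apply: contra nij => /eqP [->]|apply: evalF_pt].
apply: freeD; first exact: free_crea.
apply: freeN; case: p hp np => [q|a] hp np; last exact: free0.
by apply: free_crea => //; apply: contra np => /eqP ->.
Qed.

(** Evaluation at t_i = f of the components without dt_i. *)
Definition EF i f eta eta' : Prop := forall S, i \notin S -> evalF (subi i f) (eta S) (eta' S).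

Lemma EFD i f (a a' b b' : form) : EF i f a a' -> EF i f b b' -> EF i f (a + b) (a' + b').
Proof. by move=> h h' S iS; rewrite !formDE; apply: evalFD; [apply: h|apply: h']. Qed.
Lemma EFZ i f g g' (a a' : form) : evalF (subi i f) g g' -> EF i f a a' -> EF i f (fscale g a) (fscale g' a').
Proof. by move=> h h' S iS; rewrite !fscaleE; apply: evalFM => //; apply: h'. Qed.
Lemma EF0 i f : EF i f 0 0.
Proof. by move=> S _; rewrite form0E; apply: evalF0. Qed.
Lemma EF_sum i f (I : Type) (s : seq I) (P : pred I) (h h' : I -> form) :
  (forall x, P x -> EF i f (h x) (h' x)) -> EF i f (\sum_(x <- s | P x) h x) (\sum_(x <- s | P x) h' x).
Proof. by move=> H; apply: (big_ind2 (EF i f)) => //; [exact: EF0|move=> *; exact: EFD]. Qed.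
Lemma EF_free i f (a : form) : free i a -> EF i f a a.
Proof. by case=> _ h S _; apply: h. Qed.
Lemma EF_anni i f j (a a' : form) : i != j -> EF i f a a' -> EF i f (anni j a) (anni j a').
Proof.
move=> nij h S iS; rewrite !ffunE; case: ifP => _; first exact: evalF0.
apply: evalFM; first exact: evalF_sign.
by apply: h; rewrite !inE negb_or nij.
Qed.

Lemma evalF_pole i T p p' : okc i T p -> okc i T p' ->
  evalF (subi i (pt p)) ((t i - pt p) * (t i - pt p')^-1) ((p == p')%:R).
Proof.
move=> hp hp'; case: (altP (p =P p')) => [<-|npp].
  by rewrite divff_nz ?(nz_ptB hp) //; exact: evalF1.
have np (r : cent) : okc i T r -> r != inl i.
  by case: r => // q /and3P[_ _ ni]; apply: contra ni => /eqP [->].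
have -> : false%:R = (pt p - pt p) * (pt p - pt p')^-1 :> F by rewrite subrr mul0r.
apply: evalF_div; last exact: (nz_pt hp hp' npp).
  by apply: evalFB; [exact: evalF_ti|apply: evalF_pt; apply: np].
by apply: evalFB; [exact: evalF_ti|apply: evalF_pt; apply: np].
Qed.

Section OneDecomposition.
Variables (i : 'I_k) (T : {set 'I_k}) (al0 : form) (al : cent -> form).
Hypotheses (niT : i \notin T) (h0 : lspan T al0) (hal : forall p, lspan T (al p)).
Hypothesis hz : forall p, ~~ okc i T p -> al p = 0.
Let eta := al0 + \sum_p wedge (yf i p) (al p).

Lemma anni_free theta : free i theta -> anni i theta = 0.
Proof.
move=> [h _]; apply: formP => S; rewrite ffunE form0E; case: ifP => // _.
by rewrite h ?mulr0 // !inE eqxx.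
Qed.

Lemma anni_decomp : anni i eta = \sum_p fscale (t i - pt p)^-1 (al p).
Proof.
rewrite /eta anniD anni_free ?add0r ?anni_sum; last exact: (lspan_free niT).
apply: eq_bigr => p _.
case: (boolP (okc i T p)) => hp; last by rewrite hz // wedge0r anni0 fscaler0.
rewrite anni_oneform; last exact: yf_is.
rewrite anni_free ?wedge0r ?subr0; last exact: (lspan_free niT).
congr (fscale _ _); rewrite /yf /dlog fscaleE dform1 derivFB derivF_var eqxx.
case: p hp => [q /and3P[_ _ ni]|a _] /=.
  by rewrite derivF_var (negPf ni) subr0 mulr1.
by rewrite derivF_cst subr0 mulr1.
Qed.

(** The coefficient at a pole is recovered as the residue there, which makes the
    decomposition unique. *)
Lemma residue_decomp p : okc i T p ->
  EF i (pt p) (fscale (t i - pt p) (anni i eta)) (al p).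
Proof.
move=> hp; rewrite anni_decomp fscale_sum.
have -> : al p = \sum_p' fscale (p == p')%:R (al p').
  rewrite (bigD1 p) //= eqxx fscale1 big1 ?addr0 // => p' np'.
  by rewrite eq_sym (negPf np') fscale0.
apply: EF_sum => p' _; case: (boolP (okc i T p')) => hp'; last first.
  by rewrite hz // !fscaler0; exact: EF0.
rewrite fscaleA; apply: EFZ; first exact: (evalF_pole hp hp').
by apply/EF_free/(lspan_free niT).
Qed.

Lemma decomp_zero : eta = 0 -> al0 = 0 /\ forall p, al p = 0.
Proof.
move=> E; have Z p : al p = 0.
  case: (boolP (okc i T p)) => hp; last exact: hz.
  apply: formP => S; rewrite form0E.
  case: (boolP (i \in S)) => iS; first exact: (proj1 (lspan_free niT (hal p))).
  have := residue_decomp hp iS; rewrite E anni0 fscaler0 form0E.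
  by move=> H; apply: (evalF_fun H (evalF0 _)).
split=> //; move: E; rewrite /eta big1 ?addr0 // => p _.
by rewrite Z wedge0r.
Qed.

End OneDecomposition.

Section Transposition.
Variables (i q : 'I_k).
Hypothesis niq : i != q.
Local Notation sw := (@pvar C k (tperm i q)).
Let inj : injev sw := @injev_pvar C k (tperm i q).

Lemma pull_off theta U : i \notin U -> q \notin U ->
  pullback sw theta U = substF sw (theta U).
Proof.
move=> iU qU; rewrite {1}(form_dX theta) (pullback_sum inj) sum_ffunE (bigD1 U) //=.
rewrite (pullbackZ inj) fscaleE pull_dX_fix ?dXE ?eqxx ?mulr1; last first.
  by move=> j jU; rewrite tpermD //; [apply: contra iU|apply: contra qU] => /eqP ->.
rewrite big1 ?addr0 // => S nS; rewrite (pullbackZ inj) fscaleE.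
have off j : j \in S -> tperm i q j \notin U -> pullback sw (dX C S) U = 0.
  move=> jS jU; rewrite (dX_crea C jS) (pullbackZ inj) pull_crea fscaleE ffunE (negPf jU).
  exact: mulr0.
case: (boolP (i \in S)) => iS; first by rewrite (off i) ?tpermL ?mulr0.
case: (boolP (q \in S)) => qS; first by rewrite (off q) ?tpermR ?mulr0.
rewrite pull_dX_fix ?dXE ?[U == S]eq_sym ?(negPf nS) ?mulr0 // => j jS.
by rewrite tpermD //; [apply: contra iS|apply: contra qS] => /eqP ->.
Qed.

Lemma evalF_swap f v : evalF (subi i (t q)) f v -> evalF (subi i (t q)) (substF sw f) v.
Proof.
move=> [p [r [nr -> ->]]].
have nr' : r != 0 by apply/eqP => r0; move: nr; rewrite r0 ev_0 nzE eqxx.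
rewrite (substF_eq inj (evalF_div (evalF_poly _ p) (evalF_poly _ r) (inj nr'))).
have h j : evalF (subi i (t q)) (sw j) (subi i (t q) j).
  rewrite /pvar; have := evalF_var (subi i (t q)) (tperm i q j); rewrite {2}/subi {3}/subi.
  case: tpermP => [->|->|/eqP n1 /eqP n2]; rewrite ?eqxx //.
    by rewrite [q == i]eq_sym (negPf niq).
  by rewrite [q == i]eq_sym (negPf niq).
by apply: evalF_div => //; apply: evalF_mmap.
Qed.

Lemma substF_diff : substF sw (t i - t q) = - (t i - t q).
Proof. by rewrite (substFB inj) !(substF_var inj) /pvar tpermL tpermR opprB. Qed.

End Transposition.

Lemma F_double0 f : f = - f -> f = 0.
Proof.
move=> E; have : f * cstF k (2%:R : C) = 0.
  rewrite /cstF /polyF rmorph_nat rmorph_nat mulr_natr mulr2n {1}E; exact: addNr.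
by move/eqP; rewrite mulf_eq0 cstF_eq0 pnatr_eq0 orbF => /eqP.
Qed.

Definition ctr p eta : form := if p is inl q then crea q eta else 0.

Lemma wedge_yf_off i p eta S : i \notin S ->
  wedge (yf i p) eta S = - ((t i - pt p)^-1 * ctr p eta S).
Proof.
move=> iS; rewrite wedge_yf fscaleE formDE formNE [crea i eta S]ffunE (negPf iS) add0r mulrN.
by case: p.
Qed.

Lemma free_ctr i T p eta : okc i T p -> free i eta -> free i (ctr p eta).
Proof.
case: p => [q /and3P[_ _ ni]|a _] h; [exact: free_crea|exact: free0].
Qed.

Section SkewZero.
Variables (i q : 'I_k) (T : {set 'I_k}) (al0 : form) (al : cent -> form).
Hypotheses (niT : i \notin T) (h0 : lspan T al0) (hal : forall p, lspan T (al p)).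
Hypothesis hz : forall p, ~~ okc i T p -> al p = 0.
Hypothesis hq : okc i T (inl q).
Let eta := al0 + \sum_p wedge (yf i p) (al p).
Local Notation sw := (@pvar C k (tperm i q)).
Hypothesis skew : pullback sw eta = - eta.
Local Notation ph := (t i - t q).

Let niq : i != q. Proof. by case/and3P: hq. Qed.

Lemma anni_q_decomp S : i \notin S -> q \notin S ->
  evalF (subi i (t q)) (ph * anni q eta S) (- al (inl q) S).
Proof.
move=> iS qS; rewrite /eta anniD anni_sum formDE sum_ffunE mulrDr.
have E0 : evalF (subi i (t q)) ph 0.
  rewrite -(subrr (t q)); apply: evalFB; first exact: evalF_ti.
  by apply: (@evalF_pt i _ (inl q)); apply: contra niq => /eqP [->].
rewrite -[X in evalF _ _ X]add0r; apply: evalFD.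
  rewrite -(mul0r (anni q al0 S)); apply: evalFM => //.
  by apply: (proj2 (free_anni q (lspan_free niT h0))).
have -> : - al (inl q) S = \sum_(p : cent) (if p == inl q then - al (inl q) S else 0).
  by rewrite -big_mkcond big_pred1_eq.
rewrite mulr_sumr; apply: evalF_sum => p _.
case: (boolP (okc i T p)) => hp; last first.
  rewrite (hz hp) wedge0r anni0 form0E mulr0; case: eqP hp => [->|_ _]; last exact: evalF0.
  by rewrite hq.
rewrite anni_oneform; last exact: yf_is.
rewrite formDE formNE fscaleE wedge_yf_off // opprK.
have yq : yf i p [set q]%SET = - ((t i - pt p)^-1 * (if p == inl q then 1 else 0)).
  rewrite /yf /dlog fscaleE dform1 derivFB derivF_var eq_sym (negPf niq) sub0r mulrN.
  case: p {hp} => [r|a] /=; last by rewrite derivF_cst.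
  have -> : (inl r == inl q :> cent) = (r == q) by apply/eqP/eqP => [[->]|->].
  by rewrite derivF_var [q == r]eq_sym; case: eqP.
rewrite yq; case: (altP (p =P inl q)) => [->|np].
  rewrite /ctr [crea q _ S]ffunE (negPf qS) mulr0 addr0 mulr1 mulNr mulrN mulrA /=.
  rewrite divff_nz ?nz_var_sub // mul1r.
  by apply/evalFN/(proj2 (lspan_free niT (hal (inl q)))).
rewrite mulr0 oppr0 mul0r add0r.
rewrite -(mul0r ((t q - pt p)^-1 * ctr p (anni q (al p)) S)).
apply: evalFM => //; apply: evalFM.
  apply: evalFV; last by apply: (nz_pt hq hp); rewrite eq_sym.
  apply: evalFB; first exact: evalF_ti.
  by apply: evalF_pt; case: p hp {np yq} => // r /and3P[_ _ ni]; apply: contra ni => /eqP [->].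
by apply: (proj2 (free_ctr hp (free_anni q (lspan_free niT (hal p))))).
Qed.

(** Exchanging t_i and t_q fixes the residue at t_i = t_q, while skewness
    multiplies (t_i - t_q) times the contraction by d/dt_i by a sign: on
    components without dt_q compare with the contraction by d/dt_q, whose
    residue is the opposite one, and on components with dt_q use that the double
    contraction is invariant. Either way the residue equals its opposite. *)
Lemma skew_residue_zero : al (inl q) = 0.
Proof.
have inj := @injev_pvar C k (tperm i q).
have fr := lspan_free niT (hal (inl q)).
have R := residue_decomp niT h0 hal hz hq; rewrite -/eta /= in R.
apply: formP => S; rewrite form0E.
case: (boolP (i \in S)) => iS; first exact: (proj1 fr).
case: (boolP (q \in S)) => qS.
  have iU : i \notin (S :\ q)%SET by rewrite !inE (negPf iS) andbF.
  have qU : q \notin (S :\ q)%SET by rewrite !inE eqxx.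
  pose th := anni q (anni i eta).
  have pth : pullback sw th = th.
    rewrite /th !pull_anni tpermL tpermR skew !anniN (anni_anti _ niq).
    by rewrite opprK.
  have := EF_anni niq R iU; rewrite anniZ fscaleE -/th [X in evalF _ _ X]ffunE (negPf qU) setD1K //.
  set v := sg _ _ _ * _ => ev1.
  have ev2 := evalF_swap niq ev1.
  rewrite (substFM inj) substF_diff -(pull_off _ iU qU) pth mulNr in ev2.
  have v0 : v = 0 by apply: F_double0; apply: (evalF_fun ev2 (evalFN ev1)).
  have : sg C q (S :\ q)%SET * v = 0 by rewrite v0 mulr0.
  by rewrite /v mulrA sg_sq mul1r.
have ev1 := R S iS; rewrite fscaleE in ev1.
have ev2 := evalF_swap niq ev1.
rewrite (substFM inj) substF_diff -(pull_off _ iS qS) pull_anni tpermL skew anniN formNE mulrNN in ev2.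
by apply: F_double0; apply: (evalF_fun ev2 (anni_q_decomp iS qS)).
Qed.

End SkewZero.

Lemma lspan_pull T (s : 'S_k) eta : (forall i, (s i \in T) = (i \in T)) -> (forall i, cls i (s i)) ->
  lspan T eta -> lspan T (pullback (pvar s) eta).
Proof.
move=> hT hc; have inj := @injev_pvar C k s.
elim=> {eta} [|c eta theta _ h1 _ h2|i p eta iT hp _ IH].
- by rewrite (pullback_form1 inj); exact: ls_one.
- by rewrite (pullbackD inj) (pullback_scale inj); apply: ls_lin.
rewrite (pullback_wedge inj).
case: p hp => [q /and3P[qT iq niq]|a ia].
  have -> : pullback (pvar s) (yf i (inl q)) = yf (s i) (inl (s q)) by exact: pull_xf.
  apply: ls_gen => //=; first by rewrite hT.
  rewrite hT qT (inj_eq perm_inj) niq andbT /=.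
  by rewrite (cls_trans _ (hc q)) // (cls_trans _ iq) // cls_sym.
have -> : pullback (pvar s) (yf i (inr a)) = yf (s i) (inr a) by exact: pull_wf.
by apply: ls_gen => //=; [rewrite hT|rewrite -(acol_cls (hc i))].
Qed.

(** Constant combinations of monomials with colours allowed on T. *)
Definition inL T eta : Prop := exists c : {ffun 'I_k -> option 'I_n} -> C,
  eta = \sum_chi c chi *: lam z chi /\
  forall chi, c chi != 0 -> forall i a, chi i = Some a -> i \in T /\ acol i a.

Lemma inL_lin T (c : C) eta theta : inL T eta -> inL T theta -> inL T (c *: eta + theta).
Proof.
move=> [d [-> hd]] [d' [-> hd']]; exists (fun chi => c * d chi + d' chi); split.
  rewrite scaler_sumr -big_split; apply: eq_bigr => chi _ /=.
  by rewrite scalerA scalerDl.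
move=> chi nz0; have [E|] := eqVneq (d chi) 0; last exact: hd.
by apply: hd'; move: nz0; rewrite E mulr0 add0r.
Qed.

Lemma inL_lam T (c : C) chi : (forall i a, chi i = Some a -> i \in T /\ acol i a) ->
  inL T (c *: lam z chi).
Proof.
move=> h; exists (fun chi' => if chi' == chi then c else 0); split.
  rewrite (bigD1 chi) //= eqxx big1 ?addr0 // => chi' /negPf ->; rewrite ?scale0r //.
by move=> chi'; case: (chi' =P chi) => [-> _|]; rewrite ?eqxx.
Qed.

Lemma inL0 T : inL T 0.
Proof.
exists (fun _ => 0); split; first by rewrite big1 // => chi _; rewrite scale0r.
by move=> chi; rewrite eqxx.
Qed.

Lemma inL_sum T (I : Type) (s : seq I) (P : pred I) (h : I -> form) :
  (forall x, P x -> inL T (h x)) -> inL T (\sum_(x <- s | P x) h x).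
Proof.
move=> H; apply: big_ind => //; first exact: inL0.
by move=> a b ha hb; have := inL_lin 1 ha hb; rewrite scale1r.
Qed.

Lemma inL_mono T T' eta : T \subset T' -> inL T eta -> inL T' eta.
Proof.
move=> sT [c [-> h]]; exists c; split=> // chi nz0 i a E.
by have [iT ia] := h chi nz0 i a E; split=> //; apply: (subsetP sT).
Qed.

Lemma fscale_sign m eta : fscale ((-1) ^+ m) eta = ((-1) ^+ m : C) *: eta.
Proof.
rewrite scaleE; congr fscale; elim: m => [|m IH]; first by rewrite !expr0 cstF1.
by rewrite !exprS IH cstFM cstFN cstF1.
Qed.

Lemma inL_wf i T a eta : i \notin T -> acol i a -> inL T eta ->
  inL (i |: T)%SET (wedge (wf z i a) eta).
Proof.
move=> niT ia [c [-> h]]; rewrite wedge_sumr; apply: inL_sum => chi _.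
rewrite wedgeZc wedge_wf_lam; case: ifP => hi; first by rewrite scaler0; exact: inL0.
have [->|nz0] := eqVneq (c chi) 0; first by rewrite scale0r; exact: inL0.
rewrite fscale_sign scalerA; apply: inL_lam => j b; rewrite setcE in_setU1.
by case: eqP => [-> [<-]|_ /(h chi nz0)] //=.
Qed.

Lemma lspan_empty eta : lspan set0 eta -> inL set0 eta.
Proof.
elim=> {eta} [|c eta theta _ h1 _ h2|i p eta]; last by rewrite inE.
- have -> : form1 C k = 1 *: lam z [ffun _ => None].
    rewrite scale1r /lam /gfun big1 ?fscale1 => [|i _]; last by rewrite /den ffunE invr1.
    by rewrite -dX0; congr dX; apply/setP => i; rewrite !inE ffunE.
  by apply: inL_lam => i a; rewrite ffunE.
exact: inL_lin.
Qed.

(** Induction on the number of variables: in the partial fraction decomposition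
    in t_i only the poles at the z_a remain, and their coefficients are again
    skew in the other variables. *)
Theorem skew_lspan T eta : lspan T eta ->
  (forall i q, i \in T -> q \in T -> i != q -> cls i q -> pullback (pvar (tperm i q)) eta = - eta) ->
  inL T eta.
Proof.
have [N] := ubnP #|T|; elim: N T eta => // N IH T eta /ltnSE leT.
case: (set_0Vmem T) => [->|[i iT]]; first by move=> h _; apply: lspan_empty.
rewrite -(setD1K iT); have niT : i \notin (T :\ i)%SET by rewrite !inE eqxx.
move: leT; rewrite (cardsD1 i) iT; move: (T :\ i)%SET niT => {iT}T niT leT h skew.
have [al0 [al [h0 hal hz E]]] := decompP niT h.
have zq q : al (inl q) = 0.
  case: (boolP (okc i T (inl q))) => hq; last exact: hz.
  case/and3P: (hq) => qT iq niq.
  apply: (skew_residue_zero niT h0 hal hz hq).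
  by rewrite -E; apply: skew; rewrite ?in_setU1 ?eqxx ?qT ?orbT.
have sk q r : q \in T -> r \in T -> q != r -> cls q r ->
    pullback (pvar (tperm q r)) al0 = - al0 /\ forall p, pullback (pvar (tperm q r)) (al p) = - al p.
  move=> qT rT nqr qr; have inj := @injev_pvar C k (tperm q r).
  have si : tperm q r i = i.
    by rewrite tpermD //; [apply: contra niT => /eqP <-|apply: contra niT => /eqP <-].
  have hT j : (tperm q r j \in T) = (j \in T).
    by case: tpermP => [->|->|_ _]; rewrite ?qT ?rT.
  have hc j : cls j (tperm q r j).
    by case: tpermP => [->|->|_ _] //; rewrite cls_sym.
  have [] := @decomp_zero i T (pullback (pvar (tperm q r)) al0 + al0)
     (fun p => pullback (pvar (tperm q r)) (al p) + al p) niT.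
  - by apply: lspanD => //; apply: lspan_pull.
  - by move=> p; apply: lspanD => //; apply: lspan_pull.
  - by move=> p np; rewrite hz // (pullback0 inj) addr0.
  - have := skew q r; rewrite !in_setU1 qT rT !orbT => /(_ isT isT nqr qr).
    rewrite E (pullbackD inj) (pullback_sum inj) => sk.
    under eq_bigr => p _ do rewrite wedgeDr.
    rewrite big_split addrACA; apply/eqP; rewrite addr_eq0 -sk; apply/eqP.
    congr (_ + _); apply: eq_bigr => p _; rewrite (pullback_wedge inj).
    case: p => [p|a]; first by rewrite zq (pullback0 inj) !wedge0r.
    congr wedge; rewrite -[in LHS]si; apply/esym; exact: pull_wf.
  by move=> /eqP e0 e; split=> [|p]; apply/eqP; rewrite -addr_eq0 // e.
have IH0 : inL T al0 by apply: IH => // q r qT rT nqr qr; have [] := sk q r qT rT nqr qr.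
have IHp p : inL T (al p) by apply: IH => // q r qT rT nqr qr; have [_] := sk q r qT rT nqr qr; apply.
rewrite E -[al0]scale1r; apply: inL_lin; first by apply: inL_mono IH0; apply: subsetUr.
apply: inL_sum => p _; case: p => [q|a]; first by rewrite zq wedge0r; exact: inL0.
case: (boolP (acol i a)) => ia; last by rewrite hz // wedge0r; exact: inL0.
exact: inL_wf.
Qed.

End PoleTheorem.

(** * Logarithmic forms on a component *)

Section LogAlgebra.
Variables (C : numFieldType) (n k n0 : nat) (m : 'I_n -> nat) (z : 'I_n -> C).
Hypothesis z_inj : injective z.
Local Notation F := (ratfun C k).
Local Notation form := (ratform C k).
Local Notation t i := (varF C (i : 'I_k)).
Local Notation zc a := (cstF k (z a)).
Local Notation label := (label n k).
Implicit Types (i q r : 'I_k) (a b j : 'I_n) (S T U : {set 'I_k}) (eta theta : form) (f g : F) (c : label).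
Implicit Types chi : {ffun 'I_k -> option 'I_n}.
Local Notation comp := (is_component n0 m).

Lemma comp_disj c i j j' : comp c -> i \in c j -> i \in c j' -> j = j'.
Proof.
case/andP => _ /forallP h ij ij'; apply/eqP; apply: contraT => njj.
have /forallP/(_ j')/implyP/(_ njj) := h j.
by rewrite disjoint_subset => /subsetP/(_ i ij); rewrite inE ij'.
Qed.

Lemma comp_card c j : comp c -> c j != set0 -> (j < n0)%N /\ #|c j| = (m j).+1.
Proof. by case/andP => /forallP h _ nj; have /implyP/(_ nj)/andP[-> /eqP ->] := h j. Qed.

Definition cls c : rel 'I_k := fun i q => [forall j, (i \in c j) == (q \in c j)].
Definition acol c i : pred 'I_n := fun a => [forall j, (i \in c j) ==> (a == j)].

Lemma clsP c i q : reflect (forall j, (i \in c j) = (q \in c j)) (cls c i q).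
Proof. by apply: (iffP forallP) => h j; [apply/eqP/h|apply/eqP]. Qed.

Lemma cls_refl c : reflexive (cls c).
Proof. by move=> i; apply/clsP. Qed.
Lemma cls_sym c : symmetric (cls c).
Proof. by move=> i q; apply/clsP/clsP => h j; rewrite h. Qed.
Lemma cls_trans c : transitive (cls c).
Proof. by move=> i q r /clsP h /clsP h'; apply/clsP => j; rewrite h h'. Qed.
Lemma acol_cls c i q : cls c i q -> acol c i =1 acol c q.
Proof. by move=> /clsP h a; apply: eq_forallb => j; rewrite h. Qed.

Lemma cls_in c i q j : comp c -> i \in c j -> cls c i q = (q \in c j).
Proof.
move=> hc ij; apply/clsP/idP => [<- //|qj j'].
by apply/idP/idP => h; [rewrite -(comp_disj hc ij h)|rewrite -(comp_disj hc qj h)].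
Qed.

Lemma cls_free c i q : free_coord c i -> cls c i q = free_coord c q.
Proof.
move=> /forallP hi; apply/clsP/forallP => [h j|h j]; first by rewrite -h hi.
by rewrite (negPf (hi j)) (negPf (h j)).
Qed.

Lemma acol_in c i j a : comp c -> i \in c j -> acol c i a = (a == j).
Proof.
move=> hc ij; apply/forallP/eqP => [/(_ j)/implyP/(_ ij)/eqP //|-> j'].
by apply/implyP => /(comp_disj hc ij) ->.
Qed.
Lemma acol_free c i a : free_coord c i -> acol c i a.
Proof. by move=> /forallP h; apply/forallP => j; rewrite (negPf (h j)). Qed.

Lemma free_or c i : free_coord c i \/ exists j, i \in c j.
Proof.
case: (boolP (free_coord c i)) => h; first by left.
by right; move: h; rewrite negb_forall => /existsP[j]; rewrite negbK; exists j.
Qed.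

(** Products of degree d with generators multiplied on the left, which turns the
    algebra of logarithmic forms into an inductive span. *)
Inductive gspan (G : form -> Prop) : nat -> form -> Prop :=
| gs_one : gspan G 0 (form1 C k)
| gs_zero d : gspan G d 0
| gs_lin d (x : C) eta theta : gspan G d eta -> gspan G d theta -> gspan G d (x *: eta + theta)
| gs_gen d u eta : G u -> gspan G d eta -> gspan G d.+1 (wedge u eta).

Lemma gspan_wedge G d d' eta theta : gspan G d eta -> gspan G d' theta -> gspan G (d + d') (wedge eta theta).
Proof.
move=> h h'; elim: h => {d eta} [|d|d x eta eta' _ IH1 _ IH2|d u eta hu _ IH].
- by rewrite wedge1l.
- by rewrite wedge0l; apply: gs_zero.
- by rewrite wedgeDl scaleE wedgeZl -scaleE; apply: gs_lin.
- by rewrite -wedgeA addSn; apply: gs_gen.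
Qed.

Definition dlogs c u : Prop := exists2 g, log_divisor z c g & u = dlog g.

Lemma log_gspan c d eta : log_algebra z c d eta -> gspan (dlogs c) d eta.
Proof.
elim=> {d eta} [g hg||d|d x eta theta _ h1 _ h2|d d' eta theta _ h1 _ h2].
- rewrite -[dlog g]wedge1r; apply: gs_gen; first by exists g.
  exact: gs_one.
- exact: gs_one.
- exact: gs_zero.
- exact: gs_lin.
- exact: gspan_wedge.
Qed.

Lemma base_in (I : {set 'I_k}) i : i \in I -> base I i \in I.
Proof.
rewrite -!(mem_enum I) /base; case: (enum I) => // x s _ /=; exact: mem_head.
Qed.
Lemma base_eq (I : {set 'I_k}) i q : i \in I -> base I q = base I i.
Proof. by rewrite -(mem_enum I) /base; case: (enum I). Qed.

Lemma in_base_set c i j : comp c -> i \in c j -> (i \in base_set c) = (i == base (c j) i).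
Proof.
move=> hc ij; rewrite inE; apply/existsP/eqP => [[j' /andP[ij' /eqP]]|E]; first by rewrite (comp_disj hc ij ij').
by exists j; rewrite ij -E eqxx.
Qed.

Lemma dlog_ucoord j (I : {set 'I_k}) i : dlog (ucoord z j I i) = wf z i j - wf z (base I i) j.
Proof. by rewrite /ucoord dlog_div ?nz_var_cst. Qed.

Lemma dlog_ucoord1 j (I : {set 'I_k}) i : i != base I i ->
  dlog (ucoord z j I i - 1) = xf C i (base I i) - wf z (base I i) j.
Proof.
move=> nb; have nzb := nz_var_cst (base I i) (z j).
have -> : ucoord z j I i - 1 = (t i - t (base I i)) / (t (base I i) - zc j).
  by rewrite /ucoord -(divff_nz nzb) -mulrBl; congr (_ / _); ring.
by rewrite dlog_div ?nz_var_sub // nzb.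
Qed.

Lemma dlog_ucoord2 j (I : {set 'I_k}) i q : i \in I -> i != q ->
  dlog (ucoord z j I i - ucoord z j I q) = xf C i q - wf z (base I i) j.
Proof.
move=> iI nq; have -> : ucoord z j I i - ucoord z j I q = (t i - t q) / (t (base I i) - zc j).
  by rewrite /ucoord (base_eq q iI) -mulrBl; congr (_ / _); ring.
by rewrite dlog_div ?nz_var_sub ?nz_var_cst.
Qed.

Local Notation lsp c := (lspan z (cls c) (acol c) [set: 'I_k]).

Lemma wf_lspan c i a eta : acol c i a -> lsp c eta -> lsp c (wedge (wf z i a) eta).
Proof. by move=> ia h; apply: (@ls_gen _ _ _ _ _ _ _ i (inr a)) => //; rewrite inE. Qed.
Lemma xf_lspan c i q eta : cls c i q -> i != q -> lsp c eta -> lsp c (wedge (xf C i q) eta).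
Proof.
move=> iq nq h; apply: (@ls_gen _ _ _ _ _ _ _ i (inl q)) => //; first by rewrite inE.
by rewrite /= inE iq nq.
Qed.

Lemma dlogs_lspan c u eta : comp c -> dlogs c u -> lsp c eta -> lsp c (wedge u eta).
Proof.
move=> hc [g hg ->] h; elim: hg => {g} [j i ij nb|j i ij nb|j i q ij nb qj nbq niq|i q hi hq niq|i l hi].
- rewrite dlog_ucoord wedgeDl wedgeNl; apply: lspanD; last apply: lspanN.
    by apply: wf_lspan => //; rewrite (acol_in _ hc ij).
  by apply: wf_lspan => //; rewrite (acol_in _ hc (base_in ij)).
- rewrite dlog_ucoord1 // wedgeDl wedgeNl; apply: lspanD; last apply: lspanN.
    by apply: xf_lspan => //; rewrite (cls_in _ hc ij) base_in.
  by apply: wf_lspan => //; rewrite (acol_in _ hc (base_in ij)).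
- rewrite dlog_ucoord2 // wedgeDl wedgeNl; apply: lspanD; last apply: lspanN.
    by apply: xf_lspan => //; rewrite (cls_in _ hc ij).
  by apply: wf_lspan => //; rewrite (acol_in _ hc (base_in ij)).
- by apply: xf_lspan => //; rewrite cls_free.
- by apply: wf_lspan => //; exact: acol_free.
Qed.

Lemma gspan_lspan c d eta : comp c -> gspan (dlogs c) d eta -> lsp c eta.
Proof.
move=> hc; elim=> {d eta} [|d|d x eta theta _ h1 _ h2|d u eta hu _ h].
- exact: ls_one.
- exact: lspan0.
- exact: ls_lin.
- exact: dlogs_lspan.
Qed.

(** The Euler vector field of the block j: the forms on the component are pulled
    back from the projectivization of the block, hence annihilated by it. *)
Definition eul c j : 'I_k -> F := fun i => if i \in c j then t i - zc j else 0.

Lemma dlogs_is c u : dlogs c u -> is_oneform u.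
Proof. by case=> g _ ->; apply: dlog_is. Qed.

Lemma ev1D (v : 'I_k -> F) eta theta : ev1 v (eta + theta) = ev1 v eta + ev1 v theta.
Proof. by rewrite /ev1 -big_split; apply: eq_bigr => i _; rewrite formDE mulrDr. Qed.
Lemma ev1N (v : 'I_k -> F) eta : ev1 v (- eta) = - ev1 v eta.
Proof. by rewrite /ev1 -sumrN; apply: eq_bigr => i _; rewrite formNE mulrN. Qed.
Lemma ev1_dlog (v : 'I_k -> F) f : ev1 v (dlog f) = f^-1 * \sum_i v i * derivF i f.
Proof.
by rewrite /ev1 mulr_sumr; apply: eq_bigr => i _; rewrite /dlog fscaleE dform1 mulrCA.
Qed.
Lemma sum_derivF_var (v : 'I_k -> F) i : \sum_q v q * derivF q (t i) = v i.
Proof.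
rewrite (bigD1 i) //= derivF_var eqxx mulr1 big1 ?addr0 // => q nq.
by rewrite derivF_var (negPf nq) mulr0.
Qed.
Lemma ev1_wf (v : 'I_k -> F) i a : ev1 v (wf z i a) = v i / (t i - zc a).
Proof.
rewrite ev1_dlog mulrC; congr (_ / _); rewrite -[RHS]sum_derivF_var.
by apply: eq_bigr => q _; rewrite derivFB derivF_cst subr0.
Qed.
Lemma ev1_xf (v : 'I_k -> F) i q : ev1 v (xf C i q) = (v i - v q) / (t i - t q).
Proof.
rewrite ev1_dlog mulrC; congr (_ / _); rewrite -(sum_derivF_var v i) -(sum_derivF_var v q).
by rewrite -sumrB; apply: eq_bigr => r _; rewrite derivFB mulrBr.
Qed.

(** The function u_i has degree zero for the scaling of the block. *)
Lemma dlogs_eul c j u : comp c -> dlogs c u -> ev1 (eul c j) u = 0.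
Proof.
move=> hc [g hg ->]; elim: hg => {g} [j' i ij nb|j' i ij nb|j' i q ij nb qj nbq niq|i q hi hq niq|i l hi].
- rewrite dlog_ucoord ev1D ev1N !ev1_wf /eul.
  have bj := base_in ij; case: (altP (j' =P j)) => [<-|nj].
    by rewrite ij bj !divff_nz ?nz_var_cst // subrr.
  by rewrite !ifN ?mul0r ?subrr //; apply: contra nj => h; apply/eqP; apply: (comp_disj hc _ h).
- rewrite dlog_ucoord1 // ev1D ev1N ev1_wf ev1_xf /eul.
  have bj := base_in ij; case: (altP (j' =P j)) => [<-|nj].
    rewrite ij bj [X in X / _](_ : _ = t i - t (base (c j') i)); last by ring.
    by rewrite !divff_nz ?nz_var_cst ?nz_var_sub // subrr.
  by rewrite !ifN ?subrr ?mul0r ?subrr //; apply: contra nj => h; apply/eqP; apply: (comp_disj hc _ h).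
- rewrite dlog_ucoord2 // ev1D ev1N ev1_wf ev1_xf /eul.
  have bj := base_in ij; case: (altP (j' =P j)) => [<-|nj].
    rewrite ij bj qj [X in X / _](_ : _ = t i - t q); last by ring.
    by rewrite !divff_nz ?nz_var_cst ?nz_var_sub // subrr.
  by rewrite !ifN ?subrr ?mul0r ?subrr //; apply: contra nj => h; apply/eqP; apply: (comp_disj hc _ h).
- move/forallP/(_ j): hi => hi; move/forallP/(_ j): hq => hq.
  by rewrite ev1_xf /eul (negPf hi) (negPf hq) subrr mul0r.
- by move/forallP/(_ j): hi => hi; rewrite ev1_wf /eul (negPf hi) mul0r.
Qed.

Lemma gspan_eul c d eta j : comp c -> gspan (dlogs c) d eta -> contr (eul c j) eta = 0.
Proof.
move=> hc; elim=> {d eta} [|d|d x eta theta _ h1 _ h2|d u eta hu _ h].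
- exact: contr_form1.
- exact: contr0.
- by rewrite contrD scaleE contrZ h1 h2 fscaler0 addr0.
- by rewrite (contr_wedge _ _ (dlogs_is hu)) (dlogs_eul j hc hu) fscale0 h wedge0r subr0.
Qed.

Lemma gspan_deg G d eta S : (forall u, G u -> is_oneform u) -> gspan G d eta -> #|S| != d -> eta S = 0.
Proof.
move=> hG h; elim: h S => {d eta} [|d|d x eta theta _ h1 _ h2|d u eta hu _ h] S nS.
- by rewrite -dX0 dXE; case: (S =P set0) nS => [->|//]; rewrite cards0.
- by rewrite form0E.
- by rewrite scaleE formDE fscaleE h1 // h2 // mulr0 addr0.
- rewrite (is_oneformP (hG _ hu)) wedge_oneform sum_ffunE big1 // => i _.
  rewrite fscaleE ffunE; case: ifP => iS; rewrite ?mulr0 // h ?mulr0 //.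
  by apply: contra nS => /eqP E; rewrite (cardsD1 i) iS E.
Qed.

End LogAlgebra.

Lemma perm_of_fibers (T : eqType) (k : nat) (f g : 'I_k -> T) :
  (forall y, #|[set i | f i == y]| = #|[set i | g i == y]|) ->
  exists s : 'S_k, forall i, f (s i) = g i.
Proof.
move=> h; pose tf := [tuple f i | i < k]; pose tg := [tuple g i | i < k].
have cnt (u : 'I_k -> T) y : count_mem y [tuple u i | i < k] = #|[set i | u i == y]|.
  by rewrite /= count_map -sum1dep_card -sum1_count big_enum_cond.
have /tuple_permP[s E] : perm_eq tg tf.
  by apply/allP => y _ /=; rewrite !cnt h.
exists s => i.
have := congr1 (fun u => nth (f i) u i) E; rewrite -!tnth_nth !tnth_mktuple.
by move=> ->.
Qed.

(** * Skew-symmetric chains built from colourings *)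

Section Structure.
Variables (C : numFieldType) (n k n0 : nat) (m : 'I_n -> nat) (z : 'I_n -> C).
Hypothesis z_inj : injective z.
Local Notation F := (ratfun C k).
Local Notation form := (ratform C k).
Local Notation t i := (varF C (i : 'I_k)).
Local Notation zc a := (cstF k (z a)).
Local Notation label := (label n k).
Local Notation chains := (chains C n k).
Implicit Types (i q : 'I_k) (r : seq 'I_k) (a b j : 'I_n) (S T U : {set 'I_k}) (eta theta : form) (f g : F) (c : label).
Implicit Types (chi : {ffun 'I_k -> option 'I_n}) (o : option 'I_n) (s : 'S_k).
Local Notation comp := (is_component n0 m).
Local Notation lam := (lam z).
Local Notation vol := (vol C k).

Definition nset c chi o : {set 'I_k} :=
  if o is Some j then [set i in c j | chi i == None]%SET
  else [set i | free_coord c i && (chi i == None)]%SET.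
Definition slots c : seq (option 'I_n) := rcons [seq Some j | j <- enum (index_set c)] None.
(** The uncoloured coordinates, block after block and then the free one.
    Contracting the volume form in this order rather than in increasing order
    makes the sign equivariant under permutations. *)
Definition os c chi : seq 'I_k := flatten [seq enum (nset c chi o) | o <- slots c].
Definition annis (r : seq 'I_k) eta : form := foldr (@anni C k) eta r.
(** The monomial of chi up to a sign ([hlam_lam]) chosen so that permutations
    act on these forms by their signature only ([pull_hlam]). *)
Definition hlam c chi : form := fscale (gfun z chi) (annis (os c chi) vol).

Definition colok c chi : bool := [forall i, if chi i is Some a then acol c i a else true].
(** The colourings that occur in a skew chain: one uncoloured coordinate in each
    block, at most one uncoloured free coordinate. *)
Definition valid c chi : bool :=
  [&& colok c chi, [forall j in index_set c, #|nset c chi (Some j)| == 1%N] & (#|nset c chi None| <= 1)%N].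

Definition Kof c chi : 'X_{1..n} :=
  [multinom #|[set i | free_coord c i && (chi i == Some a)]%SET| | a < n].

Definition tau (A : {set 'I_n} -> 'X_{1..n} -> C) : chains :=
  [ffun c => if comp c then \sum_(chi | valid c chi) A (index_set c) (Kof c chi) *: hlam c chi else 0].

Lemma annis_cat r r' eta : annis (r ++ r') eta = annis r (annis r' eta).
Proof. by rewrite /annis foldr_cat. Qed.

Lemma annisZ r f eta : annis r (fscale f eta) = fscale f (annis r eta).
Proof. by elim: r => //= i r ->; rewrite anniZ. Qed.

Lemma sg_sign i S : exists e : bool, forall eta, fscale (sg C i S) eta = (-1) ^+ e *: eta.
Proof. by exists (odd (below i S)) => eta; rewrite /sg -signr_odd fscale_sign. Qed.

Lemma annis_vol r : uniq r ->
  exists e : bool, annis r vol = (-1) ^+ e *: dX C (~: [set i in r])%SET.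
Proof.
elim: r => [_|i r IH] /=.
  by exists false; rewrite expr0 scale1r /vol; congr (dX C _); apply/setP => i; rewrite !inE.
move=> /andP[ir /IH[e ->]]; rewrite scaleE anniZ -scaleE anni_dX !inE ir.
have [e' ->] := sg_sign i (~: [set i0 in r])%SET.
exists (e (+) e'); rewrite scalerA signr_addb; congr (_ *: dX C _).
by apply/setP => q; rewrite !inE negb_or.
Qed.

Lemma uniq_flatten (T : eqType) (r : seq T) (A : T -> {set 'I_k}) : uniq r ->
  (forall x y i, x \in r -> y \in r -> i \in A x -> i \in A y -> x = y) ->
  uniq (flatten [seq enum (A x) | x <- r]).
Proof.
elim: r => //= x r IH /andP[xr ur] h; rewrite cat_uniq enum_uniq IH //=; last first.
  by move=> u v i ur' vr; apply: h; rewrite inE ?ur' ?vr orbT.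
rewrite andbT; apply/hasPn => i /flattenP[l /mapP[y yr ->]]; rewrite mem_enum => iy.
apply/negP; rewrite /= mem_enum => ix; move: xr.
by rewrite (h x y i) ?yr // inE ?eqxx // yr orbT.
Qed.

Lemma index_setE c j i : i \in c j -> j \in index_set c.
Proof. by move=> h; rewrite inE; apply/set0Pn; exists i. Qed.

Lemma mem_nset c chi o i : i \in nset c chi o -> chi i = None.
Proof. by case: o => [j|]; rewrite inE => /andP[_ /eqP]. Qed.

Lemma slots_uniq c : uniq (slots c).
Proof.
rewrite rcons_uniq map_inj_uniq ?enum_uniq ?andbT; last by move=> x y [].
by apply/mapP => -[].
Qed.

Lemma nset_disj c chi o o' i : comp c -> i \in nset c chi o -> i \in nset c chi o' -> o = o'.
Proof.
move=> hc; case: o o' => [j|] [j'|] //=; rewrite !inE.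
- by move=> /andP[h _] /andP[h' _]; rewrite (comp_disj hc h h').
- by move=> /andP[h _] /andP[/forallP/(_ j)]; rewrite h.
- by move=> /andP[/forallP/(_ j') h _] /andP[h' _]; rewrite h' in h.
Qed.

Lemma os_uniq c chi : comp c -> uniq (os c chi).
Proof.
move=> hc; apply: uniq_flatten; first exact: slots_uniq.
by move=> o o' i _ _; apply: nset_disj.
Qed.

Lemma mem_slots c o : (o \in slots c) = if o is Some j then j \in index_set c else true.
Proof.
rewrite mem_rcons inE; case: o => [j|] //=.
by rewrite (mem_map (@Some_inj _)) mem_enum.
Qed.

Lemma mem_os c chi i : (i \in os c chi) = (chi i == None).
Proof.
apply/flattenP/eqP => [[l /mapP[o _ ->]]|h]; first by rewrite mem_enum => /mem_nset.
have [fi|[j ij]] := free_or c i.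
  exists (enum (nset c chi None)); last by rewrite mem_enum inE fi h.
  by apply/mapP; exists None => //; rewrite mem_slots.
exists (enum (nset c chi (Some j))); last by rewrite mem_enum inE ij h.
by apply/mapP; exists (Some j) => //; rewrite mem_slots; apply: index_setE ij.
Qed.

Lemma hlam_lam c chi : comp c -> exists e : bool, hlam c chi = (-1) ^+ e *: lam chi.
Proof.
move=> hc; have [e E] := annis_vol (os_uniq chi hc); exists e.
rewrite /hlam E scaleE !fscaleA mulrC -fscaleA -scaleE; congr (_ *: fscale _ (dX C _)).
by apply/setP => i; rewrite !inE mem_os.
Qed.

Lemma lam_neq0 chi : lam chi <> 0.
Proof.
move=> E; have H : \sum_x ((x == chi)%:R : C) *: lam x = 0.
  by rewrite (bigD1 chi) //= eqxx E scaler0 big1 ?addr0 // => x /negPf ->; rewrite scale0r.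
by have /eqP := lam_indep z_inj H chi; rewrite eqxx oner_eq0.
Qed.

Definition pc s c : label := [ffun j => (s @^-1: c j)%SET].
Definition pchi s chi : {ffun 'I_k -> option 'I_n} := [ffun i => chi (s i)].

Lemma in_pc s c j i : (i \in pc s c j) = (s i \in c j).
Proof. by rewrite ffunE inE. Qed.
Lemma free_pc s c i : free_coord (pc s c) i = free_coord c (s i).
Proof. by apply: eq_forallb => j; rewrite in_pc. Qed.
Lemma card_pre s (A : {set 'I_k}) : #|(s @^-1: A)%SET| = #|A|.
Proof. by rewrite card_preimset //; apply: perm_inj. Qed.
Lemma pc_eq0 s c j : (pc s c j == set0) = (c j == set0).
Proof. by rewrite -!cards_eq0 ffunE card_pre. Qed.
Lemma index_pc s c : index_set (pc s c) = index_set c.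
Proof. by apply/setP => j; rewrite !inE pc_eq0. Qed.
Lemma comp_pc s c : comp c -> comp (pc s c).
Proof.
move=> hc; apply/andP; split; apply/forallP => j.
  by apply/implyP; rewrite pc_eq0 => h; have [-> <-] := comp_card hc h; rewrite ffunE card_pre eqxx.
apply/forallP => j'; apply/implyP => nj; rewrite disjoint_subset; apply/subsetP => i.
rewrite in_pc => h; rewrite inE in_pc; apply: contra nj => h'.
by apply/eqP; apply: (comp_disj hc h h').
Qed.
Lemma nset_pc s c chi o : nset (pc s c) (pchi s chi) o = (s @^-1: nset c chi o)%SET.
Proof. by case: o => [j|]; apply/setP => i; rewrite !inE ?in_pc ?free_pc !ffunE ?inE. Qed.
Lemma acol_pc s c i a : acol (pc s c) i a = acol c (s i) a.
Proof. by apply: eq_forallb => j; rewrite in_pc. Qed.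
Lemma colok_pc s c chi : colok (pc s c) (pchi s chi) = colok c chi.
Proof.
apply/forallP/forallP => h i.
  by have := h (s^-1%g i); rewrite ffunE permKV; case: (chi i) => // a; rewrite acol_pc permKV.
by rewrite ffunE; have := h (s i); case: (chi _) => // a; rewrite acol_pc.
Qed.
Lemma valid_pc s c chi : valid (pc s c) (pchi s chi) = valid c chi.
Proof.
rewrite /valid colok_pc nset_pc card_pre; congr [&& _, _ & _].
by rewrite index_pc; apply: eq_forallb => j; rewrite nset_pc card_pre.
Qed.
Lemma Kof_pc s c chi : Kof (pc s c) (pchi s chi) = Kof c chi.
Proof.
apply/mnmP => a; rewrite !mnmE.
rewrite -(card_pre s [set i | free_coord c i && (chi i == Some a)]%SET); congr #|pred_of_set _|.
by apply/setP => i; rewrite !inE free_pc ffunE.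
Qed.

Lemma pchi_bij s : bijective (pchi s).
Proof.
by exists (pchi s^-1%g) => chi; apply/ffunP => i; rewrite !ffunE ?permK ?permKV.
Qed.

Lemma enum_card1 (A : {set 'I_k}) : (#|A| <= 1)%N -> A = set0 \/ exists x, A = [set x]%SET.
Proof.
case: (posnP #|A|) => [/eqP|h1 h2]; first by rewrite cards_eq0 => /eqP; left.
by right; apply/cards1P; rewrite eqn_leq h2.
Qed.

Lemma enum_pre s (A : {set 'I_k}) : (#|A| <= 1)%N -> map s (enum (s @^-1: A)%SET) = enum A.
Proof.
case/enum_card1 => [->|[x ->]]; first by rewrite preimset0 !enum_set0.
have -> : (s @^-1: [set x] = [set s^-1%g x])%SET.
  by apply/setP => i; rewrite !inE (can2_eq (permK s) (permKV s)).
by rewrite !enum_set1 /= permKV.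
Qed.

Lemma valid_card c chi o : valid c chi -> o \in slots c -> (#|nset c chi o| <= 1)%N.
Proof.
case/and3P => _ /forallP h h0; case: o => [j|//]; rewrite mem_slots => hj.
by have /implyP/(_ hj)/eqP -> := h j.
Qed.

Lemma os_pc s c chi : valid c chi -> map s (os (pc s c) (pchi s chi)) = os c chi.
Proof.
move=> hv; rewrite /os map_flatten -map_comp /slots index_pc -/(slots c); congr flatten.
apply/eq_in_map => o ho /=; rewrite nset_pc enum_pre //.
exact: valid_card ho.
Qed.

Lemma pull_annis s r eta : pullback (pvar s) (annis r eta) = annis (map s r) (pullback (pvar s) eta).
Proof. by elim: r => //= i r <-; rewrite pull_anni. Qed.

Lemma subst_gfun s chi : substF (pvar s) (gfun z (pchi s chi)) = gfun z chi.
Proof.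
have inj := @injev_pvar C k s.
apply: (substF_eq inj); rewrite [X in evalF _ _ X](reindex_inj (@perm_inj _ s)).
apply: evalF_prod => i _.
have -> : (den z chi (s i))^-1 = substF (pvar s) (den z (pchi s chi) i)^-1.
  rewrite (substFV inj) /den ffunE; case: (chi (s i)) => [a|]; last by rewrite (substF1 inj).
  by rewrite (substFB inj) (substF_var inj) (substF_cst inj).
exact: evalF_subst.
Qed.

Lemma pull_hlam s c chi : valid c chi ->
  pullback (pvar s) (hlam (pc s c) (pchi s chi)) = (-1) ^+ s *: hlam c chi.
Proof.
move=> hv; have inj := @injev_pvar C k s.
rewrite /hlam (pullbackZ inj) subst_gfun pull_annis os_pc // pull_vol annisZ.
by rewrite fscaleA mulrC -fscaleA fscale_sign.
Qed.

Lemma pull_dX_sign s S : exists e : bool,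
  pullback (pvar s) (dX C (s @^-1: S)%SET) = (-1) ^+ e *: dX C S.
Proof.
have inj := @injev_pvar C k s.
have [N] := ubnP #|S|; elim: N S => // N IH S /ltnSE leS.
case: (set_0Vmem S) => [->|[i iS]].
  by exists false; rewrite preimset0 dX0 (pullback_form1 inj) scale1r.
have hi : s^-1%g i \in (s @^-1: S)%SET by rewrite inE permKV.
have [|e E] := IH (S :\ i)%SET; first by move: leS; rewrite (cardsD1 i) iS.
rewrite (dX_crea C hi).
have -> : (s @^-1: S :\ s^-1%g i = s @^-1: (S :\ i))%SET.
  by apply/setP => q; rewrite !inE (can2_eq (permK s) (permKV s)).
have [e1 ->] := sg_sign (s^-1%g i) (s @^-1: S)%SET.
rewrite (pullback_scale inj) pull_crea permKV E scaleE creaZ -scaleE.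
have [e2 E2] := sg_sign i S.
have -> : crea i (dX C (S :\ i)%SET) = (-1) ^+ e2 *: dX C S.
  by rewrite [in RHS](dX_crea C iS) -E2 fscaleA sg_sq fscale1.
by exists (e1 (+) (e (+) e2)); rewrite !scalerA !signr_addb mulrA.
Qed.

Lemma pull_lam_sign s chi : exists e : bool,
  pullback (pvar s) (lam (pchi s chi)) = (-1) ^+ e *: lam chi.
Proof.
have inj := @injev_pvar C k s; have [e E] := pull_dX_sign s (supp chi); exists e.
have -> : lam (pchi s chi) = fscale (gfun z (pchi s chi)) (dX C (s @^-1: supp chi)%SET).
  by congr (fscale _ (dX C _)); apply/setP => i; rewrite !inE ffunE.
by rewrite (pullbackZ inj) subst_gfun E !scaleE !fscaleA mulrC.
Qed.

Lemma sum_pchi s (V : zmodType) (G : {ffun 'I_k -> option 'I_n} -> V) :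
  \sum_chi G chi = \sum_chi G (pchi s chi).
Proof. exact: (reindex _ (onW_bij _ (pchi_bij s))). Qed.

Lemma perm_actE s (v : chains) c : perm_act s v c = pullback (pvar s) (v (pc s c)).
Proof. by rewrite ffunE. Qed.

Lemma comp_pcE s c : comp (pc s c) = comp c.
Proof.
apply/idP/idP; last exact: comp_pc.
move/(comp_pc s^-1%g); congr is_true; congr is_component.
by apply/ffunP => j; apply/setP => i; rewrite !in_pc permKV.
Qed.

Lemma tau_skew s A : perm_act s (tau A) = (-1) ^+ s *: tau A.
Proof.
apply/ffunP => c; rewrite perm_actE [in RHS]ffunE !ffunE comp_pcE.
have inj := @injev_pvar C k s.
case: ifP => hc; last by rewrite (pullback0 inj) scaler0.
rewrite (pullback_sum inj) (reindex _ (onW_bij _ (pchi_bij s))) scaler_sumr.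
apply: eq_big => [chi|chi]; first exact: valid_pc.
rewrite valid_pc => hv; rewrite (pullback_scale inj) pull_hlam // index_pc Kof_pc.
by rewrite !scalerA mulrC.
Qed.

End Structure.

Arguments tau {C n k} n0 m z A.

(** * Every skew-symmetric chain comes from coefficients *)

Section StructureTheorem.
Variables (C : numFieldType) (n k n0 : nat) (m : 'I_n -> nat) (z : 'I_n -> C).
Hypothesis z_inj : injective z.
Local Notation F := (ratfun C k).
Local Notation form := (ratform C k).
Local Notation t i := (varF C (i : 'I_k)).
Local Notation label := (label n k).
Local Notation chains := (chains C n k).
Implicit Types (i q : 'I_k) (r : seq 'I_k) (a b j : 'I_n) (S T U : {set 'I_k}) (eta theta : form) (f g : F) (c : label).
Implicit Types (chi : {ffun 'I_k -> option 'I_n}) (o : option 'I_n) (s : 'S_k) (v : chains).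
Local Notation comp := (is_component n0 m).
Local Notation lam := (lam z).
Local Notation hlam := (hlam z).
Local Notation vol := (vol C k).

Definition bk c i : option 'I_n := [pick j | i \in c j].

Lemma bkP c i j : comp c -> (bk c i == Some j) = (i \in c j).
Proof.
move=> hc; rewrite /bk; case: pickP => [j' ij'|h]; last by rewrite h.
apply/eqP/idP => [[<-] //|ij]; congr Some; exact: (comp_disj hc ij' ij).
Qed.
Lemma bkN c i : (bk c i == None) = free_coord c i.
Proof.
rewrite /bk; case: pickP => [j ij|h]; first by apply/esym/negP => /forallP/(_ j); rewrite ij.
by apply/esym/forallP => j; rewrite h.
Qed.

Lemma colok_in c chi i j : comp c -> colok c chi -> i \in c j -> chi i = None \/ chi i = Some j.
Proof.
move=> hc /forallP/(_ i) h ij; case: (chi i) h => [a|]; last by left.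
by rewrite (acol_in _ hc ij) => /eqP ->; right.
Qed.

Lemma fiber_count c chi y : comp c -> valid c chi -> y != (None, None) ->
  #|[set i | (bk c i, chi i) == y]|
  = match y with
    | (Some j, None) => (j \in index_set c : nat)
    | (Some j, Some a) => if (a == j) && (j \in index_set c) then m j else 0%N
    | (None, Some a) => Kof c chi a
    | _ => 0%N end.
Proof.
move=> hc hv; have [hcol /forallP h1 _] := and3P hv.
case: y => -[j|] [a|] // _.
- case: (altP (a =P j)) => [->|naj] /=; last first.
    apply: eq_card0 => i; rewrite !inE; apply/negP => /eqP [/eqP].
    rewrite bkP // => ij E; have [E'|E'] := colok_in hc hcol ij; rewrite E' in E => //.
    by case: E => E; rewrite E eqxx in naj.
  case: ifP => hj; last first.
    apply: eq_card0 => i; rewrite !inE; apply/negP => /eqP [/eqP].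
    by rewrite bkP // => /index_setE; rewrite hj.
  have nj : c j != set0 by move: hj; rewrite inE.
  have [_ cj] := comp_card hc nj; have /implyP/(_ hj)/eqP c1 := h1 j.
  set X := [set i | _]%SET; suff : (#|nset c chi (Some j)| + #|X| = #|c j|)%N by rewrite c1 cj add1n => -[].
  rewrite -cardsUI (_ : _ :&: _ = set0) ?cards0 ?addn0; last first.
    by apply/setP => i; rewrite !inE xpair_eqE; case: (chi i) => [b|]; rewrite ?andbF.
  congr #|pred_of_set _|; apply/setP => i; rewrite !inE xpair_eqE bkP //.
  case: (boolP (i \in c j)) => //= ij.
  by have [->|->] := colok_in hc hcol ij; rewrite eqxx ?orbT.
- case: (boolP (j \in index_set c)) => hj.
    have /implyP/(_ hj)/eqP c1 := h1 j; rewrite -[RHS]c1; congr #|pred_of_set _|.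
    by apply/setP => i; rewrite !inE xpair_eqE bkP.
  apply: eq_card0 => i; rewrite !inE; apply/negP => /eqP [/eqP].
  by rewrite bkP // => /index_setE; rewrite (negPf hj).
- rewrite mnmE; congr #|pred_of_set _|; apply/setP => i.
  by rewrite !inE xpair_eqE bkN.
Qed.

Lemma fiber_total (X : finType) (f : 'I_k -> X) (y0 : X) :
  #|[set i | f i == y0]| = (k - \sum_(y | y != y0) #|[set i | f i == y]|)%N.
Proof.
have E : k = \sum_y #|[set i | f i == y]|.
  rewrite -{1}(card_ord k) -sum1_card (partition_big f predT) //=.
  by apply: eq_bigr => y _; rewrite -sum1dep_card.
rewrite (bigD1 y0) //= in E.
by rewrite [X in (X - _)%N]E addnK.
Qed.

(** A valid colouring is determined up to permutation by J and K, since these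
    give the sizes of all classes of coordinates with the same block and colour. *)
Lemma valid_trans c c0 chi chi0 : comp c -> comp c0 -> valid c chi -> valid c0 chi0 ->
  index_set c = index_set c0 -> Kof c chi = Kof c0 chi0 ->
  exists s : 'S_k, pc s c = c0 /\ pchi s chi = chi0.
Proof.
move=> hc hc0 hv hv0 EJ EK.
have h y : y != (None, None) -> #|[set i | (bk c i, chi i) == y]| = #|[set i | (bk c0 i, chi0 i) == y]|.
  move=> ny; rewrite !fiber_count // EJ; case: y ny => [[j|] [a|]] //; by rewrite EK.
have [s hs] : exists s : 'S_k, forall i, (bk c (s i), chi (s i)) = (bk c0 i, chi0 i).
  apply: (@perm_of_fibers _ _ (fun i => (bk c i, chi i)) (fun i => (bk c0 i, chi0 i))) => y.
  case: (altP (y =P (None, None))) => [->|]; last exact: h.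
  rewrite (fiber_total (fun i => (bk c i, chi i))) (fiber_total (fun i => (bk c0 i, chi0 i))).
  by congr (k - _)%N; apply: eq_bigr.
exists s; split.
  apply/ffunP => j; apply/setP => i; rewrite in_pc -!bkP //.
  by have [-> _] := hs i.
by apply/ffunP => i; rewrite ffunE; have [_ ->] := hs i.
Qed.

Lemma scale_lam_inj chi (x y : C) : x *: lam chi = y *: lam chi -> x = y.
Proof.
move=> /eqP; rewrite -subr_eq0 -scalerBl scaler_eq0 => /orP[|/eqP E].
  by rewrite subr_eq0 => /eqP.
by case: (lam_neq0 z_inj E).
Qed.

Lemma tperm_cls_pc c i q : cls c i q -> pc (tperm i q) c = c.
Proof.
move=> /clsP h; apply/ffunP => j; apply/setP => l; rewrite in_pc.
by case: tpermP => [->|->|_ _]; rewrite ?h.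
Qed.

Section FixedChain.
Variables (v : chains) (co : label -> {ffun 'I_k -> option 'I_n} -> C).
Hypothesis hco : forall c, comp c -> v c = \sum_chi co c chi *: lam chi.
Hypothesis hcol : forall c chi, comp c -> co c chi != 0 -> colok c chi.
Hypothesis hskew : forall s, perm_act s v = (-1) ^+ s *: v.
Hypothesis heul : forall c j, comp c -> contr (eul z c j) (v c) = 0.

Lemma co_equiv s c chi (e : C) : comp c -> pullback (pvar s) (lam (pchi s chi)) = e *: lam chi ->
  co (pc s c) (pchi s chi) * e = (-1) ^+ s * co c chi.
Proof.
move=> hc he; have inj := @injev_pvar C k s.
have [E hE] := choice (fun x => pull_lam_sign z s x).
have := congr1 (fun u : chains => u c) (hskew s).
rewrite perm_actE [X in _ = X]ffunE hco ?comp_pc // hco // (sum_pchi s) (pullback_sum inj) scaler_sumr.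
under eq_bigr => x _ do rewrite (pullback_scale inj) hE scalerA.
under [RHS]eq_bigr => x _ do rewrite scalerA.
move=> /(lam_indep2 z_inj)/(_ chi) <-.
by congr (_ * _); apply: (@scale_lam_inj chi); rewrite -he hE.
Qed.

(** A transposition of two uncoloured coordinates of one class fixes the
    monomial, while skewness changes its sign. *)
Lemma co_twoNone c chi i q : comp c -> i != q -> cls c i q -> chi i = None -> chi q = None ->
  co c chi = 0.
Proof.
move=> hc niq iq hi hq.
have Ec := tperm_cls_pc iq.
have Echi : pchi (tperm i q) chi = chi.
  by apply/ffunP => l; rewrite ffunE; case: tpermP => [->|->|_ _]; rewrite ?hi ?hq.
have inj := @injev_pvar C k (tperm i q).
have Elam : pullback (pvar (tperm i q)) (lam (pchi (tperm i q) chi)) = 1 *: lam chi.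
  rewrite {1}/lam (pullbackZ inj) subst_gfun scale1r Echi pull_dX_fix // => l.
  by rewrite inE => nl; apply: tpermD; apply: contra nl => /eqP <-; rewrite ?hi ?hq.
have := co_equiv hc Elam; rewrite Ec Echi mulr1 odd_tperm niq expr1 mulN1r => /eqP.
by rewrite -addr_eq0 -mulr2n mulrn_eq0 /= => /eqP.
Qed.

Lemma contr_lam c j chi : comp c -> colok c chi ->
  contr (eul z c j) (lam chi) = \sum_(i in c j)
    (if chi i == Some j then fscale (sg C i (supp chi)) (lam (setc chi i None)) else 0).
Proof.
move=> hc hcl; rewrite /contr big_mkcond [RHS]big_mkcond; apply: eq_bigr => i _ /=.
rewrite /eul; case: ifP => ij; last by rewrite fscale0.
case: (altP (chi i =P Some j)) => [E|]; first exact: lam_anni.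
have [E|->] := colok_in hc hcl ij; last by rewrite eqxx.
by move=> _; rewrite lam_anniN // fscaler0.
Qed.

Lemma reindex_setc i j (V : zmodType) (G : {ffun 'I_k -> option 'I_n} -> V) :
  \sum_(chi : {ffun 'I_k -> option 'I_n} | chi i == Some j) G chi = \sum_(chi : {ffun 'I_k -> option 'I_n} | chi i == None) G (setc chi i (Some j)).
Proof.
rewrite (reindex_onto (fun x => setc x i (Some j)) (fun x => setc x i None)) /=; last first.
  by move=> chi /eqP E; apply/ffunP => q; rewrite !setcE; case: eqP => // ->.
apply: eq_bigl => chi; rewrite setcE eqxx eqxx /=; apply/eqP/eqP => [<-|E].
  by rewrite setcE eqxx.
by apply/ffunP => q; rewrite !setcE; case: eqP => // ->.
Qed.

(** If the block is completely coloured by j, the contraction with the Euler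
    field produces monomials that cannot cancel otherwise. *)
Lemma co_noNone c chi j : comp c -> j \in index_set c -> nset c chi (Some j) = set0 -> co c chi = 0.
Proof.
move=> hc hj hN; have [//|nz0] := eqVneq (co c chi) 0.
have hcl := hcol hc nz0; have [i0 ij0] : exists i, i \in c j by move: hj; rewrite inE => /set0Pn.
pose sgn (i : 'I_k) (x : {ffun 'I_k -> option 'I_n}) : C := (-1) ^+ below i (supp x).
have := heul j hc; rewrite hco // contr_sum.
have -> : \sum_x contr (eul z c j) (co c x *: lam x)
  = \sum_(i in c j) \sum_(x : {ffun 'I_k -> option 'I_n} | x i == Some j) (co c x * sgn i x) *: lam (setc x i None).
  under [RHS]eq_bigr => i _ do rewrite big_mkcond.
  rewrite [RHS]exchange_big; apply: eq_bigr => x _ /=.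
  rewrite scaleE contrZ -scaleE; have [->|nx] := eqVneq (co c x) 0.
    by rewrite scale0r big1 // => i _; rewrite mul0r scale0r if_same.
  rewrite contr_lam ?hcol // scaler_sumr; apply: eq_bigr => i _.
  case: ifP => _; last by rewrite scaler0.
  by rewrite /sg fscale_sign scalerA.
under eq_bigr => i _ do rewrite reindex_setc big_mkcond.
rewrite exchange_big /= => H.
have H2 : \sum_(x : {ffun 'I_k -> option 'I_n}) (\sum_(i in c j) (if x i == None then
     co c (setc x i (Some j)) * sgn i (setc x i (Some j)) else 0)) *: lam x = 0.
  rewrite -[RHS]H; apply: eq_bigr => x _; rewrite scaler_suml; apply: eq_bigr => i _.
  case: eqP => E; last by rewrite scale0r.
  congr (_ *: lam _); apply/ffunP => q; rewrite !setcE; case: eqP => // ->; by rewrite E.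
have := lam_indep z_inj H2 (setc chi i0 None).
rewrite (bigD1 i0) //= setcE eqxx big1 ?addr0 => [|i /andP[ij ni]]; last first.
  rewrite setcE (negPf ni); case: eqP => // E.
  by have : i \in nset c chi (Some j); [rewrite inE ij E|rewrite hN inE].
have -> : setc (setc chi i0 None) i0 (Some j) = chi.
  apply/ffunP => q; rewrite !setcE; case: eqP => // ->.
  have [E|-> //] := colok_in hc hcl ij0.
  by have : i0 \in nset c chi (Some j); [rewrite inE ij0 E|rewrite hN inE].
by move=> /eqP; rewrite mulf_eq0 signr_eq0 orbF => /eqP.
Qed.

Lemma co_valid c chi : comp c -> co c chi != 0 -> valid c chi.
Proof.
move=> hc nz0; apply/and3P; split; first exact: hcol.
  apply/forallP => j; apply/implyP => hj; rewrite eqn_leq; apply/andP; split.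
    rewrite leqNgt; apply/negP => /card_gt1P[x [y [xN yN nxy]]].
    move: (nz0); rewrite (co_twoNone hc nxy) ?eqxx ?(mem_nset xN) ?(mem_nset yN) //.
    by move: xN yN; rewrite !inE => /andP[xj _] /andP[yj _]; rewrite (cls_in _ hc xj).
  rewrite lt0n cards_eq0; apply: contra nz0 => /eqP h; apply/eqP.
  exact: co_noNone hj h.
rewrite leqNgt; apply/negP => /card_gt1P[x [y [xN yN nxy]]].
move: (nz0); rewrite (co_twoNone hc nxy) ?eqxx ?(mem_nset xN) ?(mem_nset yN) //.
by move: xN yN; rewrite !inE => /andP[xj _] /andP[yj _]; rewrite cls_free.
Qed.

Lemma chain_tau : (forall c, ~~ comp c -> v c = 0) -> exists A, v = tau n0 m z A.
Proof.
move=> hnc.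
have he' c : exists e : {ffun 'I_k -> option 'I_n} -> bool,
    forall chi, comp c -> hlam c chi = (-1) ^+ e chi *: lam chi.
  case: (boolP (comp c)) => hc; last by exists (fun _ => false).
  by have [e he] := choice (fun chi => hlam_lam z chi hc); exists e => chi _.
have [e he] := choice he'.
pose ah c chi : C := (-1) ^+ e c chi * co c chi.
have lamE c chi : comp c -> lam chi = (-1) ^+ e c chi *: hlam c chi.
  by move=> hc; rewrite he // scalerA -expr2 sqrr_sign scale1r.
have ahE s c chi : comp c -> valid c chi -> ah (pc s c) (pchi s chi) = ah c chi.
  move=> hc hv; have hc' := comp_pc s hc.
  have [E hE] := pull_lam_sign z s chi.
  have H1 := co_equiv hc hE.
  have := pull_hlam z s hv; rewrite he // he // (pullback_scale (@injev_pvar C k s)) hE !scalerA.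
  move/scale_lam_inj => H2; rewrite /ah.
  have s2 (b : bool) : (-1) ^+ b * (-1) ^+ b = 1 :> C by rewrite -expr2 sqrr_sign.
  have -> : co (pc s c) (pchi s chi) = (-1) ^+ s * co c chi * (-1) ^+ E.
    by rewrite -H1 -mulrA s2 mulr1.
  have R1 (x y u w : C) : x * (y * u * w) = x * w * (y * u) by ring.
  have R2 (x y u : C) : x * y * (x * u) = x * x * (y * u) by ring.
  rewrite R1 H2 R2.
  by rewrite s2 mul1r.
pose P J K (p : label * {ffun 'I_k -> option 'I_n}) :=
  [&& comp p.1, valid p.1 p.2, index_set p.1 == J & Kof p.1 p.2 == K].
exists (fun J K => if [pick p | P J K p] is Some p then ah p.1 p.2 else 0).
apply/ffunP => c; rewrite [RHS]ffunE; case: ifP => hc; last by apply: hnc; rewrite hc.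
rewrite hco // (bigID (valid c)) /= [X in _ + X]big1 ?addr0; last first.
  move=> chi nv; have [->|nz0] := eqVneq (co c chi) 0; first by rewrite scale0r.
  by rewrite (co_valid hc nz0) in nv.
apply: eq_bigr => chi hv; rewrite (lamE c) // scalerA; congr (_ *: _).
case: pickP => [p /and4P[hc' hv' /eqP EJ /eqP EK]|/(_ (c, chi))]; last by rewrite /P /= hc hv !eqxx.
have [s [<- <-]] := valid_trans hc hc' hv hv' (esym EJ) (esym EK).
by rewrite ahE // /ah mulrC.
Qed.

End FixedChain.

Lemma aomoto_log (l : int) v c : aomoto n0 m z l v -> comp c ->
  v c = 0 \/ exists d : nat, l - (2 * #|index_set c|)%:Z = d%:Z /\ log_algebra z c d (v c).
Proof.
move=> /(_ c) h hc; rewrite hc in h; case: (l - _) h => d h; last by left.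
by right; exists d.
Qed.

Theorem skew_tau (l : int) v : aomoto_skew n0 m z l v -> exists A, v = tau n0 m z A.
Proof.
move=> [hl hs].
have H c : exists co : {ffun 'I_k -> option 'I_n} -> C, comp c ->
    v c = \sum_chi co chi *: lam chi /\ forall chi, co chi != 0 -> colok c chi.
  case: (boolP (comp c)) => hc; last by exists (fun _ => 0).
  have L : lspan z (cls c) (acol c) [set: 'I_k]%SET (v c).
    case: (aomoto_log hl hc) => [->|[d [_ /log_gspan /(gspan_lspan hc)]]] //; exact: lspan0.
  have [|co [E hco]] := skew_lspan z_inj (@cls_refl _ _ c) (@cls_sym _ _ c) (@cls_trans _ _ c) (@acol_cls _ _ c) L.
    move=> i q _ _ niq iq; have := congr1 (fun u : chains => u c) (hs (tperm i q)).
    rewrite perm_actE (tperm_cls_pc iq) odd_tperm niq expr1 => ->.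
    by rewrite ffunE scaleN1r.
  exists co => _; split=> // chi nz0; apply/forallP => i.
  by case E' : (chi i) => [a|//]; have [_] := hco chi nz0 i a E'.
have [co hco] := choice H.
apply: (@chain_tau v co) => //.
- by move=> c hc; have [] := hco c hc.
- by move=> c chi hc; have [_] := hco c hc; apply.
- move=> c j hc; case: (aomoto_log hl hc) => [->|[d [_ /log_gspan h]]]; first exact: contr0.
  exact: (gspan_eul j hc h).
- by move=> c hc; have := hl c; rewrite (negPf hc).
Qed.

End StructureTheorem.

(** * Counting permutations between two colourings *)

Section CountPermutations.
Import fingroup.fingroup action.
Variables (k : nat) (X : finType).
Implicit Types (f g : 'I_k -> X) (s : 'S_k) (Y : {set X}).

Definition fiber f y : {set 'I_k} := [set i | f i == y].

Definition pres f (Y : {set X}) : {set 'S_k} :=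
  [set s : 'S_k | [forall i, (f (s i) == f i) && ((f i \notin Y) ==> (s i == i))]].

Lemma presP f Y s : reflect (forall i, f (s i) = f i /\ (f i \notin Y -> s i = i)) (s \in pres f Y).
Proof.
rewrite inE; apply: (iffP forallP) => h i.
  by have /andP[/eqP -> /implyP h2] := h i; split=> // /h2/eqP.
by have [-> h2] := h i; rewrite eqxx; apply/implyP => /h2 ->.
Qed.

(** Splits off the restriction of the permutation to the fibre over y, an
    arbitrary permutation of that fibre. *)
Lemma card_presU f (Y : {set X}) y : y \notin Y ->
  #|pres f (y |: Y)%SET| = (#|pres f Y| * (#|fiber f y|)`!)%N.
Proof.
move=> ny; pose B : {set 'S_k} := [set s : 'S_k | perm_on (fiber f y) s].
have -> : (#|fiber f y|)`! = #|B| by rewrite -card_perm cardsE.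
have Bp s : (s \in B) = perm_on (fiber f y) s by rewrite in_set.
pose mul (p : 'S_k * 'S_k) : 'S_k := (p.1 * p.2)%g.
have hB s i : s \in B -> f i != y -> s i = i.
  by rewrite Bp => hs nf; apply: (out_perm hs); rewrite inE.
have hB2 s i : s \in B -> f i = y -> f (s i) = y.
  rewrite Bp => hs fi; apply/eqP; have : s i \in fiber f y by rewrite (perm_closed _ hs) inE fi.
  by rewrite inE.
rewrite -cardsX -(@card_in_imset _ _ mul); last first.
  move=> [s1 s2] [u1 u2]; rewrite !in_setX /= => /andP[/presP h1 h2] /andP[/presP g1 g2] E.
  have E' i : s2 (s1 i) = u2 (u1 i) by have := congr1 (fun s : 'S_k => s i) E; rewrite !permM.
  have Es2 : s2 = u2.
    apply/permP => i; case: (altP (f i =P y)) => fi; last by rewrite hB // hB.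
    have := E' i; have [_ ->] := h1 i; last by rewrite fi.
    by have [_ ->] := g1 i; last by rewrite fi.
  by rewrite Es2; congr pair; apply/permP => i; apply: (@perm_inj _ u2); rewrite -{1}Es2.
apply/eq_card => s; apply/idP/imsetP => [/presP h|[[s1 s2]]].
  have hN : s \in 'N(fiber f y | 'P)%g.
    apply/astabsP => i; rewrite /= apermE !inE; by have [-> _] := h i.
  exists ((s * (restr_perm (fiber f y) s)^-1)%g, restr_perm (fiber f y) s); last by rewrite /mul mulgKV.
  have hr : restr_perm (fiber f y) s \in B by rewrite Bp; exact: restr_perm_on.
  rewrite in_setX hr andbT; apply/presP => i /=; rewrite permM.
  have [h1 h2] := h i; case: (altP (f i =P y)) => fi.
    have -> : s i = restr_perm (fiber f y) s i by rewrite restr_permE // inE fi.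
    by rewrite permK; split.
  have -> : (restr_perm (fiber f y) s)^-1%g (s i) = s i.
    have E := hB _ (s i) hr; rewrite h1 in E.
    by apply: (@perm_inj _ (restr_perm (fiber f y) s)); rewrite permKV E.
  split=> // fY; apply: h2.
  by rewrite !inE negb_or fi.
rewrite in_setX /= => /andP[/presP h1 h2] ->; apply/presP => i.
rewrite /mul permM /=; have [e1 e2] := h1 i.
case: (altP (f i =P y)) => fi.
  by rewrite e2 ?fi // hB2 //; split=> //; rewrite !inE eqxx.
rewrite hB ?e1 //; split=> //; rewrite !inE negb_or => /andP[_]; exact: e2.
Qed.

Lemma card_pres f : #|[set s : 'S_k | [forall i, f (s i) == f i]]| = (\prod_y (#|fiber f y|)`!)%N.
Proof.
transitivity #|pres f [set: X]|.
  apply: eq_card => s; rewrite inE; apply/forallP/presP => h i; last by have [-> _] := h i.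
  by split; [apply/eqP|rewrite inE].
rewrite -(big_mkcond predT) /=.
have : forall Y : {set X}, #|pres f Y| = (\prod_(y in Y) (#|fiber f y|)`!)%N.
  move=> Y; have [N] := ubnP #|Y|; elim: N Y => // N IH Y /ltnSE leY.
  case: (set_0Vmem Y) => [->|[y yY]].
    rewrite big_set0 (_ : pres f set0 = [set 1%g]) ?cards1 //; apply/setP => s; rewrite !inE.
    apply/idP/eqP => [|->]; last by apply/forallP => i; rewrite perm1 !eqxx implybT.
    move=> /forallP h; apply/permP => i; rewrite perm1.
    by have /andP[_ /implyP] := h i; rewrite inE => /(_ isT)/eqP.
  rewrite -(setD1K yY) card_presU ?inE ?eqxx // big_setU1 ?inE ?eqxx //= IH 1?mulnC //.
  by move: leY; rewrite (cardsD1 y) yY.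
by move=> ->; apply: eq_bigl => y; rewrite inE.
Qed.

(** The transporter is a coset of the stabilizer, which is a product of
    symmetric groups. *)
Lemma card_transporter f g : (forall y, #|fiber f y| = #|fiber g y|) ->
  #|[set s : 'S_k | [forall i, f (s i) == g i]]| = (\prod_y (#|fiber g y|)`!)%N.
Proof.
move=> h; have [s0 hs0] := @perm_of_fibers X k f g h.
rewrite -card_pres -[RHS](card_imset _ (mulIg s0)).
apply/eq_card => s; rewrite inE; apply/forallP/imsetP => [hs|[u]].
  exists (s * s0^-1)%g; last by rewrite mulgKV.
  rewrite inE; apply/forallP => i; rewrite -hs0 permM permKV; exact: hs.
by rewrite inE => /forallP hu -> i; rewrite permM hs0.
Qed.
End CountPermutations.

(** * Products over intervals of coordinates *)

Section Ranges.
Variables (C : fieldType) (k : nat).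
Local Notation form := (ratform C k).

Lemma big_enum_ord (N : nat) (A : {set 'I_N}) (w : 'I_N -> form) :
  \big[@wedge C k/form1 C k]_(i <- enum A) w i = \big[@wedge C k/form1 C k]_(i in A) w i.
Proof.
have -> : enum A = [seq i <- enum 'I_N | i \in A] by rewrite enumT.
by rewrite index_enum_ordE big_filter.
Qed.

Definition rng (N : nat) (lo hi : nat) (w : 'I_N -> form) : form :=
  \big[@wedge C k/form1 C k]_(i < N | (lo <= i < hi)%N) w i.

Lemma big_range_cat (N lo mid hi : nat) (w : 'I_N -> form) (r : seq 'I_N) :
  (lo <= mid <= hi)%N -> sorted (fun i q : 'I_N => i < q)%N r ->
  wedge (\big[@wedge C k/form1 C k]_(i <- r | (lo <= i < mid)%N) w i)
        (\big[@wedge C k/form1 C k]_(i <- r | (mid <= i < hi)%N) w i)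
  = \big[@wedge C k/form1 C k]_(i <- r | (lo <= i < hi)%N) w i.
Proof.
move=> /andP[lm mh]; elim: r => [|x r IH] hs; first by rewrite !big_nil wedge1l.
have hx : {in r, forall y : 'I_N, (x < y)%N}.
  by apply/allP; apply: (order_path_min _ hs) => a b c; apply: ltn_trans.
have {IH} := IH (path_sorted hs); rewrite !big_cons => IH.
case: (leqP mid x) => hm.
  rewrite andbF /= [X in wedge X]big1_seq ?wedge1l; last first.
    by move=> y /andP[/andP[_ ym] /hx xy]; move: (ltn_trans (leq_ltn_trans hm xy) ym); rewrite ltnn.
  rewrite (leq_trans lm hm) /=; case: ifP => _; last first.
    rewrite -IH [X in wedge X _]big1_seq ?wedge1l //.
    by move=> y /andP[/andP[_ ym] /hx xy]; move: (ltn_trans (leq_ltn_trans hm xy) ym); rewrite ltnn.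
  congr wedge; rewrite -IH [X in wedge X _]big1_seq ?wedge1l //.
  by move=> y /andP[/andP[_ ym] /hx xy]; move: (ltn_trans (leq_ltn_trans hm xy) ym); rewrite ltnn.
rewrite andbT /= (leq_trans hm mh) andbT; case: ifP => // _.
by rewrite -wedgeA IH.
Qed.

Lemma rng_cat (N lo mid hi : nat) (w : 'I_N -> form) : (lo <= mid <= hi)%N ->
  wedge (rng lo mid w) (rng mid hi w) = rng lo hi w.
Proof.
by move=> h; rewrite /rng index_enum_ordE; apply: big_range_cat => //; exact: sorted_enum_ord.
Qed.

Lemma rng_empty (N lo hi : nat) (w : 'I_N -> form) : (hi <= lo)%N -> rng lo hi w = form1 C k.
Proof.
move=> h; rewrite /rng big_pred0 // => i; apply/negP => /andP[h1 h2].
by move: (leq_ltn_trans h1 h2); rewrite ltnNge h.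
Qed.

Definition psum (n : nat) (len : 'I_n -> nat) (p : nat) : nat := (\sum_(b < n | (b < p)%N) len b)%N.

Lemma psumS n (len : 'I_n -> nat) (a : 'I_n) : psum len a.+1 = (psum len a + len a)%N.
Proof.
rewrite /psum (bigD1 a) //= addnC; congr (_ + _)%N; apply: eq_bigl => b.
by rewrite ltnS ltn_neqAle -val_eqE andbC.
Qed.
Lemma psum_mono n (len : 'I_n -> nat) p p' : (p <= p')%N -> (psum len p <= psum len p')%N.
Proof.
move=> h; rewrite /psum big_mkcond [X in (_ <= X)%N]big_mkcond; apply: leq_sum => b _.
by case: ifP => // bp; rewrite (leq_trans bp h).
Qed.
Lemma psum_full n (len : 'I_n -> nat) : psum len n = (\sum_b len b)%N.
Proof. by rewrite /psum; apply: eq_bigl => b; rewrite ltn_ord. Qed.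

(** An interval cut into consecutive blocks. *)
Lemma rng_blocks (N n s : nat) (len : 'I_n -> nat) (w : 'I_N -> form) :
  \big[@wedge C k/form1 C k]_(a < n) rng (s + psum len a) (s + psum len a + len a) w
  = rng s (s + \sum_(a < n) len a)%N w.
Proof.
pose G (a : 'I_n) := rng (s + psum len a) (s + psum len a + len a) w; 
suff H p : (p <= n)%N -> rng 0 p G = rng s (s + psum len p) w.
  by rewrite -psum_full -H // /rng; apply: eq_bigl => a; rewrite ltn_ord.
elim: p => [_|p IH hp].
  rewrite rng_empty // rng_empty // /psum big_pred0 ?addn0 //.
rewrite -(@rng_cat _ 0 p p.+1) ?leqnSn // IH 1?ltnW //.
have -> : rng p p.+1 G = G (Ordinal hp).
  rewrite /rng (big_pred1 (Ordinal hp)) // => a.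
  rewrite ltnS -eqn_leq eq_sym /=; apply/eqP/eqP => [h|->] //; exact: val_inj.
rewrite /G (psumS len (Ordinal hp)) /= addnA; apply: rng_cat.
by rewrite leq_addr leq_addr.
Qed.

Lemma card_range (lo len : nat) : (lo + len <= k)%N -> #|[set i : 'I_k | (lo <= i < lo + len)%N]| = len.
Proof.
elim: len => [|len IH] h.
  by apply: eq_card0 => i; rewrite !inE addn0; case: leqP.
have hk : (lo + len < k)%N by rewrite -addnS.
have -> : [set i : 'I_k | (lo <= i < lo + len.+1)%N]
  = (Ordinal hk |: [set i : 'I_k | (lo <= i < lo + len)%N])%SET.
  by apply/setP => i; rewrite !inE -val_eqE /=; apply/idP/idP; lia.
by rewrite cardsU1 inE /= ltnn andbF add1n IH // ltnW.
Qed.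

End Ranges.

Section ContractedProducts.
Variables (C : fieldType) (k : nat).
Local Notation F := (ratfun C k).
Local Notation form := (ratform C k).
Implicit Types (i q : 'I_k) (eta theta : form) (v : 'I_k -> F).

(** If v takes the value 1 on w and u, then multiplying by w and contracting
    replaces u by u - w. Iterating it turns the contraction of a product of
    1-forms into the product of their differences with the first one. *)
Lemma contr_shift v w u eta : is_oneform w -> is_oneform u -> ev1 v w = 1 -> ev1 v u = 1 ->
  contr v (wedge w (wedge u eta)) = wedge (u - w) (contr v (wedge w eta)).
Proof.
move=> hw hu vw vu; rewrite !contr_wedge // vw vu !fscale1 !(wedgeDr, wedgeDl, wedgeNr, wedgeNl).
by rewrite (wedge_sq _ hw) (wedge_anti _ hu hw) !opprK ?oppr0 addr0 opprD opprK addrA.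
Qed.

Lemma contr_wedge_closed v eta theta : contr v theta = 0 ->
  contr v (wedge eta theta) = wedge (contr v eta) theta.
Proof.
move=> h0; elim/form_ind: eta => [|a a' Ha Ha'|f a Ha||i a Ha].
- by rewrite wedge0l !contr0 wedge0l.
- by rewrite wedgeDl !contrD Ha Ha' wedgeDl.
- by rewrite wedgeZl !contrZ Ha wedgeZl.
- by rewrite wedge1l h0 contr_form1 wedge0l.
rewrite wedge_crea -[crea i (wedge a theta)]wedge_dvar -[crea i a]wedge_dvar.
rewrite (contr_wedge _ (wedge a theta) (dform_is _)) Ha (contr_wedge _ a (dform_is _)).
by rewrite wedgeDl wedgeZl wedgeNl -wedgeA.
Qed.

Lemma contr_big_closed v (I : eqType) (r : seq I) (P : pred I) (w : I -> form) eta :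
  (forall x, x \in r -> P x -> is_oneform (w x) /\ ev1 v (w x) = 0) ->
  contr v (wedge (\big[@wedge C k/form1 C k]_(x <- r | P x) w x) eta)
  = (-1) ^+ count P r *: wedge (\big[@wedge C k/form1 C k]_(x <- r | P x) w x) (contr v eta).
Proof.
elim: r => [|x r IH] h; first by rewrite big_nil !wedge1l expr0 scale1r.
have {IH} := IH (fun y hy => h y (mem_behead (s := x :: r) hy)); rewrite big_cons /= => IH.
case: ifP => Px; last by rewrite IH.
have [h1 h2] := h x (mem_head x r) Px.
rewrite -!wedgeA contr_wedge // h2 fscale0 sub0r IH !scaleE wedgeZr -!scaleE.
by rewrite exprS mulN1r scaleNr.
Qed.

Lemma contr_big_shift v (I : eqType) (r : seq I) (w : I -> form) (x : I) :
  (forall y, y \in x :: r -> is_oneform (w y) /\ ev1 v (w y) = 1) ->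
  contr v (\big[@wedge C k/form1 C k]_(y <- x :: r) w y)
  = \big[@wedge C k/form1 C k]_(y <- r) (w y - w x).
Proof.
rewrite big_cons; elim: r => [|y r IH] h; have [hx vx] := h x (mem_head _ _).
  by rewrite !big_nil contr_wedge // vx fscale1 contr_form1 wedge0r subr0.
have [hy vy] : is_oneform (w y) /\ ev1 v (w y) = 1 by apply: h; rewrite !inE eqxx orbT.
rewrite !big_cons contr_shift // IH // => u; rewrite inE => hu; apply: h.
by rewrite !inE; case/orP: hu => ->; rewrite ?orbT.
Qed.

Lemma prodform_scaled (f : 'I_k -> F) S :
  prodform (fun i => fscale (f i) (crea i (form1 C k))) S = fscale (\prod_(i in S) f i) (dX C S).
Proof.
have hw i : is_oneform (fscale (f i) (crea i (form1 C k))).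
  by apply: is_oneformZ; rewrite -dform_var; exact: dform_is.
have [N] := ubnP #|S|; elim: N S => // N IH S /ltnSE leS.
case: (set_0Vmem S) => [->|[i iS]]; first by rewrite prodform0 big_set0 fscale1 dX0.
rewrite (prodformD1 hw iS) IH; last by move: leS; rewrite (cardsD1 i) iS.
rewrite wedgeZl wedgeZr wedge_crea wedge1l (dX_crea C iS) !fscaleA (big_setD1 i iS) /=.
congr fscale; ring.
Qed.

End ContractedProducts.

(** * Consecutive intervals and the standard component *)

Section Blocks.
Variables (n : nat) (len : 'I_n -> nat).
Implicit Types (a b : 'I_n).

Lemma psum_find x : (x < \sum_a len a)%N -> exists a, (psum len a <= x < psum len a + len a)%N.
Proof.
rewrite -psum_full => hx; have ex : exists p, (x < psum len p)%N by exists n.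
have [p hp hmin] := ex_minnP ex.
have p0 : (0 < p)%N by case: p hp {hmin} => //; rewrite /psum big_pred0.
have pn : (p <= n)%N by apply: hmin.
have hq : (p.-1 < n)%N by rewrite prednK.
exists (Ordinal hq); rewrite -psumS /= prednK // hp andbT leqNgt; apply/negP => /hmin.
by rewrite -ltnS prednK // ltnn.
Qed.

Lemma psum_uniq x a b : (psum len a <= x < psum len a + len a)%N ->
  (psum len b <= x < psum len b + len b)%N -> a = b.
Proof.
rewrite -!psumS => /andP[a1 a2] /andP[b1 b2]; apply/val_inj/eqP; rewrite eqn_leq.
apply/andP; split; rewrite leqNgt; apply/negP => h.
  by have := leq_ltn_trans (leq_trans (psum_mono len h) a1) b2; rewrite ltnn.
by have := leq_ltn_trans (leq_trans (psum_mono len h) b1) a2; rewrite ltnn.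
Qed.

Lemma psum_le a : (psum len a + len a <= \sum_b len b)%N.
Proof. by rewrite -psumS -psum_full; apply: psum_mono. Qed.

Definition find_block (x : nat) : option 'I_n := [pick a : 'I_n | (psum len a <= x < psum len a + len a)%N].

Lemma find_blockP x a : (find_block x == Some a) = (psum len a <= x < psum len a + len a)%N.
Proof.
rewrite /find_block; case: pickP => [b hb|h]; last by rewrite h.
by apply/eqP/idP => [[<-] //|ha]; congr Some; apply: psum_uniq hb ha.
Qed.

Lemma find_blockN x : (find_block x == None) = (\sum_a len a <= x)%N.
Proof.
rewrite /find_block; case: pickP => [b /andP[_ hb]|h].
  by apply/esym/negP => h; have := leq_trans (leq_trans hb (psum_le b)) h; rewrite ltnn.
by apply/esym; rewrite leqNgt; apply/negP => /psum_find[a]; rewrite h.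
Qed.
End Blocks.

Section Geometry.
Variables (n k n0 : nat) (m : 'I_n -> nat) (J : {set 'I_n}).
Local Notation label := (label n k).
Implicit Types (i : 'I_k) (j a : 'I_n).
Hypothesis hJ : forall j, j \in J -> (j < n0)%N.
Hypothesis hs : (s_of m J <= k)%N.

Definition blen j : nat := if j \in J then (m j).+1 else 0%N.

Lemma s_ofE : s_of m J = (\sum_j blen j)%N.
Proof. by rewrite /s_of big_mkcond. Qed.

Lemma in_I0 i j : (i \in I0 k m J j) = (psum blen j <= i < psum blen j + blen j)%N.
Proof.
rewrite ffunE /blen; case: ifP => jJ; last by rewrite inE addn0; case: leqP.
by rewrite inE /psum big_mkcondl.
Qed.

Lemma bk_I0 i j : i \in I0 k m J j = (find_block blen i == Some j).
Proof. by rewrite in_I0 find_blockP. Qed.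

Lemma card_I0 j : #|I0 k m J j| = blen j.
Proof.
rewrite -(@card_range k (psum blen j) (blen j)); last first.
  by apply: leq_trans (psum_le _ _) _; rewrite -s_ofE.
by congr #|pred_of_set _|; apply/setP => i; rewrite in_I0 inE.
Qed.

Lemma index_I0 : index_set (I0 k m J) = J.
Proof.
apply/setP => j; rewrite inE -cards_eq0 card_I0 /blen.
by case: ifP.
Qed.

Lemma comp_I0 : is_component n0 m (I0 k m J).
Proof.
apply/andP; split; apply/forallP => j.
  apply/implyP; rewrite -cards_eq0 card_I0 /blen; case: ifP => // jJ _.
  by rewrite hJ //=.
apply/forallP => j'; apply/implyP => nj; rewrite disjoint_subset; apply/subsetP => i.
rewrite !inE !in_I0 => h; apply: contra nj => h'.
by apply/eqP; apply: psum_uniq h h'.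
Qed.

Lemma free_I0 i : free_coord (I0 k m J) i = (s_of m J <= i)%N.
Proof.
rewrite s_ofE -find_blockN; apply/forallP/eqP => [h|h j].
  case E : (find_block blen i) => [j|//].
  by have := h j; rewrite bk_I0 E eqxx.
by rewrite bk_I0 h.
Qed.

Variable K : 'X_{1..n}.

(** The colouring of theta before contraction: the blocks of J, then K_1
    coordinates of colour 1, and so on. At most the last coordinate is left
    uncoloured. *)
Definition chifull : {ffun 'I_k -> option 'I_n} :=
  [ffun i : 'I_k => if (i < s_of m J)%N then find_block blen i else find_block K (i - s_of m J)].

Lemma chifull_in i j : i \in I0 k m J j -> chifull i = Some j.
Proof.
rewrite in_I0 => h; rewrite ffunE ifT; first by apply/eqP; rewrite find_blockP.
by rewrite s_ofE; case/andP: h => _ h; apply: leq_trans h (psum_le _ _).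
Qed.

Lemma chifull_free i a : free_coord (I0 k m J) i ->
  (chifull i == Some a) = (s_of m J + psum K a <= i < s_of m J + psum K a + K a)%N.
Proof.
rewrite free_I0 => h; rewrite ffunE ifN -?leqNgt // find_blockP.
by rewrite leq_subRL // -addnA ltn_subLR // addnA.
Qed.

Lemma chifull_None i : (chifull i == None) = (s_of m J + mdeg K <= i)%N.
Proof.
rewrite ffunE mdegE; case: ltnP => h.
  have [j /eqP ->] : exists j, find_block blen i == Some j.
    rewrite s_ofE in h; have [j hj] := psum_find h; exists j; by rewrite find_blockP.
  by apply/esym/negP => h'; have := leq_ltn_trans (leq_trans (leq_addr _ _) h') h; rewrite ltnn.
by rewrite find_blockN leq_subRL.
Qed.

Lemma chifull_rng i a :
  (s_of m J + psum K a <= i < s_of m J + psum K a + K a)%N -> chifull i = Some a.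
Proof.
move=> h; apply/eqP; rewrite chifull_free // free_I0.
by case/andP: h => h _; apply: leq_trans h; apply: leq_addr.
Qed.

End Geometry.

(** * The form theta as an iterated contraction *)

Section Theta.
Variables (C : numFieldType) (n k n0 : nat) (m : 'I_n -> nat) (z : 'I_n -> C) (J : {set 'I_n}) (K : 'X_{1..n}).
Local Notation F := (ratfun C k).
Local Notation form := (ratform C k).
Local Notation t i := (varF C (i : 'I_k)).
Local Notation label := (label n k).
Implicit Types (i q : 'I_k) (a b j : 'I_n) (eta theta : form) (js : seq 'I_n).
Implicit Types (chi : {ffun 'I_k -> option 'I_n}).
Hypothesis hJ : forall j, j \in J -> (j < n0)%N.
Hypothesis hs : (s_of m J <= k)%N.
Local Notation c0 := (I0 k m J).
Local Notation chif := (chifull k m J K).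
Local Notation "\wedge_ ( i <- r | P ) E" := (\big[@wedge C k/form1 C k]_(i <- r | P) E)
  (at level 41, i, r, P at level 50).
Local Notation "\wedge_ ( i <- r ) E" := (\big[@wedge C k/form1 C k]_(i <- r) E)
  (at level 41, i, r at level 50).
Local Notation "\wedge_ ( i 'in' A ) E" := (\big[@wedge C k/form1 C k]_(i in A) E)
  (at level 41, i, A at level 50).

Let hc0 : is_component n0 m c0 := comp_I0 hJ hs.

Definition wc chi i : form := if chi i is Some a then wf z i a else form1 C k.

Lemma lam_prod chi : lam z chi = \wedge_(i in supp chi) wc chi i.
Proof.
have -> : lam z chi = fscale (\prod_(i in supp chi) (den z chi i)^-1) (dX C (supp chi)).
  rewrite /lam /gfun (bigID (mem (supp chi))) /= [X in _ * X]big1 ?mulr1 // => i.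
  by rewrite inE negbK /den => /eqP ->; rewrite invr1.
rewrite -prodform_scaled; apply: eq_bigr => i; rewrite inE /wc /den.
by case: (chi i) => // a _; rewrite -[wf z i a]wedge1r wedge_wf.
Qed.

Definition Wj j : form := \wedge_(i in c0 j) wf z i j.

Lemma Wj_rng j : j \in J -> Wj j = rng (0 + psum (blen m J) j) (0 + psum (blen m J) j + blen m J j) (wc chif).
Proof.
move=> jJ; rewrite /Wj /rng; apply: eq_big => i; first by rewrite in_I0 add0n.
by move=> ij; rewrite /wc (chifull_in _ ij).
Qed.

Definition Hform : form := \big[@wedge C k/form1 C k]_(a < n) eta_form k m z J K a.

Lemma eta_rng a : eta_form k m z J K a
  = rng (s_of m J + psum K a) (s_of m J + psum K a + K a) (wc chif).
Proof.
rewrite /eta_form /rng; apply: eq_bigr => i hi.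
by rewrite /wc (chifull_rng hi).
Qed.

Lemma lam_chifull : lam z chif = wedge (\wedge_(j in J) Wj j) Hform.
Proof.
rewrite lam_prod; have -> : \wedge_(j in J) Wj j = rng 0 (s_of m J) (wc chif).
  rewrite s_ofE -(rng_blocks 0 (blen m J) (wc chif)) big_mkcond; apply: eq_bigr => j _.
  case: ifP => jJ; first exact: Wj_rng.
  by rewrite rng_empty // /blen jJ addn0.
have -> : Hform = rng (s_of m J) (s_of m J + mdeg K) (wc chif).
  by rewrite mdegE -rng_blocks; apply: eq_bigr => a _; rewrite eta_rng.
rewrite rng_cat ?leq_addr //; apply: eq_bigl => i.
by rewrite inE chifull_None -ltnNge.
Qed.

Local Notation eulJ := (eul z c0).

Lemma ev1_eul_in i j : i \in c0 j -> ev1 (eulJ j) (wf z i j) = 1.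
Proof. by move=> h; rewrite ev1_wf /eul h divff_nz // nz_var_cst. Qed.
Lemma ev1_eul_out i j a : i \notin c0 j -> ev1 (eulJ j) (wf z i a) = 0.
Proof. by move=> h; rewrite ev1_wf /eul (negPf h) mul0r. Qed.

Definition Mj j : form := mu_form z j (c0 j).

(** The differences dlog u_i = dlog(t_i - z_j) - dlog(t_(i_0) - z_j) come from
    contracting with the Euler field of the block. *)
Lemma Mj_contr j : j \in J -> Mj j = contr (eulJ j) (Wj j).
Proof.
move=> jJ; rewrite /Mj /mu_form /Wj -big_enum_ord.
have h i : i \in enum (c0 j) -> is_oneform (wf z i j) /\ ev1 (eulJ j) (wf z i j) = 1.
  by rewrite mem_enum => ij; split; [exact: wf_is|exact: ev1_eul_in].
have hb i : i \in c0 j -> base (c0 j) i = head i (enum (c0 j)) by [].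
have hm i : (i \in enum (c0 j)) = (i \in c0 j) by rewrite mem_enum.
case: (enum (c0 j)) h hb hm => [|b r] h hb hm.
  have : #|c0 j| = 0%N by apply: eq_card0 => i; rewrite -hm.
  by rewrite (card_I0 hs) /blen jJ.
rewrite contr_big_shift //= [in LHS]big_seq [RHS]big_seq; apply: eq_bigr => i ir.
by rewrite dlog_ucoord hb // -hm inE ir orbT.
Qed.

Lemma Wj_closed j j' eta : j != j' ->
  contr (eulJ j) (wedge (Wj j') eta) = (-1) ^+ #|c0 j'| *: wedge (Wj j') (contr (eulJ j) eta).
Proof.
move=> njj; rewrite /Wj -big_enum_ord contr_big_closed ?count_predT -?cardE // => i.
rewrite mem_enum => ij' _; split; first exact: wf_is.
apply: ev1_eul_out; apply: contra njj => ij; apply/eqP.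
exact: (comp_disj hc0 ij ij').
Qed.

Lemma contr_Mj j j' eta : j' \in J -> contr (eulJ j) eta = 0 -> contr (eulJ j) (wedge (Mj j') eta) = 0.
Proof.
move=> jJ h; rewrite contr_wedge_closed //; case: (altP (j =P j')) => [->|njj].
  by rewrite Mj_contr // contr_sq wedge0l.
suff -> : contr (eulJ j) (Mj j') = 0 by rewrite wedge0l.
rewrite -[Mj j']wedge1r /Mj /mu_form contr_big_closed ?contr_form1 ?wedge0r ?scaler0 // => i.
move=> ir _; split; first exact: dlog_is.
have ij' : i \in c0 j' by rewrite -mem_enum; apply: mem_behead ir.
rewrite dlog_ucoord ev1D ev1N !ev1_eul_out ?subrr //; apply: contra njj => h'; apply/eqP.
  exact: (comp_disj hc0 h' (base_in ij')).
exact: (comp_disj hc0 h' ij').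
Qed.

Lemma contr_Hform j : contr (eulJ j) Hform = 0.
Proof.
have killed a eta : contr (eulJ j) eta = 0 -> contr (eulJ j) (wedge (eta_form k m z J K a) eta) = 0.
  move=> h; rewrite /eta_form contr_big_closed ?h ?wedge0r ?scaler0 // => i _ /andP[hi _].
  split; first exact: wf_is.
  have : free_coord c0 i by rewrite free_I0; apply: leq_trans hi; apply: leq_addr.
  by move/forallP/(_ j) => hij; apply: ev1_eul_out.
rewrite /Hform; elim: (index_enum _) => [|a r IH]; first by rewrite big_nil contr_form1.
by rewrite big_cons killed.
Qed.

Definition contrs js eta : form := foldr (fun j x => contr (eulJ j) x) eta js.
(** Number of 1-forms that the contractions have to pass; it is the exponent in
    the sign of theta. *)
Fixpoint dsum js : nat := if js is j :: js' then (size js' * (m j).+1 + dsum js')%N else 0%N.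

Lemma contrs_Wj js j eta : j \notin js ->
  contrs js (wedge (Wj j) eta) = (-1) ^+ (size js * #|c0 j|) *: wedge (Wj j) (contrs js eta).
Proof.
elim: js => [_|j' js IH]; first by rewrite mul0n expr0 scale1r.
rewrite inE negb_or => /andP[nj /IH] /= ->.
rewrite scaleE contrZ -scaleE Wj_closed 1?eq_sym // scalerA -exprD.
by rewrite mulSn addnC.
Qed.

Lemma contrs_product js : uniq js -> {subset js <= J} ->
  contrs js (wedge (\wedge_(j <- js) Wj j) Hform)
  = (-1) ^+ dsum js *: wedge (\wedge_(j <- js) Mj j) Hform.
Proof.
elim: js => [_ _|j js IH /= /andP[njs us] sJ]; first by rewrite !big_nil expr0 scale1r.
have jJ : j \in J by apply: sJ; rewrite inE eqxx.
have sJ' : {subset js <= J} by move=> x hx; apply: sJ; rewrite inE hx orbT.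
rewrite !big_cons -!wedgeA contrs_Wj // IH // (card_I0 hs) /blen jJ.
rewrite scaleE contrZ -scaleE wedgeZc scaleE contrZ -scaleE scalerA -exprD; congr (_ *: _).
rewrite Mj_contr // contr_wedge_closed //.
elim: {IH njs us} js sJ' {sJ} => [_|j' js IH sJ]; first by rewrite big_nil wedge1l contr_Hform.
have jJ' : j' \in J by apply: sJ; rewrite inE eqxx.
rewrite big_cons -wedgeA contr_Mj ?IH // => x hx.
by apply: sJ; rewrite inE hx orbT.
Qed.

Lemma dsum_sorted js : sorted (fun i q : 'I_n => i < q)%N js ->
  dsum js = (\sum_(j <- js) count (fun l : 'I_n => j < l)%N js * (m j).+1)%N.
Proof.
elim: js => [|j js IH] hsrt; first by rewrite big_nil.
have hx : {in js, forall y : 'I_n, (j < y)%N}.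
  by apply/allP; apply: (order_path_min _ hsrt) => a b c; apply: ltn_trans.
rewrite big_cons /= ltnn add0n (IH (path_sorted hsrt)); congr (_ * _ + _)%N.
  by apply/esym/eqP; rewrite -all_count; apply/allP.
apply: eq_big_seq => l ljs; congr (_ * _)%N.
by rewrite ltnNge ltnW ?hx.
Qed.

Lemma sorted_enum_set N (A : {set 'I_N}) : sorted (fun i q : 'I_N => i < q)%N (enum A).
Proof.
rewrite /enum_mem -enumT; apply: sorted_filter; last exact: sorted_enum_ord.
by move=> a b c; apply: ltn_trans.
Qed.

Lemma d_ofE : d_of m J = dsum (enum J).
Proof.
rewrite dsum_sorted ?sorted_enum_set // /d_of big_enum; apply: eq_bigr => j _; congr (_ * _)%N.
by rewrite -sum1_count big_enum_cond -sum1dep_card.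
Qed.

(** Contracting all blocks of a monomial at once; moving each Euler field past
    the blocks before it produces the sign (-1)^(d_j). *)
Lemma theta_contrs :
  wedge (\wedge_(j in J) Mj j) Hform = (-1) ^+ d_of m J *: contrs (enum J) (lam z chif).
Proof.
rewrite lam_chifull -!big_enum_ord contrs_product ?enum_uniq // => [|j]; last by rewrite mem_enum.
by rewrite d_ofE scalerA -expr2 sqrr_sign scale1r.
Qed.

End Theta.

(** * Changing the colour of one coordinate *)

Section Recolouring.
Variables (n k n0 : nat) (m : 'I_n -> nat).
Local Notation label := (label n k).
Local Notation colt := {ffun 'I_k -> option 'I_n}.
Implicit Types (i q o : 'I_k) (a b j : 'I_n) (c : label) (chi : {ffun 'I_k -> option 'I_n}).

Lemma setcK chi o x y : setc (setc chi o x) o y = setc chi o y.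
Proof. by apply/ffunP => i; rewrite !setcE; case: eqP. Qed.
Lemma setc_id chi o x : chi o = x -> setc chi o x = chi.
Proof. by move=> h; apply/ffunP => i; rewrite setcE; case: eqP => // ->. Qed.

Lemma sum_setc (V : zmodType) o (a : option 'I_n) (P : pred colt) (G : colt -> V) :
  \sum_(chi : colt | P chi && (chi o == None)) G chi
  = \sum_(chi : colt | P (setc chi o None) && (chi o == a)) G (setc chi o None).
Proof.
rewrite (reindex_onto (fun x => setc x o None) (fun x => setc x o a)) /=; last first.
  by move=> chi /andP[_ /eqP E]; rewrite setcK setc_id.
apply: eq_bigl => chi; rewrite setcE !eqxx andbT setcK; congr (_ && _).
by apply/eqP/eqP => [<-|E]; [rewrite setcE eqxx|rewrite setc_id].
Qed.

(** Sum over colourings with one uncoloured coordinate in I, organized by that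
    coordinate. *)
Lemma sum_one_None (V : zmodType) (I : {set 'I_k}) (P : pred colt) (G : colt -> V) :
  (forall chi, P chi -> #|[set i in I | chi i == None]%SET| = 1%N) ->
  \sum_(chi : colt | P chi) G chi
  = \sum_(o in I) \sum_(chi : colt | P chi && (chi o == None)) G chi.
Proof.
move=> h; under [RHS]eq_bigr => o _ do rewrite big_mkcondr.
rewrite [RHS]exchange_big /=; apply: eq_bigr => chi /h /eqP/cards1P[x Ex].
rewrite -big_mkcondr (eq_bigl (pred1 x)) ?big_pred1_eq // => o.
by have := congr1 (fun A : {set 'I_k} => o \in A) Ex; rewrite !inE.
Qed.

Lemma colok_setc c chi o x : free_coord c o -> colok c (setc chi o x) = colok c chi.
Proof.
move=> fo; apply/forallP/forallP => h i.
  case: (altP (i =P o)) => [->|nio]; first by case: (chi o) => // a; exact: acol_free.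
  by have := h i; rewrite setcE (negPf nio).
rewrite setcE; case: (altP (i =P o)) => [->|nio]; last exact: h.
by case: x {h} => // a; exact: acol_free.
Qed.

Lemma nset_setc_block c chi o x j : o \notin c j -> nset c (setc chi o x) (Some j) = nset c chi (Some j).
Proof.
move=> oj; apply/setP => i; rewrite !inE setcE; case: (i =P o) => [->|//].
by rewrite (negPf oj).
Qed.
Lemma nset_setc_None c chi o : free_coord c o -> nset c (setc chi o None) None = (o |: nset c chi None)%SET.
Proof. by move=> fo; apply/setP => i; rewrite !inE setcE; case: (i =P o) => [->|//]; rewrite fo. Qed.
Lemma nset_setc_Some c chi o a : free_coord c o -> nset c (setc chi o (Some a)) None = (nset c chi None :\ o)%SET.
Proof. by move=> fo; apply/setP => i; rewrite !inE setcE; case: (i =P o) => [->|//]; rewrite andbF. Qed.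

Lemma enumD1 (J : {set 'I_n}) b : b \in J -> exists s1 s2,
  [/\ enum J = s1 ++ b :: s2, enum (J :\ b)%SET = s1 ++ s2 & size s1 = #|[set j in J | (j < b)%N]%SET|].
Proof.
move=> bJ; have bJ' : b \in enum J by rewrite mem_enum.
have srt : sorted (fun i q : 'I_n => i < q)%N (enum J) := sorted_enum_set _.
have irr : irreflexive (fun i q : 'I_n => i < q)%N by move=> x; exact: ltnn.
have tr : transitive (fun i q : 'I_n => i < q)%N by move=> x y w; exact: ltn_trans.
case/splitPr E : _ / bJ' => [s1 s2]; exists s1, s2.
have u : uniq (s1 ++ b :: s2) by rewrite -E enum_uniq.
have nb : (b \notin s1) && (b \notin s2).
  by move: u; rewrite cat_uniq /= negb_or => /and3P[_ /andP[-> _] /andP[-> _]].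
split=> //.
  apply: (irr_sorted_eq tr irr); first exact: sorted_enum_set.
    apply: (subseq_sorted tr _ srt); rewrite E; apply: cat_subseq => //; exact: subseq_cons.
  move=> x; rewrite mem_enum !inE -(mem_enum J) E !mem_cat inE.
  case: (altP (x =P b)) => //= -> ; by move: nb => /andP[/negPf -> /negPf ->].
transitivity (count (fun j : 'I_n => (j < b)%N) (enum J)); last first.
  by rewrite -sum1_count big_enum_cond -sum1dep_card.
rewrite E count_cat /= ltnn add0n; move: srt; rewrite E (sorted_pairwise tr) pairwise_cat /=.
case/and3P => /allrelP h1 _ /andP[/allP h2 _].
have -> : count (fun j : 'I_n => (j < b)%N) s1 = size s1.
  by apply/eqP; rewrite -all_count; apply/allP => x xs; apply: h1; rewrite ?mem_head.
have -> : count (fun j : 'I_n => (j < b)%N) s2 = 0%N; last by rewrite addn0.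
by apply/eqP; rewrite -leqn0 leqNgt -has_count; apply/hasPn => x /h2 h; rewrite -leqNgt ltnW.
Qed.
End Recolouring.

(** * Expansion of theta into colourings *)

Section Expansion.
Variables (C : numFieldType) (n k n0 : nat) (m : 'I_n -> nat) (z : 'I_n -> C) (J : {set 'I_n}) (K : 'X_{1..n}).
Hypothesis z_inj : injective z.
Local Notation F := (ratfun C k).
Local Notation form := (ratform C k).
Local Notation t i := (varF C (i : 'I_k)).
Local Notation zc a := (cstF k (z a)).
Local Notation label := (label n k).
Local Notation chains := (chains C n k).
Local Notation colt := {ffun 'I_k -> option 'I_n}.
Implicit Types (i q o : 'I_k) (a b j : 'I_n) (eta theta xi : form) (js : seq 'I_n) (s : 'S_k) (c : label).
Implicit Types (chi : {ffun 'I_k -> option 'I_n}).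
Hypothesis hJ : forall j, j \in J -> (j < n0)%N.
Hypothesis hs : (s_of m J <= k)%N.
Local Notation c0 := (I0 k m J).
Local Notation chif := (chifull k m J K).
Local Notation comp := (is_component n0 m).
Local Notation vol := (vol C k).
Local Notation hlam := (hlam z).

Let hc0 : comp c0 := comp_I0 hJ hs.

(** The colourings obtained from that of theta by uncolouring one coordinate in
    each of the blocks js. *)
Definition Xset js chi : bool :=
  [forall i, (chi i == chif i) || ((chi i == None) && has (fun j => i \in c0 j) js)]
  && all (fun j => #|nset c0 chi (Some j)| == 1%N) js.
Definition osj js chi : seq 'I_k := flatten [seq enum (nset c0 chi (Some j)) | j <- js].

Lemma gfun_setN chi i a : chi i = Some a -> (t i - zc a) * gfun z chi = gfun z (setc chi i None).
Proof.
move=> hi; have E : gfun z chi = (t i - zc a)^-1 * gfun z (setc chi i None).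
  rewrite -gfun_setc ?supp_setN ?inE ?eqxx //; congr gfun.
  by apply/ffunP => j; rewrite !setcE; case: eqP => // ->.
by rewrite E mulrA divff_nz ?nz_var_cst // mul1r.
Qed.

Lemma contr_gfun c j chi eta : (forall i, i \in c j -> chi i = Some j) ->
  contr (eul z c j) (fscale (gfun z chi) eta)
  = \sum_(o in c j) fscale (gfun z (setc chi o None)) (anni o eta).
Proof.
move=> h; rewrite /contr [RHS]big_mkcond; apply: eq_bigr => i _; rewrite /eul.
case: ifP => ij; last by rewrite fscale0.
by rewrite anniZ fscaleA (gfun_setN (h i ij)).
Qed.

Lemma XsetP js chi : reflect
  ((forall i, chi i = chif i \/ (chi i = None /\ exists2 j, j \in js & i \in c0 j)) /\
   (forall j, j \in js -> #|nset c0 chi (Some j)| = 1%N)) (Xset js chi).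
Proof.
apply: (iffP andP) => -[h1 h2]; split.
- move=> i; have /forallP/(_ i)/orP[/eqP -> |/andP[/eqP -> /hasP[j hj ij]]] := h1; first by left.
  by right; split=> //; exists j.
- by move=> j hj; apply/eqP; apply: (allP h2).
- apply/forallP => i; have [->|[-> [j hj ij]]] := h1 i; first by rewrite eqxx.
  by apply/orP; right; rewrite eqxx /=; apply/hasP; exists j.
- by apply/allP => j /h2 ->.
Qed.

Lemma Xset_nil chi : Xset [::] chi = (chi == chif).
Proof.
apply/XsetP/eqP => [[h _]|->]; last by split=> // i; left.
by apply/ffunP => i; have [//|[_ [j]]] := h i; rewrite in_nil.
Qed.

Lemma osj_setc_out js chi o x j : o \in c0 j -> j \notin js -> osj js (setc chi o x) = osj js chi.
Proof.
move=> oj nj; congr flatten; apply/eq_in_map => l ljs; rewrite nset_setc_block //.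
apply: contra nj => ol; by rewrite (comp_disj hc0 oj ol).
Qed.

Lemma Xset_block js chi i j : Xset js chi -> j \notin js -> i \in c0 j -> chi i = Some j.
Proof.
move=> /XsetP[h _] nj ij; have [->|[_ [l ljs il]]] := h i; first exact: chifull_in.
by move: nj; rewrite (comp_disj hc0 ij il) ljs.
Qed.

Lemma Xset_cons js chi o j : j \notin js -> o \in c0 j ->
  [&& Xset (j :: js) (setc chi o None) & setc (setc chi o None) o (Some j) == chi] = Xset js chi.
Proof.
move=> nj oj; apply/andP/idP => [[/XsetP[h1 h2] /eqP E]|hX].
  have co : chi o = Some j by rewrite -E setcE eqxx.
  apply/XsetP; split=> [i|l ljs]; last first.
    rewrite -(h2 l) ?inE ?ljs ?orbT // nset_setc_block //.
    by apply: contra nj => ol; rewrite (comp_disj hc0 oj ol).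
  have := h1 i; rewrite setcE; case: eqP => [->|nio].
    by move=> _; left; rewrite co (chifull_in _ oj).
  move=> [->|[ci [l ljs il]]]; first by left.
  right; split=> //; exists l => //; move: ljs; rewrite inE => /orP[/eqP lj|//].
  subst l; have c1 := h2 j (mem_head _ _).
  have : o \in nset c0 (setc chi o None) (Some j) by rewrite inE oj setcE eqxx.
  have : i \in nset c0 (setc chi o None) (Some j) by rewrite inE il setcE ci; case: ifP.
  by move/eqP/cards1P: c1 => [x ->]; rewrite !inE => /eqP ix /eqP ox; case: nio; rewrite ix ox.
have co := Xset_block hX nj oj; split; last first.
  by apply/eqP/ffunP => i; rewrite !setcE; case: eqP => // ->.
have /XsetP[h1 h2] := hX; apply/XsetP; split=> [i|l].
  rewrite setcE; case: eqP => [->|_].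
    by right; split=> //; exists j => //; rewrite inE eqxx.
  have [->|[-> [l ljs il]]] := h1 i; first by left.
  by right; split=> //; exists l => //; rewrite inE ljs orbT.
rewrite inE => /orP[/eqP ->|ljs].
  apply/eqP/cards1P; exists o; apply/setP => i; rewrite !inE setcE.
  case: (altP (i =P o)) => [->|_]; first by rewrite oj.
  by case: (boolP (i \in c0 j)) => //= ij; rewrite (Xset_block hX nj ij).
rewrite nset_setc_block ?h2 //.
by apply: contra nj => ol; rewrite (comp_disj hc0 oj ol).
Qed.

(** Each contraction uncolours one coordinate of its block, with the sign
    recorded by the order of the contractions. *)
Lemma contrs_expand js xi : uniq js -> {subset js <= J} ->
  contrs m z J js (fscale (gfun z chif) xi)
  = \sum_(chi | Xset js chi) fscale (gfun z chi) (annis (osj js chi) xi).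
Proof.
elim: js => [_ _|j js IH /= /andP[nj us] sJ].
  by rewrite (eq_bigl (pred1 chif)) ?big_pred1_eq // => chi; rewrite Xset_nil.
rewrite IH //; last by move=> x hx; apply: sJ; rewrite inE hx orbT.
rewrite contr_sum.
have -> : \sum_(chi | Xset js chi) contr (eul z c0 j) (fscale (gfun z chi) (annis (osj js chi) xi))
  = \sum_(o in c0 j) \sum_(chi | Xset js chi)
       fscale (gfun z (setc chi o None)) (anni o (annis (osj js chi) xi)).
  rewrite [RHS]exchange_big /=; apply: eq_bigr => chi hX; apply: contr_gfun => i.
  exact: Xset_block hX nj.
have -> : \sum_(chi | Xset (j :: js) chi) fscale (gfun z chi) (annis (osj (j :: js) chi) xi)
  = \sum_(o in c0 j) \sum_(chi : colt | Xset (j :: js) chi && (chi o == None))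
      fscale (gfun z chi) (annis (osj (j :: js) chi) xi).
  under [RHS]eq_bigr => o _ do rewrite big_mkcondr.
  rewrite [RHS]exchange_big /=; apply: eq_bigr => chi /XsetP[_ /(_ j (mem_head _ _)) c1].
  rewrite -big_mkcondr /=; move/eqP/cards1P: c1 => [x Ex].
  rewrite (eq_bigl (pred1 x)) ?big_pred1_eq // => o.
  by have := congr1 (fun A : {set 'I_k} => o \in A) Ex; rewrite !inE.
apply: eq_bigr => o oj.
rewrite [RHS](reindex_onto (fun chi => setc chi o None) (fun chi => setc chi o (Some j))) /=; last first.
  by move=> chi /andP[_ /eqP E]; apply/ffunP => i; rewrite !setcE; case: eqP => // ->.
apply: eq_big => [chi|chi hX].
  by rewrite setcE !eqxx andbT -(Xset_cons chi nj oj).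
congr (fscale _ _); 
rewrite -[osj (j :: js) _]/(enum (nset c0 (setc chi o None) (Some j)) ++ osj js _).
rewrite annis_cat (osj_setc_out _ _ oj nj).
have -> : nset c0 (setc chi o None) (Some j) = [set o]%SET; last by rewrite enum_set1.
apply/setP => i; rewrite !inE setcE; case: (altP (i =P o)) => [->|_]; first by rewrite oj.
by case: (boolP (i \in c0 j)) => //= ij; rewrite (Xset_block hX nj ij).
Qed.

Hypothesis hK : (s_of m J + mdeg K = k)%N \/ (s_of m J + mdeg K).+1 = k.

Definition esg : nat := if (s_of m J + mdeg K == k)%N then 0%N else k.-1.

Lemma dX_supp : dX C (supp chif) = (-1) ^+ esg *: annis (enum (~: supp chif)%SET) vol.
Proof.
rewrite /esg; case: eqP hK => [E _|nE [//|E]].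
  have -> : (~: supp chif = set0)%SET.
    by apply/setP => i; rewrite !inE negbK chifull_None E leqNgt ltn_ord.
  rewrite enum_set0 expr0 scale1r /= /vol; congr (dX C _); apply/setP => i.
  by rewrite !inE chifull_None E leqNgt ltn_ord.
have k0 : (k.-1 < k)%N by rewrite -E.
pose l := Ordinal k0.
have El : (~: supp chif = [set l])%SET.
  apply/setP => i; rewrite !inE negbK chifull_None -val_eqE /=.
  by have := ltn_ord i; move: (nat_of_ord i) => x; lia.
rewrite El enum_set1 /= /vol anni_dX in_setT /sg.
have -> : below l [set: 'I_k] = k.-1.
  rewrite /below (eq_bigl predT) => [|x]; last by rewrite inE.
  transitivity (\sum_(q < k) (if (q < k.-1)%N then 1 else 0))%N; first by apply: eq_bigr => q _; case: ltnP.
  rewrite -big_mkcond sum1dep_card -[RHS](@card_range k 0 k.-1) ?add0n ?leq_pred //.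
rewrite fscale_sign scalerA -expr2 sqrr_sign scale1r; congr (dX C _).
by rewrite -[LHS]setCK El; apply/setP => x; rewrite !inE andbT.
Qed.

Lemma nset_None_X chi : Xset (enum J) chi -> nset c0 chi None = (~: supp chif)%SET.
Proof.
move=> /XsetP[h _]; apply/setP => i; rewrite !inE negbK.
case: (boolP (free_coord c0 i)) => hi /=.
  have [->//|[_ [j _ ij]]] := h i; by move/forallP/(_ j): hi; rewrite ij.
apply/esym/negP; rewrite chifull_None => h'; move: hi; rewrite free_I0.
by rewrite (leq_trans (leq_addr _ _) h').
Qed.

Lemma X_valid chi : Xset (enum J) chi -> valid c0 chi.
Proof.
move=> hX; have /XsetP[h1 h2] := hX; apply/and3P; split.
- apply/forallP => i; have [->|[-> _]] := h1 i => //.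
  case: (free_or c0 i) => [fi|[j ij]]; first by case: (chif i) => // a; apply: acol_free.
  by rewrite (chifull_in _ ij) (acol_in _ hc0 ij).
- by apply/forallP => j; apply/implyP; rewrite index_I0 // => jJ; rewrite h2 // mem_enum.
rewrite nset_None_X //; case: hK => E.
  rewrite (_ : (~: supp chif)%SET = set0) ?cards0 //.
  by apply/setP => i; rewrite !inE negbK chifull_None E leqNgt ltn_ord.
have k0 : (k.-1 < k)%N by rewrite -E.
rewrite (_ : (~: supp chif = [set Ordinal k0])%SET) ?cards1 //.
apply/setP => i; rewrite !inE negbK chifull_None -val_eqE /=.
by have := ltn_ord i; move: (nat_of_ord i) => x; lia.
Qed.

Lemma X_Kof chi : Xset (enum J) chi -> Kof c0 chi = K.
Proof.
move=> /XsetP[h _]; apply/mnmP => a; rewrite mnmE.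
have lek : (s_of m J + psum K a + K a <= k)%N.
  rewrite -addnA; apply: leq_trans (_ : s_of m J + mdeg K <= k)%N; last by case: hK => [->|<-].
  by rewrite leq_add2l mdegE psum_le.
rewrite -[RHS](@card_range k (s_of m J + psum K a) (K a)) //; congr #|pred_of_set _|.
apply/setP => i; rewrite !inE; case: (boolP (free_coord c0 i)) => fi /=.
  have [->|[_ [j _ ij]]] := h i; first by rewrite chifull_free.
  by move/forallP/(_ j): fi; rewrite ij.
move: fi; rewrite free_I0 => fi; apply/esym/negP => /andP[hi _].
by move/negP: fi; apply; apply: leq_trans hi; apply: leq_addr.
Qed.

Lemma X_os chi : Xset (enum J) chi -> os c0 chi = osj (enum J) chi ++ enum (~: supp chif)%SET.
Proof.
move=> hX; rewrite /os /slots map_rcons flatten_rcons index_I0 // -map_comp.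
by rewrite nset_None_X.
Qed.

Lemma theta_expand :
  wedge (\big[@wedge C k/form1 C k]_(j in J) Mj k m z J j) (Hform k m z J K)
  = (-1) ^+ (d_of m J + esg) *: \sum_(chi | Xset (enum J) chi) hlam c0 chi.
Proof.
rewrite (theta_contrs _ _ hJ hs) /lam contrs_expand ?enum_uniq //; last by move=> j; rewrite mem_enum.
rewrite exprD -scalerA; congr (_ *: _); rewrite scaler_sumr; apply: eq_bigr => chi hX.
rewrite dX_supp /hlam X_os // annis_cat.
have annisS r (x : C) eta : annis r (x *: eta) = x *: annis r eta by rewrite scaleE annisZ -scaleE.
by rewrite annisS scaleE fscaleA mulrC -fscaleA -scaleE.
Qed.

End Expansion.

(** * Skew-symmetrization of theta *)

Section CodeCount.
Variables (n k n0 : nat) (m : 'I_n -> nat).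
Local Notation label := (label n k).
Local Notation colt := {ffun 'I_k -> option 'I_n}.
Implicit Types (i q o : 'I_k) (a b j : 'I_n) (s : 'S_k) (c : label).
Implicit Types (chi : {ffun 'I_k -> option 'I_n}).
Local Notation comp := (is_component n0 m).

(** Block of a coordinate, or else its colour: the invariant of (c, chi) that
    remembers the position of the blocks but not which coordinate of a block is
    uncoloured. *)
Definition code c chi i : 'I_n + 'I_n + unit :=
  if bk c i is Some j then inl (inl j) else if chi i is Some a then inl (inr a) else inr tt.

Lemma fiber_code_block c chi j : comp c -> fiber (code c chi) (inl (inl j)) = c j.
Proof.
move=> hc; apply/setP => i; rewrite inE -(bkP _ _ hc) /code.
by case: (bk c i) => [j'|] //; case: (chi i).
Qed.

Lemma fiber_code_free c chi a : #|fiber (code c chi) (inl (inr a))| = Kof c chi a.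
Proof.
rewrite mnmE; apply: eq_card => i; rewrite !inE -bkN /code.
by case: (bk c i) => [j'|] //=; case: (chi i).
Qed.

Lemma fiber_code_None c chi : fiber (code c chi) (inr tt) = nset c chi None.
Proof.
apply/setP => i; rewrite !inE -bkN /code.
by case: (bk c i) => [j'|] //=; case: (chi i).
Qed.

Lemma prod_fiber_code c chi : comp c -> valid c chi ->
  (\prod_y (#|fiber (code c chi) y|)`! = (\prod_(j in index_set c) ((m j).+1)`!) * \prod_(a < n) (Kof c chi a)`!)%N.
Proof.
move=> hc hv; rewrite !big_sumType /= -[RHS]muln1; congr (_ * _ * _)%N.
- rewrite [RHS]big_mkcond; apply: eq_bigr => j _; rewrite fiber_code_block // inE.
  by case: eqP => [->|/eqP nj]; [rewrite cards0|have [_ ->] := comp_card hc nj].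
- by apply: eq_bigr => a _; rewrite fiber_code_free.
rewrite (bigD1 tt) //= big1 => [|[]//]; rewrite fiber_code_None muln1.
have [_ _] := and3P hv; by case: #|_| => [|[|]].
Qed.
Lemma s_of_split (J' : {set 'I_n}) : s_of m J' = (#|J'| + \sum_(j in J') m j)%N.
Proof. by rewrite -sum1_card -big_split /=; apply: eq_bigr => j _; rewrite add1n. Qed.

Lemma e_ofE (J' : {set 'I_n}) : e_of k m J' = k%:Z - (s_of m J')%:Z.
Proof.
rewrite s_of_split /e_of; have -> : \sum_(j in J') (m j)%:Z = (\sum_(j in J') m j)%N%:Z.
  by rewrite (big_morph Posz PoszD (erefl _)).
lia.
Qed.

Lemma card_le_s (J' : {set 'I_n}) : (#|J'| <= s_of m J')%N.
Proof. by rewrite -sum1_card /s_of; apply: leq_sum. Qed.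

End CodeCount.

Section OmegaForms.
Variables (C : numFieldType) (n k n0 : nat) (m : 'I_n -> nat) (z : 'I_n -> C) (kappa : C).
Variables (J : {set 'I_n}) (K : 'X_{1..n}).
Hypothesis z_inj : injective z.
Hypothesis k_gt0 : (0 < k)%N.
Local Notation F := (ratfun C k).
Local Notation form := (ratform C k).
Local Notation t i := (varF C (i : 'I_k)).
Local Notation zc a := (cstF k (z a)).
Local Notation label := (label n k).
Local Notation chains := (chains C n k).
Local Notation colt := {ffun 'I_k -> option 'I_n}.
Implicit Types (i q o : 'I_k) (a b j : 'I_n) (eta theta xi : form) (js : seq 'I_n) (s : 'S_k) (c : label).
Implicit Types (chi : {ffun 'I_k -> option 'I_n}).
Hypothesis hJ : forall j, j \in J -> (j < n0)%N.
Hypothesis hK : (s_of m J + mdeg K)%N = k \/ (s_of m J + mdeg K).+1 = k.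
Local Notation c0 := (I0 k m J).
Local Notation chif := (chifull k m J K).
Local Notation comp := (is_component n0 m).
Local Notation hlam := (hlam z).
Local Notation X := (@Xset n k m J K (enum J)).

Let hs : (s_of m J <= k)%N.
Proof. by case: hK => <-; rewrite ?leqW ?leq_addr. Qed.
Let hc0 : comp c0 := comp_I0 hJ hs.

Definition chi0 : colt := [ffun i => if i \in base_set c0 then None else chif i].

Lemma chi0E i : chi0 i = if i \in base_set c0 then None else chif i.
Proof. by rewrite ffunE. Qed.

Lemma X_chi0 : X chi0.
Proof.
apply/XsetP; split=> [i|j].
  rewrite chi0E; case: ifP => hb; last by left.
  right; split=> //; move: hb; rewrite inE => /existsP[j /andP[ij _]].
  by exists j => //; rewrite mem_enum -(index_I0 hs) (index_setE ij).
rewrite mem_enum => jJ; have : index_set c0 = J by apply: index_I0.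
move/setP/(_ j); rewrite jJ inE => /set0Pn[i ij].
apply/eqP/cards1P; exists (base (c0 j) i); apply/setP => q; rewrite in_set1 [nset _ _ _]/= in_set chi0E.
apply/andP/eqP => [[qj]|->].
  by rewrite (in_base_set hc0 qj) (base_eq q ij); case: (q =P _) => // _; rewrite (chifull_in _ qj).
have bj := base_in ij; split=> //.
by rewrite (in_base_set hc0 bj) (base_eq (base (c0 j) i) ij) eqxx.
Qed.

Lemma valid_chi0 : valid c0 chi0.
Proof. exact: (X_valid hJ hs hK X_chi0). Qed.
Lemma Kof_chi0 : Kof c0 chi0 = K.
Proof. exact: (X_Kof hK X_chi0). Qed.

Lemma transporterP c chi s : comp c -> valid c chi ->
  (pc s c == c0) && X (pchi s chi) = [forall i, code c chi (s i) == code c0 chi0 i].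
Proof.
move=> hc hv; have free0 i : bk c0 i = None -> chi0 i = chif i.
  move=> fi; rewrite chi0E ifN // inE; apply/existsP => -[j /andP[ij _]].
  by have := bkP i j hc0; rewrite ij fi.
have bkpc i : bk (pc s c) i = bk c (s i) by apply: eq_pick => j; rewrite in_pc.
apply/andP/forallP => [[/eqP E hX] i|h].
  have Eb : bk c (s i) = bk c0 i by rewrite -bkpc E.
  apply/eqP; rewrite /code Eb; case Ei : (bk c0 i) => [//|]; rewrite (free0 _ Ei).
  have /XsetP[/(_ i) h _] := hX; move: h; rewrite ffunE => -[->//|[_ [j _ ij]]].
  by have := bkP i j hc0; rewrite ij Ei.
have Eb i : bk c (s i) = bk c0 i.
  have /eqP := h i; rewrite /code; case: (bk c (s i)) => [j|]; case: (bk c0 i) => [j'|] //.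
  - by case=> ->.
  - by case: (chi0 i).
  - by case: (chi (s i)).
have E : pc s c = c0.
  by apply/ffunP => j; apply/setP => i; rewrite in_pc -!(bkP _ _ hc) -(bkP i j hc0) Eb.
have hv' : valid c0 (pchi s chi) by rewrite -E valid_pc.
split; first exact/eqP; apply/XsetP; split=> [i|j].
  case Ei : (bk c0 i) => [j|].
    have /eqP := Ei; rewrite (bkP _ _ hc0) => ij.
    have [hcol _ _] := and3P hv'; have [->|->] := colok_in hc0 hcol ij.
      by right; split=> //; exists j => //; rewrite mem_enum -(index_I0 hs) (index_setE ij).
    by left; rewrite (chifull_in _ ij).
  left; have /eqP := h i; rewrite /code Eb Ei free0 // [pchi _ _ _]ffunE.
  by case: (chi (s i)) => [a|]; case: (chif i) => // a' [->].
rewrite mem_enum => jJ0; have jJ : j \in index_set c0 by rewrite index_I0.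
by have [_ /forallP/(_ j)/implyP/(_ jJ)/eqP ->] := and3P hv'.
Qed.

(** Number of permutations that carry a given colouring to one of those of
    theta; it cancels the factorials of alpha. *)
Definition mult : nat := ((\prod_(j in J) ((m j).+1)`!) * \prod_(a < n) (K a)`!)%N.

(** For a fixed valid colouring, a permutation carries c to the standard
    component and chi into the support of theta exactly when it matches the
    codes. *)
Lemma card_transport c chi : comp c ->
  #|[set s : 'S_k | (pc s c == c0) && X (pchi s chi)]|
  = if [&& valid c chi, index_set c == J & Kof c chi == K] then mult else 0%N.
Proof.
move=> hc; case: ifP => [/and3P[hv /eqP EJ /eqP EK]|h]; last first.
  apply: eq_card0 => s; rewrite inE; apply/negP => /andP[/eqP E hX]; move/negP: h; apply.
  have := X_valid hJ hs hK hX; rewrite -{1}E valid_pc => ->.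
  have := X_Kof hK hX; rewrite -{1}E Kof_pc => ->.
  by rewrite -(index_pc s) E index_I0 // !eqxx.
have [||s [Ec Echi]] := valid_trans hc hc0 hv valid_chi0; first by rewrite index_I0.
  by rewrite Kof_chi0.
transitivity #|[set s : 'S_k | [forall i, code c chi (s i) == code c0 chi0 i]]|.
  by apply: eq_card => u; rewrite !inE transporterP.
rewrite card_transporter => [|y].
  by rewrite (prod_fiber_code hc0 valid_chi0) Kof_chi0 index_I0.
have := transporterP s hc hv; rewrite Ec eqxx Echi X_chi0 => /esym/forallP hsi.
rewrite -(card_pre s (fiber (code c chi) y)); apply: eq_card => i; rewrite !inE.
by rewrite (eqP (hsi i)).
Qed.

Lemma theta_c0 : theta_form k m z J K c0
  = ((-1) ^+ esg k m J K / mult%:R) *: \sum_(chi | X chi) hlam c0 chi.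
Proof.
rewrite ffunE eqxx; have /= -> := theta_expand z hJ hs hK; rewrite scalerA; congr (_ *: _).
rewrite /alpha_coef /mult natrM !natr_prod mulrAC -exprD addnA addnn exprD.
by rewrite -mul2n exprM sqrrN !expr1n mul1r.
Qed.

(** The coefficient of omega_K^j; it differs from 1 by the powers of kappa and
    the sign of the definition of omega. *)
Definition nrm (J' : {set 'I_n}) (K' : 'X_{1..n}) : C :=
  if (s_of m J' + mdeg K' == k)%N then kappa ^- k else (-1) ^+ #|J'|.+1 * kappa ^- k.-1.

Lemma mult_neq0 : mult%:R != 0 :> C.
Proof.
rewrite pnatr_eq0 -lt0n muln_gt0 !prodn_gt0 // => i; exact: fact_gt0.
Qed.

(** All valid colourings of type (J, K) receive the same coefficient, namely the
    number of permutations that reach the support of theta. *)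
Lemma skew_theta (N : C) : Skew (N *: theta_form k m z J K)
  = tau n0 m z (fun J' K' => if (J' == J) && (K' == K) then N * (-1) ^+ esg k m J K else 0).
Proof.
apply/ffunP => c; rewrite /Skew sum_ffunE ffunE.
have inj s := @injev_pvar C k s.
have E1 s : ((-1) ^+ s *: perm_act s (N *: theta_form k m z J K)) c
   = (-1) ^+ s *: pullback (pvar s) (if pc s c == c0 then N *: theta_form k m z J K c0 else 0).
  rewrite ffunE perm_actE; congr (_ *: pullback _ _).
  have -> : (N *: theta_form k m z J K) (pc s c) = N *: theta_form k m z J K (pc s c) by rewrite [LHS]ffunE.
  case: (altP (pc s c =P c0)) => [->//|nE].
  by rewrite [theta_form _ _ _ _ _ _]ffunE (negPf nE) scaler0.
rewrite (eq_bigr _ (fun s _ => E1 s)); case: ifP => hc; last first.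
  rewrite big1 // => s _; case: eqP => E; last by rewrite (pullback0 (inj s)) scaler0.
  by move: hc0; rewrite -E comp_pcE hc.
rewrite theta_c0; set x := _ / _; have E2 s :
   (-1) ^+ s *: pullback (pvar s) (if pc s c == c0 then N *: (x *: \sum_(chi | X chi) hlam c0 chi) else 0)
   = (N * x) *: \sum_(chi | (pc s c == c0) && X (pchi s chi)) hlam c chi.
  case: (altP (pc s c =P c0)) => E /=; last by rewrite (pullback0 (inj s)) scaler0 big_pred0_eq scaler0.
  rewrite scalerA (pullback_scale (inj s)) scalerA mulrC -[LHS]scalerA; apply: (congr1 (fun u => (N * x) *: u)).
  rewrite (pullback_sum (inj s)) (reindex _ (onW_bij _ (@pchi_bij n k s))) scaler_sumr.
  apply: eq_bigr => chi hX.
  have hv : valid c chi by rewrite -(valid_pc s) E (X_valid hJ hs hK hX).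
  by rewrite -E pull_hlam // scalerA -expr2 sqrr_sign scale1r.
rewrite (eq_bigr _ (fun s _ => E2 s)) -scaler_sumr.
under eq_bigr => s _ do rewrite big_mkcond.
rewrite exchange_big /= scaler_sumr [RHS]big_mkcond; apply: eq_bigr => chi _.
rewrite -big_mkcond sumr_const -cardsE card_transport //.
case: (valid c chi) => /=; last by rewrite mulr0n scaler0.
case: (_ && _) => /=; last by rewrite mulr0n scaler0 scale0r.
rewrite -scaler_nat scalerA; congr (_ *: _).
by rewrite /x -!mulrA mulVf ?mult_neq0 // mulr1.
Qed.

Lemma omega_tau : omega_form k m z kappa J K
  = tau n0 m z (fun J' K' => if (J' == J) && (K' == K) then nrm J K else 0).
Proof.
have pk := leq_trans (card_le_s m J) hs.
rewrite /omega_form e_ofE /nrm; have -> : ((mdeg K)%:Z == k%:Z - (s_of m J)%:Z) = (s_of m J + mdeg K == k)%N by lia.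
have E := skew_theta; rewrite /esg in E; case: ifP E => h E; rewrite E; congr (tau _ _ _ _).
  by apply: funext => J'; apply: funext => K'; rewrite expr0 mulr1.
apply: funext => J'; apply: funext => K'; case: ifP => // _.
rewrite mulrAC -exprD; congr (_ * _).
rewrite -[LHS]signr_odd -[RHS]signr_odd; have -> : odd (k - #|J| + k.-1)%N = odd #|J|.+1 by lia.
by [].
Qed.

Lemma wf_diff_log c j i q : i \in c j -> q \in c j -> log_algebra z c 1 (wf z i j - wf z q j).
Proof.
move=> ij qj; have Eb : base (c j) i = base (c j) q := base_eq i qj.
have h o : o \in c j -> log_algebra z c 1 (wf z o j - wf z (base (c j) o) j).
  move=> oj; case: (altP (o =P base (c j) o)) => [<-|no]; first by rewrite subrr; exact: Log_zero.
  by rewrite -dlog_ucoord; apply: Log_gen; apply: Div_u0.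
have := Log_lin (-1) (h _ qj) (h _ ij); congr (log_algebra _ _ _ _).
by rewrite scaleN1r Eb opprB addrC addrA subrK.
Qed.

Lemma big_log c (I : eqType) (r : seq I) (P : pred I) (w : I -> form) :
  (forall x, x \in r -> P x -> log_algebra z c 1 (w x)) ->
  log_algebra z c (count P r) (\big[@wedge C k/form1 C k]_(x <- r | P x) w x).
Proof.
elim: r => [|x r IH] h; first by rewrite big_nil; exact: Log_one.
rewrite big_cons /=; have IH' := IH (fun y hy => h y (mem_behead (s := x :: r) hy)).
case: ifP => // hx; rewrite add1n -add1n; apply: Log_wedge => //.
by apply: h => //; rewrite mem_head.
Qed.

Lemma big_log_deg c (I : eqType) (r : seq I) (d : I -> nat) (w : I -> form) :
  (forall x, x \in r -> log_algebra z c (d x) (w x)) ->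
  log_algebra z c (\sum_(x <- r) d x) (\big[@wedge C k/form1 C k]_(x <- r) w x).
Proof.
elim: r => [|x r IH] h; first by rewrite !big_nil; exact: Log_one.
rewrite !big_cons; apply: Log_wedge; first by apply: h; rewrite mem_head.
by apply: IH => y hy; apply: h; rewrite inE hy orbT.
Qed.

Lemma pull_theta_log s c : pc s c = c0 ->
  log_algebra z c (\sum_(j in J) m j + mdeg K) (pullback (pvar s) (theta_form k m z J K c0)).
Proof.
move=> E; have inj := @injev_pvar C k s.
have scale_log x d eta : log_algebra z c d eta -> log_algebra z c d (x *: eta).
  by move=> h; rewrite -[_ *: _]addr0; apply: Log_lin => //; exact: Log_zero.
rewrite ffunE eqxx (pullback_scale inj); apply: scale_log.
rewrite (pullback_wedge inj) !(pullback_big inj); apply: Log_wedge.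
  rewrite -big_enum -big_enum_ord /=; apply: big_log_deg => j; rewrite mem_enum => jJ.
  rewrite /mu_form (pullback_big inj).
  have -> : m j = count predT (behead (enum (c0 j))).
    by rewrite count_predT size_behead -cardE card_I0 // /blen jJ.
  apply: big_log => i /mem_behead; rewrite mem_enum => ij _.
  rewrite dlog_ucoord (pullbackD inj) (pullbackN inj) !pull_wf; apply: wf_diff_log.
    by rewrite -in_pc E.
  by rewrite -in_pc E base_in.
rewrite mdegE; apply: big_log_deg => a _; rewrite /eta_form (pullback_big inj) big_mkcondl.
have lek : (s_of m J + psum K a + K a <= k)%N.
  rewrite -addnA; apply: leq_trans (_ : s_of m J + mdeg K <= k)%N; last by case: hK => [->|<-].
  by rewrite leq_add2l mdegE psum_le.
rewrite -big_mkcondl -[X in log_algebra _ _ X _](card_range lek) -sum1dep_card sum1_count.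
apply: big_log => i _ /andP[hi _]; rewrite pull_wf -[wf _ _ _]/(dlog _); apply: Log_gen; apply: Div_tz.
rewrite -free_pc E free_I0; apply: leq_trans hi; exact: leq_addr.
Qed.

(** The products in theta are made of differences dlog(t_i - z_j) - dlog(t_q -
    z_j) inside the blocks and of dlog(t_i - z_a) for free i, which gives the
    membership in the algebra of the component and the degree. *)
Lemma omega_skew : aomoto_skew n0 m z
  (if (s_of m J + mdeg K == k)%N then (k + #|J|)%:Z else (k + #|J|)%:Z - 1) (omega_form k m z kappa J K).
Proof.
split; last by move=> s; rewrite omega_tau tau_skew.
have [N EN] : exists N, omega_form k m z kappa J K = Skew (N *: theta_form k m z J K).
  by rewrite /omega_form; case: ifP => _; eexists.
move=> c; have Eom : ~~ comp c -> omega_form k m z kappa J K c = 0.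
  by rewrite omega_tau ffunE => /negPf ->.
case hc : (comp c); last by apply: Eom; rewrite hc.
case: (altP (index_set c =P J)) => [EJ|nJ]; last first.
  have -> : omega_form k m z kappa J K c = 0.
    by rewrite omega_tau ffunE hc big1 // => chi _; rewrite (negPf nJ) scale0r.
  by case: (_ - _) => // d; exact: Log_zero.
have -> : (if (s_of m J + mdeg K == k)%N then (k + #|J|)%:Z else (k + #|J|)%:Z - 1) - (2 * #|index_set c|)%:Z
   = (\sum_(j in J) m j + mdeg K)%:Z.
  rewrite EJ s_of_split; move: hK; rewrite s_of_split; case: eqP; lia.
rewrite EN /Skew sum_ffunE.
apply: (big_ind (log_algebra z c _)) => [|x y hx hy|s _]; first exact: Log_zero.
  by rewrite -[x]scale1r; apply: Log_lin.
rewrite ffunE perm_actE; have inj := @injev_pvar C k s.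
rewrite -[_ *: _]addr0; apply: Log_lin; last exact: Log_zero.
case: (altP (pc s c =P c0)) => E.
  rewrite E ffunE (pullback_scale inj) -[_ *: _]addr0; apply: Log_lin; last exact: Log_zero.
  exact: pull_theta_log.
by rewrite !ffunE (negPf E) scaler0 (pullback0 inj); exact: Log_zero.
Qed.

End OmegaForms.

(** * Uniqueness of the coefficients and their degrees *)

Section Coefficients.
Variables (C : numFieldType) (n k n0 : nat) (m : 'I_n -> nat) (z : 'I_n -> C) (kappa : C).
Hypothesis z_inj : injective z.
Hypothesis k_gt0 : (0 < k)%N.
Hypothesis kappa_neq0 : kappa != 0.
Local Notation form := (ratform C k).
Local Notation label := (label n k).
Local Notation chains := (chains C n k).
Local Notation colt := {ffun 'I_k -> option 'I_n}.
Implicit Types (c : label) (chi : {ffun 'I_k -> option 'I_n}) (J : {set 'I_n}) (K : 'X_{1..n}).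
Implicit Types (A B : {set 'I_n} -> 'X_{1..n} -> C).
Local Notation comp := (is_component n0 m).
Local Notation hlam := (hlam z).
Local Notation tau := (@tau C n k n0 m z).

Definition top J K : bool := (s_of m J + mdeg K == k)%N.
(** The pairs (J, K) that label the basis omega_K^j. *)
Definition adm J K : bool :=
  [forall (j | j \in J), (j < n0)%N] && (top J K || ((s_of m J + mdeg K).+1 == k)%N).

Lemma admP J K : adm J K -> (forall j, j \in J -> (j < n0)%N) /\
  ((s_of m J + mdeg K)%N = k \/ (s_of m J + mdeg K).+1 = k).
Proof.
case/andP => /forallP h1 h2; split; first by move=> j jJ; have /implyP := h1 j; apply.
by case/orP: h2 => /eqP ->; [left|right].
Qed.

Lemma code_total c chi : comp c -> 
  k = (s_of m (index_set c) + mdeg (Kof c chi) + #|nset c chi None|)%N.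
Proof.
move=> hc; transitivity (\sum_(i < k) 1)%N; first by rewrite sum1_card card_ord.
rewrite (partition_big (code c chi) predT) //= !big_sumType /=; congr (_ + _ + _)%N.
- rewrite /s_of [RHS]big_mkcond; apply: eq_bigr => j _.
  rewrite sum1dep_card -/(fiber (code c chi) _) (fiber_code_block _ _ hc) inE.
  by case: eqP => [->|/eqP nj]; [rewrite cards0|have [_ ->] := comp_card hc nj].
- rewrite mdegE; apply: eq_bigr => a _.
  by rewrite sum1dep_card -fiber_code_free.
by have /= <- := fiber_code_None c chi; rewrite (big_pred1 tt) => [|[]//]; rewrite sum1dep_card.
Qed.

Lemma valid_adm c chi : comp c -> valid c chi -> adm (index_set c) (Kof c chi).
Proof.
move=> hc hv; apply/andP; split.
  by apply/forallP => j; apply/implyP; rewrite inE => nj; have [] := comp_card hc nj.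
have := code_total chi hc; have [_ _] := and3P hv; rewrite /top; lia.
Qed.

Lemma valid_supp c chi : comp c -> valid c chi ->
  (#|supp chi| + #|index_set c| = if top (index_set c) (Kof c chi) then k else k.-1)%N.
Proof.
move=> hc hv; have Es : (~: supp chi = [set i in os c chi])%SET.
  by apply/setP => i; rewrite !inE mem_os negbK.
have E1 : #|(~: supp chi)%SET| = (#|index_set c| + #|nset c chi None|)%N.
  rewrite Es cardsE (card_uniqP (os_uniq _ hc)) size_flatten /shape -map_comp sumnE big_map.
  rewrite /slots -cats1 big_cat big_seq1 /= -cardE big_map; congr (_ + _)%N; rewrite big_enum -sum1_card.
  apply: eq_bigr => j hj /=; rewrite -cardE.
  by have [_ /forallP/(_ j)/implyP/(_ hj)/eqP ->] := and3P hv.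
have := cardsC (supp chi); rewrite card_ord E1.
have := code_total chi hc; have [_ _] := and3P hv; rewrite /top; case: eqP => h; lia.
Qed.

Lemma adm_rep J K : adm J K -> exists c chi, [/\ comp c, valid c chi, index_set c = J & Kof c chi = K].
Proof.
case/admP => hJ hK; have hs : (s_of m J <= k)%N by case: hK => <-; rewrite ?leqW ?leq_addr.
exists (I0 k m J), (chi0 k m J K); split; first exact: comp_I0 hJ hs.
- exact: valid_chi0.
- exact: index_I0.
- exact: Kof_chi0.
Qed.

Lemma tau_lam A c : comp c -> exists e : colt -> bool,
  tau A c = \sum_chi (if valid c chi then (-1) ^+ e chi * A (index_set c) (Kof c chi) else 0) *: lam z chi.
Proof.
move=> hc; have [e he] := choice (fun chi => hlam_lam z chi hc); exists e.
rewrite ffunE hc big_mkcond; apply: eq_bigr => chi _; case: ifP => _; last by rewrite scale0r.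
by rewrite he scalerA mulrC.
Qed.

(** The number of coloured coordinates is determined by (J, K), and the
    monomials are homogeneous and independent. *)
Lemma tau_degree (l : int) A J K : aomoto n0 m z l (tau A) -> adm J K -> A J K != 0 ->
  l = (if top J K then (k + #|J|)%:Z else (k + #|J|)%:Z - 1).
Proof.
move=> hl hadm hA; have [c [chi [hc hv EJ EK]]] := adm_rep hadm.
have [e he] := tau_lam A hc.
have nz0 : (if valid c chi then (-1) ^+ e chi * A (index_set c) (Kof c chi) else 0) != 0.
  by rewrite hv EJ EK mulf_neq0 ?signr_eq0.
have hsupp := valid_supp hc hv; rewrite EJ EK in hsupp.
case: (aomoto_log hl hc) => [E0|[d [Ed /log_gspan hd]]].
  by move: nz0; rewrite (lam_indep z_inj (etrans (esym he) E0)) eqxx.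
case: (altP (#|supp chi| =P d)) => [Esd|nd]; first by move: Ed; rewrite EJ -Esd; move: hsupp k_gt0; case: ifP; lia.
suff : \sum_chi' (if #|supp chi'| == d then 0 else
   (if valid c chi' then (-1) ^+ e chi' * A (index_set c) (Kof c chi') else 0)) *: lam z chi' = 0.
  by move/(lam_indep z_inj)/(_ chi)/eqP; rewrite (negPf nd) (negPf nz0).
apply: formP => S; rewrite form0E sum_ffunE.
case: (altP (#|S| =P d)) => [ES|nS].
  rewrite big1 // => chi' _; rewrite scaleE fscaleE.
  case: (altP (#|supp chi'| =P d)) => [_|nd']; first by rewrite cstF0 mul0r.
  rewrite /lam fscaleE dXE; case: eqP => [ES'|_]; last by rewrite !mulr0.
  by move: nd'; rewrite -ES' ES eqxx.
have /= E := gspan_deg (@dlogs_is _ _ _ _ c) hd nS; rewrite -[RHS]E he sum_ffunE.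
apply: eq_bigr => chi' _; rewrite !scaleE !fscaleE.
case: (altP (#|supp chi'| =P d)) => [Ed'|//].
rewrite /lam ?fscaleE dXE; case: eqP => [ES'|_]; last by rewrite !mulr0.
by move: nS; rewrite ES' Ed' eqxx.
Qed.

Lemma tau_inj A B J K : tau A = tau B -> adm J K -> A J K = B J K.
Proof.
move=> E hadm; have [c [chi [hc hv EJ EK]]] := adm_rep hadm.
have := congr1 (fun u : chains => u c) E; rewrite !ffunE hc => {}E.
have [e he] := choice (fun chi => hlam_lam z chi hc).
have h D : \sum_(x | valid c x) D (index_set c) (Kof c x) *: hlam c x
  = \sum_x (if valid c x then (-1) ^+ e x * D (index_set c) (Kof c x) else 0) *: lam z x.
  rewrite big_mkcond; apply: eq_bigr => x _; case: ifP => _; last by rewrite scale0r.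
  by rewrite he scalerA mulrC.
rewrite !h in E; have := lam_indep2 z_inj E chi; rewrite hv EJ EK.
by apply: mulfI; rewrite signr_eq0.
Qed.

Lemma tauD A B : tau (fun J K => A J K + B J K) = tau A + tau B.
Proof.
apply/ffunP => c; rewrite ![in RHS]ffunE ffunE; case: ifP => _; last by rewrite addr0.
by rewrite -big_split; apply: eq_bigr => chi _; rewrite scalerDl.
Qed.
Lemma tauZ (x : C) A : tau (fun J K => x * A J K) = x *: tau A.
Proof.
apply/ffunP => c; rewrite ffunE [in RHS]ffunE [tau A c]ffunE; case: ifP => _; last by rewrite scaler0.
by rewrite scaler_sumr; apply: eq_bigr => chi _; rewrite scalerA.
Qed.
Lemma tau0 : tau (fun _ _ => 0) = 0.
Proof.
apply/ffunP => c; rewrite !ffunE; case: ifP => // _.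
by rewrite big1 // => chi _; rewrite scale0r.
Qed.

Local Notation nrm := (nrm k m kappa).
Lemma nrm_neq0 J K : nrm J K != 0.
Proof. by rewrite /nrm; case: ifP => _; rewrite ?mulf_neq0 ?signr_eq0 // invr_eq0 expf_neq0. Qed.

Local Notation omega := (omega_form k m z kappa).

(** Only finitely many exponents K are admissible, all of degree at most k. *)
Lemma tau_span A : tau A = \sum_J \sum_(K : 'X_{1..n < k.+1} | adm J K) (A J K / nrm J K) *: omega J K.
Proof.
apply/ffunP => c; rewrite sum_ffunE ffunE; case: ifP => hc; last first.
  rewrite big1 // => J _; rewrite sum_ffunE big1 // => K /admP[hJ hK].
  by rewrite ffunE (omega_tau z kappa k_gt0 hJ hK) ffunE hc scaler0.
transitivity (\sum_(J : {set 'I_n}) \sum_(K : 'X_{1..n < k.+1} | adm J K) \sum_(chi | valid c chi)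
    (if (index_set c == J) && (Kof c chi == K) then A J K else 0) *: hlam c chi); last first.
  apply: eq_bigr => J _; rewrite sum_ffunE; apply: eq_bigr => K /admP[hJ hK].
  rewrite ffunE (omega_tau z kappa k_gt0 hJ hK) ffunE hc scaler_sumr; apply: eq_bigr => chi _.
  rewrite scalerA; case: ifP => _; last by rewrite mulr0.
  by rewrite -mulrA mulVf ?mulr1 ?nrm_neq0.
under [RHS]eq_bigr => J _ do rewrite exchange_big.
rewrite [RHS]exchange_big /=; apply: eq_bigr => chi hv.
have hadm := valid_adm hc hv.
have hdeg : (mdeg (Kof c chi) < k.+1)%N by have := code_total chi hc; lia.
rewrite (bigD1 (index_set c)) //= (bigD1 (BMultinom hdeg)) //= !eqxx [X in _ + X + _]big1 => [|K /andP[_ nK]].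
  rewrite addr0 big1 ?addr0 // => J nJ; rewrite big1 // => K _.
  by rewrite eq_sym (negPf nJ) scale0r.
have -> : (Kof c chi == K) = false by apply/eqP => E; move/eqP: nK; apply; apply: val_inj; rewrite /= E.
by rewrite scale0r.
Qed.

End Coefficients.

(** * Restriction to coordinate subspaces *)

Section Restriction.
Variables (C : fieldType) (k : nat) (V : {set 'I_k}).
Local Notation F := (ratfun C k).
Local Notation form := (ratform C k).
Local Notation t i := (varF C (i : 'I_k)).
Implicit Types (i q : 'I_k) (a b : form) (f g : F) (S : {set 'I_k}).

(** The point of the coordinate subspace t_i = 0, i in V, generic otherwise. *)
Definition killv i : F := if i \in V then 0 else t i.

Lemma polyF_killP p : polyF (killP V p) = ev killv p.
Proof.
elim/poly_gen_ind: p => [c|i|p q hp hq|p q hp hq].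
- by rewrite /killP comp_mpolyC ev_C.
- rewrite /killP comp_mpolyXU -tnth_nth tnth_mktuple ev_X /killv.
  by case: ifP => // _; rewrite polyF0.
- by rewrite /killP comp_mpolyD polyFD evD -hp -hq.
- by rewrite /killP rmorphM polyFM evM -hp -hq.
Qed.

Lemma restrF_eq f g : evalF killv f g -> restrF V f = g.
Proof.
move=> h; rewrite /restrF; apply: xget_unique.
  case: h => p [q [nq -> ->]]; exists p, q; rewrite !polyF_killP; split=> //.
  by rewrite -nz_polyF polyF_killP.
move=> g' [p [q [nq E ->]]]; apply: (evalF_fun _ h); exists p, q; rewrite !polyF_killP; split=> //.
by rewrite -polyF_killP nz_polyF.
Qed.

(** The form a has coefficients regular along the subspace and restricts to a'.
    Unlike [restr_form], which has a junk value on poles, this relation is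
    compatible with sums and products. *)
Definition restr_to a a' : Prop :=
  (forall S, exists v, evalF killv (a S) v) /\
  (forall S, if [disjoint S & V] then evalF killv (a S) (a' S) else a' S = 0).

Lemma restr_formE a a' : restr_to a a' -> restr_form V a = a'.
Proof.
move=> [_ h]; apply: formP => S; rewrite ffunE; have := h S.
by case: ifP => // _ /restrF_eq.
Qed.

Lemma rt0 : restr_to 0 0.
Proof. by split=> S; rewrite form0E; [exists 0; exact: evalF0|case: ifP => // _; exact: evalF0]. Qed.

Lemma rtD a a' b b' : restr_to a a' -> restr_to b b' -> restr_to (a + b) (a' + b').
Proof.
move=> [h1 h2] [g1 g2]; split=> S; rewrite !formDE.
  by have [v hv] := h1 S; have [w hw] := g1 S; exists (v + w); apply: evalFD.
have := h2 S; have := g2 S; case: ifP => _ => [h h'|-> ->]; last by rewrite addr0.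
exact: evalFD.
Qed.

Lemma rtZ f f' a a' : evalF killv f f' -> restr_to a a' -> restr_to (fscale f a) (fscale f' a').
Proof.
move=> hf [h1 h2]; split=> S; rewrite !fscaleE.
  by have [v hv] := h1 S; exists (f' * v); apply: evalFM.
have := h2 S; case: ifP => _ => [h|->]; last by rewrite mulr0.
exact: evalFM.
Qed.

Lemma rtZc (x : C) a a' : restr_to a a' -> restr_to (x *: a) (x *: a').
Proof. by rewrite !scaleE; apply: rtZ; apply: evalF_cst. Qed.
Lemma rtN a a' : restr_to a a' -> restr_to (- a) (- a').
Proof. by rewrite -!fscaleN1; apply: rtZ; apply/evalFN/evalF1. Qed.
Lemma rtB a a' b b' : restr_to a a' -> restr_to b b' -> restr_to (a - b) (a' - b').
Proof. by move=> h h'; apply: rtD => //; apply: rtN. Qed.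
Lemma rt_sum (I : Type) (r : seq I) (P : pred I) (h h' : I -> form) :
  (forall x, P x -> restr_to (h x) (h' x)) ->
  restr_to (\sum_(x <- r | P x) h x) (\sum_(x <- r | P x) h' x).
Proof. by move=> H; apply: (big_ind2 restr_to) => //; [exact: rt0|move=> *; exact: rtD]. Qed.

Lemma rt1 : restr_to (form1 C k) (form1 C k).
Proof.
split=> S; rewrite -dX0 dXE; first by exists (S == set0)%:R; case: eqP => _; [exact: evalF1|exact: evalF0].
case: ifP => [_|/negP dS]; first by case: eqP => _; [exact: evalF1|exact: evalF0].
case: eqP => // ES; case: dS; rewrite ES; apply/pred0P => q /=; by rewrite inE.
Qed.

Lemma rt_crea i a a' : i \notin V -> restr_to a a' -> restr_to (crea i a) (crea i a').
Proof.
move=> iV [h1 h2]; split=> S; rewrite !ffunE; case: (boolP (i \in S)) => iS.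
- by have [v hv] := h1 (S :\ i)%SET; eexists; apply: evalFM hv; apply: evalF_sign.
- by exists 0; apply: evalF0.
- have := h2 (S :\ i)%SET; have -> : [disjoint S :\ i & V] = [disjoint S & V].
    apply/idP/idP; rewrite -!setI_eq0 => /eqP E; apply/eqP/setP => q; move/setP/(_ q): E; rewrite !inE.
      by case: (altP (q =P i)) => [->|//]; rewrite (negPf iV) !andbF.
    by case: (altP (q =P i)) => [->|//]; rewrite (negPf iV) ?andbF /= ?andbT.
  case: ifP => _ => [h|->]; last by rewrite mulr0.
  by apply: evalFM => //; apply: evalF_sign.
- by case: ifP => // _; apply: evalF0.
Qed.

Lemma rt_crea_in i a a' : i \in V -> restr_to a a' -> restr_to (crea i a) 0.
Proof.
move=> iV [h1 h2]; split=> S; rewrite ?form0E !ffunE; case: (boolP (i \in S)) => iS.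
- by have [v hv] := h1 (S :\ i)%SET; eexists; apply: evalFM hv; apply: evalF_sign.
- by exists 0; apply: evalF0.
- by rewrite ifF //; apply/negP => /pred0P/(_ i) /=; rewrite iS iV.
- by case: ifP => // _; apply: evalF0.
Qed.

(** Regularity of all coefficients, not only of those of the restriction, is
    what makes products compatible. *)
Lemma rt_wedge a a' b b' : restr_to a a' -> restr_to b b' -> restr_to (wedge a b) (wedge a' b').
Proof.
move=> [h1 h2] [g1 g2]; split=> S; rewrite !ffunE.
  have [u hu] := choice h1; have [v hv] := choice g1.
  exists (\sum_(A : {set 'I_k} | A \subset S) wedge_sign C A (S :\: A)%SET * u A * v (S :\: A)%SET).
  apply: evalF_sum => A _; apply: evalFM; last exact: hv.
  by apply: evalFM; [exact: evalF_sign|exact: hu].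
case: ifP => dS.
  apply: evalF_sum => A sA; apply: evalFM; last first.
    by have := g2 (S :\: A)%SET; rewrite ifT // (disjointWl _ dS) // subsetDl.
  apply: evalFM; first exact: evalF_sign.
  by have := h2 A; rewrite ifT // (disjointWl sA dS).
apply: big1 => A sA; have := h2 A; have := g2 (S :\: A)%SET.
case: ifP => d1; last by move=> -> _; rewrite mulr0.
case: ifP => d2; last by move=> _ ->; rewrite mulr0 mul0r.
move/negP: dS; case; rewrite -setI_eq0; apply/eqP/setP => q; rewrite !inE.
apply/negP => /andP[qS qV]; case: (boolP (q \in A)) => qA.
  by move/pred0P/(_ q): d2; rewrite /= qA qV.
by move/pred0P/(_ q): d1; rewrite /= inE qA qS qV.
Qed.

Definition dres f f' : Prop := evalF killv f f' /\ restr_to (dform f) (dform f').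

Lemma dresD f f' g g' : dres f f' -> dres g g' -> dres (f + g) (f' + g').
Proof. by move=> [h h2] [g1 g2]; split; [exact: evalFD|rewrite !dformD; exact: rtD]. Qed.
Lemma dresB f f' g g' : dres f f' -> dres g g' -> dres (f - g) (f' - g').
Proof. by move=> [h h2] [g1 g2]; split; [exact: evalFB|rewrite !dformB; exact: rtB]. Qed.
Lemma dresM f f' g g' : dres f f' -> dres g g' -> dres (f * g) (f' * g').
Proof.
move=> [h h2] [g1 g2]; split; first exact: evalFM.
by rewrite !dformM; apply: rtD; apply: rtZ.
Qed.
Lemma dres_cst (x : C) : dres (cstF k x) (cstF k x).
Proof. by split; [exact: evalF_cst|rewrite dform_cst; exact: rt0]. Qed.
Lemma dres1 : dres 1 1.
Proof. by rewrite -(cstF1 C k); exact: dres_cst. Qed.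
Lemma dres_var i : dres (t i) (killv i).
Proof.
split; first exact: evalF_var.
rewrite /killv dform_var; case: ifP => iV; last by rewrite dform_var; apply: rt_crea rt1; rewrite iV.
by rewrite -(cstF0 C k) dform_cst; apply: rt_crea_in rt1.
Qed.
Lemma rt_dlog f f' : dres f f' -> nz f' -> restr_to (dlog f) (dlog f').
Proof. by move=> [h h2] nf; apply: rtZ => //; apply: evalFV. Qed.

End Restriction.

(** * The form omega_a on a component *)

Section Charts.
Variables (C : numFieldType) (n k n0 : nat) (m : 'I_n -> nat) (z : 'I_n -> C) (kappa : C).
Hypothesis z_inj : injective z.
Local Notation F := (ratfun C k).
Local Notation form := (ratform C k).
Local Notation t i := (varF C (i : 'I_k)).
Local Notation zc a := (cstF k (z a)).
Local Notation label := (label n k).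
Local Notation comp := (is_component n0 m).
Implicit Types (i q : 'I_k) (a b j : 'I_n) (eta zeta : form).
Variable c : label.
Hypothesis hc : comp c.
Local Notation wf := (wf z).
Local Notation xf := (xf C).
Local Notation V := (base_set c).
Local Notation ch := (chart z c).
Local Notation coch := (cochart z c).

(** The coordinate u_i on a block, equal to 1 at the base. *)
Definition uc j i : F := if i == base (c j) i then 1 else t i.

Lemma pick_block (T : Type) i j (f : 'I_n -> T) (x : T) : i \in c j ->
  (if [pick j | i \in c j] is Some j then f j else x) = f j.
Proof. by move=> ij; have /eqP := bkP i j hc; rewrite ij /bk; case: pickP => // j' _ [->]. Qed.
Lemma pick_free (T : Type) i (f : 'I_n -> T) (x : T) : free_coord c i ->
  (if [pick j | i \in c j] is Some j then f j else x) = x.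
Proof. by rewrite -bkN /bk; case: pickP. Qed.

Lemma chart_in i j : i \in c j -> ch i = zc j + t (base (c j) i) * uc j i.
Proof.
move=> ij; rewrite /chart (pick_block _ _ ij) /= /uc; congr (_ + _).
by case: eqP => [<-|_]; rewrite ?mulr1.
Qed.
Lemma chart_free i : free_coord c i -> ch i = t i.
Proof. by move=> fi; rewrite /chart pick_free. Qed.
Lemma cochart_in i j : i \in c j ->
  coch i = if i == base (c j) i then t i - zc j else (t i - zc j) / (t (base (c j) i) - zc j).
Proof. by move=> ij; rewrite /cochart (pick_block _ _ ij). Qed.
Lemma cochart_free i : free_coord c i -> coch i = t i.
Proof. by move=> fi; rewrite /cochart pick_free. Qed.

Lemma base_idem i j : i \in c j -> base (c j) (base (c j) i) = base (c j) i.
Proof. by move=> ij; exact: (base_eq (base (c j) i) ij). Qed.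

Lemma base_V i j : i \in c j -> base (c j) i \in V.
Proof. by move=> ij; rewrite (in_base_set hc (base_in ij)) base_idem. Qed.
Lemma free_V i : free_coord c i -> i \notin V.
Proof. by move=> fi; rewrite inE; apply/existsP => -[j /andP[ij _]]; move/forallP/(_ j): fi; rewrite ij. Qed.

(** The chart and the cochart are inverse to each other; this makes both of them
    admissible substitutions. *)
Lemma coch_chart i : evalF coch (ch i) (t i).
Proof.
have [fi|[j ij]] := free_or c i.
  by rewrite chart_free // -{2}(cochart_free fi); apply: evalF_var.
rewrite (chart_in ij); have bj := base_in ij.
have eb : evalF coch (t (base (c j) i)) (t (base (c j) i) - zc j).
  by have := evalF_var coch (base (c j) i); rewrite (cochart_in bj) base_idem // eqxx.
have -> : t i = zc j + (t (base (c j) i) - zc j) * ((t i - zc j) / (t (base (c j) i) - zc j)).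
  by rewrite mulrC divfK_nz ?nz_var_cst // addrC subrK.
apply: evalFD; first exact: evalF_cst.
apply: evalFM => //; rewrite /uc; case: (altP (i =P _)) => [<-|ni].
  by rewrite divff_nz ?nz_var_cst //; exact: evalF1.
by have := evalF_var coch i; rewrite (cochart_in ij) (negPf ni).
Qed.

Lemma nz_var i : nz (t i).
Proof. by have := nz_var_cst i (0 : C); rewrite cstF0 subr0. Qed.

Lemma chart_coch i : evalF ch (coch i) (t i).
Proof.
have [fi|[j ij]] := free_or c i.
  by rewrite cochart_free // -{2}(chart_free fi); apply: evalF_var.
have chB q : q \in c j -> evalF ch (t q - zc j) (t (base (c j) q) * uc j q).
  move=> qj; have -> : t (base (c j) q) * uc j q = ch q - zc j by rewrite (chart_in qj) addrC addKr.
  by apply: evalFB; [exact: evalF_var|exact: evalF_cst].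
rewrite (cochart_in ij); case: (altP (i =P _)) => ni.
  by have := chB i ij; rewrite /uc -ni eqxx mulr1.
rewrite [X in evalF _ _ X](_ : _ = (t (base (c j) i) * t i) / t (base (c j) i)); last by rewrite [t (base _ _) * _]mulrC mulfK_nz // nz_var.
apply: evalF_div; last exact: nz_var.
  by have := chB i ij; rewrite /uc (negPf ni).
by have := chB _ (base_in ij); rewrite /uc base_idem // eqxx mulr1.
Qed.

Lemma injev_chart : injev ch. Proof. exact: (injev_inv coch_chart). Qed.
Lemma injev_coch : injev coch. Proof. exact: (injev_inv chart_coch). Qed.

Lemma coch_chartK eta : pullback coch (pullback ch eta) = eta.
Proof.
rewrite (pullback_comp _ injev_coch injev_chart (@injev_var C k) coch_chart).
exact: pullback_id.
Qed.

(** Restriction to the stratum, for forms in the coordinates t. A form zeta with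
    [chres eta zeta] is the restriction of eta. *)
Definition chres eta zeta : Prop := restr_to V (pullback ch eta) (pullback ch zeta).

Lemma chresD eta eta' zeta zeta' : chres eta zeta -> chres eta' zeta' -> chres (eta + eta') (zeta + zeta').
Proof. by rewrite /chres !(pullbackD injev_chart); apply: rtD. Qed.
Lemma chresN eta zeta : chres eta zeta -> chres (- eta) (- zeta).
Proof. by rewrite /chres !(pullbackN injev_chart); apply: rtN. Qed.
Lemma chresZ (x : C) eta zeta : chres eta zeta -> chres (x *: eta) (x *: zeta).
Proof. by rewrite /chres !(pullback_scale injev_chart); apply: rtZc. Qed.
Lemma chres_sum (I : Type) (r : seq I) (P : pred I) (h h' : I -> form) :
  (forall x, P x -> chres (h x) (h' x)) ->
  chres (\sum_(x <- r | P x) h x) (\sum_(x <- r | P x) h' x).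
Proof. by move=> H; rewrite /chres !(pullback_sum injev_chart); apply: rt_sum. Qed.

Lemma chresE eta zeta : chres eta zeta -> pullback coch (restr_form V (pullback ch eta)) = zeta.
Proof. by move=> /restr_formE ->; rewrite coch_chartK. Qed.

Lemma substB_cst s i a : injev s -> substF s (t i - zc a) = s i - zc a.
Proof. by move=> inj; rewrite (substFB inj) (substF_var inj) (substF_cst inj). Qed.
Lemma pull_chart_wf i a : pullback ch (wf i a) = dlog (ch i - zc a).
Proof. by rewrite -[wf i a]/(dlog (t i - zc a)) (pullback_dlog _ injev_chart) (substB_cst _ _ injev_chart). Qed.
Lemma pull_chart_xf i q : pullback ch (xf i q) = dlog (ch i - ch q).
Proof.
by rewrite -[xf i q]/(dlog (t i - t q)) (pullback_dlog _ injev_chart) (substFB injev_chart) !(substF_var injev_chart).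
Qed.

Lemma dres_uc i j : i \in c j -> dres V (uc j i) (uc j i).
Proof.
move=> ij; rewrite /uc; case: (boolP (i == _)) => ni; first exact: dres1.
by have := dres_var C V i; rewrite /killv (in_base_set hc ij) (negPf ni).
Qed.
Lemma dres_free i : free_coord c i -> dres V (t i) (t i).
Proof. by move=> fi; have := dres_var C V i; rewrite /killv (negPf (free_V fi)). Qed.
Lemma dres_block i j : i \in c j -> dres V (ch i) (zc j).
Proof.
move=> ij; rewrite (chart_in ij) -[X in dres V _ X]addr0 -(mul0r (uc j i)).
apply: dresD; first exact: dres_cst.
apply: dresM; last exact: dres_uc.
by have := dres_var C V (base (c j) i); rewrite /killv base_V.
Qed.

Lemma nz_uc i j : nz (uc j i).
Proof. by rewrite /uc; case: eqP => _; [exact: nz1|exact: nz_var]. Qed.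

Lemma nz_ucB i q j : i \in c j -> q \in c j -> i != q -> nz (uc j i - uc j q).
Proof.
move=> ij qj niq; rewrite /uc (base_eq q ij).
case: (altP (i =P _)) => hi; case: (altP (q =P _)) => hq.
- by move: niq; rewrite hq -hi eqxx.
- have := nz_var_cst q (1 : C); rewrite cstF1 -opprB => h.
  by apply/nzP => E; move/nzP: h; apply; rewrite E oppr0.
- by have := nz_var_cst i (1 : C); rewrite cstF1.
- exact: nz_var_sub.
Qed.

Lemma pull_wf_in i j : i \in c j -> pullback ch (wf i j) = dlog (uc j i) + dlog (t (base (c j) i)).
Proof.
move=> ij; rewrite pull_chart_wf (chart_in ij) addrC addKr dlogM ?nz_var ?nz_uc //.
exact: addrC.
Qed.

(** In the chart both forms have the pole dlog(t_(i_0) - z_j), which cancels in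
    the difference. *)
Lemma chres_pair i q j : i \in c j -> q \in c j -> i != q ->
  chres (xf i q - wf i j) (xf i q - wf i j).
Proof.
move=> ij qj niq; rewrite /chres (pullbackD injev_chart) (pullbackN injev_chart).
rewrite pull_chart_xf (pull_wf_in ij) (chart_in ij) (chart_in qj) (base_eq q ij).
rewrite opprD addrACA subrr add0r -mulrBr dlogM ?nz_var ?nz_ucB //.
rewrite [dlog (uc j i) + _]addrC opprD addrACA subrr add0r; apply: rtB.
  by apply: rt_dlog; [apply: dresB; exact: dres_uc|exact: nz_ucB].
by apply: rt_dlog; [exact: dres_uc|exact: nz_uc].
Qed.
Lemma chres_free i q : free_coord c i -> free_coord c q -> i != q -> chres (xf i q) (xf i q).
Proof.
move=> fi fq niq; rewrite /chres pull_chart_xf !chart_free //.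
by apply: rt_dlog; [apply: dresB; exact: dres_free|exact: nz_var_sub].
Qed.
Lemma chres_mixed i q j : free_coord c i -> q \in c j -> chres (xf i q) (wf i j).
Proof.
move=> fi qj; rewrite /chres pull_chart_xf pull_chart_wf !(chart_free fi).
apply: rt_dlog; last exact: nz_var_cst.
by apply: dresB; [exact: dres_free|exact: dres_block].
Qed.
Lemma chres_far i q j l : i \in c j -> q \in c l -> j != l -> chres (xf i q) 0.
Proof.
move=> ij ql njl; rewrite /chres pull_chart_xf (pullback0 injev_chart).
rewrite -(dlog_cst k (z j - z l)) cstFB.
by apply: rt_dlog; [apply: dresB; exact: dres_block|exact: nz_zc].
Qed.
Lemma chres_wf i a : free_coord c i -> chres (wf i a) (wf i a).
Proof.
move=> fi; rewrite /chres pull_chart_wf chart_free //.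
by apply: rt_dlog; [apply: dresB; [exact: dres_free|exact: dres_cst]|exact: nz_var_cst].
Qed.
Lemma chres_wf_out i j a : i \in c j -> a != j -> chres (wf i a) 0.
Proof.
move=> ij naj; rewrite /chres pull_chart_wf (pullback0 injev_chart).
rewrite -(dlog_cst k (z j - z a)) cstFB.
by apply: rt_dlog; [apply: dresB; [exact: dres_block|exact: dres_cst]|rewrite nz_zc // eq_sym].
Qed.

(** The total weight of a coordinate at z_a on the component: for a free
    coordinate the points t_q of the block of a have merged with z_a, each
    contributing -2. *)
Definition weight i a : int := if free_coord c i then mvec m (index_set c) a else if i \in c a then (m a)%:Z else 0.
Definition omc : form :=
  \sum_i (\sum_(q | (q != i) && cls c i q) xf i q - \sum_a (weight i a)%:~R *: wf i a).
Definition omfull : form :=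
  \sum_i (\sum_(q | q != i) xf i q - \sum_a (m a)%:R *: wf i a).

Definition blk i : form := \sum_(a | i \in c a) wf i a.
Lemma blk_in i j : i \in c j -> blk i = wf i j.
Proof.
move=> ij; rewrite /blk (big_pred1 j) // => a; apply/idP/eqP => [ia|->//].
exact: (comp_disj hc ia ij).
Qed.
Lemma blk_free i : free_coord c i -> blk i = 0.
Proof. by move=> /forallP fi; rewrite /blk big_pred0 // => a; apply/negbTE. Qed.

Definition bx i q : form := if free_coord c i then \sum_(a | q \in c a) wf i a else 0.

Lemma bx_block i q j : free_coord c i -> q \in c j -> bx i q = wf i j.
Proof.
move=> fi qj; rewrite /bx fi (big_pred1 j) // => a; apply/idP/eqP => [qa|->//].
exact: (comp_disj hc qa qj).
Qed.
Lemma bx_free i q : free_coord c q -> bx i q = 0.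
Proof.
by move=> /forallP fq; rewrite /bx; case: ifP => // _; rewrite big_pred0 // => a; apply/negbTE.
Qed.
Lemma block_nfree i j : i \in c j -> free_coord c i = false.
Proof. by move=> ij; apply/negP => /forallP/(_ j); rewrite ij. Qed.
Lemma bx_in i q j : i \in c j -> bx i q = 0.
Proof. by move=> ij; rewrite /bx (block_nfree ij). Qed.
Lemma chres_xf i q : i != q ->
  chres (xf i q - (if cls c i q then blk i else 0))
        (if cls c i q then xf i q - blk i else bx i q + bx q i).
Proof.
move=> niq; have [fi|[j ij]] := free_or c i; have [fq|[l ql]] := free_or c q.
- by rewrite cls_free // fq blk_free // subr0; exact: chres_free.
- rewrite cls_free // (block_nfree ql) subr0 (bx_block fi ql) (bx_in _ ql) addr0.
  exact: chres_mixed.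
- have -> : cls c i q = false.
    by rewrite (cls_in _ hc ij); apply/negbTE; move/forallP: fq.
  rewrite subr0 (bx_block fq ij) bx_free // add0r xfC; exact: chres_mixed.
rewrite (cls_in _ hc ij); case: ifP => qj.
  by rewrite (blk_in ij); exact: chres_pair.
rewrite subr0 (bx_in _ ij) (bx_in _ ql) addr0; apply: (chres_far ij ql).
by apply: contraFN qj => /eqP ->.
Qed.

Lemma sum_blk i : \sum_(q | (q != i) && cls c i q) blk i = \sum_(a | i \in c a) (m a)%:R *: wf i a.
Proof.
have [fi|[j ij]] := free_or c i.
  rewrite blk_free // big1 // big_pred0 // => a; apply/negbTE; by move/forallP: fi.
rewrite (big_pred1 j) => [|a]; last first.
  by apply/idP/eqP => [ia|->//]; exact: (comp_disj hc ia ij).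
have nj : c j != set0 by apply/set0Pn; exists i.
have [_ cj] := comp_card hc nj.
rewrite sumr_const (blk_in ij) scaler_nat; congr (_ *+ _).
have -> : m j = #|(c j :\ i)%SET| by have := cardsD1 i (c j); rewrite ij cj; case.
by apply: eq_card => q; rewrite !inE unfold_in /= (cls_in _ hc ij).
Qed.

Lemma card_block a : #|c a| = if a \in index_set c then (m a).+1 else 0%N.
Proof. by rewrite inE; case: eqP => [->|/eqP nj]; [rewrite cards0|have [_ ->] := comp_card hc nj]. Qed.

Lemma sum_bx : \sum_i \sum_(q | (q != i) && ~~ cls c i q) (bx i q + bx q i)
  = \sum_i (if free_coord c i then \sum_a (2 * #|c a|)%:R *: wf i a else 0).
Proof.
have H : \sum_i \sum_(q | (q != i) && ~~ cls c i q) bx i q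
  = \sum_i (if free_coord c i then \sum_a #|c a|%:R *: wf i a else 0).
  apply: eq_bigr => i _; case: (boolP (free_coord c i)) => fi; last first.
    by rewrite big1 // => q _; rewrite /bx (negPf fi).
  rewrite (eq_bigl (fun q => ~~ free_coord c q)); last first.
    move=> q; rewrite cls_free //; case: (altP (q =P i)) => // ->; by rewrite fi.
  transitivity (\sum_q \sum_(a | q \in c a) wf i a).
    rewrite [RHS](bigID (free_coord c)) /= [X in _ = X + _]big1 ?add0r; last first.
      by move=> q fq; rewrite big_pred0 // => a; apply/negbTE; move/forallP: fq.
    by apply: eq_bigr => q _; rewrite /bx fi.
  rewrite (exchange_big_dep predT) //=; apply: eq_bigr => a _.
  by rewrite sumr_const scaler_nat.
transitivity (\sum_i \sum_(q | (q != i) && ~~ cls c i q) bx i q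
   + \sum_i \sum_(q | (q != i) && ~~ cls c i q) bx q i).
  by rewrite -big_split; apply: eq_bigr => i _; rewrite -big_split.
have -> : \sum_i \sum_(q | (q != i) && ~~ cls c i q) bx q i
  = \sum_i \sum_(q | (q != i) && ~~ cls c i q) bx i q.
  rewrite (exchange_big_dep predT) //=; apply: eq_bigr => i _; apply: eq_bigl => q.
  by rewrite eq_sym cls_sym.
rewrite H -big_split; apply: eq_bigr => i _ /=; case: ifP => _; last by rewrite addr0.
rewrite -big_split; apply: eq_bigr => a _ /=.
by rewrite -scalerDl mul2n -addnn natrD.
Qed.

(** Resonance: the m_j pairs containing i in a block of size m_j + 1 compensate
    the weight of dlog(t_i - z_j), so that omega_a is a sum of terms without
    pole along the block. *)
Lemma omfullE : omfull = \sum_i (\sum_(q | q != i) (xf i q - (if cls c i q then blk i else 0))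
   - \sum_(a | i \notin c a) (m a)%:R *: wf i a).
Proof.
apply: eq_bigr => i _; rewrite sumrB -big_mkcondr sum_blk -addrA; congr (_ + _).
by rewrite -opprD [in LHS](bigID (fun a => i \in c a)) /=.
Qed.

Lemma omcE : omc = \sum_i (\sum_(q | q != i) (if cls c i q then xf i q - blk i else bx i q + bx q i)
   - \sum_(a | i \notin c a) (m a)%:R *: (if free_coord c i then wf i a else 0)).
Proof.
transitivity (\sum_i (\sum_(q | (q != i) && cls c i q) (xf i q - blk i)
    + (if free_coord c i then \sum_a (2 * #|c a|)%:R *: wf i a else 0)
    - \sum_(a | i \notin c a) (m a)%:R *: (if free_coord c i then wf i a else 0))).
  apply: eq_bigr => i _; rewrite sumrB sum_blk -!addrA; congr (_ + _).
  case: (boolP (free_coord c i)) => fi.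
    rewrite [X in - X + _]big_pred0; last by move=> a; apply/negbTE; move/forallP: fi.
    rewrite oppr0 add0r [X in _ - X](eq_bigl predT); last by move=> a; move/forallP: fi => ->.
    rewrite -sumrB -sumrN; apply: eq_bigr => a _; rewrite -scalerBl -scaleNr; congr (_ *: _).
    rewrite /weight fi /mvec card_block; case: ifP => _; last by rewrite muln0 sub0r.
    rewrite intrB intrN -[(Posz (m a))%:~R]/((m a)%:R) -[2%:~R]/(2%:R : C).
    by rewrite natrM -[(m a).+1]addn1 natrD; ring.
  rewrite add0r [X in _ - X]big1 ?subr0 => [|a _]; last by rewrite scaler0.
  congr (- _); rewrite [RHS]big_mkcond; apply: eq_bigr => a _; rewrite /weight (negPf fi).
  by case: ifP => _; rewrite ?scale0r.
rewrite !big_split /= -sum_bx -big_split; congr (_ + _); apply: eq_bigr => i _.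
rewrite [RHS](bigID (cls c i)) /=; congr (_ + _); apply: eq_bigr => q /andP[_ h].
  by rewrite h.
by rewrite (negPf h).
Qed.

Lemma chres_om : chres omfull omc.
Proof.
rewrite omfullE omcE; apply: chres_sum => i _; apply: chresD.
  by apply: chres_sum => q nq; apply: chres_xf; rewrite eq_sym.
apply: chresN; apply: chres_sum => a ia; apply: chresZ.
have [fi|[j ij]] := free_or c i; first by rewrite fi; exact: chres_wf.
rewrite (block_nfree ij); apply: (chres_wf_out ij).
by apply: contraNneq ia => ->.
Qed.

Lemma omega_aE : omega_a k m z kappa = kappa^-1 *: omfull.
Proof.
have pair : \sum_i \sum_(q | q != i) xf i q = 2 *: \sum_(i < k) \sum_(q : 'I_k | (i < q)%N) xf i q.
  transitivity (\sum_(i < k) \sum_(q : 'I_k | (i < q)%N) xf i q + \sum_(i < k) \sum_(q : 'I_k | (q < i)%N) xf i q).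
    rewrite -big_split; apply: eq_bigr => i _ /=.
    rewrite (bigID (fun q : 'I_k => (i < q)%N)) /=; congr (_ + _); apply: eq_bigl => q.
      by rewrite -val_eqE neq_ltn; case: ltngtP.
    by rewrite -val_eqE neq_ltn; case: ltngtP.
  rewrite [X in _ + X](exchange_big_dep predT) //= scaler_nat mulr2n; congr (_ + _).
  by apply: eq_bigr => i _; apply: eq_bigr => q _; rewrite xfC.
rewrite /omega_a /omfull sumrB pair scalerBr scalerA; congr (_ - _).
  rewrite scaler_sumr; apply: eq_bigr => i _; rewrite scaler_sumr; apply: eq_bigr => q _.
  by rewrite mulrC.
rewrite scaler_sumr; apply: eq_bigr => i _; rewrite scaler_sumr; apply: eq_bigr => a _.
by rewrite scalerA mulrC.
Qed.

(** Termwise restriction: pairs in the same class are unchanged, a free and a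
    block coordinate give the form at z_j, and coordinates of different blocks
    give 0. *)
Lemma omega_a_onE : omega_a_on m z kappa c = kappa^-1 *: omc.
Proof. by rewrite /omega_a_on omega_aE; apply: chresE; apply: chresZ; exact: chres_om. Qed.

End Charts.

(** * Residues as contractions *)

Section Residues.
Variables (C : numFieldType) (n k n0 : nat) (m : 'I_n -> nat) (z : 'I_n -> C).
Hypothesis z_inj : injective z.
Local Notation F := (ratfun C k).
Local Notation form := (ratform C k).
Local Notation t i := (varF C (i : 'I_k)).
Local Notation zc a := (cstF k (z a)).
Local Notation label := (label n k).
Local Notation comp := (is_component n0 m).
Implicit Types (i q : 'I_k) (a j : 'I_n) (eta zeta al be : form).
Implicit Types (chi : {ffun 'I_k -> option 'I_n}).
Variables (c : label) (b : 'I_n) (i0 : 'I_k).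
Hypotheses (hc : comp c) (ib : i0 \in c b) (i0b : i0 = base (c b) i0).
Local Notation wf := (wf z).
Local Notation ch := (chart z c).
Local Notation coch := (cochart z c).
Local Notation rt := (restr_to [set i0]%SET).
Local Notation d0 := (dlog (t i0)).
Local Notation inj := (injev_chart z hc).
Local Notation hlam := (hlam z).

Lemma dis1 (S : {set 'I_k}) : [disjoint S & [set i0]%SET] = (i0 \notin S).
Proof. by rewrite disjoint_sym disjoints1. Qed.

Lemma wedge_d0 eta : wedge d0 eta = fscale (t i0)^-1 (crea i0 eta).
Proof. by rewrite /dlog wedgeZl wedge_dvar. Qed.

Lemma residueE eta (S : {set 'I_k}) :
  residue i0 eta S = if i0 \in S then 0 else restrF [set i0]%SET (t i0 * anni i0 eta S).
Proof.
rewrite ffunE; case: ifP => // iS; congr (restrF _ (_ * _)); rewrite ffunE iS; congr (_ * _).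
by rewrite wedge_sign_below big_set1.
Qed.

(** First order pole along t_(i_0) = 0, with al' and be' the restrictions of the
    regular part and of the residue. *)
Definition logpole eta al' be' : Prop := exists al be,
  [/\ pullback ch eta = al + wedge d0 be, rt al al' & rt be be'].

Lemma logpole_residue eta al' be' : logpole eta al' be' -> residue i0 (pullback ch eta) = be'.
Proof.
move=> [al [be [-> hal hbe]]]; apply: formP => S; rewrite residueE.
have := hbe.2 S; rewrite dis1; case: (boolP (i0 \in S)) => iS //= hS.
apply: restrF_eq; rewrite wedge_d0 anniD anniZ anni_crea formDE fscaleE formDE formNE.
rewrite [crea i0 _ S]ffunE (negPf iS) subr0 mulrDr mulrA divff_nz ?nz_var // mul1r.
rewrite -[be' S]add0r; apply: evalFD => //.
have [v hv] := hal.1 (i0 |: S)%SET.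
rewrite ffunE (negPf iS) -(mul0r (sg C i0 S * v)); apply: evalFM.
  by have := evalF_var (killv C [set i0]%SET) i0; rewrite /killv inE eqxx.
by apply: evalFM => //; apply: evalF_sign.
Qed.

Lemma logpoleD eta al be eta' al' be' : logpole eta al be -> logpole eta' al' be' ->
  logpole (eta + eta') (al + al') (be + be').
Proof.
move=> [x [y [E hx hy]]] [x' [y' [E' hx' hy']]]; exists (x + x'), (y + y'); split; try exact: rtD.
by rewrite (pullbackD inj) E E' wedgeDr addrACA.
Qed.
Lemma logpoleZ (x : C) eta al be : logpole eta al be -> logpole (x *: eta) (x *: al) (x *: be).
Proof.
move=> [u [v [E hu hv]]]; exists (x *: u), (x *: v); split; try exact: rtZc.
by rewrite (pullback_scale inj) E scalerDr wedgeZc.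
Qed.

Lemma pull_wedge w eta al1 (e : bool) al be :
  pullback ch w = al1 + (e%:R : C) *: d0 -> is_oneform al1 ->
  pullback ch eta = al + wedge d0 be ->
  pullback ch (wedge w eta) = wedge al1 al + wedge d0 ((e%:R : C) *: al - wedge al1 be).
Proof.
move=> E h1 E'; have hd : is_oneform d0 by exact: dlog_is.
rewrite (pullback_wedge inj) {}E {}E'; move: (d0) hd => d hd.
rewrite !wedgeDl !wedgeDr wedgeNr.
rewrite scaleE !wedgeZl -!scaleE wedgeZc -addrA; congr (_ + _).
rewrite (wedge_sq be hd) scaler0 addr0 addrC; congr (_ + _).
exact: wedge_anti.
Qed.

Definition good_factor w : Prop := exists al1 (e : bool),
  [/\ pullback ch w = al1 + (e%:R : C) *: d0, is_oneform al1 & rt al1 al1].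
Definition bad_factor w : Prop := exists al1,
  [/\ pullback ch w = al1, is_oneform al1 & rt al1 0].
Definition logself eta : Prop := exists al be,
  [/\ pullback ch eta = al + wedge d0 be, rt al al & rt be be].

Lemma logself_pole eta : logself eta -> exists al be, logpole eta al be.
Proof. by move=> [al [be [E h1 h2]]]; exists al, be, al, be. Qed.

Lemma logself1 : logself (form1 C k).
Proof.
exists (form1 C k), 0; rewrite (pullback_form1 inj) wedge0r addr0; split=> //; [exact: rt1|exact: rt0].
Qed.

Lemma good_self w eta : good_factor w -> logself eta -> logself (wedge w eta).
Proof.
move=> [al1 [e [E h1 hw]]] [al [be [E' ha hb]]].
exists (wedge al1 al), ((e%:R : C) *: al - wedge al1 be); split.
- exact: pull_wedge.
- exact: rt_wedge.
by apply: rtB; [exact: rtZc|exact: rt_wedge].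
Qed.

Lemma good_zero w eta : good_factor w -> logpole eta 0 0 -> logpole (wedge w eta) 0 0.
Proof.
move=> [al1 [e [E h1 hw]]] [al [be [E' ha hb]]].
exists (wedge al1 al), ((e%:R : C) *: al - wedge al1 be); split.
- exact: pull_wedge.
- by rewrite -(wedge0r al1); exact: rt_wedge.
rewrite -[0]subr0; apply: rtB; first by rewrite -(scaler0 _ e%:R); exact: rtZc.
by rewrite -(wedge0r al1); exact: rt_wedge.
Qed.

Lemma bad_zero w eta al' be' : bad_factor w -> logpole eta al' be' -> logpole (wedge w eta) 0 0.
Proof.
move=> [al1 [E h1 hw]] [al [be [E' ha hb]]].
have E1 : pullback ch w = al1 + ((false%:R : C)) *: d0 by rewrite E scale0r addr0.
exists (wedge al1 al), ((false%:R : C) *: al - wedge al1 be); split.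
- exact: pull_wedge.
- by rewrite -(wedge0l al'); exact: rt_wedge.
rewrite scale0r sub0r -oppr0 -(wedge0l be'); apply: rtN; exact: rt_wedge.
Qed.

Lemma i0_block i j : i \in c j -> j != b -> i != i0.
Proof. by move=> ij nj; apply: contra nj => /eqP Ei; rewrite Ei in ij; apply/eqP; exact: (comp_disj hc ij ib). Qed.

Lemma dres0_var i : i != i0 -> dres [set i0]%SET (t i) (t i).
Proof. by move=> ni; have := dres_var C [set i0]%SET i; rewrite /killv inE (negPf ni). Qed.
Lemma dres0_uc i j : i \in c j -> dres [set i0]%SET (uc C c j i) (uc C c j i).
Proof.
move=> ij; rewrite /uc; case: (boolP (i == _)) => ni; first exact: dres1.
apply: dres0_var; case: (altP (j =P b)) => [E|]; last exact: (i0_block ij).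
by subst j; apply: contra ni => /eqP ->; rewrite -i0b.
Qed.
Lemma base_b i : i \in c b -> base (c b) i = i0.
Proof. by move=> hi; rewrite (base_eq i ib) -i0b. Qed.

Lemma free_i0 i : free_coord c i -> i != i0.
Proof. by move=> fi; apply: contraL ib => /eqP <-; move/forallP: fi. Qed.

Lemma good_b i : i \in c b -> good_factor (wf i b).
Proof.
move=> hi; exists (dlog (uc C c b i)), true; split; last first.
- by apply: rt_dlog; [exact: dres0_uc|exact: nz_uc].
- exact: dlog_is.
by rewrite (pull_wf_in z hc hi) base_b // scale1r.
Qed.
Lemma good_block i j : i \in c j -> j != b -> good_factor (wf i j).
Proof.
move=> ij nj; have bj := base_in ij.
exists (dlog (uc C c j i) + dlog (t (base (c j) i))), false; split.
- by rewrite (pull_wf_in z hc ij) scale0r addr0.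
- by apply: is_oneformD; exact: dlog_is.
apply: rtD; apply: rt_dlog; rewrite ?nz_uc ?nz_var //; first exact: dres0_uc.
by apply: dres0_var; exact: (i0_block bj).
Qed.
Lemma good_free i a : free_coord c i -> good_factor (wf i a).
Proof.
move=> fi; exists (dlog (t i - zc a)), false; split; last first.
- apply: rt_dlog; last exact: nz_var_cst.
  by apply: dresB; [apply: dres0_var; exact: free_i0|exact: dres_cst].
- exact: dlog_is.
by rewrite (pull_chart_wf z hc) chart_free // scale0r addr0.
Qed.
Lemma bad_b i a : i \in c b -> a != b -> bad_factor (wf i a).
Proof.
move=> hi na; exists (dlog (ch i - zc a)); split; last first.
- rewrite -(dlog_cst k (z b - z a)) cstFB; apply: rt_dlog; last by rewrite nz_zc // eq_sym.
  apply: dresB; last exact: dres_cst.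
  rewrite (chart_in _ hc hi) base_b // -[X in dres _ _ X]addr0 -(mul0r (uc C c b i)).
  apply: dresD; first exact: dres_cst.
  apply: dresM; last exact: dres0_uc.
  by have := dres_var C [set i0]%SET i0; rewrite /killv inE eqxx.
- exact: dlog_is.
exact: (pull_chart_wf z hc).
Qed.

Local Notation c' := (label_without c b).

Lemma in_c' i j : (i \in c' j) = (j != b) && (i \in c j).
Proof. by rewrite ffunE; case: eqP; rewrite ?inE. Qed.

Lemma index_c' : index_set c' = (index_set c :\ b)%SET.
Proof. by apply/setP => j; rewrite !inE ffunE; case: (j =P b) => //= _; rewrite /= eqxx. Qed.

Lemma comp_c' : comp c'.
Proof.
have /andP[/forallP h1 /forallP h2] := hc; apply/andP; split; apply/forallP => j.
  by rewrite ffunE; case: (j =P b) => [_|_]; [rewrite /= eqxx|exact: h1].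
apply/forallP => j'; apply/implyP => nj; rewrite disjoint_subset; apply/subsetP => i.
rewrite in_c' inE in_c' => /andP[_ ij]; apply: contra nj => /andP[_ ij'].
by apply/eqP; exact: (comp_disj hc ij ij').
Qed.

Lemma free_c' i : free_coord c' i = free_coord c i || (i \in c b).
Proof.
apply/forallP/orP => [h|[/forallP h j|hi j]].
- case: (boolP (i \in c b)) => hi; [by right|left]; apply/forallP => j.
  by have := h j; rewrite in_c'; case: (altP (j =P b)) => [->|].
- by rewrite in_c' (negPf (h j)) andbF.
rewrite in_c'; apply/negP => /andP[/negP nj ij]; apply: nj; apply/eqP; exact: (comp_disj hc ij hi).
Qed.

Definition goodb chi : bool := [forall (i | i \in c b), (chi i == None) || (chi i == Some b)].

(** Each factor of a monomial has a logarithmic pole along the block if its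
    colour is b, and is regular there otherwise. A coordinate of the block with
    a colour other than b restricts to the constant z_b, so that its dlog
    vanishes. *)
Lemma logpole_lam chi : colok c' chi ->
  if goodb chi then logself (lam z chi) else logpole (lam z chi) 0 0.
Proof.
move=> /forallP hcol; rewrite lam_prod -big_enum_ord.
have hgood i a : chi i = Some a -> i \notin c b \/ a = b -> good_factor (wf i a).
  move=> E hi; have [fi|[j ij]] := free_or c i; first exact: good_free.
  have := hcol i; rewrite E => /forallP hac.
  case: (altP (j =P b)) => [Ej|nj].
    by subst j; case: hi => [|->]; [rewrite ij|exact: good_b].
  by have := hac j; rewrite in_c' nj ij => /eqP ->; exact: good_block.
pose bad i := (i \in c b) && (chi i != None) && (chi i != Some b).
have -> : goodb chi = ~~ has bad (enum (supp chi)).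
  apply/forallP/hasPn => [h i _|h i].
    by rewrite /bad; have := h i; case: (i \in c b) => //=; case: (_ == None) => //= ->.
  apply/implyP => hi; case: (boolP (chi i == None)) => //= hN.
  by have := h i; rewrite mem_enum inE hN /bad hi hN negbK => /(_ isT).
have : {subset enum (supp chi) <= supp chi} by move=> i; rewrite mem_enum.
elim: (enum (supp chi)) => [_|i r IH sr]; first by rewrite big_nil; exact: logself1.
have is_ : i \in supp chi by apply: sr; rewrite mem_head.
rewrite big_cons /= negb_or; move: (is_); rewrite inE /bad /wc.
case E : (chi i) => [a|//] _ /=.
have {}IH := IH (fun x hx => sr x (mem_behead (s := i :: r) hx)).
case: (boolP (i \in c b)) => hi /=; last first.
  have gw : good_factor (wf i a) by apply: hgood E _; left.
  by case: ifP IH => _ h; [exact: good_self|exact: good_zero].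
case: (altP (Some a =P Some b)) => [[Ea]|nab] /=.
  have gw : good_factor (wf i a) by apply: hgood E _; right.
  by case: ifP IH => _ h; [exact: good_self|exact: good_zero].
have bw : bad_factor (wf i a) by apply: bad_b => //; apply: contraNneq nab => ->.
case: ifP IH => _ h; last exact: bad_zero h.
by have [al [be h']] := logself_pole h; exact: bad_zero h'.
Qed.

(** In the chart the Euler field of the block b is t_(i_0) d/dt_(i_0). *)
Lemma eul_chart i :
  ev1 (fun q => if q == i0 then t i0 else 0) (dform (ch i)) = substF ch (eul z c b i).
Proof.
have -> f : ev1 (fun q => if q == i0 then t i0 else 0) (dform f) = t i0 * derivF i0 f.
  rewrite /ev1 (bigD1 i0) //= eqxx dform1 big1 ?addr0 // => q /negPf ->.
  by rewrite mul0r.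
have duc j q : q \in c j -> derivF i0 (uc C c j q) = 0.
  move=> qj; rewrite /uc; case: (boolP (q == _)) => nq; first by rewrite -(cstF1 C k) derivF_cst.
  rewrite derivF_var; case: eqP => // E; move: nq; rewrite -E => nq.
  by move: nq; rewrite -E in qj; rewrite (comp_disj hc qj ib) -i0b eqxx.
rewrite /eul; case: ifP => hi.
  rewrite (substB_cst z _ _ inj) (chart_in _ hc hi) base_b // [in RHS]addrC addKr.
  by rewrite derivFD derivF_cst add0r derivFM derivF_var eqxx mul1r duc // mulr0 addr0.
rewrite (substF0 inj); have [fi|[j ij]] := free_or c i.
  by rewrite chart_free // derivF_var eq_sym (negPf (free_i0 fi)) mulr0.
rewrite (chart_in _ hc ij) derivFD derivF_cst add0r derivFM duc // mulr0 addr0 derivF_var.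
have nj : j != b by apply: contraFN hi => /eqP <-.
by rewrite eq_sym (negPf (i0_block (base_in ij) nj)) mul0r mulr0.
Qed.

Lemma logself_contr eta : logself eta -> exists al', logpole eta al' (pullback ch (contr (eul z c b) eta)).
Proof.
move=> [al [be [E ha hb]]]; exists al, al, be; split=> //.
rewrite -(pullback_contr inj _ eul_chart) E.
suff -> : contr (fun q => if q == i0 then t i0 else 0) (al + wedge d0 be) = be by [].
rewrite /contr (bigD1 i0) //= eqxx big1 => [|q /negPf ->]; last by rewrite fscale0.
have an0 x : rt x x -> anni i0 x = 0.
  move=> [_ h]; apply: formP => S; rewrite ffunE form0E; case: ifP => // _.
  by have := h (i0 |: S)%SET; rewrite dis1 !inE eqxx => ->; rewrite mulr0.
rewrite addr0 anniD an0 // add0r wedge_d0 anniZ anni_crea an0 // crea0 subr0 fscaleA.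
by rewrite divff_nz ?nz_var // fscale1.
Qed.

Lemma contrZc v (x : C) eta : contr v (x *: eta) = x *: contr v eta.
Proof. by rewrite !scaleE contrZ. Qed.

(** The residue of a form with logarithmic pole is its contraction with t_(i_0)
    d/dt_(i_0). *)
Lemma res_tau (A : {set 'I_n} -> 'X_{1..n} -> C) :
  res z c b (tau n0 m z A c')
  = \sum_(chi | valid c' chi && goodb chi) A (index_set c') (Kof c' chi) *: contr (eul z c b) (hlam c' chi).
Proof.
rewrite /res; case: pickP => [i1 /andP[hV h1]|h]; last first.
  by have := h i0; rewrite inE ib andbT => /existsP[]; exists b; rewrite ib -i0b eqxx.
have -> : i1 = i0.
  move: hV; rewrite inE => /existsP[j /andP[ij /eqP ->]].
  by rewrite (comp_disj hc ij h1) (base_eq i1 ib) -i0b.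
rewrite -[RHS](coch_chartK z hc); congr (pullback _ _).
suff [al h] : exists al, logpole (tau n0 m z A c') al (\sum_(chi | valid c' chi)
    A (index_set c') (Kof c' chi) *: (if goodb chi then pullback ch (contr (eul z c b) (hlam c' chi)) else 0)).
  rewrite (logpole_residue h) (pullback_sum inj) [RHS]big_mkcondr; apply: eq_bigr => chi _.
  by case: ifP => _; rewrite ?scaler0 // (pullback_scale inj).
rewrite ffunE comp_c'.
apply: (big_ind2 (fun x y => exists al, logpole x al y)) => [|x y x' y' [al h] [al' h']|chi hv].
- exists 0, 0, 0; rewrite (pullback0 inj) wedge0r addr0; split=> //; exact: rt0.
- by exists (al + al'); exact: logpoleD.
have [e ->] := hlam_lam z chi comp_c'; have [hcol _ _] := and3P hv.
have := logpole_lam hcol; case: ifP => _ h.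
  have [al h2] := logself_contr h; exists (A (index_set c') (Kof c' chi) *: ((-1) ^+ e *: al)).
  by apply: logpoleZ; rewrite contrZc (pullback_scale inj); exact: logpoleZ.
exists (A (index_set c') (Kof c' chi) *: ((-1) ^+ e *: 0)); apply: logpoleZ.
by rewrite -[X in logpole _ _ X](scaler0 _ ((-1) ^+ e)); exact: logpoleZ.
Qed.

End Residues.

(** * The residue of a skew-symmetric chain *)

Section ResidueOfTau.
Variables (C : numFieldType) (n k n0 : nat) (m : 'I_n -> nat) (z : 'I_n -> C).
Hypothesis z_inj : injective z.
Local Notation form := (ratform C k).
Local Notation t i := (varF C (i : 'I_k)).
Local Notation zc a := (cstF k (z a)).
Local Notation label := (label n k).
Local Notation comp := (is_component n0 m).
Local Notation colt := {ffun 'I_k -> option 'I_n}.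
Implicit Types (i q o : 'I_k) (a j : 'I_n) (eta : form) (r : seq 'I_k).
Implicit Types (chi : {ffun 'I_k -> option 'I_n}).
Variables (c : label) (b : 'I_n).
Hypotheses (hc : comp c) (hb : b \in index_set c).
Local Notation c' := (label_without c b).
Local Notation hl := (hlam z).
Local Notation vol := (vol C k).

Lemma annis_anni r o eta : o \notin r -> annis r (anni o eta) = (-1) ^+ size r *: anni o (annis r eta).
Proof.
elim: r => [|q r IH] /=; first by rewrite expr0 scale1r.
rewrite inE negb_or => /andP[noq /IH ->]; rewrite scaleE anniZ -scaleE anni_anti 1?eq_sym //.
by rewrite exprS mulN1r scalerN scaleNr.
Qed.

Definition full chi : bool := [forall (i | i \in c b), chi i == Some b].
Lemma fullP chi : reflect (forall i, i \in c b -> chi i = Some b) (full chi).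
Proof.
apply: (iffP forallP) => h i; first by move=> hi; have := h i; rewrite hi => /eqP.
by apply/implyP => /h ->.
Qed.

Let ex_i : exists i0, i0 \in c b /\ i0 = base (c b) i0.
Proof.
move: hb; rewrite inE => /set0Pn[i ib]; exists (base (c b) i).
by split; [exact: base_in|rewrite (base_eq (base (c b) i) ib)].
Qed.
Let hc' : comp c'. Proof. by have [i0 [h1 h2]] := ex_i; exact: comp_c'. Qed.
Let index_c : index_set c' = (index_set c :\ b)%SET.
Proof. by have [i0 [h1 h2]] := ex_i; exact: index_c'. Qed.
Let free_c i : free_coord c' i = free_coord c i || (i \in c b).
Proof. exact: (free_c' b hc). Qed.
Let mem_c' i j : (i \in c' j) = (j != b) && (i \in c j).
Proof. exact: in_c'. Qed.

Lemma fullb_c' o : o \in c b -> free_coord c' o.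
Proof. by move=> ob; rewrite free_c ob orbT. Qed.

Lemma nset_other chi j : j != b -> nset c' chi (Some j) = nset c chi (Some j).
Proof. by move=> nj; apply/setP => i; rewrite !in_set mem_c' nj. Qed.

Lemma not_in_block o j : o \in c b -> j != b -> o \notin c j.
Proof. by move=> ob nj; apply: contra nj => oj; apply/eqP; exact: (comp_disj hc oj ob). Qed.

Lemma nset_b chi o : full chi -> o \in c b -> nset c (setc chi o None) (Some b) = [set o]%SET.
Proof.
move=> /fullP hf ob; apply/setP => i; rewrite in_set in_set1 setcE.
case: (altP (i =P o)) => [->|_]; first by rewrite ob.
by case: (boolP (i \in c b)) => // /hf ->.
Qed.

Lemma nset_None_c chi o : full chi -> o \in c b -> nset c (setc chi o None) None = nset c' chi None.
Proof.
move=> /fullP hf ob; apply/setP => i; rewrite !in_set setcE free_c.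
case: (altP (i =P o)) => [->|_]; first by rewrite (hf _ ob) (block_nfree ob) andbF.
case: (boolP (i \in c b)) => ib; last by rewrite orbF.
by rewrite (hf _ ib) !andbF.
Qed.

Lemma validP c1 chi : reflect [/\ colok c1 chi, forall j, j \in index_set c1 -> #|nset c1 chi (Some j)| = 1%N
   & (#|nset c1 chi None| <= 1)%N] (valid c1 chi).
Proof.
apply: (iffP and3P) => [[h1 /forallP h2 h3]|[h1 h2 h3]]; split=> //.
  by move=> j hj; apply/eqP; have /implyP := h2 j; apply.
by apply/forallP => j; apply/implyP => /h2 ->.
Qed.

(** Uncolouring one coordinate of a completely coloured block is a bijection
    from pairs onto the valid colourings of c. *)
Lemma valid_full chi o : o \in c b ->
  valid c (setc chi o None) && (chi o == Some b) = full chi && valid c' chi.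
Proof.
move=> ob; apply/andP/andP => [[hv /eqP co]|[hf hv]].
  have [hcol h1 h0] := validP _ _ hv.
  have hf : full chi.
    apply/fullP => i ib; case: (altP (i =P o)) => [->//|nio].
    have := colok_in hc hcol ib; rewrite setcE (negPf nio) => -[hi|//].
    have /eqP/cards1P[x Ex] := h1 b hb.
    have : i \in nset c (setc chi o None) (Some b) by rewrite in_set ib setcE (negPf nio) hi eqxx.
    have : o \in nset c (setc chi o None) (Some b) by rewrite in_set ob setcE eqxx.
    by rewrite Ex !in_set1 => /eqP Eo /eqP Ei; rewrite Ei Eo eqxx in nio.
  split=> //; apply/validP; split.
  - apply/forallP => i; case E : (chi i) => [a|//]; apply/forallP => j; apply/implyP.
    rewrite mem_c' => /andP[nj ij].
    have nio : i != o by apply: contraNneq nj => Ei; rewrite Ei in ij; apply/eqP; exact: (comp_disj hc ij ob).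
    have := forallP hcol i; rewrite setcE (negPf nio) E => /forallP/(_ j).
    by rewrite ij.
  - move=> j; rewrite index_c in_setD1 => /andP[nj hj]; rewrite nset_other // -(h1 j hj).
    by rewrite nset_setc_block // not_in_block.
  by rewrite -(nset_None_c hf ob).
have [hcol h1 h0] := validP _ _ hv; have /fullP hf' := hf.
split; last by rewrite hf'.
apply/validP; split.
- apply/forallP => i; rewrite setcE; case: eqP => // _; case E : (chi i) => [a|//].
  apply/forallP => j; apply/implyP => ij; case: (altP (j =P b)) => [Ej|nj].
    by subst j; move: E; rewrite hf' // => -[->].
  by have := forallP hcol i; rewrite E => /forallP/(_ j); rewrite mem_c' nj ij.
- move=> j hj; case: (altP (j =P b)) => [->|nj]; first by rewrite nset_b // cards1.
  rewrite nset_setc_block ?not_in_block // -nset_other // h1 // index_c in_setD1 nj; exact: hj.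
by rewrite nset_None_c.
Qed.

(** The exponent K with m_b + 1 more coordinates of colour b: those of the block
    once it is dissolved. *)
Definition shiftK (K : 'X_{1..n}) : 'X_{1..n} := [multinom (K a + (if a == b then (m b).+1 else 0))%N | a < n].

Lemma card_b : #|c b| = (m b).+1.
Proof. by rewrite (card_block hc) hb. Qed.

Lemma Kof_full chi o : full chi -> o \in c b -> Kof c' chi = shiftK (Kof c (setc chi o None)).
Proof.
move=> /fullP hf ob; apply/mnmP => a; rewrite !mnmE -card_b.
have E : [set i | free_coord c' i && (chi i == Some a)]%SET
  = ([set i | free_coord c i && (setc chi o None i == Some a)] :|: (if a == b then c b else set0))%SET.
  apply/setP => i; rewrite !in_set free_c setcE.
  case: (boolP (i \in c b)) => ib.
    rewrite orbT (block_nfree ib) (hf _ ib) /=; rewrite (inj_eq (@Some_inj _)) eq_sym.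
    by case: (altP (a =P b)) => // _; rewrite ?inE ?ib.
  rewrite orbF (_ : i == o = false); last by apply: contraNF ib => /eqP ->.
  by case: (altP (a =P b)) => _; rewrite ?(negPf ib) ?inE orbF.
rewrite E cardsU (_ : _ :&: _ = set0)%SET; last first.
  apply/setP => i; rewrite !inE; case: (altP (a =P b)) => _; rewrite ?inE ?andbF //.
  by case: (boolP (i \in c b)) => ib; rewrite ?andbF // (block_nfree ib).
rewrite cards0 subn0; congr (_ + _)%N.
by case: ifP => _ //; rewrite cards0.
Qed.

(** The uncoloured coordinate of the new block b is inserted after those of the
    blocks j < b, whence the sign. *)
Lemma os_slot chi o : full chi -> o \in c b -> valid c' chi ->
  hl c (setc chi o None) = (-1) ^+ #|[set j in index_set c | (j < b)%N]%SET|
     *: fscale (gfun z (setc chi o None)) (anni o (annis (os c' chi) vol)).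
Proof.
move=> hf ob hv; have /fullP hf' := hf; have [s1 [s2 [E1 E2 Es]]] := enumD1 hb.
have notb j : j \in s1 ++ s2 -> j != b.
  by rewrite -E2 mem_enum in_setD1 => /andP[].
have Eos s : {subset s <= s1 ++ s2} ->
   [seq enum (nset c (setc chi o None) x) | x <- [seq Some j | j <- s]]
   = [seq enum (nset c' chi x) | x <- [seq Some j | j <- s]].
  move=> hs; rewrite -!map_comp; apply/eq_in_map => j /hs/notb nj /=.
  have /= -> // : nset c (setc chi o None) (Some j) = nset c' chi (Some j).
  by rewrite nset_setc_block ?not_in_block // -nset_other.
have so1 : {subset s1 <= s1 ++ s2} by move=> x; rewrite mem_cat => ->.
have so2 : {subset s2 <= s1 ++ s2} by move=> x; rewrite mem_cat orbC => ->.
pose r1 := flatten [seq enum (nset c' chi x) | x <- [seq Some j | j <- s1]].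
pose r2 := flatten [seq enum (nset c' chi x) | x <- [seq Some j | j <- s2]] ++ enum (nset c' chi None).
have O1 : os c (setc chi o None) = r1 ++ o :: r2.
  have -> : os c (setc chi o None) = flatten [seq enum (nset c (setc chi o None) x) |
      x <- [seq Some j | j <- s1] ++ Some b :: ([seq Some j | j <- s2] ++ [:: None])].
    by rewrite /os /slots E1 map_cat -cats1 -catA.
  rewrite map_cat flatten_cat map_cons map_cat Eos // -[flatten (_ :: _)]/(_ ++ flatten _) flatten_cat Eos //.
  by rewrite nset_b // enum_set1 -[map _ [:: None]]/([:: _]) nset_None_c // -[flatten [:: _]]/(_ ++ _) cats0.
have O2 : os c' chi = r1 ++ r2.
  have -> : os c' chi = flatten [seq enum (nset c' chi x) |
      x <- [seq Some j | j <- s1] ++ ([seq Some j | j <- s2] ++ [:: None])].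
    by rewrite /os /slots index_c E2 map_cat -cats1 -catA.
  rewrite map_cat flatten_cat map_cat flatten_cat -[map _ [:: None]]/([:: _]).
  by rewrite -[flatten [:: _]]/(_ ++ _) cats0.
have sz : size r1 = size s1.
  rewrite size_flatten /shape -!map_comp sumnE big_map -sum1_size; apply: eq_big_seq => j js.
  have [_ h1 _] := validP _ _ hv; rewrite /= -cardE; apply: h1.
  by rewrite index_c -mem_enum E2 so1.
rewrite /hlam O1 O2 [annis (r1 ++ o :: r2) _]annis_cat [annis (r1 ++ r2) _]annis_cat -[annis (o :: r2) _]/(anni o (annis r2 _)) annis_anni; last first.
  have := os_uniq (setc chi o None) hc; rewrite O1 cat_uniq /= => /and3P[_ ].
  by rewrite negb_or => /andP[].
by rewrite sz Es !scaleE !fscaleA mulrC.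
Qed.

Lemma valid_half chi o : o \in c b ->
  [&& valid c' (setc chi o None), goodb c b (setc chi o None) & ~~ full (setc chi o None)] && (chi o == Some b)
  = full chi && (valid c' chi && (nset c' chi None == set0)).
Proof.
move=> ob; have fo := fullb_c' ob; have nco j : o \notin c' j by move/forallP: fo.
apply/andP/andP => [[/and3P[hv /forallP hg _] /eqP co]|[hf /andP[hv /eqP h0']]].
  have [hcol h1 h0] := validP _ _ hv; rewrite nset_setc_None // in h0.
  have E0 : (o |: nset c' chi None = [set o])%SET.
    apply/eqP; rewrite eq_sym eqEcard cards1 h0 andbT sub1set; exact: setU11.
  have hn i : i \in nset c' chi None -> i = o.
    by move=> hi; apply/set1P; rewrite -E0 inE hi orbT.
  have hno : nset c' chi None = set0.
    apply/setP => i; rewrite in_set0; apply/negP => hi; have := hi; rewrite (hn _ hi) in_set co.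
    by rewrite andbF.
  split; last first.
    rewrite hno eqxx andbT; apply/validP; split; last by rewrite hno cards0.
      by rewrite -(colok_setc chi None fo).
    by move=> j hj; rewrite -(h1 j hj) nset_setc_block.
  apply/fullP => i ib; have := hg i; rewrite ib setcE; case: (altP (i =P o)) => [->//|nio] /=.
  case/orP => /eqP // hi; have : i \in nset c' chi None by rewrite in_set fullb_c' // hi eqxx.
  by move/hn => E; rewrite E eqxx in nio.
have [hcol h1 h0] := validP _ _ hv; have /fullP hf' := hf; split; last by rewrite hf'.
apply/and3P; split.
- apply/validP; split; first by rewrite colok_setc.
    by move=> j hj; rewrite nset_setc_block // h1.
  by rewrite nset_setc_None // h0' setU0 cards1.
- apply/forallP => i; apply/implyP => ib; rewrite setcE; case: (i =P o) => // _.
  by rewrite hf' // eqxx orbT.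
by apply/negP => /fullP/(_ o ob); rewrite setcE eqxx.
Qed.

(** Colourings with the uncoloured free coordinate inside the new block add up
    to a contraction with the Euler field of b, which is contracted again. *)
Lemma half_zero (A : 'X_{1..n} -> C) :
  \sum_(chi : colt | [&& valid c' chi, goodb c b chi & ~~ full chi])
    A (Kof c' chi) *: contr (eul z c b) (hl c' chi) = 0.
Proof.
rewrite (@sum_one_None _ _ _ (c b)) => [|chi /and3P[hv /forallP hg nf]]; last first.
  have [hcol h1 h0] := validP _ _ hv; apply/eqP; rewrite eqn_leq; apply/andP; split.
    apply: leq_trans h0; apply: subset_leq_card; apply/subsetP => i; rewrite in_set => /andP[ib hi].
    by rewrite in_set fullb_c'.
  rewrite card_gt0; apply: contra nf => /eqP E; apply/fullP => i ib.
  have := hg i; rewrite ib /= => /orP[hi|/eqP //].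
  by move/setP/(_ i): E; rewrite in_set0 in_set ib hi.
transitivity (\sum_(o in c b) \sum_(chi : colt | full chi && (valid c' chi && (nset c' chi None == set0)))
   A (Kof c' (setc chi o None)) *: contr (eul z c b) (hl c' (setc chi o None))).
  apply: eq_bigr => o ob; rewrite (sum_setc o (Some b)); apply: eq_bigl => chi.
  exact: valid_half.
rewrite exchange_big /=; apply: big1 => chi /andP[hf /andP[hv /eqP hn0]].
have /fullP hf' := hf; have hn : nset c' chi None = set0 := hn0.
have [A0 EA] : exists x : C, forall o, o \in c b -> A (Kof c' (setc chi o None)) = x.
  exists (A [multinom (Kof c' chi a - (a == b))%N | a < n]) => o ob; congr A; apply/mnmP => a; rewrite !mnmE.
  have ff := fullb_c' ob; have fo := hf' _ ob.
  have -> : [set i | free_coord c' i && (setc chi o None i == Some a)]%SET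
     = ([set i | free_coord c' i && (chi i == Some a)] :\ o)%SET.
    by apply/setP => i; rewrite in_setD1 !in_set setcE; case: (altP (i =P o)) => /= _; rewrite ?andbF.
  rewrite [in RHS](cardsD1 o) in_set ff fo (inj_eq (@Some_inj _)) eq_sym /=.
  by rewrite addKn.
pose r := os c' chi.
have Eos o : o \in c b -> os c' (setc chi o None) = r ++ [:: o].
  move=> ob; rewrite /r /os /slots !map_rcons !flatten_rcons.
  rewrite nset_setc_None ?fullb_c' // hn setU0 enum_set1 enum_set0 cats0; congr (flatten _ ++ _).
  apply/eq_in_map => x /mapP[j hj ->]; rewrite nset_setc_block //.
  by move/forallP: (fullb_c' ob).
have nr o : o \in c b -> o \notin r by move=> ob; rewrite /r mem_os hf'.
have E : \sum_(o in c b) A (Kof c' (setc chi o None)) *: contr (eul z c b) (hl c' (setc chi o None))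
   = (A0 * (-1) ^+ size r) *: contr (eul z c b) (contr (eul z c b) (hl c' chi)).
  rewrite /hlam (contr_gfun _ _ hf') contr_sum scaler_sumr; apply: eq_bigr => o ob.
  rewrite EA // -scalerA; congr (_ *: _); rewrite -contrZc; congr contr.
  by rewrite /hlam Eos // annis_cat /= annis_anni ?nr // !scaleE !fscaleA mulrC.
by rewrite E contr_sq scaler0.
Qed.

Lemma res_tau_hlam (A : {set 'I_n} -> 'X_{1..n} -> C) :
  res z c b (tau n0 m z A c') = \sum_(chi | valid c chi)
   ((-1) ^+ #|[set j in index_set c | (j < b)%N]%SET| * A (index_set c :\ b)%SET (shiftK (Kof c chi))) *: hl c chi.
Proof.
have [i0 [h1 h2]] := ex_i; rewrite (res_tau z_inj hc h1 h2) index_c.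
rewrite (bigID full) /= [X in _ + X](eq_bigl (fun chi => [&& valid c' chi, goodb c b chi & ~~ full chi])); last first.
  by move=> chi; rewrite andbA.
rewrite half_zero addr0 [RHS](@sum_one_None _ _ _ (c b)) => [|chi hv]; last first.
  by have [_ h _] := validP _ _ hv; exact: h.
transitivity (\sum_(o in c b) \sum_(chi : colt | full chi && valid c' chi)
   ((-1) ^+ #|[set j in index_set c | (j < b)%N]%SET| * A (index_set c :\ b)%SET (shiftK (Kof c (setc chi o None))))
     *: hl c (setc chi o None)); last first.
  apply: eq_bigr => o ob; rewrite (sum_setc o (Some b)); apply: eq_bigl => chi.
  by rewrite valid_full.
rewrite exchange_big /=; apply: eq_big => [chi|chi /andP[/andP[hv _] hf]].
  rewrite andbC; case: (boolP (full chi)) => //= /fullP hf; rewrite (_ : goodb c b chi) ?andbT //.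
  by apply/forallP => i; apply/implyP => /hf ->; rewrite eqxx orbT.
have /fullP hf' := hf; rewrite /hlam (contr_gfun _ _ hf') scaler_sumr; apply: eq_bigr => o ob.
rewrite -(Kof_full hf ob) -[fscale (gfun z (setc _ _ _)) (annis (os c _) _)]/(hl c _) (os_slot hf ob hv).
by rewrite scalerA mulrAC -expr2 sqrr_sign mul1r.
Qed.

End ResidueOfTau.

Lemma partial_fraction (K : fieldType) (x y w h : K) : x - y != 0 -> x - w != 0 -> y - w != 0 ->
  (x - y)^-1 * ((y - w)^-1 * h - (x - w)^-1 * h) = (x - w)^-1 * ((y - w)^-1 * h).
Proof. by move=> h1 h2 h3; field; rewrite h1 h2 h3. Qed.

(** * Multiplication by omega_a *)

Section OmegaTau.
Variables (C : numFieldType) (n k n0 : nat) (m : 'I_n -> nat) (z : 'I_n -> C).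
Hypothesis z_inj : injective z.
Local Notation form := (ratform C k).
Local Notation t i := (varF C (i : 'I_k)).
Local Notation zc a := (cstF k (z a)).
Local Notation label := (label n k).
Local Notation comp := (is_component n0 m).
Local Notation colt := {ffun 'I_k -> option 'I_n}.
Implicit Types (i q o : 'I_k) (a j : 'I_n) (eta : form) (r : seq 'I_k).
Implicit Types (chi : {ffun 'I_k -> option 'I_n}).
Variables (c : label).
Hypotheses (hc : comp c).
Local Notation hl := (hlam z c).
Local Notation vol := (vol C k).
Local Notation xf := (xf C).
Local Notation wf := (wf z).

Lemma crea_annis0 i r : uniq r -> i \notin r -> crea i (annis r vol) = 0.
Proof.
move=> ur ir; have [e ->] := annis_vol C ur.
by rewrite scaleE creaZ crea_dX !inE ir fscaler0.
Qed.

Lemma crea_annis i r1 r2 : uniq (r1 ++ i :: r2) ->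
  crea i (annis (r1 ++ i :: r2) vol) = (-1) ^+ size r1 *: annis (r1 ++ r2) vol.
Proof.
move=> u; have [u1 [i1 i2] u2] : [/\ uniq (r1 ++ r2), i \notin r1 /\ i \notin r2 & i \notin r1 ++ r2].
  move: u; rewrite uniq_catC cat_cons cons_uniq uniq_catC !mem_cat !negb_or => /andP[/andP[-> ->] ->].
  by split.
rewrite annis_cat -[annis (i :: r2) _]/(anni i (annis r2 vol)) annis_anni // -annis_cat.
rewrite scaleE creaZ; congr (fscale _ _).
have -> eta : crea i (anni i eta) = eta - anni i (crea i eta).
  by rewrite anni_crea opprB addrC subrK.
by rewrite crea_annis0 // anni0 subr0.
Qed.

Lemma crea_hlam0 i chi : chi i != None -> crea i (hl chi) = 0.
Proof.
by move=> hi; rewrite /hlam creaZ crea_annis0 ?fscaler0 ?(os_uniq _ hc) // mem_os.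
Qed.

Definition gterm i q chi : form := if chi i == None then (if chi q is Some a then wedge (wf i a) (hl chi) else 0) else 0.

Lemma slot_of i : exists2 x, x \in slots c & forall chi q, cls c i q -> chi q = None -> q \in nset c chi x.
Proof.
have [fi|[j ij]] := free_or c i.
  exists None; first by rewrite mem_slots.
  by move=> chi q iq hq; rewrite inE hq -(cls_free q fi) iq.
exists (Some j); first by rewrite mem_slots (index_setE ij).
by move=> chi q iq hq; rewrite inE hq -(cls_in _ hc ij) iq.
Qed.

Lemma one_None i q chi : valid c chi -> cls c i q -> chi i = None -> chi q = None -> i = q.
Proof.
move=> hv iq hi hq; have [x hx h] := slot_of i.
have hii := h chi i (cls_refl c i) hi; have hqq := h chi q iq hq.
have := valid_card hv hx; case/enum_card1 => [E|[y E]]; first by rewrite E inE in hii.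
by move: hii hqq; rewrite E !inE => /eqP -> /eqP ->.
Qed.

Lemma os_tperm i q chi : valid c chi -> cls c i q ->
  os c (pchi (tperm i q) chi) = map (tperm i q) (os c chi).
Proof.
move=> hv iq; have := os_pc (tperm i q) hv; rewrite (tperm_cls_pc iq) => <-.
rewrite -map_comp map_id_in // => x _ /=; exact: tpermK.
Qed.

(** The transposition exchanges the uncoloured coordinate i with q of colour a.
    The two contractions are equal up to the functions 1/(t_q - z_a) and 1/(t_i
    - z_a), whose difference divided by t_i - t_q is their product. *)
Lemma pair_None i q a chi : valid c chi -> i != q -> cls c i q -> chi i = None -> chi q = Some a ->
  wedge (xf i q) (hl chi + hl (pchi (tperm i q) chi)) = wedge (wf i a) (hl chi).
Proof.
move=> hv niq iq hi hq; set chi' := pchi _ _.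
have hi' : chi' i = Some a by rewrite ffunE tpermL.
have hq' : chi' q = None by rewrite ffunE tpermR.
have io : i \in os c chi by rewrite mem_os hi.
have u := os_uniq chi hc.
have [r1 [r2 Eo]] : exists r1 r2, os c chi = r1 ++ i :: r2.
  by case/splitPr: io => r1 r2; exists r1, r2.
have Eo' : os c chi' = r1 ++ q :: r2.
  rewrite /chi' os_tperm // Eo map_cat /= tpermL.
  have fix_ x : x \in r1 ++ r2 -> tperm i q x = x.
    move=> hx; apply: tpermD.
      apply: contraTneq hx => <-; move: u; rewrite Eo uniq_catC /= cat_uniq.
      by rewrite mem_cat negb_or mem_cat negb_or => /andP[/andP[-> ->]].
    have : x \in os c chi by rewrite Eo; move: hx; rewrite !mem_cat inE => /orP[] ->; rewrite ?orbT.
    by rewrite mem_os; apply: contraTneq => <-; rewrite hq.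
  congr (_ ++ _ :: _); rewrite map_id_in // => x hx; apply: fix_; rewrite mem_cat hx ?orbT //.
rewrite Eo in u.
have u' : uniq (r1 ++ q :: r2) by rewrite -Eo'; exact: (os_uniq _ hc).
set h0 := gfun z (setc chi q None).
have g1 : gfun z chi = (t q - zc a)^-1 * h0.
  by rewrite /h0 -(gfun_setN z hq) mulrA [_^-1 * _]mulrC divff_nz ?nz_var_cst // mul1r.
have g2 : gfun z chi' = (t i - zc a)^-1 * h0.
  have -> : h0 = gfun z (setc chi' i None).
    congr gfun; apply/ffunP => x; rewrite !setcE ffunE.
    by case: tpermP => [->|->|/eqP/negPf -> /eqP/negPf ->]; rewrite ?eqxx ?hi ?hq //; case: eqP.
  by rewrite -(gfun_setN z hi') mulrA [_^-1 * _]mulrC divff_nz ?nz_var_cst // mul1r.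
have e1 : crea i (hl chi) = fscale (gfun z chi) ((-1) ^+ size r1 *: annis (r1 ++ r2) vol).
  by rewrite /hlam creaZ Eo crea_annis.
have e2 : crea q (hl chi') = fscale (gfun z chi') ((-1) ^+ size r1 *: annis (r1 ++ r2) vol).
  by rewrite /hlam creaZ Eo' crea_annis.
rewrite wedge_xf wedge_wf !creaD [crea q (hl chi)]crea_hlam0 ?hq // [crea i (hl chi')]crea_hlam0 ?hi' //.
rewrite addr0 add0r e1 e2 -fscaleN -fscaleDl !fscaleA; congr fscale.
rewrite g1 g2; apply: (congr1 (fun u => u * _)); apply: partial_fraction; rewrite -nzE; [exact: nz_var_sub|exact: nz_var_cst|exact: nz_var_cst].
Qed.

Lemma pair_id i q chi : valid c chi -> i != q -> cls c i q ->
  wedge (xf i q) (hl chi + hl (pchi (tperm i q) chi)) = gterm i q chi + gterm q i chi.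
Proof.
move=> hv niq iq; rewrite /gterm; case Ei : (chi i) => [a|]; case Eq : (chi q) => [a'|] /=.
- rewrite wedge_xf !creaD !crea_hlam0 ?ffunE ?tpermL ?tpermR ?Ei ?Eq //.
  by rewrite subrr fscaler0 addr0.
- rewrite xfC tpermC (pair_None hv _ _ Eq Ei) ?add0r // 1?eq_sym //.
  by rewrite cls_sym.
- by rewrite (pair_None hv niq iq Ei Eq) addr0.
by move: niq; rewrite (one_None hv iq Ei Eq) eqxx.
Qed.

Variable A : {set 'I_n} -> 'X_{1..n} -> C.
Local Notation J := (index_set c).
Local Notation Ac chi := (A J (Kof c chi)).
Local Notation p := #|J|.

Lemma pair_sum i q : i != q -> cls c i q ->
  wedge (xf i q) (tau n0 m z A c) *+ 2 = \sum_(chi | valid c chi) Ac chi *: (gterm i q chi + gterm q i chi).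
Proof.
move=> niq iq; rewrite ffunE hc wedge_sumr mulr2n.
rewrite [X in _ + X](reindex _ (onW_bij _ (@pchi_bij n k (tperm i q)))) /=.
rewrite [X in _ + X](eq_bigl (valid c)); last by move=> chi; rewrite -{1}(tperm_cls_pc iq) valid_pc.
rewrite -big_split; apply: eq_bigr => chi hv /=.
have -> : Kof c (pchi (tperm i q) chi) = Kof c chi by rewrite -{1}(tperm_cls_pc iq) Kof_pc.
by rewrite !wedgeZc -scalerDr -wedgeDr pair_id.
Qed.

Lemma mul2_inj (x y : form) : x *+ 2 = y *+ 2 -> x = y.
Proof.
rewrite -!(scaler_nat 2) => E; have := congr1 (fun u : form => (2%:R : C)^-1 *: u) E.
by rewrite !scalerA mulVf ?scale1r // pnatr_eq0.
Qed.

Lemma pairs_sum : \sum_i \sum_(q | (q != i) && cls c i q) wedge (xf i q) (tau n0 m z A c)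
  = \sum_(chi | valid c chi) Ac chi *: \sum_i \sum_(q | (q != i) && cls c i q) gterm i q chi.
Proof.
apply: mul2_inj; rewrite -sumrMnl.
transitivity (\sum_i \sum_(q | (q != i) && cls c i q) \sum_(chi | valid c chi) Ac chi *: (gterm i q chi + gterm q i chi)).
  apply: eq_bigr => i _; rewrite -sumrMnl; apply: eq_bigr => q /andP[nq iq].
  by rewrite pair_sum // eq_sym.
transitivity (\sum_(chi | valid c chi) Ac chi *: (\sum_i \sum_(q | (q != i) && cls c i q) (gterm i q chi + gterm q i chi))).
  under eq_bigr => i _ do rewrite exchange_big /=.
  rewrite exchange_big /=; apply: eq_bigr => chi _; rewrite scaler_sumr; apply: eq_bigr => i _.
  by rewrite scaler_sumr.
rewrite -sumrMnl; apply: eq_bigr => chi _; rewrite scalerMnr; congr (_ *: _).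
rewrite mulr2n; transitivity (\sum_i \sum_(q | (q != i) && cls c i q) gterm i q chi
   + \sum_i \sum_(q | (q != i) && cls c i q) gterm q i chi).
  by rewrite -big_split; apply: eq_bigr => i _; rewrite big_split.
congr (_ + _); rewrite (exchange_big_dep predT) //=; apply: eq_bigr => i _; apply: eq_bigl => q.
by rewrite eq_sym cls_sym.
Qed.

Lemma gterm_sum i chi : \sum_(q | (q != i) && cls c i q) gterm i q chi
  = \sum_a (if chi i == None then #|[set q | cls c i q && (chi q == Some a)]%SET| else 0%N)%:R *: wedge (wf i a) (hl chi).
Proof.
rewrite /gterm; case: (altP (chi i =P None)) => hi; last first.
  by rewrite !big1 // => a _; rewrite scale0r.
transitivity (\sum_(q | cls c i q) \sum_(a | chi q == Some a) wedge (wf i a) (hl chi)).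
  rewrite [RHS](bigD1 i) ?cls_refl //= [X in X + _]big_pred0 ?add0r; last by move=> a; rewrite hi.
  apply: eq_big => [q|q _]; first by rewrite andbC.
  case: (chi q) => [a|]; last by rewrite big_pred0.
  by rewrite (big_pred1 a) // => x; rewrite (inj_eq (@Some_inj _)) eq_sym.
rewrite (exchange_big_dep predT) //=; apply: eq_bigr => a _.
by rewrite sumr_const scaler_nat; congr (_ *+ _); apply: eq_card => q; rewrite inE.
Qed.

Lemma wf_hlam0 i a chi : chi i != None -> wedge (wf i a) (hl chi) = 0.
Proof. by move=> h; rewrite wedge_wf crea_hlam0 // fscaler0. Qed.

(** In a block all coordinates but one have the colour of the block, m_j of
    them: this is the weight. *)
Lemma weight_block i j a chi : valid c chi -> i \in c j -> chi i = None ->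
  (#|[set q | cls c i q && (chi q == Some a)]%SET|%:R : C) = (weight m c i a)%:~R.
Proof.
move=> hv ij hi; have [hcol h1 _] := validP _ _ hv.
rewrite /weight (block_nfree ij); case: (altP (a =P j)) => [->|naj].
  rewrite ij -[(Posz (m j))%:~R]/((m j)%:R); congr (_%:R).
  have := @fiber_count _ _ _ _ _ chi (Some j, Some j) hc hv isT; rewrite eqxx (index_setE ij) => /= <-.
  apply: eq_card => q; rewrite !inE xpair_eqE (bkP _ _ hc); congr (_ && _); exact: (cls_in _ hc ij).
have -> : (i \in c a) = false by apply/negP => ia; move/eqP: naj; apply; exact: (comp_disj hc ia ij).
rewrite [X in X%:R](_ : _ = 0%N) //; apply: eq_card0 => q; rewrite inE (cls_in _ hc ij).
apply/negP => /andP[qj /eqP E]; have := colok_in hc hcol qj; rewrite E => -[//|[Ea]].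
by rewrite Ea eqxx in naj.
Qed.

Lemma weight_free i a chi : free_coord c i ->
  #|[set q | cls c i q && (chi q == Some a)]%SET| = Kof c chi a.
Proof. by move=> fi; rewrite mnmE; apply: eq_card => q; rewrite !inE cls_free. Qed.

Lemma size_blocks chi : valid c chi ->
  size (flatten [seq enum (nset c chi x) | x <- [seq Some j | j <- enum J]]) = p.
Proof.
move=> hv; have [_ h1 _] := validP _ _ hv.
rewrite size_flatten /shape -!map_comp sumnE big_map big_enum -sum1_card; apply: eq_bigr => j hj.
by rewrite /= -cardE; apply: h1.
Qed.

Lemma wf_hlam_free i a chi : valid c chi -> i \in nset c chi None ->
  wedge (wf i a) (hl chi) = (-1) ^+ p *: hl (setc chi i (Some a)).
Proof.
move=> hv hi; have fi : free_coord c i by move: hi; rewrite inE => /andP[].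
have hiN := mem_nset hi.
have EN : nset c chi None = [set i]%SET.
  have [_ _ h0] := validP _ _ hv; have := enum_card1 h0 => -[E|[x E]]; first by rewrite E inE in hi.
  by move: hi; rewrite E inE => /eqP ->.
pose r := flatten [seq enum (nset c chi x) | x <- [seq Some j | j <- enum J]].
have E1 : os c chi = r ++ [:: i] by rewrite /os /slots map_rcons flatten_rcons EN enum_set1.
have E2 : os c (setc chi i (Some a)) = r.
  rewrite /os /slots map_rcons flatten_rcons nset_setc_Some // EN setDv enum_set0 cats0.
  congr flatten; apply/eq_in_map => x /mapP[j _ ->]; rewrite nset_setc_block //.
  by move/forallP: fi.
have u := os_uniq chi hc; rewrite E1 in u.
rewrite wedge_wf /hlam creaZ E1 E2 crea_annis // cats0 size_blocks // !scaleE !fscaleA.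
have -> : gfun z (setc chi i (Some a)) = (t i - zc a)^-1 * gfun z chi.
  have := @gfun_setN C n k z (setc chi i (Some a)) i a; rewrite setcE eqxx setcK (setc_id hiN).
  by move=> /(_ erefl) <-; rewrite mulrA [_^-1 * _]mulrC divff_nz ?nz_var_cst // mul1r.
by rewrite [in RHS]mulrC.
Qed.

Lemma omc_hlam : wedge (omc m z c) (tau n0 m z A c)
  = \sum_(chi | valid c chi) \sum_(i in nset c chi None) \sum_a
     (Ac chi * ((Kof c chi a)%:R - (mvec m J a)%:~R) * (-1) ^+ p) *: hl (setc chi i (Some a)).
Proof.
rewrite /omc wedge_suml.
transitivity (\sum_i \sum_(q | (q != i) && cls c i q) wedge (xf i q) (tau n0 m z A c)
   - \sum_i \sum_a (weight m c i a)%:~R *: wedge (wf i a) (tau n0 m z A c)).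
  rewrite -sumrB; apply: eq_bigr => i _; rewrite wedgeDl wedgeNl !wedge_suml; congr (_ - _).
  by apply: eq_bigr => a _; rewrite scaleE wedgeZl -scaleE.
rewrite pairs_sum.
have -> : \sum_i \sum_a (weight m c i a)%:~R *: wedge (wf i a) (tau n0 m z A c)
  = \sum_(chi | valid c chi) Ac chi *: \sum_i \sum_a (weight m c i a)%:~R *: wedge (wf i a) (hl chi).
  transitivity (\sum_i \sum_a \sum_(chi | valid c chi) Ac chi *: ((weight m c i a)%:~R *: wedge (wf i a) (hl chi))).
    apply: eq_bigr => i _; apply: eq_bigr => a _; rewrite ffunE hc wedge_sumr scaler_sumr.
    by apply: eq_bigr => chi _; rewrite wedgeZc !scalerA mulrC.
  under eq_bigr => i _ do rewrite exchange_big /=.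
  rewrite exchange_big /=; apply: eq_bigr => chi _; rewrite scaler_sumr; apply: eq_bigr => i _.
  by rewrite scaler_sumr.
rewrite -sumrB; apply: eq_bigr => chi hv; rewrite -scalerBr.
transitivity (Ac chi *: \sum_(i in nset c chi None) \sum_a
   ((Kof c chi a)%:R - (mvec m J a)%:~R) *: wedge (wf i a) (hl chi)); last first.
  rewrite scaler_sumr; apply: eq_bigr => i hi; rewrite scaler_sumr; apply: eq_bigr => a _.
  by rewrite wf_hlam_free // !scalerA.
congr (_ *: _); rewrite -sumrB [RHS]big_mkcond; apply: eq_bigr => i _.
rewrite gterm_sum -sumrB; case: (altP (chi i =P None)) => hi; last first.
  rewrite ifF; last by apply/negP => /mem_nset E; rewrite E eqxx in hi.
  by rewrite big1 // => a _; rewrite wf_hlam0 // !scaler0 subrr.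
have [fi|[j ij]] := free_or c i.
  rewrite ifT ?inE ?fi ?hi ?eqxx //; apply: eq_bigr => a _.
  by rewrite weight_free // /weight fi scalerBl.
rewrite ifF; last by rewrite inE (block_nfree ij).
by rewrite big1 // => a _; rewrite (weight_block _ hv ij hi) subrr.
Qed.

Definition decrK (K : 'X_{1..n}) a : 'X_{1..n} := [multinom (K b - (b == a))%N | b < n].

Lemma Kof_decr chi i a : free_coord c i -> chi i = Some a -> Kof c (setc chi i None) = decrK (Kof c chi) a.
Proof.
move=> fi hi; apply/mnmP => b; rewrite !mnmE.
have -> : [set q | free_coord c q && (setc chi i None q == Some b)]%SET
     = ([set q | free_coord c q && (chi q == Some b)] :\ i)%SET.
  by apply/setP => q; rewrite in_setD1 !in_set setcE; case: (altP (q =P i)) => /= _; rewrite ?andbF.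
rewrite [in RHS](cardsD1 i) in_set fi hi (inj_eq (@Some_inj _)) eq_sym /=.
by rewrite addKn.
Qed.

Lemma top_None chi : top k m J (Kof c chi) = (nset c chi None == set0).
Proof. by have := code_total chi hc; rewrite /top -cards_eq0; lia. Qed.

Lemma valid_setN chi i a : free_coord c i ->
  valid c (setc chi i None) && (chi i == Some a) = valid c chi && (top k m J (Kof c chi) && (chi i == Some a)).
Proof.
move=> fi; rewrite top_None; case: (altP (chi i =P Some a)) => hi; rewrite ?andbF // !andbT.
have ni j : i \notin c j by move/forallP: fi.
have inN : i \notin nset c chi None by rewrite inE hi andbF.
apply/idP/andP => [hv|[hv /eqP h]]; have [hcol h1 h0] := validP _ _ hv.
  have E0 : nset c chi None = set0.
    rewrite nset_setc_None // cardsU1 inN add1n ltnS leqn0 cards_eq0 in h0; exact/eqP.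
  split; last exact/eqP; apply/validP; split; last by rewrite E0 cards0.
    by rewrite -(colok_setc chi None fi).
  by move=> j hj; rewrite -(h1 j hj) nset_setc_block.
apply/validP; split; first by rewrite colok_setc.
  by move=> j hj; rewrite nset_setc_block // h1.
by rewrite nset_setc_None // h setU0 cards1.
Qed.

(** Colouring the free uncoloured coordinate by a, with K_a - 1 coordinates of
    that colour already present, has the factor K_a - 1 - m_a^j; each of the K_a
    coordinates of colour a can be the last one. *)
Lemma omc_tau : wedge (omc m z c) (tau n0 m z A c)
  = \sum_(chi | valid c chi) (if top k m J (Kof c chi) then
      (-1) ^+ p.+1 * \sum_a (Kof c chi a)%:R * (mvec m J a - (Kof c chi a)%:Z + 1)%:~R * A J (decrK (Kof c chi) a)
     else 0) *: hl chi.
Proof.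
rewrite omc_hlam.
transitivity (\sum_(i | free_coord c i) \sum_a \sum_(chi : colt | valid c chi && (chi i == None))
     (Ac chi * ((Kof c chi a)%:R - (mvec m J a)%:~R) * (-1) ^+ p) *: hl (setc chi i (Some a))).
  rewrite (exchange_big_dep (free_coord c)) /=; last by move=> chi i _; rewrite inE => /andP[].
  apply: eq_bigr => i fi; rewrite exchange_big /=; apply: eq_bigr => a _; apply: eq_bigl => chi.
  by rewrite inE fi.
transitivity (\sum_(i | free_coord c i) \sum_a \sum_(chi : colt | valid c chi && (top k m J (Kof c chi) && (chi i == Some a)))
     (A J (decrK (Kof c chi) a) * ((Kof c chi a)%:R - 1 - (mvec m J a)%:~R) * (-1) ^+ p) *: hl chi).
  apply: eq_bigr => i fi; apply: eq_bigr => a _; rewrite (sum_setc i (Some a)).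
  apply: eq_big => [chi|chi /andP[_ /eqP hi]]; first exact: valid_setN.
  rewrite setcK (setc_id hi) (Kof_decr fi hi); congr ((_ * (_ - _) * _) *: _).
  rewrite mnmE eqxx natrB //= mnmE card_gt0; apply/set0Pn; exists i; by rewrite inE fi hi eqxx.
rewrite exchange_big /=.
transitivity (\sum_a \sum_(chi : colt | valid c chi && top k m J (Kof c chi))
   (A J (decrK (Kof c chi) a) * ((Kof c chi a)%:R - 1 - (mvec m J a)%:~R) * (-1) ^+ p) *: hl chi *+ Kof c chi a).
  apply: eq_bigr => a _; rewrite (exchange_big_dep (fun chi => valid c chi && top k m J (Kof c chi))) /=; last first.
    by move=> i chi _ /and3P[-> ->].
  apply: eq_bigr => chi /andP[hv ht]; rewrite sumr_const mnmE; congr (_ *+ _).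
  by apply: eq_card => i; rewrite inE unfold_in /= hv ht.
rewrite exchange_big big_mkcondr /=; apply: eq_bigr => chi hv; case: ifP => _; last by rewrite scale0r.
rewrite mulr_sumr scaler_suml; apply: eq_bigr => a _; rewrite -scaler_nat scalerA; congr (_ *: _).
rewrite intrD intrB -[(Posz (Kof _ _ _))%:~R]/((Kof c chi a)%:R) exprS -[1%:~R]/(1%:R : C).
move: (_%:R) (_%:~R) (A _ _) ((-1) ^+ p) => x y w e; ring.
Qed.

End OmegaTau.

(** * The differential on coefficients *)

Section DifferentialOfTau.
Variables (C : numFieldType) (n k n0 : nat) (m : 'I_n -> nat) (z : 'I_n -> C) (kappa : C).
Hypothesis z_inj : injective z.
Implicit Types (J : {set 'I_n}) (K : 'X_{1..n}) (A B : {set 'I_n} -> 'X_{1..n} -> C).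

Definition f_part A J K : C :=
  \sum_a (K a)%:R * (mvec m J a - (K a)%:Z + 1)%:~R * A J (decrK K a).
Definition iota_part A J K : C :=
  \sum_(b in J) (-1) ^+ #|[set j in J | (j < b)%N]%SET| * A (J :\ b)%SET (shiftK m b K).
Definition dcoef A J K : C :=
  (if top k m J K then kappa^-1 * ((-1) ^+ #|J|.+1 * f_part A J K) else 0) + iota_part A J K.

Lemma aomoto_d_tau A : aomoto_d n0 m z kappa (@tau C n k n0 m z A) = tau n0 m z (dcoef A).
Proof.
apply/ffunP => c; rewrite [in RHS]ffunE [LHS]ffunE; case: ifP => // hc.
rewrite (omega_a_onE _ z_inj hc) [X in X + _](_ : _ = kappa^-1 *: wedge (omc m z c) (tau n0 m z A c)); last first.
  by rewrite !scaleE wedgeZl.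
rewrite (omc_tau _ hc) scaler_sumr.
rewrite [X in _ + X](_ : _ = \sum_(b in index_set c) \sum_(chi | valid c chi)
   ((-1) ^+ #|[set j in index_set c | (j < b)%N]%SET| * A (index_set c :\ b)%SET (shiftK m b (Kof c chi))) *: hlam z c chi); last first.
  by apply: eq_bigr => b hb; exact: (res_tau_hlam z_inj hc hb).
rewrite [X in _ + X]exchange_big -big_split /=; apply: eq_bigr => chi hv.
rewrite scalerA -scaler_suml -scalerDl; congr ((_ + _) *: _).
by case: ifP => _; rewrite ?mulr0.
Qed.

Lemma dcoefD A B (x : C) J K :
  dcoef (fun J K => x * A J K + B J K) J K = x * dcoef A J K + dcoef B J K.
Proof.
have fD : f_part (fun J K => x * A J K + B J K) J K = x * f_part A J K + f_part B J K.
  rewrite /f_part mulr_sumr -big_split; apply: eq_bigr => a _ /=.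
  by rewrite mulrDr mulrCA.
have iD : iota_part (fun J K => x * A J K + B J K) J K = x * iota_part A J K + iota_part B J K.
  rewrite /iota_part mulr_sumr -big_split; apply: eq_bigr => a _ /=.
  by rewrite mulrDr mulrCA.
rewrite /dcoef fD iD; case: ifP => _; last by rewrite !add0r.
move: (f_part A J K) (f_part B J K) (iota_part A J K) (iota_part B J K) ((-1) ^+ _) (kappa^-1).
by move=> u v w u' e l; ring.
Qed.

End DifferentialOfTau.

(** * Dual Verma modules in coordinates *)

Section DualVerma.
Variables (C : fieldType).
Implicit Types (mu : int) (j l : nat).

Lemma pairingX j (v : {poly C}) : pairing 'X^j v = v`_j.
Proof.
rewrite /pairing size_polyXn (bigD1 ord_max) //= coefXn eqxx mul1r big1 ?addr0 // => i ni.
by rewrite coefXn (_ : (i : nat) == j = false) ?mul0r //; apply/negbTE; rewrite -val_eqE in ni.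
Qed.

Lemma coef_transposeX (T : {poly C} -> {poly C}) j l :
  (transpose T 'X^j)`_l = if (l < j.+2)%N then (T 'X^l)`_j else 0.
Proof. by rewrite coef_poly size_polyXn pairingX. Qed.

Lemma verma_eX mu l : verma_e mu 'X^l = (l%:R * (mu - l%:Z + 1)%:~R : C) *: 'X^(l.-1).
Proof.
rewrite /verma_e size_polyXn (bigD1 ord_max) //= coefXn eqxx mul1r big1 ?addr0 // => i ni.
rewrite coefXn (_ : (i : nat) == l = false) ?mul0r ?scale0r //; apply/negbTE; by rewrite -val_eqE in ni.
Qed.

Lemma coef_dual_fX mu j l :
  (dual_f mu 'X^j)`_l = if l == j.+1 then (l%:R * (mu - l%:Z + 1)%:~R : C) else 0.
Proof.
rewrite coef_transposeX verma_eX coefZ coefXn; case: (altP (l =P j.+1)) => [->|nl].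
  by rewrite ltnSn eqxx mulr1.
case: ifP => // _; case: l nl => [|l] nl; first by rewrite !mul0r.
rewrite (_ : (j == l.+1.-1) = false) ?mulr0 //; apply/negbTE; apply: contra nl => /eqP ->.
by [].
Qed.

Lemma coef_iotaX (d j l : nat) : (@iota_dual C d 'X^j)`_l = (j == l + d.+1)%N%:R.
Proof.
rewrite coef_transposeX /verma_incl -exprD coefXn addnC; case: ltnP => // h.
by rewrite (_ : (j == _) = false) //; apply/negbTE; lia.
Qed.

Lemma coef_dual_hX mu j l : (dual_h mu 'X^j)`_l = if j == l then ((mu - 2 * l%:Z)%:~R : C) else 0.
Proof.
rewrite coef_transposeX /verma_h coef_poly size_polyXn coefXn; case: (altP (j =P l)) => [->|nj].
  by rewrite leqW // ltnSn mulr1.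
by rewrite mulr0; case: ifP => // _; case: ifP.
Qed.
End DualVerma.

Section OnFactor.
Variables (C : fieldType) (n : nat).
Implicit Types (K : 'X_{1..n}) (x y : {mpoly C[n]}) (a : 'I_n).

Lemma set_exponentE K a l b : set_exponent K a l b = if b == a then l else K b.
Proof. by rewrite mnmE. Qed.

(** If a power of X occurs in the images under T of at most one power, then the
    coefficients of 1 x ... x T x ... x 1 are obtained by substituting the
    exponent of one variable. *)
Lemma on_factor_coef a (T : {poly C} -> {poly C}) (g : nat -> nat) x K :
  (forall j l, (T 'X^j)`_l != 0 -> j = g l) ->
  (on_factor a T x)@_K = x@_(set_exponent K a (g (K a))) * (T 'X^(g (K a)))`_(K a).
Proof.
move=> hT; rewrite /on_factor raddf_sum /=.
transitivity (\sum_(K' <- msupp x) if K' == set_exponent K a (g (K a))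
   then x@_(set_exponent K a (g (K a))) * (T 'X^(g (K a)))`_(K a) else 0).
  apply: eq_bigr => K' _; rewrite raddf_sum /=.
  have E (l : nat) : (set_exponent K' a l == K) = (l == K a) && (K' == set_exponent K a (K' a)).
    apply/eqP/andP => [<-|[/eqP -> /eqP E]].
      rewrite set_exponentE eqxx; split=> //; apply/eqP/mnmP => b; rewrite !set_exponentE.
      by case: eqP => [->|].
    by apply/mnmP => b; rewrite set_exponentE; case: (b =P a) => [->//|/eqP nb]; rewrite E set_exponentE (negPf nb).
  transitivity (\sum_(l < size (T 'X^(K' a))) if (nat_of_ord l == K a) && (K' == set_exponent K a (K' a))
      then x@_K' * (T 'X^(K' a))`_(K a) else 0).
    apply: eq_bigr => l _; rewrite mcoeffZ mcoeffX E; case: ifP => [/andP[/eqP -> _]|_].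
      by rewrite mulr1.
    by rewrite mulr0.
  case: (altP (K' =P set_exponent K a (g (K a)))) => EK.
    have EK' : K' a = g (K a) by rewrite EK set_exponentE eqxx.
    rewrite EK' -EK eqxx; under eq_bigr do rewrite andbT.
    case: (ltnP (K a) (size (T 'X^(g (K a))))) => hs.
      by rewrite -big_mkcond (big_pred1 (Ordinal hs)) // => l; rewrite -val_eqE.
    by rewrite (nth_default _ hs) mulr0 big1 // => l _; case: ifP.
  apply: big1 => l _; case: ifP => // /andP[_ /eqP E'].
  have [->|/eqP] := eqVneq ((T 'X^(K' a))`_(K a)) 0; first by rewrite mulr0.
  by move/eqP/hT => E2; rewrite -E2 -E' eqxx in EK.
case: (boolP (set_exponent K a (g (K a)) \in msupp x)) => hm.
  by rewrite (bigD1_seq _ hm (msupp_uniq x)) /= eqxx big1 ?addr0 // => K' /negPf ->.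
by rewrite (memN_msupp_eq0 hm) mul0r big1 // => K' _; case: ifP.
Qed.

Lemma dual_h_coef a mu x K : (on_factor a (dual_h mu) x)@_K = x@_K * (mu - 2 * (K a)%:Z)%:~R.
Proof.
rewrite (@on_factor_coef _ _ id) => [|j l]; last by rewrite coef_dual_hX; case: (j =P l) => // _; rewrite eqxx.
rewrite coef_dual_hX eqxx; congr (_@__ * _).
by apply/mnmP => b; rewrite set_exponentE; case: eqP => [->|].
Qed.

Lemma dual_f_coef a mu x K :
  (on_factor a (dual_f mu) x)@_K = (K a)%:R * (mu - (K a)%:Z + 1)%:~R * x@_(decrK K a).
Proof.
rewrite (@on_factor_coef _ _ predn) => [|j l]; last first.
  by rewrite coef_dual_fX; case: (l =P j.+1) => [->//|_]; rewrite eqxx.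
rewrite coef_dual_fX mulrC; case: (altP (K a =P (K a).-1.+1)) => h.
  congr (_ * _@__); apply/mnmP => b; rewrite set_exponentE mnmE.
  by case: (b =P a) => [->|_]; rewrite ?subn1 ?subn0.
have -> : K a = 0%N by move: h; case: (K a) => // l; rewrite eqxx.
by rewrite !mul0r.
Qed.

Lemma iota_coef a (m : 'I_n -> nat) x K :
  (on_factor a (@iota_dual C (m a)) x)@_K = x@_(shiftK m a K).
Proof.
rewrite (@on_factor_coef _ _ (fun l => l + (m a).+1)%N) => [|j l]; last first.
  by rewrite coef_iotaX; case: (j =P _) => // _; rewrite eqxx.
rewrite coef_iotaX eqxx mulr1; congr (_@__); apply/mnmP => b; rewrite set_exponentE mnmE.
by case: eqP => [->|]; rewrite ?addn0.
Qed.
End OnFactor.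

(** * The algebraic complex on coefficients *)

Section AlgebraicSide.
Variables (C : numFieldType) (n : nat) (m : 'I_n -> nat).
Local Notation Asp := (Asp C n).
Implicit Types (x y : Asp) (J : {set 'I_n}) (K : 'X_{1..n}) (a b : 'I_n).

Definition co x J K : C := (x J)@_K.

Lemma coP x y : (forall J K, co x J K = co y J K) -> x = y.
Proof. by move=> h; apply/ffunP => J; apply/mpolyP => K; exact: h. Qed.

Lemma coD x y J K : co (x + y) J K = co x J K + co y J K.
Proof. by rewrite /co ffunE mcoeffD. Qed.
Lemma coN x J K : co (- x) J K = - co x J K.
Proof. by rewrite /co ffunE mcoeffN. Qed.
Lemma coZ (c : C) x J K : co (c *: x) J K = c * co x J K.
Proof. by rewrite /co ffunE mcoeffZ. Qed.
Lemma co0 J K : co 0 J K = 0.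
Proof. by rewrite /co ffunE mcoeff0. Qed.

Lemma co_f x J K : co (Af m x) J K = f_part m (co x) J K.
Proof.
rewrite /co ffunE raddf_sum; apply: eq_bigr => a _; exact: dual_f_coef.
Qed.
Lemma co_iota x J K : co (Aiota m x) J K = iota_part m (co x) J K.
Proof.
by rewrite /co ffunE raddf_sum /=; apply: eq_bigr => a _; rewrite linearZ /= iota_coef.
Qed.

Lemma sum_mvec J : \sum_a mvec m J a = \sum_(a < n) (m a)%:Z - 2 * (s_of m J)%:Z.
Proof.
have -> : (s_of m J)%:Z = \sum_(a in J) ((m a).+1)%:Z.
  by rewrite /s_of (big_morph Posz PoszD (erefl _)).
rewrite mulr_sumr [X in _ - X]big_mkcond -sumrB; apply: eq_bigr => a _; rewrite /mvec.
by case: ifP => _; lia.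
Qed.

(** The weight of phi^K in the summand J is |m| - 2 s_J - 2 |K|. *)
Lemma AgrP (i lam : int) x : Agr m i lam x <->
  forall J K, co x J K != 0 -> #|J|%:Z = i /\ \sum_(a < n) (m a)%:Z - 2 * (s_of m J)%:Z - 2 * (mdeg K)%:Z = lam.
Proof.
have wt J K : (\sum_(a < n) on_factor a (dual_h (mvec m J a)) (x J))@_K
   = co x J K * (\sum_(a < n) (m a)%:Z - 2 * (s_of m J)%:Z - 2 * (mdeg K)%:Z)%:~R.
  rewrite raddf_sum /=; under eq_bigr do rewrite dual_h_coef.
  rewrite -mulr_sumr -rmorph_sum; congr (_ * _%:~R).
  rewrite sumrB sum_mvec -mulr_sumr mdegE; congr (_ - _ * _).
  by rewrite (big_morph Posz PoszD (erefl _)).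
split=> h J.
  move=> K hx; have := h J; case: (altP (#|J|%:Z =P i)) => [-> E|_ E]; last first.
    by move: hx; rewrite /co E mcoeff0 eqxx.
  split=> //; have := congr1 (fun p => p@_K) E; rewrite wt mcoeffZ mulrC => /(mulIf hx)/eqP.
  by rewrite eqr_int => /eqP.
case: (altP (#|J|%:Z =P i)) => [EJ|nJ].
  apply/mpolyP => K; rewrite wt mcoeffZ mulrC.
  have [hx|hx] := eqVneq (co x J K) 0; first by have hx' : (x J)@_K = 0 := hx; rewrite hx hx' !mulr0.
  by have [_ ->] := h J K hx.
apply/mpolyP => K; rewrite mcoeff0; apply/eqP; apply: contraT => hx.
by have [E _] := h J K hx; rewrite E eqxx in nJ.
Qed.

Lemma s_ofD1 J b : b \in J -> s_of m J = ((m b).+1 + s_of m (J :\ b)%SET)%N.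
Proof. by move=> bJ; rewrite /s_of (big_setD1 b). Qed.
Lemma mdeg_shift K b : mdeg (shiftK m b K) = (mdeg K + (m b).+1)%N.
Proof.
rewrite !mdegE; under eq_bigr do rewrite mnmE; rewrite big_split /=; congr (_ + _)%N.
by rewrite -big_mkcond big_pred1_eq.
Qed.
Lemma mdeg_decr K a : (0 < K a)%N -> (mdeg (decrK K a)).+1 = mdeg K.
Proof.
move=> h; rewrite !mdegE (bigD1 a) // [RHS](bigD1 a) //= mnmE eqxx -addSn; congr (_ + _)%N; first lia.
by apply: eq_bigr => b /negPf nb; rewrite mnmE nb subn0.
Qed.

Lemma iota_neq0 (A : {set 'I_n} -> 'X_{1..n} -> C) J K : iota_part m A J K != 0 ->
  exists2 b, b \in J & A (J :\ b)%SET (shiftK m b K) != 0.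
Proof.
move=> h; suff /exists_inP : [exists b in J, A (J :\ b)%SET (shiftK m b K) != 0] by [].
apply: contraNT h => /exists_inPn h; rewrite /iota_part big1 // => b /h; rewrite negbK => /eqP ->.
by rewrite mulr0.
Qed.
Lemma f_neq0 (A : {set 'I_n} -> 'X_{1..n} -> C) J K : f_part m A J K != 0 ->
  exists a, (0 < K a)%N /\ A J (decrK K a) != 0.
Proof.
move=> h; suff /existsP[a /andP[h1 h2]] : [exists a, (0 < K a)%N && (A J (decrK K a) != 0)] by exists a.
apply: contraNT h => /existsPn h; rewrite /f_part big1 // => a _; have := h a.
by rewrite negb_and -eqn0Ngt negbK => /orP[] /eqP ->; rewrite ?mul0r ?mulr0.
Qed.

(** The two orders of removing a and b have opposite signs. *)
Lemma iota_sq (A : {set 'I_n} -> 'X_{1..n} -> C) J K : iota_part m (iota_part m A) J K = 0.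
Proof.
rewrite /iota_part.
pose sgn b : C := (-1) ^+ #|[set j in J | (j < b)%N]%SET|.
pose T a b : C := sgn a * ((-1) ^+ #|[set j in (J :\ a)%SET | (j < b)%N]%SET| *
   A (J :\ a :\ b)%SET (shiftK m b (shiftK m a K))).
have E : \sum_(a in J) sgn a * (\sum_(b in (J :\ a)%SET) (-1) ^+ #|[set j in (J :\ a)%SET | (j < b)%N]%SET| *
      A (J :\ a :\ b)%SET (shiftK m b (shiftK m a K)))
    = \sum_(a in J) \sum_(b in J | (b != a)) T a b.
  apply: eq_bigr => a _; rewrite mulr_sumr; apply: eq_bigl => b; by rewrite !inE andbC.
rewrite E {E}.
have anti a b : a \in J -> (a < b)%N -> T a b = - T b a.
  move=> aJ ab; rewrite /T.
  have -> : (J :\ b :\ a = J :\ a :\ b)%SET by apply/setP => j; rewrite !inE andbCA.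
  have -> : shiftK m a (shiftK m b K) = shiftK m b (shiftK m a K).
    by apply/mnmP => j; rewrite !mnmE addnAC.
  have -> : [set j in (J :\ b)%SET | (j < a)%N]%SET = [set j in J | (j < a)%N]%SET.
    apply/setP => j; rewrite !inE; case: (altP (j =P b)) => //= ->.
    by rewrite ltnNge (ltnW ab) andbF.
  rewrite /sgn; set e1 := (-1) ^+ #|[set j in J | (j < a)%N]%SET|.
  have -> : #|[set j in J | (j < b)%N]%SET| = (#|[set j in (J :\ a)%SET | (j < b)%N]%SET|).+1.
    rewrite (cardsD1 a) inE aJ ab add1n; congr (_.+1); apply: eq_card => j.
    by rewrite !inE andbA.
  rewrite exprS; move: (_ ^+ _) e1 (A _ _) => u v w; ring.
have split_sum : \sum_(a in J) \sum_(b in J | b != a) T a b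
   = \sum_(a in J) \sum_(b in J | (a < b)%N) T a b + \sum_(a in J) \sum_(b in J | (b < a)%N) T a b.
  rewrite -big_split; apply: eq_bigr => a _ /=.
  rewrite (bigID (fun b : 'I_n => (a < b)%N)) /=; congr (_ + _); apply: eq_bigl => b.
    by rewrite -val_eqE neq_ltn; case: (b \in J) => //=; case: ltngtP.
  by rewrite -val_eqE neq_ltn; case: (b \in J) => //=; case: ltngtP.
rewrite split_sum [X in _ + X](exchange_big_dep (mem J)) /=; last by move=> a b _ /andP[].
rewrite -big_split big1 // => a aJ /=.
have -> : \sum_(i in J | (a \in J) && (a < i)%N) T i a = - \sum_(b in J | (a < b)%N) T a b.
  rewrite -sumrN; apply: eq_big => [b|b /andP[_ /andP[_ ab]]]; first by rewrite aJ.
  by rewrite (anti a b aJ ab) opprK.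
exact: subrr.
Qed.

(** For the factor b itself this is the identity K (-m - K - 1) = (K + m +
    1)(-K), which says that iota is a map of modules. *)
Lemma f_iota (A : {set 'I_n} -> 'X_{1..n} -> C) J K :
  f_part m (iota_part m A) J K = iota_part m (f_part m A) J K.
Proof.
rewrite /f_part /iota_part.
under eq_bigr do rewrite mulr_sumr; rewrite exchange_big /=; apply: eq_bigr => b bJ.
rewrite mulr_sumr; apply: eq_bigr => a _; rewrite mulrCA; congr (_ * _).
have Em : mvec m (J :\ b)%SET a = if a == b then (m a)%:Z else mvec m J a.
  by rewrite /mvec !inE; case: eqP => //=.
rewrite Em mnmE; case: (altP (a =P b)) => [Eab|nab]; last first.
  rewrite addn0; congr (_ * A _ _); apply/mnmP => j; rewrite !mnmE.
  by case: (altP (j =P b)) => [->|_]; rewrite ?addn0 // eq_sym (negPf nab) !subn0.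
subst a; rewrite /mvec bJ.
have [K0|Kpos] := posnP (K b).
  rewrite K0 add0n !mul0r (_ : (m b)%:Z - (m b).+1%:Z + 1 = 0) ?mulr0 ?mul0r //; lia.
have -> : shiftK m b (decrK K b) = decrK (shiftK m b K) b.
  apply/mnmP => j; rewrite !mnmE; case: (altP (j =P b)) => [->|_]; last by rewrite !subn0 addn0.
  lia.
congr (_ * _); rewrite -[(K b)%:R]/((Posz (K b))%:~R) -[(K b + _)%N%:R]/((Posz (K b + (m b).+1)%N)%:~R).
rewrite -!intrM; congr (_%:~R).
have -> : (K b + (m b).+1)%N%:Z = (K b)%:Z + (m b)%:Z + 1 by lia.
ring.
Qed.

End AlgebraicSide.

(** * The isomorphism of complexes *)

Section Isomorphism.
Variables (C : numFieldType) (n k n0 : nat) (m : 'I_n -> nat) (z : 'I_n -> C) (kappa : C).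
Hypotheses (k_gt0 : (0 < k)%N) (m_gt : forall j : 'I_n, (n0 <= j)%N -> (k.-1 < m j)%N).
Hypotheses (z_inj : injective z) (kappa_neq0 : kappa != 0).
Local Notation chains := (chains C n k).
Local Notation Bsp := (Bsp C n).
Implicit Types (J : {set 'I_n}) (K : 'X_{1..n}) (A B : {set 'I_n} -> 'X_{1..n} -> C) (v : chains) (l : int).
Local Notation adm := (adm k n0 m).
Local Notation top := (top k m).
Local Notation nrm := (nrm k m kappa).
Local Notation tau := (@tau C n k n0 m z).
Local Notation skewc := (@aomoto_skew C n k n0 m z).
Local Notation omega := (omega_form k m z kappa).
Local Notation d := (aomoto_d n0 m z kappa).

Lemma topE J K : top J K = (s_of m J + mdeg K == k)%N.
Proof. by []. Qed.
Lemma nrmE J K : nrm J K = if top J K then kappa ^- k else (-1) ^+ #|J|.+1 * kappa ^- k.-1.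
Proof. by []. Qed.

Lemma admI J K : (forall j, j \in J -> (j < n0)%N) ->
  (s_of m J + mdeg K == k)%N || ((s_of m J + mdeg K).+1 == k)%N -> adm J K.
Proof. by move=> h1 h2; apply/andP; split=> //; apply/forallP => j; apply/implyP; exact: h1. Qed.

(** This is where the nonresonant indices are excluded: their blocks would have
    more than k elements. *)
Lemma resonant J b : b \in J -> (s_of m J <= k)%N -> (b < n0)%N.
Proof.
move=> bJ h; rewrite ltnNge; apply/negP => /m_gt; move: h k_gt0; rewrite (s_ofD1 m bJ); lia.
Qed.

Lemma adm_deg J K : (s_of m J + mdeg K == k)%N || ((s_of m J + mdeg K).+1 == k)%N -> adm J K.
Proof. by move=> h; apply: admI => // j jJ; apply: (resonant jJ); lia. Qed.
Lemma admE J K : adm J K = (s_of m J + mdeg K == k)%N || ((s_of m J + mdeg K).+1 == k)%N.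
Proof. by apply/idP/idP => [/andP[]|/adm_deg]. Qed.

Lemma top_adm J K : top J K -> adm J K.
Proof. by rewrite admE topE => ->. Qed.

Lemma top_decr J K a : (0 < K a)%N ->
  adm J (decrK K a) && ~~ top J (decrK K a) = top J K.
Proof. by move=> h; have := mdeg_decr h; rewrite admE !topE; lia. Qed.
Lemma deg_shift J K b : b \in J -> (s_of m (J :\ b)%SET + mdeg (shiftK m b K) = s_of m J + mdeg K)%N.
Proof. by move=> bJ; rewrite mdeg_shift (s_ofD1 m bJ) addnCA addnC [(s_of m (J :\ b)%SET + _)%N]addnC. Qed.
Lemma wt_shift J K b (x : int) : b \in J ->
  x - 2 * (s_of m (J :\ b)%SET)%:Z - 2 * (mdeg (shiftK m b K))%:Z = x - 2 * (s_of m J)%:Z - 2 * (mdeg K)%:Z.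
Proof. by move=> bJ; have := deg_shift K bJ; lia. Qed.
Lemma card_del J b (i : int) : b \in J -> #|(J :\ b)%SET|%:Z = i -> #|J|%:Z = i + 1.
Proof. by move=> bJ <-; rewrite (cardsD1 b J) bJ; lia. Qed.
Lemma top_shift J K b : b \in J -> top (J :\ b)%SET (shiftK m b K) = top J K.
Proof. by move=> bJ; rewrite !topE deg_shift. Qed.
Lemma adm_shift J K b : b \in J -> adm (J :\ b)%SET (shiftK m b K) = adm J K.
Proof. by move=> bJ; rewrite !admE deg_shift. Qed.
Lemma nrm_shift J K b : b \in J ->
  nrm (J :\ b)%SET (shiftK m b K) = (if top J K then 1 else -1) * nrm J K.
Proof.
move=> bJ; rewrite !nrmE top_shift //; case: ifP => _; first by rewrite mul1r.
by rewrite mulrA (cardsD1 b J) bJ add1n [in RHS]exprS mulrA mulrNN !mul1r.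
Qed.

(** Coefficients of the image of [tau A], for the pairs selected by P. *)
Definition part (P : pred bool) A : Asp C n :=
  [ffun J => \sum_(K : 'X_{1..n < k.+1} | adm J K && P (top J K)) (A J K / nrm J K) *: 'X_[K]].
(** The first component carries the factor f, hence the colourings with an
    uncoloured free coordinate. *)
Definition Gm A : Bsp := (part negb A, part id A).

Lemma co_part P A J K : co (part P A) J K = if adm J K && P (top J K) then A J K / nrm J K else 0.
Proof.
rewrite /co ffunE raddf_sum /=.
under eq_bigr => L _ do rewrite mcoeffZ mcoeffX.
case: ifP => [h|h]; last first.
  rewrite big1 // => L hL; case: eqP => [E|_]; last by rewrite mulr0.
  by rewrite E h in hL.
have hd : (mdeg K < k.+1)%N by case/andP: h => [+ _]; rewrite admE; lia.
rewrite (bigD1 (BMultinom hd)) //= eqxx mulr1 big1 ?addr0 // => L /andP[_ nL].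
case: eqP => [E|_]; last by rewrite mulr0.
by move/eqP: nL => []; apply: val_inj.
Qed.

Lemma Gm_ext A B : (forall J K, adm J K -> A J K = B J K) -> Gm A = Gm B.
Proof.
move=> h; congr pair; apply: coP => J K; rewrite !co_part; case: ifP => // /andP[/h -> _ //].
Qed.

Lemma Gm_inj A B J K : Gm A = Gm B -> adm J K -> A J K = B J K.
Proof.
move=> [E1 E2] hadm; have nz0 : (nrm J K)^-1 != 0 by rewrite invr_eq0 nrm_neq0.
apply: (mulIf nz0); case ht : (top J K).
  by have := congr1 (fun x => co x J K) E2; rewrite !co_part hadm ht.
by have := congr1 (fun x => co x J K) E1; rewrite !co_part hadm ht.
Qed.

Lemma Gm_lin (x : C) A B : Gm (fun J K => x * A J K + B J K) = x *: Gm A + Gm B.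
Proof.
congr pair; apply: coP => J K; rewrite coD coZ !co_part; case: ifP => _; rewrite ?mulr0 ?addr0 //;
by rewrite mulrDl mulrA.
Qed.

(** The signs of the definition of omega make both terms of the differential
    correspond: passing from (J without b) to J changes the sign of [nrm] for
    the component with f and not for the other. *)
Lemma Gm_d A : Gm (dcoef k m kappa A) = Bd m (Gm A).
Proof.
congr pair; apply: coP => J K.
  rewrite coN co_iota co_part /dcoef; case: (boolP (adm J K && ~~ top J K)) => h.
    have /andP[_ /negPf ht] := h; rewrite ht add0r /iota_part -sumrN mulr_suml; apply: eq_bigr => b bJ.
    rewrite co_part adm_shift // top_shift // h nrm_shift // ht mulN1r invrN !mulrN.
    by rewrite opprK mulrA.
  rewrite /iota_part big1 ?oppr0 // => b bJ; rewrite co_part adm_shift // top_shift // (negPf h).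
  by rewrite mulr0.
rewrite coD co_f co_iota co_part /dcoef.
have Ei : iota_part m (co (Gm A).2) J K = if adm J K && top J K then iota_part m A J K / nrm J K else 0.
  case: (boolP (adm J K && top J K)) => h.
    rewrite /iota_part mulr_suml; apply: eq_bigr => b bJ.
    rewrite co_part adm_shift // top_shift // h nrm_shift //; case/andP: h => _ ->.
    by rewrite mul1r mulrA.
  rewrite /iota_part big1 // => b bJ; rewrite co_part adm_shift // top_shift // (negPf h).
  by rewrite mulr0.
have Ef : f_part m (co (Gm A).1) J K = if top J K then kappa^-1 * ((-1) ^+ #|J|.+1 * f_part m A J K) / nrm J K else 0.
  case: (boolP (top J K)) => h; last first.
    rewrite /f_part big1 // => a _; have [->|h0] := posnP (K a); first by rewrite !mul0r.
    by rewrite co_part top_decr // (negPf h) mulr0.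
  rewrite /f_part !mulr_sumr mulr_suml; apply: eq_bigr => a _; have [->|h0] := posnP (K a).
    by rewrite !(mul0r, mulr0).
  rewrite co_part top_decr // h.
  have ht : top J (decrK K a) = false by have := top_decr J h0; rewrite h => /andP[_ /negPf].
  rewrite !nrmE h ht invrK invfM invrK invr_sign.
  have -> : kappa ^+ k = kappa * kappa ^+ k.-1 by rewrite -exprS prednK.
  move: (_%:R) (_%:~R) (A _ _) ((-1) ^+ _) (kappa ^+ k.-1) => u w x e y.
  by field.
rewrite Ei Ef; case: (boolP (top J K)) => ht; last by rewrite andbF addr0.
by rewrite top_adm //= mulrDl.
Qed.

Definition deg J K : int := if top J K then (k + #|J|)%:Z else (k + #|J|)%:Z - 1.

Lemma omega_in J K : adm J K -> skewc (deg J K) (omega J K).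
Proof. by move=> /admP[hJ hK]; exact: omega_skew. Qed.

Lemma skew_lin l (a : C) u v : skewc l u -> skewc l v -> skewc l (a *: u + v).
Proof.
move=> [h1 h2] [g1 g2]; split=> [c|s].
  move: (h1 c) (g1 c); rewrite [(a *: u + v) c]ffunE [(a *: u) c]ffunE.
  case: (is_component _ _ _); last by move=> -> ->; rewrite scaler0 addr0.
  case: (l - (2 * #|index_set c|)%:Z) => d' h g; first exact: Log_lin.
  by rewrite h g scaler0 addr0.
have -> : perm_act s (a *: u + v) = a *: perm_act s u + perm_act s v.
  have inj := @injev_pvar C k s.
  apply/ffunP => c; rewrite ![in RHS]ffunE [LHS]ffunE.
  have -> w w' c' : (a *: w + w' : chains) c' = a *: w c' + w' c' by rewrite !ffunE.
  by rewrite (pullbackD inj) (pullback_scale inj).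
by rewrite h2 g2 scalerDr !scalerA mulrC.
Qed.
Lemma skew0 l : skewc l 0.
Proof.
split=> [c|s]; last first.
  rewrite scaler0; apply/ffunP => c; rewrite !ffunE; exact: (pullback0 (@injev_pvar C k s)).
rewrite ffunE; case: (is_component _ _ _) => //.
by case: (l - (2 * #|index_set c|)%:Z) => // d'; exact: Log_zero.
Qed.
Lemma skew_sum l (I : Type) (r : seq I) (P : pred I) (h : I -> chains) :
  (forall x, P x -> skewc l (h x)) -> skewc l (\sum_(x <- r | P x) h x).
Proof.
move=> H; apply: (big_ind (skewc l)) => // [|x y hx hy]; first exact: skew0.
by rewrite -[x]scale1r; exact: skew_lin.
Qed.

Lemma tau_in l A : (forall J K, adm J K -> A J K != 0 -> l = deg J K) -> skewc l (tau A).
Proof.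
move=> h; rewrite (tau_span _ _ _ k_gt0 kappa_neq0); apply: skew_sum => J _; apply: skew_sum => K hadm.
have [->|nA] := eqVneq (A J K) 0; first by rewrite mul0r scale0r; exact: skew0.
rewrite -[_ *: _]addr0; apply: skew_lin; last exact: skew0.
by rewrite (h J K hadm nA); exact: omega_in.
Qed.

Lemma tau_deg l A J K : skewc l (tau A) -> adm J K -> A J K != 0 -> l = deg J K.
Proof. by move=> [h _]; exact: (tau_degree z_inj k_gt0 kappa_neq0 h). Qed.

Lemma tau_lin (a : C) A B : tau (fun J K => a * A J K + B J K) = a *: tau A + tau B.
Proof. by rewrite (tauD k n0 m z (fun J K => a * A J K)) tauZ. Qed.

Lemma tau_eq A B : (forall J K, adm J K -> A J K = B J K) -> tau A = tau B.
Proof.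
move=> h; rewrite !(tau_span _ _ _ k_gt0 kappa_neq0); apply: eq_bigr => J _; apply: eq_bigr => K hadm.
by rewrite h.
Qed.

(** The chains in the sum of all degrees are the chains [tau A] as well, since
    only the degrees from k - 1 to k + n occur. *)
Lemma direct_tau v : direct_sum skewc v <-> exists A, v = tau A.
Proof.
split=> [[s [w [hw ->]]]|[A ->]].
  elim: s => [|l s [A IH]]; first by exists (fun _ _ => 0); rewrite big_nil tau0.
  have [B EB] := skew_tau z_inj (hw l); exists (fun J K => 1 * B J K + A J K).
  by rewrite big_cons IH tau_lin scale1r -EB.
pose dom : seq int := [seq (k%:Z - 1 + i%:Z) | i <- iota 0 n.+2].
have udom : uniq dom by rewrite map_inj_uniq ?iota_uniq // => x y /addrI [].
have in_dom J K : deg J K \in dom.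
  have pJ : (#|J| <= n)%N by rewrite -[X in (_ <= X)%N]card_ord max_card.
  apply/mapP; rewrite /deg; case: ifP => _.
    by exists #|J|.+1; rewrite ?mem_iota; lia.
  by exists #|J|; rewrite ?mem_iota; lia.
exists dom, (fun l => \sum_J \sum_(K : 'X_{1..n < k.+1} | adm J K)
   if deg J K == l then (A J K / nrm J K) *: omega J K else 0); split.
  move=> l; apply: skew_sum => J _; apply: skew_sum => K hadm; case: eqP => [<-|_]; last exact: skew0.
  rewrite -[_ *: _]addr0; apply: skew_lin; last exact: skew0.
  exact: omega_in.
rewrite (tau_span _ _ _ k_gt0 kappa_neq0) exchange_big /=; apply: eq_bigr => J _.
rewrite exchange_big /=; apply: eq_bigr => K hadm.
rewrite (bigD1_seq _ (in_dom J K) udom) /= eqxx big1 ?addr0 // => l nl.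
by rewrite eq_sym (negPf nl).
Qed.

(** Any coefficients of v; they are unique on admissible pairs. *)
Definition coefs v : {set 'I_n} -> 'X_{1..n} -> C :=
  if pselect (exists A, v = tau A) is left h then sval (cid h) else fun _ _ => 0.
Definition gamma v : Bsp := Gm (coefs v).

Lemma gamma_tau A : gamma (tau A) = Gm A.
Proof.
rewrite /gamma /coefs; case: pselect => [h|[]]; last by exists A.
apply: Gm_ext => J K hadm; apply: (tau_inj z_inj _ hadm); exact: (esym (svalP (cid h))).
Qed.

Lemma gamma_linear : linear_on (direct_sum skewc) gamma.
Proof.
move=> a u v /direct_tau[A ->] /direct_tau[B ->].
by rewrite -tau_lin !gamma_tau Gm_lin.
Qed.

Lemma gamma_omega J K : adm J K ->
  gamma (omega J K) = if top J K then no_f (phi C J K) else f_tensor (phi C J K).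
Proof.
move=> hadm; have [hJ hK] := admP hadm; rewrite (omega_tau z kappa k_gt0 hJ hK) gamma_tau.
have E P J' K' : co (part P (fun J' K' => if (J' == J) && (K' == K) then nrm J K else 0)) J' K'
   = if P (top J K) then co (phi C J K) J' K' else 0.
  rewrite co_part /co /phi ffunE; case: (altP (J' =P J)) => [->|_] /=; last first.
    by rewrite mcoeff0 mul0r; case: ifP; case: ifP.
  rewrite mcoeffX eq_sym; case: (altP (K =P K')) => [<-|_] /=; last by rewrite mul0r; case: ifP; case: ifP.
  by rewrite hadm /= divff ?nrm_neq0.
by case: ifP => ht; congr pair; apply: coP => J' K'; rewrite E ht ?co0.
Qed.

Lemma d_tau A : d (tau A) = tau (dcoef k m kappa A).
Proof. exact: aomoto_d_tau. Qed.

Lemma gamma_d v : direct_sum skewc v -> gamma (d v) = Bd m (gamma v).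
Proof. by move=> /direct_tau[A ->]; rewrite d_tau !gamma_tau Gm_d. Qed.

Lemma skew_direct l v : skewc l v -> direct_sum skewc v.
Proof. by move=> h; apply/direct_tau; exact: (skew_tau z_inj h). Qed.

Lemma Bd_sq (b : Bsp) : Bd m (Bd m b) = 0.
Proof.
have Ei x : co (Aiota m x) = iota_part m (co x) :> (_ -> _ -> C).
  by apply: funext => J; apply: funext => K; exact: co_iota.
have EN (x : Asp C n) : co (- x) = (fun J K => - co x J K).
  by apply: funext => J; apply: funext => K; exact: coN.
have ED (x y : Asp C n) : co (x + y) = (fun J K => co x J K + co y J K).
  by apply: funext => J; apply: funext => K; exact: coD.
have iN A J K : iota_part m (fun J K => - A J K) J K = - iota_part m A J K.
  by rewrite -sumrN /iota_part; apply: eq_bigr => a _; rewrite mulrN.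
have fN A J K : f_part m (fun J K => - A J K) J K = - f_part m A J K.
  by rewrite -sumrN /f_part; apply: eq_bigr => a _; rewrite mulrN.
have iD A B J K : iota_part m (fun J K => A J K + B J K) J K = iota_part m A J K + iota_part m B J K.
  by rewrite -big_split /iota_part; apply: eq_bigr => a _; rewrite mulrDr.
have Ef x : co (Af m x) = f_part m (co x) :> (_ -> _ -> C).
  by apply: funext => J; apply: funext => K; exact: co_f.
congr pair; apply: coP => J K; rewrite co0 /=.
  by rewrite coN co_iota EN iN Ei iota_sq !oppr0.
by rewrite coD co_f co_iota EN fN ED iD Ei Ef f_iota Ei iota_sq addr0 addNr.
Qed.

Lemma Bd_linear (a : C) (u v : Bsp) : Bd m (a *: u + v) = a *: Bd m u + Bd m v.
Proof.
have iL (x y : Asp C n) J K : iota_part m (co (a *: x + y)) J K = a * iota_part m (co x) J K + iota_part m (co y) J K.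
  rewrite /iota_part mulr_sumr -big_split; apply: eq_bigr => b _ /=.
  by rewrite coD coZ mulrDr mulrCA.
have fL (x y : Asp C n) J K : f_part m (co (a *: x + y)) J K = a * f_part m (co x) J K + f_part m (co y) J K.
  rewrite /f_part mulr_sumr -big_split; apply: eq_bigr => b _ /=.
  by rewrite coD coZ mulrDr mulrCA.
congr pair; apply: coP => J K.
  by rewrite coN co_iota iL coD coZ !coN !co_iota; ring.
by rewrite coD co_f co_iota fL iL !coD coZ coD !co_f !co_iota; ring.
Qed.

Local Notation lam := (\sum_(j < n) (m j)%:Z - 2 * k%:Z).

Lemma Bgr_complex : is_complex (@Bgr C n m lam) (Bd m).
Proof.
split.
- by move=> l; split; apply/AgrP => J K; rewrite co0 eqxx.
- have H i lam' (a : C) (x y : Asp C n) : Agr m i lam' x -> Agr m i lam' y -> Agr m i lam' (a *: x + y).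
    move=> /AgrP h /AgrP g; apply/AgrP => J K; rewrite coD coZ.
    have [E|nx] := eqVneq (co x J K) 0; last by move=> _; exact: h.
    by rewrite E mulr0 add0r; exact: g.
  by move=> l a u v [h1 h2] [g1 g2]; split; apply: H.
- by move=> l a u v _ _; exact: Bd_linear.
- move=> l v [/AgrP h1 /AgrP h2]; split; apply/AgrP => J K /=.
    rewrite coN oppr_eq0 co_iota => /iota_neq0[b bJ] /h1 [Ec Ed].
    by rewrite (card_del bJ Ec) -(wt_shift _ _ bJ); split=> //; exact: Ed.
  rewrite coD co_f co_iota.
  have [E|nf _] := eqVneq (f_part m (co v.1) J K) 0; last first.
    have [a [a0 /h1[Ec Ed]]] := f_neq0 nf; rewrite -(mdeg_decr a0); split; first by rewrite addrK.
    have F (x w : int) (e : nat) : x - 2 * e%:Z = w + 2 -> x - 2 * (e.+1)%:Z = w by lia.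
    exact: F Ed.
  rewrite E add0r => /iota_neq0[b bJ] /h2 [Ec Ed].
  by rewrite (card_del bJ Ec) -(wt_shift _ _ bJ); split=> //; lia.
by move=> l v _; exact: Bd_sq.
Qed.

Lemma Gm_bgr l A : (forall J K, adm J K -> A J K != 0 -> l = deg J K) -> Bgr m lam (l + (1 - k%:Z)) (Gm A).
Proof.
move=> h; split; apply/AgrP => J K; rewrite co_part.
  case: ifP => [/andP[hadm ht]|_]; last by rewrite eqxx.
  rewrite mulf_eq0 negb_or => /andP[/(h J K hadm) El _]; move: El; rewrite /deg (negPf ht) => ->.
  by move: hadm ht; rewrite admE !topE; lia.
case: ifP => [/andP[hadm ht]|_]; last by rewrite eqxx.
rewrite mulf_eq0 negb_or => /andP[/(h J K hadm) El _]; move: El; rewrite /deg ht => ->.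
by move: hadm ht; rewrite admE !topE; lia.
Qed.

Lemma Bgr_Gm l b : Bgr m lam (l + (1 - k%:Z)) b ->
  exists A, (forall J K, adm J K -> A J K != 0 -> l = deg J K) /\ Gm A = b.
Proof.
move=> [/AgrP h1 /AgrP h2].
exists (fun J K => nrm J K * (if top J K then co b.2 J K else co b.1 J K)); split.
  move=> J K hadm; rewrite mulf_eq0 negb_or /deg => /andP[_]; case: ifP => ht.
    by move/h2 => [Ec _]; lia.
  by move/h1 => [Ec _]; lia.
case: b h1 h2 => [b1 b2] /= h1 h2; congr pair; apply: coP => J K; rewrite co_part.
  case: ifP => [/andP[_ /negPf ->]|h]; first by rewrite mulrAC divff ?mul1r ?nrm_neq0.
  apply/esym/eqP; apply: contraFT h => /h1[_]; rewrite admE !topE; lia.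
case: ifP => [/andP[_ ->]|h]; first by rewrite mulrAC divff ?mul1r ?nrm_neq0.
apply/esym/eqP; apply: contraFT h => /h2[_]; rewrite admE !topE; lia.
Qed.

Lemma d_degree l v : skewc l v -> skewc (l + 1) (d v).
Proof.
move=> h; have [A E] := skew_tau z_inj h; rewrite E in h *; rewrite d_tau; apply: tau_in => J K hadm hd.
have H : f_part m A J K != 0 /\ top J K \/ iota_part m A J K != 0.
  move: hd; rewrite /dcoef; have [->|ni] := eqVneq (iota_part m A J K) 0; last by right.
  rewrite addr0; case: ifP => [ht|_]; last by rewrite eqxx.
  by rewrite !mulf_eq0 !negb_or => /andP[_ /andP[_ nf]]; left.
case: H => [[/f_neq0[a [a0 nA]] ht]|/iota_neq0[b bJ nA]].
  have := top_decr J a0; rewrite ht => /andP[hadm' /negPf ht'].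
  by have := tau_deg h hadm' nA; rewrite /deg ht ht'; lia.
have hadm' := adm_shift K bJ; rewrite hadm in hadm'.
have := tau_deg h hadm' nA; rewrite /deg top_shift // !PoszD (card_del bJ erefl).
by case: ifP; lia.
Qed.

Lemma d_linear l : linear_on (skewc l) d.
Proof.
move=> a u v hu hv; have [A ->] := skew_tau z_inj hu; have [B ->] := skew_tau z_inj hv.
rewrite -tau_lin !d_tau -tau_lin; apply: tau_eq => J K _; exact: dcoefD.
Qed.

Lemma skew_complex : is_complex skewc d.
Proof.
split; [exact: skew0|exact: skew_lin|exact: d_linear|exact: d_degree|].
move=> l v hv; have [A E] := skew_tau z_inj hv; rewrite E !d_tau -(tau0 k n0 m z).
apply: tau_eq => J K; apply: Gm_inj; rewrite !Gm_d Bd_sq.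
by congr pair; apply: coP => J' K'; rewrite co0 co_part mul0r; case: ifP.
Qed.

Lemma is_gamma_omega J K : (forall j, j \in J -> (j < n0)%N) ->
  (mdeg K)%:Z = e_of k m J \/ (mdeg K)%:Z = e_of k m J - 1 -> adm J K.
Proof. by move=> hJ; rewrite e_ofE => h; apply: admI => //; lia. Qed.

Lemma gamma_is_gamma : is_gamma n0 m z kappa gamma.
Proof.
split; first exact: gamma_linear.
move=> J K hJ _; split=> [h|h|h].
- by apply: skew_direct; apply: omega_in; exact: is_gamma_omega.
- rewrite gamma_omega; last by apply: is_gamma_omega => //; right.
  by rewrite ifF //; move: h; rewrite e_ofE !topE; lia.
rewrite gamma_omega; last by apply: is_gamma_omega => //; left.
by rewrite ifT //; move: h; rewrite e_ofE !topE; lia.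
Qed.

(** A linear map is determined by its values on the omega_K^j, which span. *)
Lemma gamma_unique gamma' : is_gamma n0 m z kappa gamma' ->
  forall v, direct_sum skewc v -> gamma' v = gamma v.
Proof.
move=> [lin' om'] v /direct_tau[A ->].
pose P u := direct_sum skewc u /\ gamma' u = gamma u.
have D0 : direct_sum skewc 0 by apply: (@skew_direct 0); exact: skew0.
have P0 : P 0.
  split=> //; have g0 g : linear_on (direct_sum skewc) g -> g 0 = 0 :> Bsp.
    by move=> lin; have := lin 1 0 0 D0 D0; rewrite scaler0 addr0 scale1r => /eqP; rewrite -subr_eq subrr => /eqP.
  by rewrite (g0 _ lin') (g0 _ gamma_linear).
have PL (a : C) u w : P u -> P w -> P (a *: u + w).
  move=> [du Eu] [dw Ew]; split; last by rewrite lin' // gamma_linear // Eu Ew.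
  move: du dw => /direct_tau[B ->] /direct_tau[B' ->]; apply/direct_tau.
  by eexists; rewrite -tau_lin.
suff [] : P (tau A) by [].
rewrite (tau_span _ _ _ k_gt0 kappa_neq0).
have PS (I : Type) (r : seq I) (Q : pred I) (h : I -> chains) :
    (forall x, Q x -> P (h x)) -> P (\sum_(x <- r | Q x) h x).
  by move=> H; apply: (big_ind P) => // x y hx hy; rewrite -[x]scale1r; exact: PL.
apply: (PS) => J _; apply: (PS) => K hadm; rewrite -[_ *: _]addr0; apply: PL => //.
have [hJ hK] := admP hadm.
split; first by apply: skew_direct; exact: omega_in.
rewrite gamma_omega //; have e0 : 0 <= e_of k m J by rewrite e_ofE; case: hK; lia.
have [_ g1 g2] := om' J K hJ e0.
case: ifP => ht; first by apply: g2; move: ht; rewrite e_ofE !topE; lia.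
by apply: g1; move: ht hK; rewrite e_ofE !topE; lia.
Qed.

Lemma gamma_iso : complex_iso skewc d (@Bgr C n m lam) (Bd m) (1 - k%:Z) gamma.
Proof.
split; [exact: skew_complex|exact: Bgr_complex|exact: gamma_linear| |].
- move=> l; split.
  + move=> v hv; have [A E] := skew_tau z_inj hv; rewrite E in hv *; rewrite gamma_tau.
    by apply: Gm_bgr => J K; exact: (tau_deg hv).
  + move=> u v /set_mem/(skew_tau z_inj)[A ->] /set_mem/(skew_tau z_inj)[B ->]; rewrite !gamma_tau => E.
    by apply: tau_eq => J K; exact: Gm_inj.
  move=> b /Bgr_Gm[A [hA <-]]; exists (tau A); last exact: gamma_tau.
  exact: tau_in.
by move=> l v /skew_direct; exact: gamma_d.
Qed.

End Isomorphism.

Theorem theorem7p7 (R : realType) (n k n0 : nat) (m : 'I_n -> nat)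
    (z : 'I_n -> R[i]) (kappa : R[i])
    (k_gt0 : (0 < k)%N) (le_n0_n : (n0 <= n)%N)
    (m_gt0 : forall j, (0 < m j)%N)
    (m_le : forall j : 'I_n, (j < n0)%N -> (m j <= k.-1)%N)
    (m_gt : forall j : 'I_n, (n0 <= j)%N -> (k.-1 < m j)%N)
    (z_inj : injective z) (kappa_neq0 : kappa != 0) :
  exists gamma : chains R[i] n k -> Bsp R[i] n,
    [/\ is_gamma n0 m z kappa gamma,
        forall gamma', is_gamma n0 m z kappa gamma' ->
          forall v, direct_sum (aomoto_skew n0 m z) v -> gamma' v = gamma v
      & complex_iso
          (aomoto_skew n0 m z) (aomoto_d n0 m z kappa)
          (Bgr m (\sum_(j < n) (m j)%:Z - 2 * k%:Z)) (Bd m)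
          (1 - k%:Z) gamma].
Proof.
exists (@gamma R[i] n k n0 m z kappa); split.
- exact: gamma_is_gamma.
- exact: gamma_unique.
exact: gamma_iso.
Qed.
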